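(* Let $(\{f_\alpha\}_{\alpha\in\Omega},\mathbb P)$ be an admissible random cusp system (as defined in the context). Then the annealed transfer operator $L_{\mathbb P}$ admits a stationary density $h_0\in W^{2,1}(I)$, which is unique among stationary densities of $L_{\mathbb P}$ belonging to $W^{1,1}(I)$. Moreover, $L_{\mathbb P}$ has a spectral gap when acting on both $W^{1,1}(I)$ and $W^{2,1}(I)$. In particular, $\mathrm{Id}-L_{\mathbb P}$ is invertible on $W^{1,1}_0(I)$ and there exists $C>0$ such that $$\left\|(\mathrm{Id}-L_{\mathbb P})^{-1}\right\|_{W^{1,1}_0\to W^{1,1}}\le C.$$
   Context: Let $I=[0,1]$, let $m$ be Lebesgue measure on $I$, let $\Omega\subset\mathbb R$ be a compact interval with its Borel $\sigma$-algebra, and let $\mathbb P$ be a Borel probability measure on $\Omega$. Derivatives in the parameter $\alpha$ at the endpoints of $\Omega$ are one-sided. Fix $c\in(0,1)$, $a\in(0,1]$ and $\beta\in(-1,-1/2)$. An admissible random cusp system consists of $\mathbb P$ and maps $f_\alpha:I\to I$, $\alpha\in\Omega$, such that: (A1) For every $\alpha\in\Omega$ the restrictions $f_\alpha|_{[0,c)}$ and $f_\alpha|_{(c,1]}$ are one-to-one. (A2) For every $\alpha\in\Omega$, $f_\alpha(0)=f_\alpha(1)=0$ and $f_\alpha(c)=\lim_{x\to c^-}f_\alpha(x)=\lim_{x\to c^+}f_\alpha(x)=a$. (A3) For every $\alpha\in\Omega$, $f_\alpha|_{I\setminus\{c\}}\in C^3$. (A4) There exists $\theta>1$ with $\inf_{\alpha\in\Omega}\inf_{x\ne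 c}|f_\alpha'(x)|\ge\theta$. (A5) There are constants $m_1,M_1,M_2,M_3>0$ such that for all $\alpha\in\Omega$, $x\ne c$: $m_1|x-c|^{\beta}\le|f_\alpha'(x)|\le M_1|x-c|^{\beta}$, $|f_\alpha''(x)|\le M_2|x-c|^{\beta-1}$, $|f_\alpha'''(x)|\le M_3|x-c|^{\beta-2}$. (A6) For $k=0,1,2,3$ (with $f_\alpha^{(0)}:=f_\alpha$; superscripts denote $x$-derivatives) the functions $(\alpha,x)\mapsto f_\alpha^{(k)}(x)$ are continuous on $\Omega\times(I\setminus\{c\})$. For $k=0,1,2$ the parameter derivatives $\partial_\alpha f_\alpha^{(k)}(x)$ exist and are continuous there; $\partial_x\partial_\alpha f_\alpha^{(k)}=\partial_\alpha f_\alpha^{(k+1)}$ for $k=0,1$; and there are constants $D_0,D_1,D_2>0$ with $|\partial_\alpha f_\alpha^{(k)}(x)|\le D_k|x-c|^{\beta-k+1}$ for $k=0,1,2$. (A7) Let $S:=\operatorname{Supp}\mathbb P$. The skew product $T:S^{\mathbb N}\times[0,a]\to S^{\mathbb N}\times[0,a]$, $T(\omega,x)=(\sigma\omega,f_{\omega_0}(x))$, where $\sigma$ is the one-sided shift and $S^{\mathbb N}$ has the product of the relative topology on $S$, is topologically mixing. Transfer operators: $L_\alpha:L^1(I)\to L^1(I)$ is defined by $\int_I(L_\alpha\phi)\psi\,dm=\int_I\phi\,(\psi\circ f_\alpha)\,dm$ for $\phi\in L^1(I)$, $\psi\in L^\infty(I)$. The annealed transfer operator is $L_{\mathbb P}\phi:=\int_\Omega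 L_\alpha\phi\,d\mathbb P(\alpha)$. A stationary density of $L_{\mathbb P}$ is a function $h\ge0$ with $\int_Ih\,dm=1$ and $L_{\mathbb P}h=h$. Sobolev spaces: $\|\phi\|_{W^{k,1}}:=\sum_{j=0}^k\|\phi^{(j)}\|_{L^1}$ for $k=1,2$, and $W^{k,1}_0(I):=\{\phi\in W^{k,1}(I):\int_I\phi\,dm=0\}$ (zero average, not zero boundary values). Spectral gap on $W^{k,1}(I)$ means: $1$ is an algebraically simple isolated eigenvalue of $L_{\mathbb P}$ acting on (the complexification of) $W^{k,1}(I)$, and the rest of the spectrum is contained in a disk centred at $0$ of radius strictly smaller than $1$. $\mathrm{Id}$ denotes the identity operator. *)

(* Defs.v *)
From HB Require Import structures.
From mathcomp Require Import all_boot all_order all_algebra.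
From mathcomp Require Import all_classical all_reals all_analysis.
From mathcomp Require Import complex.
Set Implicit Arguments.
Unset Strict Implicit.
Unset Printing Implicit Defensive.
Import Order.TTheory GRing.Theory Num.Theory.
Import numFieldNormedType.Exports.
Local Open Scope classical_set_scope.
Local Open Scope ring_scope.

(* At a boundary point of [D] these are the one-sided derivatives. *)
Definition has_deriv_in (R : realType) (D : set R) (u : R -> R) (x l : R) : Prop :=
  (u y - u x) / (y - x) @[y --> within D x^'] --> l.

Definition deriv_in (R : realType) (D : set R) (u : R -> R) (x : R) : R :=
  lim ((u y - u x) / (y - x) @[y --> within D x^']).

Definition derivn_in (R : realType) (D : set R) (n : nat) (u : R -> R) : R -> R :=
  iter n (deriv_in D) u.

Definition Cn_in (R : realType) (n : nat) (D : set R) (u : R -> R) : Prop :=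
  (forall (k : nat) (x : R), (k < n)%N -> D x ->
     has_deriv_in D (derivn_in D k u) x (derivn_in D k.+1 u x)) /\
  {within D, continuous (derivn_in D n u)}.

(* Mixing of the restriction of [T] to the subspace [Y], whose open sets are
   the traces [Y `&` U] of open sets of the ambient space. *)
Definition topologically_mixing_on (X : topologicalType) (Y : set X)
    (T : X -> X) : Prop :=
  {homo T : x / Y x} /\
  forall U V : set X, open U -> open V ->
    Y `&` U !=set0 -> Y `&` V !=set0 ->
    exists n0 : nat, forall n : nat, (n0 <= n)%N ->
      (iter n T @` (Y `&` U)) `&` (Y `&` V) !=set0.

(* A Borel probability on a compact interval is represented by a probability
   on the line giving mass 1 to that interval; the support is then contained
   in the interval. *)
Definition supp (R : realType) (P : probability (measurableTypeR R) R) : set R :=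
  [set t | forall U : set R, open U -> U t -> (0 < P U)%E].

Definition skew_product (R : realType) (f : R -> R -> R)
    (p : prod_topology (fun _ : nat => R) * R) :
    prod_topology (fun _ : nat => R) * R :=
  (fun n => p.1 n.+1, f (p.1 0%N) p.2).

Definition skew_space (R : realType) (S : set R) (a : R) :
    set (prod_topology (fun _ : nat => R) * R) :=
  [set p | (forall n, S (p.1 n)) /\ p.2 \in `[0, a]].

Definition I01 (R : realType) : set R := `[0, 1]%classic.
Arguments I01 {R}.

Definition I_minus (R : realType) (c : R) : set R := I01 `\ c.

(* The maps are [f t : R -> R] for [t] in [Omega]; only their values on [I01]
   are constrained or used.  In [cusp_A6], [g k t x] is the derivative of the
   k-th x-derivative with respect to the parameter. *)
Record admissible (R : realType) (c a beta : R) (Omega : set R)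
    (P : probability (measurableTypeR R) R) (f : R -> R -> R) : Prop :=
  Admissible {
  cusp_maps : forall t, Omega t -> {homo f t : x / I01 x};
  cusp_A1 : forall t, Omega t ->
    {in `[0, c[ &, injective (f t)} /\ {in `]c, 1] &, injective (f t)};
  cusp_A2 : forall t, Omega t ->
    [/\ f t 0 = 0, f t 1 = 0, f t c = a,
        f t x @[x --> c^'-] --> a & f t x @[x --> c^'+] --> a];
  cusp_A3 : forall t, Omega t -> Cn_in 3 (I_minus c) (f t);
  cusp_A4 : exists2 theta : R, 1 < theta &
    forall t x, Omega t -> I_minus c x ->
      theta <= `|derivn_in (I_minus c) 1 (f t) x|;
  cusp_A5 : exists m1 M1 M2 M3 : R,
    [/\ 0 < m1, 0 < M1, 0 < M2 & 0 < M3] /\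
    forall t x, Omega t -> I_minus c x ->
      [/\ m1 * `|x - c| `^ beta <= `|derivn_in (I_minus c) 1 (f t) x|,
          `|derivn_in (I_minus c) 1 (f t) x| <= M1 * `|x - c| `^ beta,
          `|derivn_in (I_minus c) 2 (f t) x|
            <= M2 * `|x - c| `^ (beta - 1) &
          `|derivn_in (I_minus c) 3 (f t) x|
            <= M3 * `|x - c| `^ (beta - 2)];
  cusp_A6 :
    (forall k : nat, (k <= 3)%N ->
       {within Omega `*` (I_minus c), continuous
         (fun p : R * R => derivn_in (I_minus c) k (f p.1) p.2)}) /\
    exists g : nat -> R -> R -> R,
    [/\ forall (k : nat) t x, (k <= 2)%N -> Omega t -> I_minus c x ->
          has_deriv_in Omega
            (fun s => derivn_in (I_minus c) k (f s) x) t (g k t x),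
        forall k : nat, (k <= 2)%N ->
          {within Omega `*` (I_minus c), continuous
            (fun p : R * R => g k p.1 p.2)},
        forall (k : nat) t x, (k <= 1)%N -> Omega t -> I_minus c x ->
          has_deriv_in (I_minus c) (g k t) x (g k.+1 t x) &
        exists D : nat -> R, forall k : nat, (k <= 2)%N -> 0 < D k /\
          forall t x, Omega t -> I_minus c x ->
            `|g k t x| <= D k * `|x - c| `^ (beta - k%:R + 1)];
  cusp_A7 :
    topologically_mixing_on (skew_space (supp P) a) (skew_product f)
}.

(* Elements of [L^1(I)], [L^oo(I)] and the Sobolev spaces are represented by
   functions [R -> R], considered on [I01] up to Lebesgue-a.e. equality. *)

Definition L1I (R : realType) (phi : R -> R) : Prop :=
  (@lebesgue_measure R).-integrable I01 (EFin \o phi).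

Definition LooI (R : realType) (psi : R -> R) : Prop :=
  measurable_fun I01 psi /\
  exists K : R, \forall x \ae (@lebesgue_measure R), I01 x -> `|psi x| <= K.

Definition integral_I (R : realType) (phi : R -> R) : R :=
  \int[@lebesgue_measure R]_(x in I01) phi x.

Definition eqI (R : realType) (phi phi' : R -> R) : Prop :=
  \forall x \ae (@lebesgue_measure R), I01 x -> phi x = phi' x.

(* The duality relation determines the operator up to a.e. equality; [get]
   picks a representative. *)
Definition transfer (R : realType) (T : R -> R) (phi : R -> R) : R -> R :=
  get [set g : R -> R | L1I g /\
    forall psi : R -> R, LooI psi ->
      integral_I (fun x => g x * psi x) =
      integral_I (fun x => phi x * psi (T x))].

(* The integral of the [L^1(I)]-valued map [t |-> transfer (f t) phi] is taken
   in the weak sense: it is the element of [L^1(I)] whose pairing with every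
   element of the dual [L^oo(I)] is the integral of the pairings. *)
Definition annealed (R : realType) (Omega : set R)
    (P : probability (measurableTypeR R) R) (f : R -> R -> R)
    (phi : R -> R) : R -> R :=
  get [set g : R -> R | L1I g /\
    forall psi : R -> R, LooI psi ->
      let pairing t := integral_I (fun x => transfer (f t) phi x * psi x) in
      P.-integrable Omega (EFin \o pairing) /\
      integral_I (fun x => g x * psi x) = \int[P]_(t in Omega) pairing t].

Definition stationary_density (R : realType) (L : (R -> R) -> (R -> R))
    (h : R -> R) : Prop :=
  [/\ L1I h,
      \forall x \ae (@lebesgue_measure R), I01 x -> 0 <= h x,
      integral_I h = 1 & eqI (L h) h].

Definition test_function (R : realType) (eta : R -> R) : Prop :=
  (forall (n : nat) (x : R), derivable (derive1n n eta) x 1) /\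
  exists p q : R, [/\ 0 < p, q < 1 &
    forall x, x \notin `[p, q] -> eta x = 0].

Definition is_weak_deriv (R : realType) (j : nat) (phi g : R -> R) : Prop :=
  L1I g /\ forall eta : R -> R, test_function eta ->
    integral_I (fun x => phi x * derive1n j eta x) =
    (-1) ^+ j * integral_I (fun x => g x * eta x).

Definition weak_deriv (R : realType) (j : nat) (phi : R -> R) : R -> R :=
  get (is_weak_deriv j phi).

Definition W1 (R : realType) (k : nat) : set (R -> R^o) :=
  [set phi | L1I phi /\
    forall j : nat, (j <= k)%N -> exists g, is_weak_deriv j phi g].

Definition W1_norm (R : realType) (k : nat) (phi : R -> R^o) : R :=
  \sum_(j < k.+1) integral_I (fun x => `|weak_deriv j phi x|).

Definition W1_0 (R : realType) (k : nat) : set (R -> R^o) :=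
  [set phi | W1 k phi /\ integral_I phi = 0].

(* The complexification of [W^{k,1}(I)] is realised as [W^{k,1}(I; C)]. *)

Definition Re_fun (R : realType) (u : R -> R[i]) : R -> R :=
  fun x => complex.Re (u x).
Definition Im_fun (R : realType) (u : R -> R[i]) : R -> R :=
  fun x => complex.Im (u x).

Definition cW1 (R : realType) (k : nat) : set (R -> (R[i])^o) :=
  [set u | W1 k (Re_fun u) /\ W1 k (Im_fun u)].

Definition cW1_norm (R : realType) (k : nat) (u : R -> (R[i])^o) : R :=
  \sum_(j < k.+1) integral_I (fun x =>
    Normc.normc (weak_deriv j (Re_fun u) x +i* weak_deriv j (Im_fun u) x)%C).

Definition complexify (R : realType) (L : (R -> R) -> (R -> R))
    (u : R -> (R[i])^o) : R -> (R[i])^o :=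
  fun x => (L (Re_fun u) x +i* L (Im_fun u) x)%C.

(* A normed space is presented as a subspace [W] of a module [E] with a
   seminorm [N] on [W]; vectors [u], [v] with [N (u - v) = 0] are identified. *)

Definition linear_on (R : realType) (K : nzRingType) (E : lmodType K)
    (W : set E) (N : E -> R) (A : E -> E) : Prop :=
  (forall u, W u -> W (A u)) /\
  (forall (z : K) u v, W u -> W v ->
     N (A (z *: u + v) - (z *: A u + A v)) = 0).

Definition bounded_on (R : realType) (K : nzRingType) (E : lmodType K)
    (W : set E) (N : E -> R) (A : E -> E) (C : R) : Prop :=
  forall u, W u -> N (A u) <= C * N u.

Definition inverse_on (R : realType) (K : nzRingType) (E : lmodType K)
    (W : set E) (N : E -> R) (A B : E -> E) : Prop :=
  [/\ linear_on W N A, linear_on W N B,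
      forall u, W u -> N (B (A u) - u) = 0 &
      forall u, W u -> N (A (B u) - u) = 0].

Definition resolvent_set (R : realType) (K : nzRingType) (E : lmodType K)
    (W : set E) (N : E -> R) (A : E -> E) : set K :=
  [set z | exists B : E -> E,
    inverse_on W N (fun u => z *: u - A u) B /\
    exists C : R, bounded_on W N B C].

Definition spectrum (R : realType) (K : nzRingType) (E : lmodType K)
    (W : set E) (N : E -> R) (A : E -> E) : set K :=
  ~` resolvent_set W N A.

(* The Riesz projection of [A] at an isolated point [z] of the spectrum: the
   bounded projection commuting with [A] that splits the spectrum of [A] into
   [z], on its range, and the rest, on its kernel. *)
Definition spectral_projection (R : realType) (K : nzRingType)
    (E : lmodType K) (W : set E) (N : E -> R) (A : E -> E) (z : K)
    (Pi : E -> E) : Prop :=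
  [/\ linear_on W N Pi /\ (exists C : R, bounded_on W N Pi C),
      forall u, W u ->
        N (Pi (Pi u) - Pi u) = 0 /\ N (Pi (A u) - A (Pi u)) = 0,
      forall w, spectrum [set u | W u /\ N (Pi u - u) = 0] N A w -> w = z &
      resolvent_set [set u | W u /\ N (Pi u) = 0] N A z].

(* The algebraic multiplicity of an isolated eigenvalue is the dimension of
   the range of its spectral projection. *)
Definition algebraically_simple (R : realType) (K : nzRingType)
    (E : lmodType K) (W : set E) (N : E -> R) (A : E -> E) (z : K) : Prop :=
  exists2 Pi : E -> E, spectral_projection W N A z Pi &
  exists u0 : E,
    [/\ W u0, N u0 != 0, N (Pi u0 - u0) = 0 &
        forall u, W u -> exists s : K, N (Pi u - s *: u0) = 0].

Definition isolated_eigenvalue (R : realType) (E : lmodType R[i])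
    (W : set E) (N : E -> R) (A : E -> E) (z : R[i]) : Prop :=
  (exists u : E, [/\ W u, N u != 0 & N (A u - z *: u) = 0]) /\
  exists2 e : R, 0 < e & forall w, spectrum W N A w -> w != z ->
    e <= Normc.normc (w - z).

Definition spectral_gap (R : realType) (E : lmodType R[i])
    (W : set E) (N : E -> R) (A : E -> E) : Prop :=
  [/\ linear_on W N A /\ (exists C : R, bounded_on W N A C),
      isolated_eigenvalue W N A 1,
      algebraically_simple W N A 1 &
      exists2 r : R, 0 <= r < 1 & forall w, spectrum W N A w -> w != 1 ->
        Normc.normc w <= r].

(* Main.v *)
(** If the cusp value [a] were below 1, expansion would make an interval
    [[b, a]] with [b > 0] forward invariant for every parameter in the
    support, against the mixing hypothesis; so [a = 1] and every branch is
    onto [[0, 1]].  Hence no boundary terms arise when a weak derivative is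
    pushed forward, and with [L] the annealed operator
      [(L phi)'  = push (phi' / f' - phi f'' / f'^2)],
      [(L phi)'' = push (phi'' / f'^2 - 3 phi' f'' / f'^3 - phi f''' / f'^3
                         + 3 phi f''^2 / f'^4)],
    where the bounds on the derivatives turn the singular factors into
    integrable powers of [|x - c|] because [-1 < beta < -1/2].  This gives
    Lasota-Yorke inequalities in [W^{1,1}] and [W^{2,1}].

    The branches are expanding and onto, so the image of a ball of radius [theta^-n]
    under [n] maps is everything, which yields a minorization of [L^n].  A
    function of zero average with [|u'|_1 <= K |u|_1] is bounded below, and
    so is its opposite, by a multiple of [|u|_1] on intervals whose length
    depends on [K] only; hence [L^n] contracts its [L^1] norm.  Combined with
    the Lasota-Yorke inequality as in Harris' theorem, [L^n] decays
    geometrically on functions of zero average, first in [W^{1,1}], then in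
    [W^{2,1}].  The density [h] is the limit of [L^n 1], the spectral
    projection is [u |-> (\int u) h], and the resolvents are Neumann series. *)

Require Import Defs.
From HB Require Import structures.
From mathcomp Require Import all_boot all_order all_algebra.
From mathcomp Require Import all_classical all_reals all_analysis.
From mathcomp Require Import complex.
From mathcomp Require Import ring lra measurable_realfun.
Import Order.TTheory GRing.Theory Num.Theory.
Import numFieldNormedType.Exports.
Local Open Scope classical_set_scope.
Local Open Scope ring_scope.

Set Implicit Arguments.
Unset Strict Implicit.
Unset Printing Implicit Defensive.

(** * Integrals over the unit interval *)

(** The operators are given by duality, up to null sets, and no formula over inverse branches is
    used for them. Everything goes through one device: the density of the push-forward of a weighted
    measure on parameter times space under [(t, x) |-> f t x]. It exists by Radon-Nikodym, and
    norms, signs and weak derivatives of [L phi] are read off its pairings with bounded functions.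
    Lower bounds are proved on the dual side, where averages of [chi (f t x)] over [t] are defined
    at every point of the branches. The exponents decide the rest. As [|f'|] is at least
    [m1 |x - c|^beta], the quotient [f'' / f'^2] costs [|x - c|^(-1 - beta)]: unbounded, but its
    mass near the cusp is small, so that its contribution can be kept below the gain [1 - theta^-1]
    from expansion. The quotients [f''' / f'^3] and [f''^2 / f'^4] cost [|x - c|^(-2 - 2 beta)],
    integrable exactly because [beta < -1/2]; they multiply [phi] itself, whose supremum is of lower
    order in [W^{2,1}], so no smallness is required there. *)

Lemma bounded_in (R : realType) (T : Type) (D : set T) (h : T -> R) (K : R) :
  (forall x, D x -> `|h x| <= K) -> [bounded h x | x in D].
Proof.
move=> hK; exists K; split; first exact: num_real.
by move=> M KM x Dx; exact: le_trans (hK x Dx) (ltW KM).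
Qed.

Section RealIntegral.
Context d (T : measurableType d) (R : realType) (mu : {measure set T -> \bar R}).
Implicit Types (D : set T) (u v h : T -> R).

Lemma integrable_ae_eq D u v : measurable D -> mu.-integrable D (EFin \o u) ->
  measurable_fun D v -> (\forall x \ae mu, D x -> u x = v x) ->
  mu.-integrable D (EFin \o v).
Proof.
move=> mD iu mv uv; apply/integrableP; split; first exact/measurable_EFinP.
move/integrableP: iu => [mu_ iu]; apply: le_lt_trans iu.
rewrite (@ae_eq_integral _ _ _ mu D (fun x => `|(EFin \o v) x|)%E (fun x => `|(EFin \o u) x|)%E) //.
- exact: measurableT_comp.
- by apply: measurableT_comp => //; exact/measurable_EFinP.
- by apply: filterS uv => x h Dx; rewrite /= h.
Qed.

Lemma Rintegral_ae_eq D u v : measurable D -> measurable_fun D u ->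
  measurable_fun D v -> (\forall x \ae mu, D x -> u x = v x) ->
  \int[mu]_(x in D) u x = \int[mu]_(x in D) v x.
Proof.
move=> mD mu_ mv uv; rewrite /Rintegral; congr fine; apply: ae_eq_integral => //.
- exact/measurable_EFinP.
- exact/measurable_EFinP.
- by apply: filterS uv => x h Dx; rewrite /= h.
Qed.

Lemma Rintegral_ae_le D u v : measurable D -> mu.-integrable D (EFin \o u) ->
  mu.-integrable D (EFin \o v) -> (\forall x \ae mu, D x -> u x <= v x) ->
  \int[mu]_(x in D) u x <= \int[mu]_(x in D) v x.
Proof.
move=> mD iu iv uv.
have mu_ : measurable_fun D u by exact/measurable_EFinP/(measurable_int mu).
have mv_ : measurable_fun D v by exact/measurable_EFinP/(measurable_int mu).
(* The maximum equals [v] almost everywhere and dominates [u] at every point. *)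
pose w x := Num.max (u x) (v x).
have mw : measurable_fun D w by exact: measurable_maxr.
have vw : \forall x \ae mu, D x -> v x = w x.
  by apply: filterS uv => x h Dx; rewrite /w max_r // h.
have iw : mu.-integrable D (EFin \o w) by exact: integrable_ae_eq iv mw vw.
rewrite (Rintegral_ae_eq mD mv_ mw vw); apply: le_Rintegral => // x Dx.
by rewrite /w le_max lexx.
Qed.

Lemma Rintegral_eq0_ae D u : measurable D -> mu.-integrable D (EFin \o u) ->
  (\forall x \ae mu, D x -> 0 <= u x) -> \int[mu]_(x in D) u x = 0 ->
  \forall x \ae mu, D x -> u x = 0.
Proof.
move=> mD iu u0 I0.
have mEu := measurable_int mu iu.
have mu_ : measurable_fun D u by exact/measurable_EFinP.
have : (\int[mu]_(x in D) `|(EFin \o u) x|)%E = 0%E.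
  rewrite (@ae_eq_integral _ _ _ mu D (EFin \o u)) //.
  - have := integrable_fin_num mD iu; move=> /fineK <-.
    by move: I0; rewrite /Rintegral => ->.
  - exact: measurableT_comp.
  - by apply: filterS u0 => x h Dx; rewrite /= ger0_norm // h.
move/(ae_eq_integral_abs mu mD mEu) => h.
by apply: filterS h => x h Dx; have := h Dx => /= -[].
Qed.

Lemma integrable_bounded_mul D u h (K : R) : measurable D ->
  mu.-integrable D (EFin \o u) -> measurable_fun D h ->
  (forall x, D x -> `|h x| <= K) -> mu.-integrable D (EFin \o (fun x => u x * h x)).
Proof.
move=> mD iu mh hK.
have := integrableMl mD iu mh (bounded_in hK).
by apply: eq_integrable => // x _ /=; rewrite EFinM.
Qed.

Lemma integrable_dominated D u v : measurable D -> measurable_fun D u ->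
  (forall x, D x -> `|u x| <= v x) -> mu.-integrable D (EFin \o v) ->
  mu.-integrable D (EFin \o u).
Proof.
move=> mD mu_ uv iv; apply: (le_integrable mD _ _ iv); first exact/measurable_EFinP.
by move=> x Dx /=; rewrite lee_fin (le_trans (uv x Dx)) // ler_norm.
Qed.

Lemma integrable_cmul D u (k : R) : measurable D ->
  mu.-integrable D (EFin \o u) -> mu.-integrable D (EFin \o (fun x => k * u x)).
Proof. by move=> mD iu; have := integrableZl mD k iu; apply: eq_integrable. Qed.

Lemma integrable_add D u v : measurable D -> mu.-integrable D (EFin \o u) ->
  mu.-integrable D (EFin \o v) -> mu.-integrable D (EFin \o (fun x => u x + v x)).
Proof. by move=> mD iu iv; have := integrableD mD iu iv; apply: eq_integrable. Qed.

Lemma integrable_sub D u v : measurable D -> mu.-integrable D (EFin \o u) ->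
  mu.-integrable D (EFin \o v) -> mu.-integrable D (EFin \o (fun x => u x - v x)).
Proof. by move=> mD iu iv; have := integrableB mD iu iv; apply: eq_integrable. Qed.

Lemma integrable_abs D u : mu.-integrable D (EFin \o u) ->
  mu.-integrable D (EFin \o (fun x => `|u x|)).
Proof. exact: integrable_norm. Qed.

End RealIntegral.

Section UnitInterval.
Variable R : realType.
Implicit Types (u v g h psi : R -> R).
Notation mu := (@lebesgue_measure R).
Notation TR := (measurableTypeR R).

Lemma aeS (P Q : R -> Prop) : (forall x, P x -> Q x) ->
  (\forall x \ae mu, P x) -> (\forall x \ae mu, Q x).
Proof. by move=> h; exact: (@filterS TR (almost_everywhere mu) _ P Q h). Qed.

Lemma aeS2 (P Q S : R -> Prop) : (forall x, P x -> Q x -> S x) ->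
  (\forall x \ae mu, P x) -> (\forall x \ae mu, Q x) -> (\forall x \ae mu, S x).
Proof. by move=> h; exact: (@filterS2 TR (almost_everywhere mu) _ P Q S h). Qed.

Lemma aeT (P : R -> Prop) : (forall x, P x) -> \forall x \ae mu, P x.
Proof. by move=> h; apply: (@aeW _ TR). Qed.

Lemma measurable_I01 : measurable (I01 : set TR).
Proof. exact: measurable_itv. Qed.

Lemma lebesgue_I01 : mu I01 = 1%E.
Proof. by rewrite /I01 lebesgue_measure_itv /= lte_fin ltr01 oppr0 addr0. Qed.

Lemma L1I_measurable u : L1I u -> measurable_fun I01 u.
Proof. by move=> iu; apply: (@measurable_EFinP _ TR R I01 u).1; exact: (measurable_int mu). Qed.

Lemma L1I_add u v : L1I u -> L1I v -> L1I (fun x => u x + v x).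
Proof. exact: (@integrable_add _ TR R mu I01 u v measurable_I01). Qed.

Lemma L1I_sub u v : L1I u -> L1I v -> L1I (fun x => u x - v x).
Proof. exact: (@integrable_sub _ TR R mu I01 u v measurable_I01). Qed.

Lemma L1I_scale (k : R) u : L1I u -> L1I (fun x => k * u x).
Proof. exact: (@integrable_cmul _ TR R mu I01 u k measurable_I01). Qed.

Lemma L1I_norm u : L1I u -> L1I (fun x => `|u x|).
Proof. exact: integrable_abs. Qed.

Lemma L1I_mulb u h (K : R) : L1I u -> measurable_fun I01 h ->
  (forall x, I01 x -> `|h x| <= K) -> L1I (fun x => u x * h x).
Proof. exact: (@integrable_bounded_mul _ TR R mu I01 u h K measurable_I01). Qed.

Lemma L1I_bounded h (K : R) : measurable_fun I01 h ->
  (forall x, I01 x -> `|h x| <= K) -> L1I h.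
Proof.
move=> mh hK; apply: (@measurable_bounded_integrable _ TR R mu h I01) => //; last exact: bounded_in hK.
  exact: measurable_I01.
by have h1 : (mu I01 < +oo)%E by [rewrite lebesgue_I01 ltry]; exact: h1.
Qed.

Lemma L1I_cst (k : R) : L1I (fun=> k).
Proof. by apply: (@L1I_bounded _ `|k|) => //; exact: measurable_cst. Qed.

Lemma L1I_dominated u v : measurable_fun I01 u -> (forall x, I01 x -> `|u x| <= v x) ->
  L1I v -> L1I u.
Proof. exact: (@integrable_dominated _ TR R mu I01 u v measurable_I01). Qed.

Lemma L1I_eqI u v : L1I u -> measurable_fun I01 v -> eqI u v -> L1I v.
Proof. exact: (@integrable_ae_eq _ TR R mu I01 u v measurable_I01). Qed.

Lemma integral_I_add u v : L1I u -> L1I v ->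
  integral_I (fun x => u x + v x) = integral_I u + integral_I v.
Proof. exact: (@RintegralD _ TR R mu I01 u v measurable_I01). Qed.

Lemma integral_I_sub u v : L1I u -> L1I v ->
  integral_I (fun x => u x - v x) = integral_I u - integral_I v.
Proof. exact: (@RintegralB _ TR R mu I01 u v measurable_I01). Qed.

Lemma integral_I_scale (k : R) u : L1I u ->
  integral_I (fun x => k * u x) = k * integral_I u.
Proof. by move=> iu; apply: (@RintegralZl _ TR R mu I01 u k measurable_I01). Qed.

Lemma integral_I_cst (k : R) : integral_I (fun=> k) = k.
Proof.
by rewrite /integral_I Rintegral_cst /= ?lebesgue_I01 /= ?mulr1 //; exact: measurable_I01.
Qed.

Lemma integral_I_ge0 u : (forall x, I01 x -> 0 <= u x) -> 0 <= integral_I u.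
Proof. exact: (@Rintegral_ge0 _ TR R mu). Qed.

Lemma integral_I_ae_le u v : L1I u -> L1I v ->
  (\forall x \ae mu, I01 x -> u x <= v x) -> integral_I u <= integral_I v.
Proof. exact: (@Rintegral_ae_le _ TR R mu I01 u v measurable_I01). Qed.

Lemma integral_I_le u v : L1I u -> L1I v ->
  (forall x, I01 x -> u x <= v x) -> integral_I u <= integral_I v.
Proof. exact: (@le_Rintegral _ TR R mu I01 u v measurable_I01). Qed.

Lemma integral_I_abs u : L1I u -> `|integral_I u| <= integral_I (fun x => `|u x|).
Proof. exact: (@le_normr_Rintegral _ TR R mu I01 u measurable_I01). Qed.

Lemma integral_I_eqI u v : measurable_fun I01 u -> measurable_fun I01 v ->
  eqI u v -> integral_I u = integral_I v.
Proof. exact: (@Rintegral_ae_eq _ TR R mu I01 u v measurable_I01). Qed.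

Lemma integral_I_eq u v : (forall x, I01 x -> u x = v x) -> integral_I u = integral_I v.
Proof. by move=> uv; apply: eq_Rintegral => x /[!inE] /uv. Qed.

Lemma eqI_refl u : eqI u u.
Proof. exact/aeT. Qed.

Lemma eqI_sym u v : eqI u v -> eqI v u.
Proof. by apply: aeS => x h /h ->. Qed.

Lemma eqI_trans u v h : eqI u v -> eqI v h -> eqI u h.
Proof. by apply: aeS2 => x h1 h2 Ix; rewrite h1 ?h2. Qed.

Lemma integral_I_abs_eq0 u : L1I u -> integral_I (fun x => `|u x|) = 0 -> eqI u (fun=> 0).
Proof.
move=> iu /(@Rintegral_eq0_ae _ TR R mu I01 _ measurable_I01 (L1I_norm iu)) h.
have {}h : \forall x \ae mu, I01 x -> `|u x| = 0 by apply: h; apply: aeT => x _.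
by apply: aeS h => x h /h /eqP; rewrite normr_eq0 => /eqP.
Qed.

Lemma sub_eqI0 u v : eqI (fun x => u x - v x) (fun=> 0) -> eqI u v.
Proof. by apply: aeS => x h /h /eqP; rewrite subr_eq0 => /eqP. Qed.

Lemma LooI_bounded psi (K : R) : measurable_fun I01 psi ->
  (forall x, I01 x -> `|psi x| <= K) -> LooI psi.
Proof. by move=> m b; split=> //; exists K; exact: aeT. Qed.

(** Cutting [psi] to zero off the set where its essential bound holds gives a bound at every point
    and measurability on the whole line, as the uniform approximation by step functions requires. *)
Lemma LooI_repr psi : LooI psi -> exists psi' (K : R),
  [/\ measurable_fun setT psi', 0 <= K, forall x, `|psi' x| <= K & eqI psi psi'].
Proof.
move=> [mpsi [K hK]].
pose A := [set x | I01 x /\ `|psi x| <= `|K|].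
have mA : measurable (A : set (measurableTypeR R)).
  have -> : A = I01 `&` (fun x => `|psi x|) @^-1` `]-oo, `|K|].
    by apply/seteqP; split => x /=; rewrite in_itv.
  have m : measurable_fun I01 (fun x => `|psi x|) by exact: measurableT_comp.
  by apply: m; [exact: measurable_I01|exact: measurable_itv].
exists (psi \_ A), `|K|; split => //.
- have mA' : measurable (A : set R) by exact: mA.
  apply: (measurable_restrictT psi mA').1; apply: (measurable_funS _ _ mpsi).
  + exact: measurable_I01.
  + by move=> x [].
- by move=> x; rewrite patchE; case: ifPn => [/[!inE] -[]//|_]; rewrite normr0.
- apply: aeS hK => x h Ix; rewrite patchE mem_set //.
  by split => //; rewrite (le_trans (h Ix)) // ler_norm.
Qed.

(** Signs are the bounded functions that recover an [L^1] norm from a pairing, since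
    [u * sg u = |u|]; this is how duality statements become norm estimates below. *)
Lemma measurable_sgr (D : set R) u : measurable_fun D u ->
  measurable_fun D (fun x => Num.sg (u x)).
Proof.
move=> m mD; pose s (y : R) : R := if 0 < y then 1 else if y < 0 then -1 else 0.
have -> : (fun x => Num.sg (u x)) = s \o u.
  apply/funext => x /=; rewrite /s; case: ltrgt0P => [h|h|->].
  - by rewrite gtr0_sg.
  - by rewrite ltr0_sg.
  - by rewrite sgr0.
move: mD; apply: measurableT_comp => //; rewrite /s.
apply: measurable_fun_ifT => //; first exact: measurable_fun_ltr.
by apply: measurable_fun_ifT => //; exact: measurable_fun_ltr.
Qed.

Lemma norm_sgr_le1 (x : R) : `|Num.sg x| <= 1.
Proof. by rewrite normr_sg; case: (x != 0). Qed.

Lemma mulr_sgr_norm (x : R) : x * Num.sg x = `|x|.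
Proof. by rewrite mulrC -normrEsg // num_real. Qed.

End UnitInterval.

(** * Densities of push-forwards *)

Section LebesgueComparison.
Variable R : realType.
Notation mu := (@lebesgue_measure R).
Notation TR := (measurableTypeR R).

(** Lebesgue measure is an infimum over countable covers by half-open intervals; the bound on
    intervals passes to each cover by subadditivity, then to the infimum. *)
Lemma measure_le_lebesgue (nu : {measure set TR -> \bar R}) (k : R) : 0 < k ->
  (forall a b : R, a <= b -> (nu `]a, b]%classic <= (k * (b - a))%:E)%E) ->
  forall A : set TR, measurable A -> (nu A <= k%:E * mu A)%E.
Proof.
move=> k0 hnu A mA.
suff : (k^-1%:E * nu A <= mu A)%E.
  move=> h; have -> : nu A = (k%:E * (k^-1%:E * nu A))%E.
    by rewrite muleA -EFinM divff ?gt_eqF// mul1e.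
  by rewrite lee_pmul2l.
rewrite /lebesgue_measure /lebesgue_stieltjes_measure /measure_extension /mu_ext.
apply: le_ereal_inf_tmp => _ /= [F [mF AF] <-].
have mF' i : measurable (F i : set TR) by apply: sub_sigma_algebra; exact: mF.
have h1 : (nu A <= \sum_(0 <= i <oo) nu (F i))%E.
  apply: measure_sigma_subadditive => //.
have h2 : (\sum_(0 <= i <oo) nu (F i) <= \sum_(0 <= i <oo) k%:E * wlength idfun (F i))%E.
  apply: lee_nneseries => // i _.
  have [[a b] _ <-] := mF i.
  have [ab|ba] := leP a b.
    by rewrite wlength_itv_bnd //= -EFinM hnu.
  rewrite set_itv_ge ?measure0 -?leNgt ?bnd_simp ?(ltW ba)//.
  by rewrite mule0.
have h3 : (\sum_(0 <= i <oo) k%:E * wlength idfun (F i) =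
           k%:E * \sum_(0 <= i <oo) wlength idfun (F i))%E.
  rewrite nneseriesZl // => i _; exact: wlength_ge0.
have := le_trans h1 h2; rewrite h3 => h4.
set S := (\sum_(0 <= i <oo) wlength idfun (F i))%E in h4 *.
have -> : S = (k^-1%:E * (k%:E * S))%E by rewrite muleA -EFinM mulVf ?gt_eqF// mul1e.
by rewrite lee_pmul2l ?lte_fin ?invr_gt0.
Qed.

Lemma lebesgue_diameter_le (Z : set R) (l : R) : measurable (Z : set TR) -> 0 <= l ->
  (forall x y, Z x -> Z y -> `|x - y| <= l) -> (mu Z <= l%:E)%E.
Proof.
move=> mZ l0 hZ.
have [->|/set0P[z Zz]] := eqVneq Z set0.
  by rewrite measure0.
have lbZ : has_lbound Z.
  by exists (z - l) => x Zx; have := hZ z x Zz Zx; rewrite ler_norml => /andP[_]; lra.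
have hi : has_inf Z by split => //; exists z.
have sub : Z `<=` `[inf Z, inf Z + l].
  move=> x Zx /=; rewrite in_itv /= ge_inf //=.
  rewrite -lerBlDr; apply: lb_le_inf; first by exists z.
  by move=> y Zy; have := hZ x y Zx Zy; rewrite ler_norml => /andP[_]; lra.
have mI : measurable (`[inf Z, inf Z + l]%classic : set TR) by exact: measurable_itv.
apply: le_trans (le_measure mu _ _ sub) _; rewrite ?inE//.
have h : (mu `[inf Z, (inf Z + l)%R]%classic <= l%:E)%E.
  rewrite lebesgue_measure_itv /=; case: ifP => _; last by rewrite lee_fin.
  by rewrite -EFinB lee_fin; lra.
exact: h.
Qed.

(** The preimage of an interval of length [l] has diameter at most [l / k], so the push-forward of
    Lebesgue measure on [Y] obeys the interval bound of [measure_le_lebesgue]. This stands in for a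
    change of variables and asks for neither a derivative nor an inverse. *)
Lemma lebesgue_preimage_expanding (Y : set R) (h : R -> R) (k : R) : 0 < k ->
  measurable (Y : set TR) -> measurable_fun (Y : set TR) h ->
  (forall x y, Y x -> Y y -> k * `|x - y| <= `|h x - h y|) ->
  forall A : set TR, measurable A -> (mu (Y `&` h @^-1` A) <= k^-1%:E * mu A)%E.
Proof.
move=> k0 mY mh hk.
pose h' := h \_ Y.
have mh' : measurable_fun [set: TR] (h' : TR -> TR).
  exact: (@measurable_restrictT _ _ TR TR Y h mY).1.
pose nu0 := mrestr mu mY.
have key (A : set TR) : measurable A -> pushforward nu0 (h' : TR -> TR) A = mu (Y `&` h @^-1` A).
  move=> mA; rewrite /pushforward /nu0 /mrestr; congr (mu _).
  apply/seteqP; split => x [] /=.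
    by rewrite /h' patchE => + Yx; rewrite mem_set.
  by rewrite /h' patchE => Yx; rewrite mem_set.
pose nu : {measure set TR -> \bar R} := measure_function_pushforward__canonical__measure_function_Measure nu0 mh'.
move=> A mA; rewrite -key //.
apply: (@measure_le_lebesgue nu) => //; first by rewrite invr_gt0.
move=> a b ab.
have mab : measurable (`]a, b]%classic : set TR) by exact: measurable_itv.
rewrite /nu /= key //; apply: lebesgue_diameter_le.
- exact: mh.
- by rewrite mulr_ge0 ?subr_ge0// invr_ge0 ltW.
- move=> x y /= [Yx +] [Yy]; rewrite !in_itv /= => /andP[? ?] /andP[? ?].
  rewrite -(ler_pM2l k0) mulrA divff ?gt_eqF// mul1r.
  by apply: le_trans (hk x y Yx Yy) _; rewrite ler_norml; apply/andP; split; lra.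
Qed.

End LebesgueComparison.

(** * From an identity on sets to an identity for bounded functions *)

Section PairingExtension.
Context d (X : measurableType d) (R : realType) (M : {measure set X -> \bar R}).
Notation mu := (@lebesgue_measure R).
Notation TR := (measurableTypeR R).
Variables (g : R -> R) (F Phi : X -> R).
Hypothesis ig : mu.-integrable [set: TR] (EFin \o g).
Hypothesis iF : M.-integrable setT (EFin \o F).
Hypothesis mPhi : measurable_fun setT Phi.
Hypothesis gF : forall A : set TR, measurable A ->
  \int[mu]_(x in A) g x = \int[M]_(x in Phi @^-1` A) F x.

(** Takes the value [c j] where [y] lies in [[j, j+1[], for [j < m]; an affine rescaling of a
    bounded function taken as [y] makes it a uniform approximation. *)
Let step (m : nat) (y : R -> R) (c : nat -> R) (x : R) : R :=
  \sum_(j < m) c j * ((j%:R <= y x) && (y x < j.+1%:R))%:R.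

Let step_measurable m y c : measurable_fun [set: R] y -> measurable_fun [set: R] (step m y c).
Proof.
move=> my; apply: measurable_sum => j; apply: measurable_funM => //.
have mb : measurable_fun [set: R] (fun x => (j%:R <= y x) && (y x < j.+1%:R)).
  by apply: measurable_and; [exact: measurable_fun_ler|exact: measurable_fun_ltr].
have -> : (fun x => ((j%:R <= y x) && (y x < j.+1%:R))%:R) =
  (fun x => if (j%:R <= y x) && (y x < j.+1%:R) then 1 else 0 : R).
  by apply/funext => x; case: ifP.
exact: measurable_fun_ifT.
Qed.

Let step_bounded m y c : exists K, forall x, `|step m y c x| <= K.
Proof.
exists (\sum_(j < m) `|c j|) => x; apply: le_trans (ler_norm_sum _ _ _) _.
apply: ler_sum => j _; rewrite normrM ler_piMr //.
by case: (_ && _); rewrite ?normr1 ?normr0.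
Qed.

Let step_pairing m y c : measurable_fun [set: R] y ->
  \int[mu]_(x in [set: TR]) (g x * step m y c x) = \int[M]_x (F x * step m y c (Phi x)).
Proof.
move=> my; elim: m => [|m IH].
  rewrite (@eq_Rintegral _ _ _ mu _ (fun=> 0)); last by move=> x _; rewrite /step big_ord0 mulr0.
  rewrite (@eq_Rintegral _ _ _ M _ (fun=> 0)); last by move=> x _; rewrite /step big_ord0 mulr0.
  by rewrite /Rintegral !integral0.
pose b x : R := ((m%:R <= y x) && (y x < m.+1%:R))%:R.
pose A := [set x | (m%:R <= y x) && (y x < m.+1%:R)].
have mA : measurable (A : set TR).
  have -> : A = setT `&` y @^-1` `[m%:R, m.+1%:R[.
    by apply/seteqP; split => x /=; rewrite in_itv /= => // -[].
  by apply: my => //; exact: measurable_itv.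
have stepS x : step m.+1 y c x = step m y c x + c m * b x by rewrite /step big_ord_recr.
have bA x : b x = \1_A x.
  by rewrite /b indicE; congr (nat_of_bool _)%:R; apply/idP/idP => [h|]; rewrite inE.
have pA : \int[mu]_(x in [set: TR]) (g x * b x) = \int[M]_x (F x * b (Phi x)).
  rewrite (@eq_Rintegral _ _ _ mu _ (g \_ A)); last first.
    by move=> x _; rewrite bA indicE patchE; case: ifP => _; rewrite ?mulr1 ?mulr0.
  rewrite (@eq_Rintegral _ _ _ M _ (F \_ (Phi @^-1` A))); last first.
    move=> x _; rewrite bA indicE patchE.
    have -> : (x \in Phi @^-1` A) = (Phi x \in A) by apply/idP/idP; rewrite !inE.
    by case: ifP => _; rewrite ?mulr1 ?mulr0.
  by rewrite -!Rintegral_mkcond gF.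
have mS := @step_measurable m y c my; have [K hK] := step_bounded m y c.
have mb : measurable_fun [set: R] b by rewrite (_ : b = \1_A); [exact: measurable_indic|exact/funext].
have bb x : `|b x| <= 1 by rewrite /b; case: (_ && _); rewrite ?normr1 ?normr0.
rewrite (@eq_Rintegral _ _ _ mu _ (fun x => g x * step m y c x + c m * (g x * b x))); last first.
  by move=> x _; rewrite stepS; ring.
rewrite (@eq_Rintegral _ _ _ M _ (fun x => F x * step m y c (Phi x) + c m * (F x * b (Phi x)))); last first.
  by move=> x _; rewrite stepS; ring.
have i1 : mu.-integrable [set: TR] (EFin \o (fun x => g x * step m y c x)).
  by apply: (@integrable_bounded_mul _ TR R mu setT g _ K).
have i2 : mu.-integrable [set: TR] (EFin \o (fun x => g x * b x)).
  by apply: (@integrable_bounded_mul _ TR R mu setT g _ 1).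
have i3 : M.-integrable setT (EFin \o (fun x => F x * step m y c (Phi x))).
  by apply: (@integrable_bounded_mul _ X R M setT F _ K) => //; exact: measurableT_comp.
have i4 : M.-integrable setT (EFin \o (fun x => F x * b (Phi x))).
  by apply: (@integrable_bounded_mul _ X R M setT F _ 1) => //; exact: measurableT_comp.
rewrite !RintegralD //; try exact: integrable_cmul.
by rewrite IH !RintegralZl // pA.
Qed.

(** Both sides are linear in [psi] and continuous for uniform convergence, because [g] and [F] are
    integrable; the hypothesis on sets is the case of indicators. The error of a step function of
    mesh [1/N] is at most [C / N]. *)
Lemma pairing_bounded (psi : R -> R) (K : R) : measurable_fun [set: R] psi ->
  (forall x, `|psi x| <= K) ->
  \int[mu]_(x in [set: TR]) (g x * psi x) = \int[M]_x (F x * psi (Phi x)).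
Proof.
move=> mpsi bpsi.
have K0 : 0 <= K := le_trans (normr_ge0 _) (bpsi 0).
have i1 (h : R -> R) (L : R) : measurable_fun [set: R] h -> (forall x, `|h x| <= L) ->
    mu.-integrable [set: TR] (EFin \o (fun x => g x * h x)).
  by move=> mh bh; apply: (@integrable_bounded_mul _ TR R mu setT g _ L).
have i2 (h : R -> R) (L : R) : measurable_fun [set: R] h -> (forall x, `|h x| <= L) ->
    M.-integrable setT (EFin \o (fun x => F x * h (Phi x))).
  move=> mh bh; apply: (@integrable_bounded_mul _ X R M setT F _ L) => //.
  exact: measurableT_comp.
pose C := \int[mu]_(x in [set: TR]) `|g x| + \int[M]_x `|F x|.
suff H n : `|\int[mu]_(x in [set: TR]) (g x * psi x) - \int[M]_x (F x * psi (Phi x))| <= C / n.+1%:R.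
  apply/eqP; rewrite -subr_eq0 -normr_le0; apply/ler_addgt0Pl => e e0; rewrite addr0.
  have C0 : 0 <= C by rewrite addr_ge0 // Rintegral_ge0.
  apply: le_trans (H (Num.truncn (C / e))) _.
  rewrite ler_pdivrMr // mulrC -ler_pdivrMr //; apply/ltW; exact: truncnS_gt.
pose N : R := n.+1%:R; have N0 : 0 < N by rewrite ltr0n.
(* The values of [y] lie in [[0, 2NK]], so [truncn (y x)] is the index of the level of [x], and [c]
   undoes the rescaling. *)
pose y x := N * (psi x + K).
pose c j : R := j%:R / N - K.
pose m := (Num.truncn (2 * N * K)).+1.
have my : measurable_fun [set: R] y.
  by apply: measurable_funM => //; apply: measurable_funD.
have y0 x : 0 <= y x.
  by apply: mulr_ge0; [exact: ltW|have := bpsi x; rewrite ler_norml => /andP[? ?]; lra].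
have ym x : y x < m%:R.
  apply: le_lt_trans (truncnS_gt _); rewrite /y -mulrA mulrCA ler_pM2l //.
  by have := bpsi x; rewrite ler_norml => /andP[? ?]; lra.
have stepE x : step m y c x = (Num.truncn (y x))%:R / N - K.
  have tm : (Num.truncn (y x) < m)%N by rewrite -(ltr_nat R); apply: le_lt_trans (ym x); rewrite truncn_le.
  have other (j : 'I_m) : j != Ordinal tm -> c j * ((j%:R <= y x) && (y x < j.+1%:R))%:R = 0.
    move=> jt; case: (boolP (_ && _)) => h; last by rewrite mulr0.
    by move/eqP: jt; case; apply: val_inj; apply/esym/truncn_def.
  rewrite /step (bigD1 (Ordinal tm)) //= [X in _ + X](_ : _ = 0) ?addr0; last exact: big1.
  by have /andP[-> ->] := truncn_itv (y0 x); rewrite mulr1.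
have close x : `|psi x - step m y c x| <= N^-1.
  have /andP[h1 h2] := truncn_itv (y0 x).
  have -> : psi x - step m y c x = (y x - (Num.truncn (y x))%:R) / N.
    by rewrite stepE /y; field; rewrite gt_eqF.
  rewrite normrM [`|N^-1|]gtr0_norm ?invr_gt0// ler_piMl ?invr_ge0 ?(ltW N0)//.
  by rewrite ger0_norm ?subr_ge0//; move: h2; rewrite -natr1; lra.
have mS := @step_measurable m y c my; have [L hL] := step_bounded m y c.
have mD : measurable_fun [set: R] (fun x => psi x - step m y c x) by exact: measurable_funB.
have i1s := i1 _ _ mS hL; have i2s := i2 _ _ mS hL.
have i1d := i1 _ _ mD close; have i2d := i2 _ _ mD close.
have -> : \int[mu]_(x in [set: TR]) (g x * psi x) =
  \int[mu]_(x in [set: TR]) (g x * step m y c x) +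
  \int[mu]_(x in [set: TR]) (g x * (psi x - step m y c x)).
  rewrite -RintegralD //; apply: eq_Rintegral => x _; ring.
have -> : \int[M]_x (F x * psi (Phi x)) = \int[M]_x (F x * step m y c (Phi x)) +
  \int[M]_x (F x * (psi (Phi x) - step m y c (Phi x))).
  rewrite -RintegralD //; apply: eq_Rintegral => x _; ring.
rewrite step_pairing // opprD addrACA subrr add0r.
apply: le_trans (ler_normB _ _) _; rewrite /C mulrDl; apply: lerD.
  apply: le_trans (le_normr_Rintegral _ _) _ => //.
  rewrite -RintegralZr //; last exact: integrable_abs.
  apply: le_Rintegral => //; first exact: integrable_abs.
    by apply: (integrable_bounded_mul _ (integrable_abs ig) _ (K := `|N^-1|)).
  by move=> x _; rewrite normrM ler_wpM2l.
apply: le_trans (le_normr_Rintegral _ _) _ => //.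
rewrite -RintegralZr //; last exact: integrable_abs.
apply: le_Rintegral => //; first exact: integrable_abs.
  by apply: (integrable_bounded_mul _ (integrable_abs iF) _ (K := `|N^-1|)).
by move=> x _; rewrite normrM ler_wpM2l.
Qed.

End PairingExtension.

(** The density is the Radon-Nikodym derivative of the push-forward of the charge with density [F];
    absolute continuity is the non-singularity hypothesis. The source space is arbitrary so that the
    lemma serves a single map, the whole family on parameter times space, and inverse branches. *)
Lemma push_density d (X : measurableType d) (R : realType)
    (M : {measure set X -> \bar R}) (Y : set X) (Phi F : X -> R) :
  measurable Y -> measurable_fun Y Phi -> (forall x, Y x -> I01 (Phi x)) ->
  (forall A : set (measurableTypeR R), measurable A -> lebesgue_measure A = 0%E ->
    M (Y `&` Phi @^-1` A) = 0%E) ->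
  M.-integrable Y (EFin \o F) ->
  exists g : R -> R, L1I g /\ forall psi, LooI psi ->
    M.-integrable Y (EFin \o (fun x => F x * psi (Phi x))) /\
    integral_I (fun x => g x * psi x) = \int[M]_(x in Y) (F x * psi (Phi x)).
Proof.
move=> mY mPhi PhiI nsing iF.
pose mu := @lebesgue_measure R; pose TR := measurableTypeR R.
pose Phi0 : X -> TR := Phi \_ Y; pose F0 := F \_ Y.
have mPhi0 : measurable_fun [set: X] Phi0 by exact: (@measurable_restrictT _ _ X TR Y Phi mY).1.
have iF0 : M.-integrable setT (EFin \o F0).
  by have /(integrable_mkcond _ mY) := iF; rewrite restrict_EFin.
pose nu1 : {charge set X -> \bar R} := charge_induced_charge__canonical__charge_Charge iF0.
pose nu : {charge set TR -> \bar R} := measure_function_pushforward__canonical__charge_Charge nu1 mPhi0.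
have nuE A : nu A = (\int[M]_(x in Phi0 @^-1` A) (EFin \o F0) x)%E by [].
have mF : measurable_fun Y F by exact/measurable_EFinP/(measurable_int M).
have mF0 : measurable_fun setT F0 by exact/measurable_EFinP/(measurable_int M).
have mpre (A : set TR) : measurable A -> measurable (Phi0 @^-1` A).
  by move=> mA; rewrite -[X in measurable X]setTI; exact (mPhi0 measurableT A mA).
have mpreY (A : set TR) : measurable A -> measurable (Y `&` Phi @^-1` A).
  by move=> mA; exact: mPhi.
have dom : nu `<< mu.
  apply/null_content_dominatesP => A mA A0; rewrite nuE.
  have -> : (\int[M]_(x in Phi0 @^-1` A) (EFin \o F0) x =
             \int[M]_(x in Y `&` Phi @^-1` A) (EFin \o F) x)%E.
    rewrite integral_mkcond [RHS]integral_mkcond; apply: eq_integral => x _.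
    rewrite !patchE /=; have [xY|xY] := boolP (x \in Y).
      have -> : (x \in Y `&` Phi @^-1` A) = (x \in Phi0 @^-1` A).
        rewrite /Phi0; apply/idP/idP; rewrite !inE /= patchE xY //.
          by case.
        by split=> //; move: xY; rewrite inE.
      by rewrite /F0 patchE xY.
    rewrite /F0 patchE (negbTE xY) if_same; case: ifP => //.
    by rewrite inE => -[Yx]; move: xY; rewrite notin_setE.
  apply: null_set_integral => //; first exact: mpreY.
    by apply/measurable_EFinP; apply: (measurable_funS mY _ mF) => x [].
  exact: nsing.
pose G := Radon_Nikodym nu mu.
have iG : mu.-integrable [set: TR] G by exact: Radon_Nikodym_integrable.
pose g x := fine (G x).
have gE : EFin \o g = G by apply/funext => x /=; rewrite /g fineK //; exact: Radon_Nikodym_fin_num.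
have ig : mu.-integrable [set: TR] (EFin \o g) by rewrite gE.
exists g; split.
  apply: (@integrableS _ TR R mu setT I01) => //; exact: measurable_I01.
have pair (A : set TR) : measurable A ->
    \int[mu]_(x in A) g x = \int[M]_(x in (Phi0 : X -> R) @^-1` A) F0 x.
  move=> mA; rewrite /Rintegral.
  have -> : (\int[mu]_(x in A) (g x)%:E = \int[mu]_(x in A) G x)%E by rewrite -gE.
  by rewrite -Radon_Nikodym_integral.
move=> psi lpsi; have [psi' [K [mpsi' K0 bpsi' ee]]] := LooI_repr lpsi.
have mpsi := lpsi.1.
have mcomp : measurable_fun Y (fun x => psi (Phi x)).
  apply: (measurable_comp (F := I01)) => //; first exact: measurable_I01.
  by move=> _ [x Yx <-]; exact: PhiI.
have mcomp' : measurable_fun Y (fun x => psi' (Phi x)).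
  by apply: (measurable_comp (F := setT)).
(* A null set of the target has a null preimage, so the choice of representative of [psi] is
   invisible on the source. *)
have aeM : \forall x \ae M, Y x -> F x * psi' (Phi x) = F x * psi (Phi x).
  have [N [mN N0 subN]] := ee.
  exists (Y `&` Phi @^-1` N); split; [exact: mpreY|exact: nsing|].
  move=> x /=; rewrite not_implyE => -[Yx ne]; split => //=.
  apply: subN => /= h; apply: ne; rewrite h //; exact: PhiI.
have i' : M.-integrable Y (EFin \o (fun x => F x * psi' (Phi x))).
  by apply: (integrable_bounded_mul mY iF mcomp') => x _; exact: bpsi'.
have mm : measurable_fun Y (fun x => F x * psi (Phi x)) by exact: measurable_funM.
split; first exact: integrable_ae_eq i' mm aeM.
have mm' : measurable_fun Y (fun x => F x * psi' (Phi x)) by exact: measurable_funM.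
rewrite -(Rintegral_ae_eq mY mm' mm aeM).
have mg : measurable_fun [set: R] g by exact: (@measurable_EFinP _ TR R setT g).1 (measurable_int mu ig).
have mgI : measurable_fun (@I01 R) g by exact: measurable_funTS.
have mpI : measurable_fun (@I01 R) psi' by exact: measurable_funTS.
rewrite (@integral_I_eqI _ _ (fun x => g x * psi' x)); last first.
- by apply: aeS ee => x h /h ->.
- exact: measurable_funM.
- exact: measurable_funM.
have mI : measurable (@I01 R) := @measurable_I01 R.
(* The identity at hand concerns the whole line, where [g] need not vanish off [I01]; the indicator
   removes that part. *)
pose psi1 x := psi' x * \1_I01 x.
have mpsi1 : measurable_fun [set: R] psi1 by apply: measurable_funM.
have bpsi1 x : `|psi1 x| <= K.
  by rewrite /psi1 normrM indicE; case: (_ \in _); rewrite ?normr1 ?normr0 ?mulr1 ?mulr0.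
have := pairing_bounded ig iF0 mPhi0 pair mpsi1 bpsi1.
have -> : \int[mu]_(x in [set: TR]) (g x * psi1 x) = integral_I (fun x => g x * psi' x).
  rewrite /integral_I [RHS]Rintegral_mkcond; apply: eq_Rintegral => x _.
  by rewrite /psi1 patchE indicE; case: ifP => h; rewrite /= ?mulr1 ?mulr0.
move=> ->; rewrite [RHS]Rintegral_mkcond; apply: eq_Rintegral => x _.
rewrite /psi1 /F0 /Phi0 !patchE; case: ifP => h; last by rewrite mul0r.
by rewrite indicE mem_set ?mulr1 //; apply: PhiI; move: h; rewrite inE.
Qed.

(** * Test functions and weak derivatives *)

Lemma Rintegral_dominated_cvg d (T : measurableType d) (R : realType)
    (mu : {measure set T -> \bar R}) (D : set T) (u_ : nat -> T -> R) (u v : T -> R) :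
  measurable D -> (forall n, measurable_fun D (u_ n)) -> measurable_fun D u ->
  (\forall x \ae mu, D x -> u_ n x @[n --> \oo] --> u x) ->
  mu.-integrable D (EFin \o v) -> (forall n x, D x -> `|u_ n x| <= v x) ->
  mu.-integrable D (EFin \o u) /\
  \int[mu]_(x in D) u_ n x @[n --> \oo] --> \int[mu]_(x in D) u x.
Proof.
move=> mD mu_ mu0 cvgu iv ub.
have c : \forall x \ae mu, D x -> (EFin \o u_ n) x @[n --> \oo] --> (EFin \o u) x.
  by apply: filterS cvgu => x h Dx; apply: cvg_EFin; [exact: nearW|exact: h Dx].
have ub' : \forall x \ae mu, forall n, D x -> (`|(EFin \o u_ n) x| <= (EFin \o v) x)%E.
  by apply: aeW => x n Dx /=; rewrite lee_fin; exact: ub.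
have [i1 _ i3] := @dominated_convergence _ T R mu D mD (fun n => EFin \o u_ n) (EFin \o u) (EFin \o v)
  (fun n => (measurable_EFinP _ _).2 (mu_ n)) ((measurable_EFinP _ _).2 mu0) c iv ub'.
split=> //; rewrite /Rintegral; apply: fine_cvg.
by rewrite fineK //; exact: integrable_fin_num.
Qed.

Section DerivativeRules.
Variable R : realType.
Implicit Types (f g : R -> R) (x a b : R).

Lemma is_derive_add f g x a b : is_derive x (1 : R) f a -> is_derive x (1 : R) g b ->
  is_derive x (1 : R) (fun y => f y + g y) (a + b).
Proof. by move=> df dg; exact: (is_deriveD df dg). Qed.

Lemma is_derive_mul f g x a b : is_derive x (1 : R) f a -> is_derive x (1 : R) g b ->
  is_derive x (1 : R) (fun y => f y * g y) (a * g x + f x * b).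
Proof.
move=> df dg; apply: is_derive_eq (is_deriveM df dg) _.
by rewrite /GRing.scale /= addrC mulrC.
Qed.

Lemma is_derive_scale (c : R) g x b : is_derive x (1 : R) g b ->
  is_derive x (1 : R) (fun y => c * g y) (c * b).
Proof.
move=> dg; apply: is_derive_eq (is_derive_mul (is_derive_cst c x (1 : R)) dg) _.
by rewrite mul0r add0r.
Qed.

Lemma is_derive_comp f g x a b : is_derive (g x) (1 : R) f a -> is_derive x (1 : R) g b ->
  is_derive x (1 : R) (fun y => f (g y)) (a * b).
Proof. by move=> df dg; exact: (is_derive1_comp df dg). Qed.

Lemma is_derive_inv f x a : f x != 0 -> is_derive x (1 : R) f a ->
  is_derive x (1 : R) (fun y => (f y)^-1) (- a / f x ^+ 2).
Proof.
move=> f0 df; apply: is_derive_eq (is_deriveV f0 df) _.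
by rewrite /GRing.scale /= mulNr mulrC mulNr.
Qed.

Lemma is_derive_val f x a b : is_derive x (1 : R) f a -> a = b -> is_derive x (1 : R) f b.
Proof. by move=> + <-. Qed.

Lemma is_derive_exp f x a n : is_derive x (1 : R) f a ->
  is_derive x (1 : R) (fun y => f y ^+ n) (n%:R * f x ^+ n.-1 * a).
Proof.
move=> df; elim: n => [|n IH].
  by rewrite !mul0r; exact: is_derive_cst.
have h := is_derive_mul df IH.
have -> : (fun y => f y ^+ n.+1) = (fun y => f y * f y ^+ n) by apply/funext => y; rewrite exprS.
apply: is_derive_val h _; rewrite /= -[n.+1%:R]natr1.
case: n {IH} => [|n] /=; first by rewrite expr0; ring.
by rewrite exprS; ring.
Qed.

Lemma is_derive_opp f x a : is_derive x (1 : R) f a -> is_derive x (1 : R) (fun y => - f y) (- a).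
Proof. by move=> df; exact: (is_deriveN df). Qed.

Lemma is_derive_near f g x a : (\forall y \near x, f y = g y) ->
  is_derive x (1 : R) f a -> is_derive x (1 : R) g a.
Proof. exact: near_eq_is_derive. Qed.

End DerivativeRules.

(** * Smooth bump functions *)

Section SmoothFunctions.
Variable R : realType.
Implicit Types (u v : R -> R).

Definition smooth u := forall (n : nat) (x : R), derivable (derive1n n u) x 1.

(** A coinduction principle: closure of a class under one differentiation replaces any formula for
    the n-th derivative. *)
Lemma smooth_coind (S : set (R -> R)) :
  (forall u, S u -> (forall x, derivable u x 1) /\ S (derive1 u)) ->
  forall u, S u -> smooth u.
Proof.
move=> h u Su n; elim: n u Su => [|n IH] u Su x.
  by rewrite derive1n0; have [+ _] := h u Su; apply.
by rewrite derive1Sn; apply: IH; have [] := h u Su.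
Qed.

Lemma is_derive_derive1 u v : (forall x : R, is_derive x (1 : R) u (v x)) -> derive1 u = v.
Proof. by move=> h; apply/funext => x; rewrite derive1E; have [] := h x. Qed.

Lemma smooth_is_derive u (x : R) : smooth u -> is_derive x (1 : R) u (derive1 u x).
Proof.
by move=> su; rewrite derive1E; apply: derivableP; have := su 0%N x; rewrite derive1n0.
Qed.

Lemma smooth_derive1 u : smooth u -> smooth (derive1 u).
Proof. by move=> su n x; have := su n.+1 x; rewrite derive1Sn. Qed.

Lemma smooth_lin (c : R) u v : smooth u -> smooth v -> smooth (fun x => u x + c * v x).
Proof.
move=> su sv; apply: (@smooth_coind [set w | exists u v, [/\ smooth u, smooth v & w = fun x => u x + c * v x]]).
  move=> _ [u' [v' [su' sv' ->]]].
  have d (x : R) : is_derive x (1 : R) (fun x => u' x + c * v' x) (derive1 u' x + c * derive1 v' x).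
    by apply: is_derive_add; [|apply: is_derive_scale]; exact: smooth_is_derive.
  split=> [x|]; first by have [] := d x.
  exists (derive1 u'), (derive1 v'); split; [exact: smooth_derive1|exact: smooth_derive1|].
  exact: is_derive_derive1.
by exists u, v.
Qed.

(** The classical flat function is the case [k = 0]. The powers [x^-k] are included because the
    derivatives then stay in the linear span of the family. *)
Definition flat (k : nat) (x : R) : R := if 0 < x then (x^-1) ^+ k * expR (- x^-1) else 0.

Lemma flat_ge0 k x : 0 <= flat k x.
Proof.
rewrite /flat; case: ifP => // x0.
by rewrite mulr_ge0 ?expR_ge0// exprn_ge0 // invr_ge0 ltW.
Qed.

(** With [y = 1/x] and [m = k + 2], the bound is [(y/m)^m <= exp y]. A quadratic bound is what
    forces the derivative at 0 to vanish. *)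
Lemma flat_le_sqr k : exists2 C : R, 0 <= C & forall x, flat k x <= C * x ^+ 2.
Proof.
pose m : R := k.+2%:R; have m0 : 0 < m by rewrite ltr0n.
exists (m ^+ k.+2) => [|x]; first by rewrite exprn_ge0 // ltW.
rewrite /flat; case: ifP => x0; last by rewrite mulr_ge0 ?sqr_ge0 ?exprn_ge0 ?ltW.
set y := x^-1; have y0 : 0 < y by rewrite invr_gt0.
have h : (y / m) ^+ k.+2 <= expR y.
  have -> : expR y = expR (y / m) ^+ k.+2.
    by rewrite -expRM_natl /m mulrC divfK // gt_eqF.
  rewrite lerXn2r ?nnegrE ?expR_ge0 ?divr_ge0 ?(ltW y0) ?(ltW m0)//.
  by apply: le_trans (expR_ge1Dx _); rewrite lerDr.
have -> : x ^+ 2 = (y ^+ 2)^-1 by rewrite /y exprVn invrK.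
rewrite expRN ler_pdivrMr ?expR_gt0 //.
apply: le_trans (ler_wpM2l _ h); last by rewrite mulr_ge0 ?invr_ge0 ?exprn_ge0 ?(ltW y0) ?(ltW m0).
rewrite expr_div_n -addn2 (exprD y) le_eqVlt; apply/orP; left; apply/eqP.
by field; rewrite !gt_eqF // exprn_gt0.
Qed.

Lemma is_derive_flat0 u (C : R) : u 0 = 0 -> (forall x, `|u x| <= C * x ^+ 2) ->
  is_derive (0 : R) 1 u 0.
Proof.
move=> u0 hu.
have c : h^-1 *: (u (h *: 1 + 0) - u 0) @[h --> (0:R)^'] --> (0 : R).
  apply/cvgr0Pnorm_le => e e0.
  have C0 : 0 <= C by have := hu 1; rewrite expr1n mulr1; apply: le_trans.
  near=> h.
  have h0 : h != 0 by near: h; exact: nbhs_dnbhs_neq.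
  rewrite u0 subr0 addr0 /GRing.scale /= mulr1 normrM normfV.
  rewrite ler_pdivrMl ?normr_gt0 //; apply: le_trans (hu h) _.
  rewrite -[h ^+ 2]ger0_norm ?sqr_ge0 // normrX expr2 mulrCA ler_wpM2l //.
  have hC : `|h| < e / (C + 1).
    near: h; apply: dnbhs0_lt; rewrite divr_gt0 //; lra.
  have C1 : 0 < C + 1 by lra.
  move: hC; rewrite ltr_pdivlMr // => hC.
  have := normr_ge0 h; nra.
split; first by apply/cvg_ex; exists 0.
exact: cvg_lim c.
Unshelve. all: by end_near.
Qed.

Lemma is_derive_flat k (x : R) :
  is_derive x 1 (flat k) (flat k.+2 x - k%:R * flat k.+1 x).
Proof.
have [x0|x0|x0] := ltrgt0P x.
- have nearE : \near x, (fun x => (x^-1) ^+ k * expR (- x^-1)) x = flat k x.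
    near=> y; rewrite /flat ifT //; near: y; exact: lt_nbhsr.
  apply: near_eq_is_derive nearE _.
  have xn0 : x != 0 by rewrite gt_eqF.
  have d1 : is_derive x (1 : R) (fun y : R => y^-1) (- 1 / x ^+ 2).
    exact: (is_derive_inv xn0 (is_derive_id x (1 : R))).
  have d3 : is_derive x (1 : R) (fun y : R => expR (- y^-1)) (expR (- x^-1) * - (- 1 / x ^+ 2)).
    exact: (@is_derive_comp R expR (fun y => - y^-1) x _ _ (is_derive_expR _) (is_derive_opp d1)).
  apply: is_derive_val (is_derive_mul (is_derive_exp k d1) d3) _.
  rewrite /flat x0 -exprVn; move: (x^-1) => y.
  case: k => [|k] /=; first by rewrite !expr0; ring.
  by rewrite !exprSr; ring.
- have nearE : \near x, (fun _ => 0) x = flat k x.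
    near=> y; rewrite /flat ifF //; apply/negbTE; rewrite -leNgt ltW //; near: y; exact: lt_nbhsl.
  apply: near_eq_is_derive nearE _.
  rewrite /flat ltNge (ltW x0) /= mulr0 subrr; exact: is_derive_cst.
- have [C C0 hC] := flat_le_sqr k.
  rewrite x0 /flat ltxx mulr0 subrr; apply: (@is_derive_flat0 _ C).
    by rewrite /flat ltxx.
  by move=> y; rewrite -/(flat k y) ger0_norm ?flat_ge0.
Unshelve. all: by end_near.
Qed.

(** A class stable under differentiation, to which [smooth_coind] applies; the affine arguments
    allow bumps at any place and scale, and the products allow two-sided ones. *)
Inductive bump_algebra : (R -> R) -> Prop :=
| BumpFlat k a b : bump_algebra (fun x => flat k (a * x + b))
| BumpAdd c u v : bump_algebra u -> bump_algebra v -> bump_algebra (fun x => u x + c * v x)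
| BumpMul u v : bump_algebra u -> bump_algebra v -> bump_algebra (fun x => u x * v x).

Lemma bump_algebra_derive u : bump_algebra u ->
  exists2 u', bump_algebra u' & forall x : R, is_derive x (1 : R) u (u' x).
Proof.
elim => {u} [k a b|c u v _ [u' bu' du'] _ [v' bv' dv']|u v bu [u' bu' du'] bv [v' bv' dv']].
- pose w x := flat k.+2 (a * x + b) + (- k%:R) * flat k.+1 (a * x + b).
  have bw : bump_algebra w by apply: BumpAdd; exact: BumpFlat.
  (* This is [a * w x], written in the only form of linear combination that [BumpAdd] provides. *)
  exists (fun x => w x + (a - 1) * w x) => [|x]; first exact: BumpAdd.
  have d1 : is_derive x (1 : R) (fun x => a * x + b) (a * 1 + 0).
    by apply: is_derive_add; apply: is_derive_scale.
  apply: (is_derive_val (@is_derive_comp R (flat k) (fun y => a * y + b) x _ _ (is_derive_flat k _) d1)).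
  by rewrite /w; ring.
- exists (fun x => u' x + c * v' x) => [|x]; first exact: BumpAdd.
  by apply: is_derive_add => //; exact: is_derive_scale.
- exists (fun x => u' x * v x + 1 * (u x * v' x)) => [|x].
    by apply: BumpAdd; exact: BumpMul.
  by rewrite mul1r; exact: is_derive_mul.
Qed.

Lemma bump_algebra_smooth u : bump_algebra u -> smooth u.
Proof.
apply: smooth_coind => {}u bu; have [u' bu' du'] := bump_algebra_derive bu.
by split=> [x|]; [have [] := du' x|rewrite (is_derive_derive1 du')].
Qed.

(** Inside []p, q[] both factors are of the form [exp (-1/((n+1) d))], with [d] the distance to an
    end point; as [n] grows they tend to 1, so the bumps approximate the indicator of the interval
    from below. *)
Definition bump (n : nat) (p q x : R) : R :=
  flat 0 (n.+1%:R * (x - p)) * flat 0 (n.+1%:R * (q - x)).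

Lemma flat0_le1 x : flat 0 x <= 1.
Proof.
rewrite /flat; case: ifP => // x0; rewrite expr0 mul1r -[leRHS](@expR0 R) ler_expR.
by rewrite lerNl oppr0 invr_ge0 ltW.
Qed.

Lemma bump_ge0 n p q x : 0 <= bump n p q x.
Proof. by rewrite mulr_ge0 ?flat_ge0. Qed.

Lemma bump_le1 n p q x : bump n p q x <= 1.
Proof. by rewrite -[leRHS]mulr1 ler_pM ?flat_ge0 ?flat0_le1. Qed.

Lemma bump_smooth n p q : smooth (bump n p q).
Proof.
apply: bump_algebra_smooth.
have -> : bump n p q = fun x => flat 0 (n.+1%:R * x + (- n.+1%:R * p)) * flat 0 (- n.+1%:R * x + n.+1%:R * q).
  by apply/funext => x; rewrite /bump; congr (flat _ _ * flat _ _); ring.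
by apply: BumpMul; exact: BumpFlat.
Qed.

Lemma bump_test n p q : 0 < p -> q < 1 -> test_function (bump n p q).
Proof.
move=> p0 q1; split; first exact: bump_smooth.
exists p, q; split=> // x; rewrite in_itv /= negb_and -!ltNge => /orP[h|h]; rewrite /bump /flat.
  by rewrite ifF ?mul0r //; apply/negbTE; rewrite -leNgt pmulr_rle0 // subr_le0 ltW.
by rewrite [X in _ * X]ifF ?mulr0 //; apply/negbTE; rewrite -leNgt pmulr_rle0 // subr_le0 ltW.
Qed.

Lemma cvg_flat0 (y : R) : 0 < y -> flat 0 (n.+1%:R * y) @[n --> \oo] --> (1 : R).
Proof.
move=> y0.
have -> : (fun n => flat 0 (n.+1%:R * y)) = (fun n => expR (- (n.+1%:R^-1 * y^-1))).
  by apply/funext => n; rewrite /flat mulr_gt0 // expr0 mul1r invfM.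
rewrite -[X in _ --> X](@expR0 R).
apply: (@cvg_comp _ _ _ _ (@expR R) _ (nbhs (0 : R))); last exact: continuous_expR.
have c : - (n.+1%:R^-1 / y) @[n --> \oo] --> - (0 * y^-1).
  by apply: cvgN; apply: cvgMl; exact: cvg_harmonic.
by move: c; rewrite mul0r oppr0.
Qed.

Lemma cvg_bump p q x : bump n p q x @[n --> \oo] --> (\1_(`]p, q[%classic) x : R).
Proof.
rewrite indicE mem_setE in_itv /=.
have [px|px] /= := ltP p x; last first.
  rewrite (_ : (fun n => _) = fun=> 0); first exact: cvg_cst.
  apply/funext => n; rewrite /bump {1}/flat ifF ?mul0r //.
  by apply/negbTE; rewrite -leNgt pmulr_rle0 // subr_le0.
have [xq|xq] /= := ltP x q; last first.
  rewrite (_ : (fun n => _) = fun=> 0); first exact: cvg_cst.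
  apply/funext => n; rewrite /bump [X in _ * X]/flat ifF ?mulr0 //.
  by apply/negbTE; rewrite -leNgt pmulr_rle0 // subr_le0.
rewrite /bump; rewrite -[X in _ --> X](mulr1 1).
by apply: cvgM; apply: cvg_flat0; rewrite subr_gt0.
Qed.

End SmoothFunctions.

(** * Test functions on the unit interval *)

Section WeakDerivatives.
Variable R : realType.
Implicit Types (u v g h eta phi : R -> R).
Notation mu := (@lebesgue_measure R).
Notation TR := (measurableTypeR R).

Lemma continuous_derivable u : (forall x : R, derivable u x 1) -> continuous u.
Proof. by move=> du x; apply: differentiable_continuous; exact/derivable1_diffP. Qed.

Lemma test_smooth eta : test_function eta -> smooth eta. Proof. by case. Qed.

Lemma test_continuous eta n : test_function eta -> continuous (derive1n n eta).
Proof. by move=> [st _]; apply: continuous_derivable => x; exact: st. Qed.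

Lemma test_supp eta : test_function eta ->
  exists p q : R, [/\ 0 < p, p <= q, q < 1 & forall x, x < p \/ q < x -> eta x = 0].
Proof.
move=> [_ [p [q [p0 q1 h]]]].
have [pq|qp] := leP p q.
  exists p, q; split=> // x xpq; apply: h; rewrite in_itv /=; apply/negP => /andP[h1 h2].
  by case: xpq; rewrite ltNge ?h1 ?h2.
(* Here [q < p], so the function vanishes identically and any point inside the unit interval serves
   as support. *)
exists (1/2), (1/2); split; try lra; move=> x _; apply: h.
by rewrite in_itv /=; apply/negP => /andP[h1 h2]; lra.
Qed.

Lemma test_supp_derive1 eta (p q : R) : (forall x, x < p \/ q < x -> eta x = 0) ->
  forall x, x < p \/ q < x -> derive1 eta x = 0.
Proof.
move=> h x xpq.
have nearE : \near x, (fun=> 0) x = eta x.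
  case: xpq => hx; near=> y; rewrite h //.
    by left; near: y; exact: lt_nbhsl.
  by right; near: y; exact: lt_nbhsr.
have d : is_derive x (1 : R) eta 0 by apply: is_derive_near nearE _; exact: is_derive_cst.
by rewrite derive1E; have [] := d.
Unshelve. all: by end_near.
Qed.

Lemma test_derive1 eta : test_function eta -> test_function (derive1 eta).
Proof.
move=> te; have [p [q [p0 pq q1 h]]] := test_supp te.
split; first by apply: smooth_derive1; exact: test_smooth.
exists p, q; split=> // x; rewrite in_itv /= negb_and -!ltNge => /orP hx.
exact: test_supp_derive1 h _ _.
Qed.

Lemma test_lin (c : R) eta u : test_function eta -> test_function u ->
  test_function (fun x => eta x + c * u x).
Proof.
move=> te tu; have [p [q [p0 pq q1 h]]] := test_supp te.
have [p' [q' [p0' pq' q1' h']]] := test_supp tu.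
split; first by apply: smooth_lin; exact: test_smooth.
exists (Num.min p p'), (Num.max q q'); split; [by rewrite lt_min p0|by rewrite gt_max q1|].
move=> x; rewrite in_itv /= negb_and -!ltNge lt_min gt_max => /orP[] /andP[h1 h2].
  by rewrite h ?h' ?mulr0 ?addr0 //; left.
by rewrite h ?h' ?mulr0 ?addr0 //; right.
Qed.

Lemma continuous_measurable u : continuous u -> measurable_fun [set: R] u.
Proof. exact: continuous_measurable_fun. Qed.

Lemma test_measurable eta n (D : set R) : test_function eta -> measurable_fun D (derive1n n eta).
Proof.
move=> te; apply: measurable_funTS; apply: continuous_measurable; exact: test_continuous.
Qed.

Lemma continuous_bounded_I01 u : continuous u -> exists K, forall x, I01 x -> `|u x| <= K.
Proof.
move=> cu; have c : {within `[0, 1], continuous (fun x => `|u x|)}.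
  apply: continuous_subspaceT => x; apply: continuous_comp; first exact: cu.
  exact: norm_continuous.
have [m _ hm] := EVT_max ler01 c.
by exists `|u m| => x; exact: hm.
Qed.

Lemma test_bounded eta n : test_function eta -> exists K, forall x, I01 x -> `|derive1n n eta x| <= K.
Proof. by move=> te; apply: continuous_bounded_I01; exact: test_continuous. Qed.

Lemma L1I_mul_test u eta n : L1I u -> test_function eta -> L1I (fun x => u x * derive1n n eta x).
Proof.
move=> iu te; have [K hK] := test_bounded n te.
by apply: (L1I_mulb iu _ hK); exact: test_measurable.
Qed.

Lemma integral_I_dominated_cvg (u_ : nat -> R -> R) u v :
  (forall n, measurable_fun I01 (u_ n)) -> measurable_fun I01 u ->
  (forall x, I01 x -> u_ n x @[n --> \oo] --> u x) ->
  L1I v -> (forall n x, I01 x -> `|u_ n x| <= v x) ->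
  L1I u /\ integral_I (u_ n) @[n --> \oo] --> integral_I u.
Proof.
move=> m1 m2 c iv b.
by apply: (@Rintegral_dominated_cvg _ TR R mu I01 u_ u v) => //; [exact: measurable_I01|exact: aeT].
Qed.

(** Dominated convergence along the bumps, which stay between 0 and 1. *)
Lemma L1I_test_interval u : L1I u ->
  (forall eta, test_function eta -> integral_I (fun x => u x * eta x) = 0) ->
  forall p q : R, 0 < p -> q < 1 -> integral_I (fun x => u x * \1_(`]p, q[%classic) x) = 0.
Proof.
move=> iu h p q p0 q1.
have mI (n : nat) : measurable_fun I01 (bump n p q).
  by have := @test_measurable _ 0 I01 (bump_test n p0 q1); rewrite derive1n0.
have mu_ : measurable_fun I01 u := L1I_measurable iu.
have m1 : measurable_fun (@I01 R) (\1_(`]p, q[%classic) : R -> R).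
  by apply: measurable_indic; exact: measurable_itv.
have [||x Ix||_] := @integral_I_dominated_cvg (fun n x => u x * bump n p q x)
  (fun x => u x * \1_(`]p, q[%classic) x) (fun x => `|u x|) _ _ _ (L1I_norm iu).
- by move=> n; exact: measurable_funM.
- exact: measurable_funM.
- by apply: cvgMr; exact: cvg_bump.
- move=> n x Ix; rewrite normrM ler_piMr // ger0_norm ?bump_ge0 ?bump_le1 //.
rewrite (_ : (fun n => _) = fun=> 0); last by apply/funext => n; apply: h; exact: bump_test.
by move=> /(cvg_lim (@Rhausdorff R)) <-; apply: lim_cst; exact: Rhausdorff.
Qed.

End WeakDerivatives.

(** * Primitives, integration by parts and the one-dimensional Sobolev bound *)

Section Primitive.
Variable R : realType.
Implicit Types (u v g h eta phi zeta : R -> R).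
Notation mu := (@lebesgue_measure R).
Notation TR := (measurableTypeR R).

Lemma I01P (x : R) : I01 x <-> 0 <= x <= 1.
Proof. by rewrite /I01 /= in_itv. Qed.

Lemma ae_neq (a : R) : \forall x \ae mu, x <> a.
Proof.
exists [set a]; split; [exact: (@measurable_set1 R)|exact: lebesgue_measure_set1|].
by move=> x /= /contrapT.
Qed.

Lemma integrable_I_patch u : L1I u -> mu.-integrable [set: TR] (EFin \o (u \_ I01)).
Proof.
by move=> iu; have /(integrable_mkcond _ (@measurable_I01 R)) := iu; rewrite restrict_EFin.
Qed.

(** The indefinite integral of [v] is constant on []0, 1[], and by Lebesgue differentiation its
    derivative is [v] almost everywhere. *)
Lemma L1I_eq0_intervals v : L1I v ->
  (forall p q : R, 0 < p -> q < 1 -> integral_I (fun x => v x * \1_(`]p, q[%classic) x) = 0) ->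
  eqI v (fun=> 0).
Proof.
move=> iv h; pose f := v \_ I01.
have If := integrable_I_patch iv.
have IfS (i : interval R) : mu.-integrable [set` i] (EFin \o f).
  by apply: (@integrableS _ TR R mu setT) => //; exact: measurable_itv.
have loc : locally_integrable [set: R] f := integrable_locally (@measurable_I01 R) iv.
have := FTC1Ny (fun y => IfS `]-oo, y]) loc.
set F := fun x => _ => /= ae1.
have FE s t : 0 < s -> s <= t -> t < 1 -> F t = F s.
  move=> s0 st t1; apply/eqP; rewrite -subr_eq0 /F.
  rewrite (@Rintegral_itvB _ f -oo%O (BRight t) s) ?bnd_simp //.
  rewrite -Rintegral_itv_bndo_bndc //; apply/eqP.
  rewrite -[RHS](h s t s0 t1) /integral_I Rintegral_mkcond [RHS]Rintegral_mkcond.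
  apply: eq_Rintegral => x _; rewrite /f !patchE indicE.
  have [xI|xI] := boolP (x \in `]s, t[%classic).
    by rewrite mulr1.
  by rewrite mulr0 if_same.
apply: (aeS2 _ (aeS2 _ (ae_neq 0) (ae_neq 1)) ae1); last by move=> x; exact: conj.
move=> x [x0 x1] [dF Fx] Ix; have fx : f x = v x by rewrite /f patchE mem_set.
rewrite -fx -Fx.
have [x0' x1'] : 0 < x /\ x < 1.
  have /I01P/andP[a b] := Ix; rewrite !lt_neqAle a b !andbT.
  by split; apply/eqP => // e; exact: x0.
have nearE : \forall y \near x, F x = F y.
  near=> y; have y0 : 0 < y by near: y; exact: lt_nbhsr.
  have y1 : y < 1 by near: y; exact: lt_nbhsl.
  by have [xy|/ltW yx] := leP x y; [rewrite (FE x y)|rewrite (FE y x)].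
have d : is_derive x (1 : R) F 0 by apply: is_derive_near nearE _; exact: is_derive_cst.
by rewrite derive1E; have [] := d.
Unshelve. all: by end_near.
Qed.

Lemma fundamental_lemma v : L1I v ->
  (forall eta, test_function eta -> integral_I (fun x => v x * eta x) = 0) -> eqI v (fun=> 0).
Proof. by move=> iv h; apply: L1I_eq0_intervals => //; exact: L1I_test_interval. Qed.

Definition primitive g (x : R) : R := \int[mu]_(t in `[0, x]) g t.

Lemma L1I_sub_itv g (s t : R) : L1I g -> 0 <= s -> t <= 1 ->
  mu.-integrable `[s, t] (EFin \o g).
Proof.
move=> ig s0 t1; apply: (@integrableS _ TR R mu I01) => //.
- exact: measurable_I01.
- by move=> x /=; rewrite in_itv /= => /andP[h1 h2]; apply/I01P; lra.
Qed.

Lemma primitiveB g s t : L1I g -> 0 <= s -> s <= t -> t <= 1 ->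
  primitive g t - primitive g s = \int[mu]_(x in `[s, t]) g x.
Proof.
move=> ig s0 st t1; rewrite /primitive.
rewrite (@Rintegral_itvB _ g (BLeft 0) (BRight t) s) ?bnd_simp //; last exact: L1I_sub_itv.
rewrite Rintegral_itv_obnd_cbnd //.
apply: (@integrableS _ TR R mu `[s, t]%classic) => //; try exact: measurable_itv.
  by move=> x /=; rewrite !in_itv /= => /andP[h1 h2]; apply/andP; split; [exact: ltW|].
exact: L1I_sub_itv.
Qed.

Lemma primitiveB_le g s t : L1I g -> 0 <= s -> s <= t -> t <= 1 ->
  `|primitive g t - primitive g s| <= \int[mu]_(x in `[s, t]) `|g x|.
Proof.
move=> ig s0 st t1; rewrite primitiveB //.
apply: (@le_normr_Rintegral _ TR R mu); last exact: L1I_sub_itv.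
exact: measurable_itv.
Qed.

Lemma integral_itv_le_I g s t : L1I g -> 0 <= s -> t <= 1 ->
  \int[mu]_(x in `[s, t]) `|g x| <= integral_I (fun x => `|g x|).
Proof.
move=> ig s0 t1; rewrite /integral_I Rintegral_mkcond [leRHS]Rintegral_mkcond.
have sub : `[s, t]%classic `<=` @I01 R.
  by move=> x /=; rewrite in_itv /= => /andP[h1 h2]; apply/I01P; lra.
have i1 := integrable_I_patch (L1I_norm ig).
have i2 : mu.-integrable [set: TR] (EFin \o ((fun x => `|g x|) \_ `[s, t])).
  have := (@integrable_mkcond _ TR R mu `[s, t]%classic (EFin \o (fun x => `|g x|)) (measurable_itv _)).1
    (L1I_sub_itv (L1I_norm ig) s0 t1).
  by rewrite restrict_EFin.
apply: (@le_Rintegral _ TR R mu) => // x _; rewrite !patchE; case: ifP => // h.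
  by rewrite mem_set //; apply: sub; move: h; rewrite inE.
by case: ifP => _; [exact: normr_ge0|exact: lexx].
Qed.

Lemma primitive_bound g x : L1I g -> I01 x ->
  `|primitive g x| <= integral_I (fun x => `|g x|).
Proof.
move=> ig /I01P/andP[x0 x1].
have p0 : primitive g 0 = 0 by rewrite /primitive set_itv1 Rintegral_set1.
rewrite -[primitive g x]subr0 -p0; apply: le_trans (integral_itv_le_I ig (lexx 0) x1).
exact: primitiveB_le.
Qed.

Lemma primitive_continuous g : L1I g -> {within `[0, 1], continuous (primitive g)}.
Proof. by move=> ig; apply: parameterized_integral_continuous. Qed.

Lemma measurable_primitive g : L1I g -> measurable_fun (@I01 R) (primitive g).
Proof.
move=> ig; apply: subspace_continuous_measurable_fun; first exact: measurable_itv.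
exact: primitive_continuous.
Qed.

Lemma L1I_primitive g : L1I g -> L1I (primitive g).
Proof.
move=> ig; apply: (L1I_bounded (measurable_primitive ig)) => x Ix.
exact: primitive_bound ig Ix.
Qed.

(* Fubini on the triangle [s <= x]. *)
Lemma integral_primitive_mul g h (K : R) : L1I g -> measurable_fun (@I01 R) h ->
  (forall x, I01 x -> `|h x| <= K) ->
  integral_I (fun x => primitive g x * h x) =
  integral_I (fun s => g s * \int[mu]_(x in `[s, 1]) h x).
Proof.
move=> ig mh hK.
have mI : measurable (@I01 R : set TR) := @measurable_I01 R.
pose g0 := g \_ I01; pose h0 := h \_ I01.
have ig0 := integrable_I_patch ig.
have mg0 : measurable_fun [set: TR] g0 by apply/measurable_EFinP; exact: (measurable_int mu).
have mh0 : measurable_fun [set: TR] h0 by exact: (@measurable_restrictT _ _ TR R I01 h mI).1.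
have ih : L1I h := L1I_bounded mh hK.
have ih0 := integrable_I_patch ih.
pose ind (p : TR * TR) : R := if (p.2 <= p.1 :> R) then 1 else 0.
pose f (p : TR * TR) : R := h0 p.1 * g0 p.2 * ind p.
have mfst : measurable_fun [set: TR * TR] (fun p : TR * TR => p.1 : R) by exact: measurable_fst.
have msnd : measurable_fun [set: TR * TR] (fun p : TR * TR => p.2 : R) by exact: measurable_snd.
have mind : measurable_fun [set: TR * TR] ind.
  by apply: measurable_fun_ifT => //; exact: measurable_fun_ler.
have mf : measurable_fun [set: TR * TR] f.
  apply: measurable_funM => //; apply: measurable_funM.
    by apply: (@measurableT_comp _ _ _ _ TR R h0).
  by apply: (@measurableT_comp _ _ _ _ TR R g0).
have iF : (mu \x mu)%E.-integrable [set: TR * TR] (EFin \o f).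
  apply/integrable12ltyP; first exact/measurable_EFinP.
  have b1 x : (\int[mu]_y `|(EFin \o f) (x, y)| <= `|h0 x|%:E * \int[mu]_y `|(g0 y)%:E|)%E.
    rewrite -ge0_integralZl //; last by apply: measurableT_comp => //; exact/measurable_EFinP.
    apply: ge0_le_integral => //.
    - by apply: measurableT_comp => //; apply/measurable_EFinP; exact: measurableT_comp.
    - by apply: measurable_funeM; apply: measurableT_comp => //; exact/measurable_EFinP.
    - move=> y _ /=; rewrite -EFinM lee_fin /f normrM normrM ler_piMr ?mulr_ge0 //.
      by rewrite /ind; case: ifP; rewrite ?normr1 ?normr0.
  have G : (\int[mu]_y `|(g0 y)%:E| < +oo)%E by case/integrableP: ig0.
  have Gf : (\int[mu]_y `|(g0 y)%:E|)%E \is a fin_num by rewrite ge0_fin_numE // integral_ge0.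
  apply: (@le_lt_trans _ _ (\int[mu]_x (`|(h0 x)%:E| * \int[mu]_y `|(g0 y)%:E|))%E).
    apply: ge0_le_integral => //.
    - by move=> x _; apply: integral_ge0.
    - have mff : measurable_fun [set: TR * TR] (fun p => `|(EFin \o f) p|)%E.
        by apply: measurableT_comp => //; exact/measurable_EFinP.
      have mF := @measurable_fun_fubini_tonelli_F _ _ TR TR R mu _ mff (fun _ => abse_ge0 _).
      exact: mF.
    - by apply: emeasurable_funM => //; apply: measurableT_comp => //; exact/measurable_EFinP.
  rewrite ge0_integralZr //; last 2 first.
    by apply: measurableT_comp => //; exact/measurable_EFinP.
    exact: integral_ge0.
  by rewrite lte_mul_pinfty // ?integral_ge0 //; case/integrableP: ih0 => // _ H; rewrite ge0_fin_numE ?integral_ge0.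
have := Fubini iF.
have inner1 (x : R) : (\int[mu]_y (EFin \o f) (x, y) = ((fun x => primitive g x * h x) \_ I01 x)%:E)%E.
  rewrite patchE; case: ifP => xI; last first.
    under eq_integral do rewrite /f /h0 /= patchE xI !mul0r.
    by rewrite integral0.
  have Ix : I01 x by move: xI; rewrite inE.
  have /I01P/andP[x0 x1] := Ix.
  transitivity (\int[mu]_(y in `[0%R, x]%classic) (h x * g y)%:E)%E.
    rewrite [RHS]integral_mkcond; apply: eq_integral => y _.
    have key : h x * g0 y * (if y <= x then 1 else 0) = if 0 <= y <= x then h x * g y else 0.
      rewrite /g0 patchE /I01 mem_setE in_itv /=.
      have [yx|yx] := leP y x; have [y0|y0] := leP 0 y; rewrite /= ?mulr1 ?mulr0 ?(le_trans yx x1) //.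
    rewrite /f /h0 /ind /= !patchE xI key mem_setE in_itv /=.
    by case: ifP.
  have i1 := @L1I_sub_itv g 0 x ig (lexx _) x1.
  under eq_integral do rewrite EFinM.
  etransitivity; first exact: (@integralZl _ TR R mu `[0, x]%classic (measurable_itv _) _ i1 (h x)).
  rewrite /primitive /Rintegral -[X in (_ * X = _)%E]fineK; last first.
    by apply: integrable_fin_num => //; exact: measurable_itv.
  by rewrite -EFinM mulrC.
have inner2 (y : R) : (\int[mu]_x (EFin \o f) (x, y) =
    ((fun s => g s * \int[mu]_(x in `[s, 1]) h x) \_ I01 y)%:E)%E.
  rewrite patchE; case: ifP => yI; last first.
    under eq_integral do rewrite /f /g0 /= patchE yI mulr0 mul0r.
    by rewrite integral0.
  have Iy : I01 y by move: yI; rewrite inE.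
  have /I01P/andP[y0 y1] := Iy.
  transitivity (\int[mu]_(x in `[y, 1%R]%classic) (g y * h x)%:E)%E.
    rewrite [RHS]integral_mkcond; apply: eq_integral => x _.
    have key : h0 x * g y * (if y <= x then 1 else 0) = if y <= x <= 1 then g y * h x else 0.
      rewrite /h0 patchE /I01 mem_setE in_itv /=.
      have [yx|yx] := leP y x; have [x1|x1] := leP x 1; rewrite /= ?mulr1 ?mulr0 ?(le_trans y0 yx) ?andbF //=.
        by rewrite mulrC.
      by rewrite mul0r.
    rewrite /f /g0 /ind /= !patchE yI key mem_setE in_itv /=.
    by case: ifP.
  have i1 := @L1I_sub_itv h y 1 ih y0 (lexx _).
  under eq_integral do rewrite EFinM.
  etransitivity; first exact: (@integralZl _ TR R mu `[y, 1]%classic (measurable_itv _) _ i1 (g y)).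
  rewrite /Rintegral -[X in (_ * X = _)%E]fineK; last first.
    by apply: integrable_fin_num => //; exact: measurable_itv.
  by rewrite -EFinM.
under eq_integral do rewrite inner1.
under [X in _ = X -> _]eq_integral do rewrite inner2.
move=> e; rewrite /integral_I Rintegral_mkcond [RHS]Rintegral_mkcond /Rintegral.
by rewrite e.
Qed.

Lemma FTC2_I zeta zeta' (s t : R) : s <= t ->
  (forall x : R, is_derive x (1 : R) zeta (zeta' x)) -> continuous zeta' ->
  \int[mu]_(x in `[s, t]) zeta' x = zeta t - zeta s.
Proof.
move=> st dz cz'.
have [<-|st'] := eqVneq s t; first by rewrite set_itv1 Rintegral_set1 subrr.
have slt : s < t by rewrite lt_neqAle st' st.
have cz : continuous zeta by apply: continuous_derivable => x; have [] := dz x.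
rewrite /Rintegral (@continuous_FTC2 _ zeta' zeta) //.
- exact: continuous_subspaceT.
- split; first by move=> x _; have [] := dz x.
  + by apply: cvg_at_right_filter; exact: cz.
  + by apply: cvg_at_left_filter; exact: cz.
- by move=> x _; rewrite derive1E; have [] := dz x.
Qed.

(** Fubini on the triangle leaves the integral of [zeta'] over [[s, 1]], which is [- zeta s] because
    [zeta 1 = 0]. No condition at 0 arises: the primitive vanishes there. *)
Lemma ibp_primitive g zeta zeta' : L1I g ->
  (forall x : R, is_derive x (1 : R) zeta (zeta' x)) -> continuous zeta' -> zeta 1 = 0 ->
  integral_I (fun x => primitive g x * zeta' x) = - integral_I (fun x => g x * zeta x).
Proof.
move=> ig dz cz' z1; have [K hK] := continuous_bounded_I01 cz'.
have cz : continuous zeta by apply: continuous_derivable => x; have [] := dz x.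
rewrite (integral_primitive_mul ig _ hK); last first.
  by apply: measurable_funTS; exact: continuous_measurable.
rewrite -mulN1r -integral_I_scale; last first.
  have [L hL] := continuous_bounded_I01 cz.
  by apply: (L1I_mulb ig _ hL); apply: measurable_funTS; exact: continuous_measurable.
apply: integral_I_eq => x /I01P/andP[x0 x1]; rewrite (FTC2_I x1 dz cz') z1; ring.
Qed.

(** To the right of the support the primitive equals the total integral, which is zero; hence it is
    again compactly supported in []0, 1[]. *)
Lemma test_primitive eta : test_function eta -> integral_I eta = 0 ->
  exists H, [/\ test_function H & derive1 H = eta].
Proof.
move=> te i0; have [p [q [p0 pq q1 h]]] := test_supp te.
have ce : continuous eta by have := @test_continuous _ eta 0 te; rewrite derive1n0.
pose H x : R := \int[mu]_(t in `[0, x]) eta t.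
have Hl x : x < p -> H x = 0.
  move=> xp; rewrite /H (@eq_Rintegral _ _ _ mu _ (fun=> 0)); first by rewrite /Rintegral integral0.
  by move=> y; rewrite inE /= in_itv /= => /andP[y0 yx]; apply: h; left; exact: le_lt_trans xp.
have Hr x : q < x -> H x = 0.
  move=> qx; rewrite -i0 /H /integral_I Rintegral_mkcond [RHS]Rintegral_mkcond.
  apply: eq_Rintegral => y _; rewrite !patchE !mem_setE /= !in_itv /=.
  have [y0|//] := leP 0 y => /=.
  by have [yx|xy] := leP y x; have [y1|y1] := leP y 1 => //=; rewrite h //; right; lra.
have dH x : is_derive x (1 : R) H (eta x).
  have [xp|px] := ltP x p.
    rewrite h; last by left.
    have nearE : \forall y \near x, 0 = H y.
      by near=> y; rewrite Hl //; near: y; exact: lt_nbhsl.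
    by apply: is_derive_near nearE _; exact: is_derive_cst.
  have x0 : 0 < x by exact: lt_le_trans px.
  have ie : mu.-integrable `[0, x + 1] (EFin \o eta).
    apply: continuous_compact_integrable; first exact: segment_compact.
    exact: continuous_subspaceT.
  have xx : x < x + 1 by rewrite ltrDl.
  have [d1 d2] := continuous_FTC1_closed xx ie x0 (ce x).
  split; first exact: d1.
  by rewrite -derive1E; exact: d2.
have dHE : derive1 H = eta by exact: is_derive_derive1.
exists H; split=> //; split.
  case=> [|n] x; first by rewrite derive1n0; have [] := dH x.
  by rewrite derive1Sn dHE; exact: te.1.
exists p, q; split=> // x; rewrite in_itv /= negb_and -!ltNge => /orP[]; [exact: Hl|exact: Hr].
Unshelve. all: by end_near.
Qed.

(** If every test function had zero integral, the fundamental lemma applied to the constant 1 would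
    give [1 = 0]. *)
Lemma exists_test_integral1 : exists2 rho : R -> R, test_function rho & integral_I rho = 1.
Proof.
have [eta [te ne]] : exists eta : R -> R, test_function eta /\ integral_I eta <> 0.
  apply: contrapT => /forallNP hn.
  have z : eqI (fun=> (1 : R)) (fun=> 0).
    apply: fundamental_lemma; first exact: L1I_cst.
    move=> eta te; apply: contrapT => ne; apply: (hn eta); split=> //.
    by move=> e; apply: ne; rewrite -[RHS]e; apply: integral_I_eq => x _; rewrite mul1r.
  have := integral_I_eqI (measurable_cst _) (measurable_cst _) z.
  by rewrite !integral_I_cst => /eqP; rewrite oner_eq0.
have ie : L1I eta.
  have := @L1I_mul_test _ (fun=> 1) eta 0 (L1I_cst 1) te; rewrite derive1n0.
  by under eq_fun do rewrite mul1r.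
exists (fun x => 0 * eta x + (integral_I eta)^-1 * eta x).
  apply: test_lin => //.
  have -> : (fun x => 0 * eta x) = (fun x => eta x + (-1) * eta x) by apply/funext => x; ring.
  exact: test_lin.
under eq_fun do rewrite mul0r add0r.
by rewrite integral_I_scale // mulVf //; apply/eqP.
Qed.

(** The argument of du Bois-Reymond: [v = phi - primitive g] is orthogonal to derivatives of test
    functions, and [eta - m rho] with [m] the integral of [eta] is such a derivative. So [v] pairs
    with [eta] as the constant [C] does. *)
Lemma weak_deriv_primitive phi g : L1I phi -> is_weak_deriv 1 phi g ->
  exists C, eqI phi (fun x => C + primitive g x).
Proof.
move=> iphi [ig wd]; have [rho tr r1] := exists_test_integral1.
have iG := L1I_primitive ig.
pose v x := phi x - primitive g x.
have iv : L1I v by exact: L1I_sub.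
pose C := integral_I (fun x => v x * rho x).
have mt u eta : L1I u -> test_function eta -> L1I (fun x => u x * eta x).
  by move=> iu te; have := L1I_mul_test 0 iu te; rewrite derive1n0.
have it eta : test_function eta -> L1I eta.
  by move=> te; have := mt _ _ (L1I_cst 1) te; under eq_fun do rewrite mul1r.
exists C.
have z : eqI (fun x => v x - C) (fun=> 0).
  apply: fundamental_lemma; first by apply: L1I_sub => //; exact: L1I_cst.
  move=> eta te; pose m := integral_I eta.
  have t0 : test_function (fun x => eta x + (- m) * rho x) by exact: test_lin.
  have i0 : integral_I (fun x => eta x + (- m) * rho x) = 0.
    rewrite integral_I_add ?integral_I_scale ?r1 /m; try ring.
    - exact: it.
    - exact: it.
    - by apply: L1I_scale; exact: it.
  have [H [tH dH]] := test_primitive t0 i0.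
  have e1 := wd H tH; rewrite derive1n1 dH expr1 mulN1r in e1.
  have sH : forall x : R, is_derive x (1 : R) H (derive1 H x).
    by move=> x; apply: smooth_is_derive; exact: test_smooth.
  have cH : continuous (derive1 H).
    by rewrite dH; have := @test_continuous _ _ 0 t0; rewrite derive1n0.
  have [p [q [p0 pq q1 h]]] := test_supp tH.
  have H1 : H 1 = 0 by apply: h; right.
  have e2 := ibp_primitive ig sH cH H1; rewrite dH in e2.
  have e3 : integral_I (fun x => v x * (eta x + - m * rho x)) = 0.
    rewrite (@integral_I_eq _ _ (fun x => phi x * (eta x + - m * rho x) - primitive g x * (eta x + - m * rho x))); last first.
      by move=> x _; rewrite /v mulrBl.
    by rewrite integral_I_sub ?e1 ?e2 ?subrr //; exact: mt.
  rewrite (@integral_I_eq _ _ (fun x => v x * eta x + (- C) * eta x)); last by move=> x _; ring.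
  rewrite integral_I_add ?integral_I_scale //; try exact: mt; try exact: it; last by apply: L1I_scale; exact: it.
  move: e3; rewrite (@integral_I_eq _ _ (fun x => v x * eta x + (- m) * (v x * rho x))); last by move=> x _; ring.
  rewrite integral_I_add ?integral_I_scale //; try exact: mt; last by apply: L1I_scale; exact: mt.
  by rewrite -/C -/m => <-; ring.
by apply: aeS z => x h /h; rewrite /v; lra.
Qed.

Lemma weak_deriv_unique j phi g h : is_weak_deriv j phi g -> is_weak_deriv j phi h -> eqI g h.
Proof.
move=> [ig hg] [ih hh]; apply: sub_eqI0; apply: fundamental_lemma; first exact: L1I_sub.
move=> eta te.
have i1 : L1I (fun x => g x * eta x) by have := L1I_mul_test 0 ig te; rewrite derive1n0.
have i2 : L1I (fun x => h x * eta x) by have := L1I_mul_test 0 ih te; rewrite derive1n0.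
rewrite (@integral_I_eq _ _ (fun x => g x * eta x - h x * eta x)); last by move=> x _; ring.
rewrite integral_I_sub //; apply/eqP; rewrite subr_eq0; apply/eqP.
apply: (@mulfI _ ((-1) ^+ j)); first by rewrite expf_neq0 // oppr_eq0 oner_eq0.
by rewrite -hg // -hh.
Qed.

Lemma weak_deriv0 phi : L1I phi -> is_weak_deriv 0 phi phi.
Proof. by move=> ip; split=> // eta te; rewrite derive1n0 expr0 mul1r. Qed.

Lemma weak_derivP j phi g : is_weak_deriv j phi g ->
  is_weak_deriv j phi (weak_deriv j phi) /\ eqI (weak_deriv j phi) g.
Proof.
move=> wg; have w : is_weak_deriv j phi (weak_deriv j phi) by apply: getPex; exists g.
by split=> //; exact: weak_deriv_unique w wg.
Qed.

(** Order two is defined by testing against second derivatives; this converts it into two successive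
    first order derivatives, the form in which integration by parts is done. *)
Lemma weak_deriv_1_2 phi g1 g2 : is_weak_deriv 1 phi g1 -> is_weak_deriv 2 phi g2 ->
  is_weak_deriv 1 g1 g2.
Proof.
move=> [i1 h1] [i2 h2]; split=> // eta te.
have := h1 _ (test_derive1 te); have := h2 _ te.
rewrite !derive1n1 (_ : derive1n 2 eta = derive1 (derive1 eta)); last by rewrite derive1nS derive1n1.
rewrite !expr1 !mulN1r expr2 mulrNN mul1r mul1r => -> /eqP; rewrite -eqr_oppLR => /eqP <-.
by [].
Qed.

Section Consequences.
Variables (phi g : R -> R).
Hypothesis iphi : L1I phi.
Hypothesis wd : is_weak_deriv 1 phi g.

(** Enlarges the class of test functions to [C^1] functions that merely vanish at 0 and 1. The
    composition of a test function with a cusp map, times a quotient of derivatives, is no smoother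
    than that. *)
Lemma weak_ibp zeta zeta' :
  (forall x : R, is_derive x (1 : R) zeta (zeta' x)) -> continuous zeta' ->
  zeta 0 = 0 -> zeta 1 = 0 ->
  integral_I (fun x => phi x * zeta' x) = - integral_I (fun x => g x * zeta x).
Proof.
move=> dz cz' z0 z1; have ig := wd.1.
have [C hC] := weak_deriv_primitive iphi wd.
have mz : measurable_fun (@I01 R) zeta' by apply: measurable_funTS; exact: continuous_measurable.
have [K hK] := continuous_bounded_I01 cz'.
rewrite -(ibp_primitive ig dz cz' z1).
rewrite (@integral_I_eqI _ _ (fun x => C * zeta' x + primitive g x * zeta' x)); last first.
- by apply: aeS hC => x h /h ->; rewrite mulrDl.
- apply: measurable_funD; first exact: measurable_funM.
  by apply: measurable_funM => //; exact: measurable_primitive.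
- by apply: measurable_funM => //; exact: L1I_measurable.
have iz : L1I zeta' := L1I_bounded mz hK.
rewrite integral_I_add ?integral_I_scale //; last first.
- by apply: (L1I_mulb (L1I_primitive ig) mz hK).
- exact: L1I_scale.
have -> : integral_I zeta' = 0 by rewrite /integral_I (FTC2_I ler01 dz cz') z0 z1 subrr.
by rewrite mulr0 add0r.
Qed.

(** The continuous representative [C + primitive g] oscillates by at most the [L^1] norm of [g];
    averaging [|v x| <= |v y| + |v x - v y|] over [y] gives the bound. *)
Lemma sobolev_bound : \forall x \ae mu, I01 x ->
  `|phi x| <= integral_I (fun x => `|phi x|) + integral_I (fun x => `|g x|).
Proof.
have ig := wd.1; have [C hC] := weak_deriv_primitive iphi wd.
set A := integral_I _; set B := integral_I _.
pose v x := C + primitive g x.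
have iv : L1I v by apply: L1I_add; [exact: L1I_cst|exact: L1I_primitive].
have vA : integral_I (fun x => `|v x|) = A.
  apply: integral_I_eqI; [exact: (L1I_measurable (L1I_norm iv))|exact: (L1I_measurable (L1I_norm iphi))|].
  by apply: aeS hC => x h /h ->.
have osc x y : I01 x -> I01 y -> `|v x - v y| <= B.
  move=> /I01P/andP[x0 x1] /I01P/andP[y0 y1].
  have -> : v x - v y = primitive g x - primitive g y by rewrite /v; ring.
  have [xy|/ltW yx] := leP x y.
    rewrite distrC; apply: le_trans (primitiveB_le ig x0 xy y1) _.
    exact: integral_itv_le_I.
  by apply: le_trans (primitiveB_le ig y0 yx x1) _; exact: integral_itv_le_I.
apply: aeS hC => x h Ix; rewrite (h Ix) -/(v x) -lerBlDr -vA.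
rewrite -[leLHS]integral_I_cst; apply: integral_I_le; [exact: L1I_cst|exact: L1I_norm|].
move=> y Iy; rewrite lerBlDr; have := osc x y Ix Iy; have := ler_normD (v x - v y) (v y).
by rewrite subrK; lra.
Qed.

End Consequences.

End Primitive.

(** * Neumann series and spectral gaps *)

(** [nu] is the absolute value of the scalar field, kept abstract so that the real and the
    complexified spaces share one development. *)
Record seminormed (R : realType) (K : fieldType) (nu : K -> R) (E : lmodType K)
    (W : set E) (N : E -> R) : Prop := Seminormed {
  sn_nu0 : nu 0 = 0;
  sn_nu1 : nu 1 = 1;
  sn_nuM : forall x y, nu (x * y) = nu x * nu y;
  sn_nu_ge0 : forall x, 0 <= nu x;
  sn_nu_eq0 : forall x, nu x = 0 -> x = 0;
  sn_W0 : W 0;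
  sn_lin : forall z u v, W u -> W v -> W (z *: u + v);
  sn_ge0 : forall u, W u -> 0 <= N u;
  sn_add : forall u v, W u -> W v -> N (u + v) <= N u + N v;
  sn_scale : forall z u, W u -> N (z *: u) = nu z * N u }.

(* Completeness is only needed for sequences with geometrically decaying increments. *)
Definition geom_complete (R : realType) (K : fieldType) (E : lmodType K)
    (W : set E) (N : E -> R) : Prop :=
  forall (u : nat -> E) (C q : R), (forall n, W (u n)) -> 0 <= C -> 0 <= q < 1 ->
    (forall n, N (u n.+1 - u n) <= C * q ^+ n) ->
    exists2 v, W v & forall n, N (u n - v) <= C * q ^+ n / (1 - q).

(** The substitute for passing to the limit: an identity is obtained by bounding its defect by
    [C q^n] for every [n]. *)
Lemma geometric_squeeze (R : realType) (x C q : R) : 0 <= x -> 0 <= q < 1 ->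
  (forall n, x <= C * q ^+ n) -> x = 0.
Proof.
move=> x0 /andP[q0 q1] h; apply/eqP; rewrite eq_le x0 andbT.
have c : C * q ^+ n @[n --> \oo] --> C * 0.
  by apply: cvgMr; apply: cvg_expr; rewrite ger0_norm.
rewrite mulr0 in c; rewrite -(cvg_lim _ c)//.
apply: limr_ge; first by apply/cvg_ex; exists 0.
by apply: nearW => n; exact: h.
Qed.

(** * Calculus modulo null vectors *)

Section Seminormed.
Variables (R : realType) (K : fieldType) (nu : K -> R) (E : lmodType K).
Variables (W : set E) (N : E -> R).
Hypothesis sn : seminormed nu W N.

Lemma nuN1 : nu (-1) = 1.
Proof.
have h : nu (-1) * nu (-1) = 1 by rewrite -(sn_nuM sn) mulrNN mulr1 (sn_nu1 sn).
have /eqP : nu (-1) ^+ 2 = 1 ^+ 2 by rewrite expr1n expr2.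
by rewrite eqrXn2 // ?(sn_nu_ge0 sn) // => /eqP.
Qed.

Lemma nuV z : z != 0 -> nu z^-1 = (nu z)^-1.
Proof.
move=> z0; have nz : nu z != 0 by apply/eqP => /(sn_nu_eq0 sn) /eqP; rewrite (negbTE z0).
by apply: (mulfI nz); rewrite -(sn_nuM sn) !divff // (sn_nu1 sn).
Qed.

Lemma nuX z n : nu (z ^+ n) = nu z ^+ n.
Proof. by elim: n => [|n IH]; rewrite ?expr0 ?(sn_nu1 sn) // !exprS (sn_nuM sn) IH. Qed.

Lemma W_scale z u : W u -> W (z *: u).
Proof. by move=> Wu; rewrite -[z *: u]addr0; apply: (sn_lin sn) => //; exact: (sn_W0 sn). Qed.

Lemma W_add u v : W u -> W v -> W (u + v).
Proof. by move=> Wu Wv; rewrite -[u]scale1r; apply: (sn_lin sn). Qed.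

Lemma W_opp u : W u -> W (- u).
Proof. by move=> Wu; rewrite -scaleN1r; exact: W_scale. Qed.

Lemma W_sub u v : W u -> W v -> W (u - v).
Proof. by move=> Wu Wv; apply: W_add => //; exact: W_opp. Qed.

Lemma N0 : N 0 = 0.
Proof. by rewrite -(scale0r 0) (sn_scale sn) ?(sn_nu0 sn) ?mul0r //; exact: (sn_W0 sn). Qed.

Lemma Nopp u : W u -> N (- u) = N u.
Proof. by move=> Wu; rewrite -scaleN1r (sn_scale sn) // nuN1 mul1r. Qed.

Lemma Nsub u v : W u -> W v -> N (u - v) <= N u + N v.
Proof. by move=> Wu Wv; rewrite -(Nopp Wv); apply: (sn_add sn) => //; exact: W_opp. Qed.

Lemma dist_sym u v : W u -> W v -> N (u - v) = N (v - u).
Proof. by move=> Wu Wv; rewrite -opprB Nopp //; exact: W_sub. Qed.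

Lemma dist_tri w u v : W u -> W v -> W w -> N (u - v) <= N (u - w) + N (w - v).
Proof.
move=> Wu Wv Ww; have -> : u - v = (u - w) + (w - v) by rewrite addrA subrK.
by apply: (sn_add sn); exact: W_sub.
Qed.

Lemma dist_add u v u' v' : W u -> W v -> W u' -> W v' ->
  N ((u + v) - (u' + v')) <= N (u - u') + N (v - v').
Proof.
by move=> Wu Wv Wu' Wv'; rewrite opprD addrACA; apply: (sn_add sn); exact: W_sub.
Qed.

Lemma dist_scale z u v : W u -> W v -> N (z *: u - z *: v) = nu z * N (u - v).
Proof. by move=> Wu Wv; rewrite -scalerBr (sn_scale sn) //; exact: W_sub. Qed.

Lemma N_dist u v : W u -> W v -> N u <= N (u - v) + N v.
Proof. by move=> Wu Wv; rewrite -{1}(subrK v u); apply: (sn_add sn) => //; exact: W_sub. Qed.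

(** Equality in the quotient by null vectors. Membership is part of it because [N] is controlled on
    [W] only. *)
Definition eqv u v := [/\ W u, W v & N (u - v) = 0].

Lemma eqv_refl u : W u -> eqv u u.
Proof. by move=> Wu; split=> //; rewrite subrr N0. Qed.

Lemma eqv_sym u v : eqv u v -> eqv v u.
Proof. by case=> Wu Wv h; split=> //; rewrite dist_sym. Qed.

Lemma eqv_trans w u v : eqv u w -> eqv w v -> eqv u v.
Proof.
case=> Wu Ww h1 [_ Wv h2]; split=> //; apply/eqP; rewrite eq_le (sn_ge0 sn) ?andbT; last exact: W_sub.
by apply: le_trans (dist_tri Wu Wv Ww) _; rewrite h1 h2 addr0.
Qed.

Lemma eqv_add u v u' v' : eqv u u' -> eqv v v' -> eqv (u + v) (u' + v').
Proof.
case=> Wu Wu' h1 [Wv Wv' h2]; split; [exact: W_add|exact: W_add|].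
apply/eqP; rewrite eq_le (sn_ge0 sn) ?andbT; last by apply: W_sub; exact: W_add.
by apply: le_trans (dist_add Wu Wv Wu' Wv') _; rewrite h1 h2 addr0.
Qed.

Lemma eqv_scale z u v : eqv u v -> eqv (z *: u) (z *: v).
Proof.
case=> Wu Wv h; split; [exact: W_scale|exact: W_scale|].
by rewrite dist_scale // h mulr0.
Qed.

Lemma eqv_opp u v : eqv u v -> eqv (- u) (- v).
Proof. by rewrite -!scaleN1r; exact: eqv_scale. Qed.

Lemma eqv_sub u v u' v' : eqv u u' -> eqv v v' -> eqv (u - v) (u' - v').
Proof. by move=> h1 h2; apply: eqv_add => //; exact: eqv_opp. Qed.

Lemma eqv_N u v : eqv u v -> N u = N v.
Proof.
case=> Wu Wv h; apply/eqP; rewrite eq_le.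
rewrite (le_trans (N_dist Wu Wv)) ?h ?add0r //=.
by rewrite (le_trans (N_dist Wv Wu)) // dist_sym // h add0r.
Qed.

Lemma eqv_geometric u v (C q : R) : W u -> W v -> 0 <= q < 1 ->
  (forall n, N (u - v) <= C * q ^+ n) -> eqv u v.
Proof.
move=> Wu Wv q01 h; split=> //; apply: geometric_squeeze q01 h.
by apply: (sn_ge0 sn); exact: W_sub.
Qed.

Section LinearOn.
Variable A : E -> E.
Hypothesis linA : linear_on W N A.

Lemma lin_W u : W u -> W (A u). Proof. exact: linA.1. Qed.

Lemma lin_eqv z u v : W u -> W v -> eqv (A (z *: u + v)) (z *: A u + A v).
Proof.
move=> Wu Wv; split; [by apply: lin_W; exact: (sn_lin sn)| |exact: linA.2].
by apply: (sn_lin sn); exact: lin_W.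
Qed.

Lemma lin_add u v : W u -> W v -> eqv (A (u + v)) (A u + A v).
Proof. by move=> Wu Wv; have := lin_eqv 1 Wu Wv; rewrite !scale1r. Qed.

Lemma lin_zero : eqv (A 0) 0.
Proof.
have W0 := sn_W0 sn; have := lin_eqv (-1) W0 W0.
by rewrite scaler0 addr0 scaleN1r addNr.
Qed.

Lemma lin_scale z u : W u -> eqv (A (z *: u)) (z *: A u).
Proof.
move=> Wu; have W0 := sn_W0 sn; have := lin_eqv z Wu W0; rewrite addr0 => h.
apply: eqv_trans h _; rewrite -[X in eqv _ X]addr0.
by apply: eqv_add; [apply: eqv_refl; apply: W_scale; exact: lin_W|exact: lin_zero].
Qed.

Lemma lin_opp u : W u -> eqv (A (- u)) (- A u).
Proof. by move=> Wu; rewrite -!scaleN1r; exact: lin_scale. Qed.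

Lemma lin_sub u v : W u -> W v -> eqv (A (u - v)) (A u - A v).
Proof.
move=> Wu Wv; apply: eqv_trans (lin_add Wu (W_opp Wv)) _.
by apply: eqv_add; [apply: eqv_refl; exact: lin_W|exact: lin_opp].
Qed.

Lemma linear_on_shift z : linear_on W N (fun u => z *: u - A u).
Proof.
split=> [u Wu|y u v Wu Wv]; first by apply: W_sub; [exact: W_scale|exact: lin_W].
have [_ _ <-] : eqv (z *: (y *: u + v) - A (y *: u + v))
    (y *: (z *: u - A u) + (z *: v - A v)); last by [].
have -> : y *: (z *: u - A u) + (z *: v - A v) =
    z *: (y *: u + v) - (y *: A u + A v).
  by rewrite scalerBr scalerDr opprD addrACA !scalerA [y * z]mulrC.
apply: eqv_sub; last exact: lin_eqv.
by apply: eqv_refl; apply: W_scale; exact: (sn_lin sn).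
Qed.

Lemma iter_W n u : W u -> W (iter n A u).
Proof. by move=> Wu; elim: n => //= n IH; exact: lin_W. Qed.

Lemma linear_on_iter_eqv (congA : forall u v, eqv u v -> eqv (A u) (A v)) n z u v :
  W u -> W v -> eqv (iter n A (z *: u + v)) (z *: iter n A u + iter n A v).
Proof.
move=> Wu Wv; elim: n => [|n IH] /=; first by apply: eqv_refl; exact: (sn_lin sn).
by apply: eqv_trans (congA _ _ IH) _; apply: lin_eqv; exact: iter_W.
Qed.

End LinearOn.
End Seminormed.

(** * Neumann series *)

Section Neumann.
Variables (R : realType) (K : fieldType) (nu : K -> R) (E : lmodType K).
Variables (W : set E) (N : E -> R) (A : E -> E) (C M r : R) (z : K).
Hypothesis sn : seminormed nu W N.
Hypothesis complete : geom_complete W N.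
Hypothesis linA : linear_on W N A.
Hypothesis M0 : 0 <= M.
Hypothesis bndA : bounded_on W N A M.
Hypothesis C0 : 0 <= C.
Hypothesis r0 : 0 <= r.
Hypothesis power : forall n u, W u -> N (iter n A u) <= C * r ^+ n * N u.
Hypothesis rz : r < nu z.

Notation "u ~ v" := (eqv W N u v) (at level 70).

Let nz0 : 0 < nu z. Proof. exact: le_lt_trans rz. Qed.
Let z0 : z != 0.
Proof. by apply/eqP => h; move: nz0; rewrite h (sn_nu0 sn) ltxx. Qed.
Let q := r / nu z.
Let q01 : 0 <= q < 1.
Proof. by rewrite divr_ge0 ?(sn_nu_ge0 sn) //= ltr_pdivrMr // mul1r. Qed.

Let distA u v : W u -> W v -> N (A u - A v) <= M * N (u - v).
Proof.
move=> Wu Wv; rewrite -(eqv_N sn (lin_sub sn linA Wu Wv)).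
by apply: bndA; exact: (W_sub sn).
Qed.

Let congA u v : u ~ v -> A u ~ A v.
Proof.
case=> Wu Wv h; split; [exact: (lin_W linA)|exact: (lin_W linA)|].
apply/eqP; rewrite eq_le (sn_ge0 sn) ?andbT; last by apply: (W_sub sn); exact: (lin_W linA).
by apply: le_trans (distA Wu Wv) _; rewrite h mulr0.
Qed.

(** The partial sum of [z^-(k+1) A^k u] over [k < n]. *)
Fixpoint neumann_sum (n : nat) (u : E) : E :=
  if n is m.+1 then neumann_sum m u + (z ^- m.+1) *: iter m A u else 0.
Notation S := neumann_sum.

Let WS n u : W u -> W (S n u).
Proof.
move=> Wu; elim: n => [|n IH] /=; first exact: (sn_W0 sn).
by apply: (W_add sn) => //; apply: (W_scale sn); exact: (iter_W linA).
Qed.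

Let S_incr n u : W u -> N (S n.+1 u - S n u) <= (C / nu z * N u) * q ^+ n.
Proof.
move=> Wu /=; rewrite addrC addKr (sn_scale sn); last exact: (iter_W linA).
rewrite (nuV sn) ?expf_neq0 // (nuX sn).
have -> : C / nu z * N u * q ^+ n = (nu z ^+ n.+1)^-1 * (C * r ^+ n * N u).
  by rewrite /q exprMn exprVn exprS; field; rewrite expf_neq0 gt_eqF.
by rewrite ler_wpM2l ?invr_ge0 ?exprn_ge0 ?(sn_nu_ge0 sn) // power.
Qed.

Let S_lin n y u v : W u -> W v -> S n (y *: u + v) ~ y *: S n u + S n v.
Proof.
move=> Wu Wv; elim: n => [|n IH] /=.
  by rewrite scaler0 addr0; apply: (eqv_refl sn); exact: (sn_W0 sn).
rewrite scalerDr addrACA; apply: (eqv_add sn) => //.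
rewrite scalerA mulrC -scalerA -scalerDr; apply: (eqv_scale sn).
exact: (linear_on_iter_eqv sn).
Qed.

Let S_comm n u : W u -> S n (A u) ~ A (S n u).
Proof.
move=> Wu; elim: n => [|n IH] /=; first exact/(eqv_sym sn)/(lin_zero sn).
apply: (eqv_sym sn).
apply: (eqv_trans sn (lin_add sn linA (WS n Wu) (W_scale sn _ (iter_W linA n Wu)))).
apply: (eqv_add sn); first exact: (eqv_sym sn).
apply: (eqv_trans sn (lin_scale sn linA _ (iter_W linA n Wu))).
rewrite -iterS iterSr; apply: (eqv_refl sn); apply: (W_scale sn); apply: (iter_W linA) => //.
exact: (lin_W linA).
Qed.

Let S_telescope n u : W u -> z *: S n u + z ^- n *: iter n A u ~ A (S n u) + u.
Proof.
move=> Wu; elim: n => [|n IH].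
  rewrite /= scaler0 expr0 invr1 scale1r; apply: (eqv_add sn); last exact: (eqv_refl sn).
  exact/(eqv_sym sn)/(lin_zero sn).
have -> : z *: S n.+1 u + z ^- n.+1 *: iter n.+1 A u =
    (z *: S n u + z ^- n *: iter n A u) + z ^- n.+1 *: iter n.+1 A u.
  by rewrite /= scalerDr scalerA exprS invfM mulrA divff // mul1r.
apply: (eqv_trans sn (w := (A (S n u) + u) + z ^- n.+1 *: iter n.+1 A u)).
  by apply: (eqv_add sn) => //; apply: (eqv_refl sn); apply: (W_scale sn); exact: (iter_W linA).
rewrite addrAC; apply: (eqv_add sn); last exact: (eqv_refl sn).
apply: (eqv_sym sn) => /=.
apply: (eqv_trans sn (lin_add sn linA (WS n Wu) (W_scale sn _ (iter_W linA n Wu)))).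
apply: (eqv_add sn); last exact: (lin_scale sn linA _ (iter_W linA n Wu)).
by apply: (eqv_refl sn); apply: (lin_W linA) => //; exact: WS.
Qed.

(** The partial sums satisfy [(z - A) S_n = 1 - z^-n A^n], and both their increments and the
    remainder decay like [q^n] with [q = r / nu z]. Each property of the limit [B] then holds with a
    defect [O(q^n)] for every [n], hence exactly modulo null vectors. *)
Lemma neumann_resolvent : resolvent_set W N A z.
Proof.
pose D := C / nu z / (1 - q).
have q1 : 0 < 1 - q by case/andP: q01 => _; rewrite subr_gt0.
have D0 : 0 <= D by rewrite divr_ge0 ?(ltW q1) // divr_ge0 ?(ltW nz0).
have [B hB] : exists B : E -> E, forall u, W u ->
    W (B u) /\ forall n, N (S n u - B u) <= D * N u * q ^+ n.
  (* Limits are determined up to null vectors only, so one is chosen for each [u]; linearity of [B]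
     must then be recovered modulo [N]. *)
  exists (fun u => xget 0 [set v | W v /\ forall n, N (S n u - v) <= D * N u * q ^+ n]) => u Wu.
  have [v Wv hv] := complete (fun n => WS n Wu) (mulr_ge0 (divr_ge0 C0 (ltW nz0)) (sn_ge0 sn Wu))
    q01 (fun n => S_incr n Wu).
  have ex : exists v, [set v | W v /\ forall n, N (S n u - v) <= D * N u * q ^+ n] v.
    exists v; split=> // n; apply: le_trans (hv n) _.
    by rewrite le_eqVlt; apply/orP; left; apply/eqP; rewrite /D; field; rewrite !gt_eqF.
  exact: (xgetPex 0 ex).
have WB u : W u -> W (B u) by move=> /hB[].
have SB u n : W u -> N (S n u - B u) <= D * N u * q ^+ n by move=> /hB[].
(* The rate at [n = 0], where the partial sum is zero, already bounds [B]. *)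
have bndB : bounded_on W N B D.
  move=> u Wu; have := SB u 0%N Wu; rewrite /= sub0r (Nopp sn) ?expr0 ?mulr1 //; exact: WB.
have zA u : W u -> z *: B u ~ A (B u) + u.
  (* The three terms of [c] are the costs of replacing [B u] by the partial sum, of dropping the
     remainder, and of returning to [B u] under [A]. *)
  move=> Wu; pose c := nu z * (D * N u) + C * N u + M * (D * N u).
  apply: (eqv_geometric sn (C := c) _ _ q01) => [||n].
  - by apply: (W_scale sn); exact: WB.
  - by apply: (W_add sn) => //; apply: (lin_W linA) => //; exact: WB.
  have WBu := WB u Wu; have WSn := WS n Wu.
  have W1 := W_scale sn z WBu; have W2 := W_scale sn z WSn.
  have W3 : W (z ^- n *: iter n A u) by apply: (W_scale sn); exact: (iter_W linA).
  have W4 := W_add sn W2 W3.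
  have W5 := W_add sn (lin_W linA WSn) Wu; have W6 := W_add sn (lin_W linA WBu) Wu.
  apply: le_trans (dist_tri sn W1 W6 W2) _.
  have e1 : N (z *: B u - z *: S n u) <= nu z * (D * N u) * q ^+ n.
    rewrite (dist_scale sn) // (dist_sym sn) // -mulrA ler_wpM2l ?(ltW nz0) //; exact: SB.
  have e2 : N (z *: S n u - (z *: S n u + z ^- n *: iter n A u)) <= C * N u * q ^+ n.
    rewrite opprD addrA subrr sub0r (Nopp sn) // (sn_scale sn); last exact: (iter_W linA).
    rewrite (nuV sn) ?expf_neq0 // (nuX sn).
    have -> : C * N u * q ^+ n = (nu z ^+ n)^-1 * (C * r ^+ n * N u).
      by rewrite /q exprMn exprVn; field; apply: expf_neq0; rewrite gt_eqF.
    by rewrite ler_wpM2l ?invr_ge0 ?exprn_ge0 ?(sn_nu_ge0 sn) // power.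
  have [_ _ e3] := S_telescope n Wu.
  have e4 : N (A (S n u) + u - (A (B u) + u)) <= M * (D * N u) * q ^+ n.
    rewrite opprD addrACA subrr addr0; apply: le_trans (distA WSn WBu) _.
    by rewrite -mulrA ler_wpM2l //; exact: SB.
  have := dist_tri sn W2 W6 W4; have := dist_tri sn W4 W6 W5.
  rewrite e3 /c !mulrDl; lra.
have linB y u v : W u -> W v -> B (y *: u + v) ~ y *: B u + B v.
  move=> Wu Wv; have Wy := sn_lin sn y Wu Wv.
  pose c := D * N (y *: u + v) + nu y * (D * N u) + D * N v.
  have W1 := WB _ Wy; have W2 := sn_lin sn y (WB _ Wu) (WB _ Wv).
  apply: (eqv_geometric sn (C := c) _ _ q01) => // n.
  have W3 := WS n Wy; have W4 := sn_lin sn y (WS n Wu) (WS n Wv).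
  have [_ _ e0] := S_lin n y Wu Wv.
  have e1 := SB _ n Wy; have e2 := SB _ n Wu; have e3 := SB _ n Wv.
  have := dist_tri sn W1 W2 W3; rewrite (dist_sym sn W1 W3).
  have := dist_tri sn W3 W2 W4; rewrite e0.
  have := dist_add sn (W_scale sn y (WS n Wu)) (WS n Wv) (W_scale sn y (WB _ Wu)) (WB _ Wv).
  rewrite (dist_scale sn y (WS n Wu) (WB _ Wu)).
  have e2' : nu y * N (S n u - B u) <= nu y * (D * N u) * q ^+ n.
    by rewrite -mulrA ler_wpM2l ?(sn_nu_ge0 sn).
  rewrite /c !mulrDl; lra.
have BA u : W u -> B (z *: u - A u) ~ u.
  move=> Wu; have Wz : W (z *: u - A u) by apply: (W_sub sn); [exact: (W_scale sn)|exact: (lin_W linA)].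
  pose c := D * N (z *: u - A u) + C * N u.
  have W1 := WB _ Wz; have W2 := WS 0 Wz.
  apply: (eqv_geometric sn (C := c) _ _ q01) => // n.
  have W3 := WS n Wz; have W4 : W (z ^- n *: iter n A u) by apply: (W_scale sn); exact: (iter_W linA).
  have e1 := SB _ n Wz.
  have h : S n (z *: u - A u) ~ u - z ^- n *: iter n A u.
    have h1 := S_lin n z Wu (W_opp sn (lin_W linA Wu)).
    apply: (eqv_trans sn h1).
    have h2 : S n (- A u) ~ - A (S n u).
      have h3 := S_lin n (-1) (lin_W linA Wu) (sn_W0 sn).
      rewrite addr0 scaleN1r in h3; apply: (eqv_trans sn h3).
      rewrite scaleN1r -[X in _ ~ X]addr0; apply: (eqv_add sn).
        by apply: (eqv_opp sn); exact: S_comm.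
      have h4 := S_lin n (-1) (sn_W0 sn) (sn_W0 sn).
      by move: h4; rewrite scaler0 addr0 scaleN1r addNr.
    apply: (eqv_trans sn (eqv_add sn (eqv_refl sn (W_scale sn z (WS n Wu))) h2)).
    have h5 := S_telescope n Wu.
    have h6 := eqv_sub sn h5 (eqv_refl sn (W_add sn W4 (lin_W linA (WS n Wu)))).
    move: h6; rewrite !opprD !addrA addrK => h6.
    by move: h6; rewrite [A (S n u) + u]addrC addrAC addrK.
  have [_ _ e2] := h.
  have := dist_tri sn W1 Wu W3; rewrite (dist_sym sn W1 W3).
  have := dist_tri sn W3 Wu (W_sub sn Wu W4); rewrite e2.
  have -> : u - z ^- n *: iter n A u - u = - (z ^- n *: iter n A u) by rewrite addrC addKr.
  rewrite (Nopp sn) // (sn_scale sn); last exact: (iter_W linA).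
  rewrite (nuV sn) ?expf_neq0 // (nuX sn).
  have e3 : (nu z ^+ n)^-1 * N (iter n A u) <= C * N u * q ^+ n.
    have -> : C * N u * q ^+ n = (nu z ^+ n)^-1 * (C * r ^+ n * N u).
      by rewrite /q exprMn exprVn; field; apply: expf_neq0; rewrite gt_eqF.
    by rewrite ler_wpM2l ?invr_ge0 ?exprn_ge0 ?(sn_nu_ge0 sn) // power.
  rewrite /c mulrDl; lra.
exists B; split; last by exists D.
split; first exact: (linear_on_shift sn).
- by split=> // y u v Wu Wv; have [] := linB y u v Wu Wv.
- by move=> u Wu; have [] := BA u Wu.
- by move=> u Wu; have [_ _] := zA u Wu; rewrite opprD addrA.
Qed.

End Neumann.

(** * From decay of powers to a spectral gap *)

Section SpectralGap.
Variables (R : realType) (E : lmodType R[i]).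
Variables (W : set E) (N : E -> R) (A : E -> E) (ell : E -> R[i]) (h : E).
Variables (C M L r : R).
Notation nu := (@Normc.normc R).
Hypothesis sn : seminormed nu W N.
Hypothesis complete : geom_complete W N.
Hypothesis linA : linear_on W N A.
Hypothesis M0 : 0 <= M.
Hypothesis bndA : bounded_on W N A M.
Hypothesis ell_lin : forall z u v, W u -> W v -> ell (z *: u + v) = z * ell u + ell v.
Hypothesis L0 : 0 <= L.
Hypothesis ell_bnd : forall u, W u -> nu (ell u) <= L * N u.
Hypothesis ellA : forall u, W u -> ell (A u) = ell u.
Hypothesis Wh : W h.
Hypothesis ellh : ell h = 1.
Hypothesis Ah : N (A h - h) = 0.
Hypothesis C0 : 0 <= C.
Hypothesis r01 : 0 <= r < 1.
Hypothesis power : forall n u, W u -> ell u = 0 -> N (iter n A u) <= C * r ^+ n * N u.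

Notation "u ~ v" := (eqv W N u v) (at level 70).

Let W0 : set E := [set u | W u /\ ell u = 0].
Let p u := u - ell u *: h.

Let congA u v : u ~ v -> A u ~ A v.
Proof.
case=> Wu Wv e; split; [exact: (lin_W linA)|exact: (lin_W linA)|].
have Wuv := W_sub sn Wu Wv; have WA := W_sub sn (lin_W linA Wu) (lin_W linA Wv).
apply/eqP; rewrite eq_le (sn_ge0 sn WA) andbT.
by rewrite -(eqv_N sn (lin_sub sn linA Wu Wv)) (le_trans (bndA Wuv)) // e mulr0.
Qed.

Let ell0 : ell 0 = 0.
Proof.
have := ell_lin 1 (sn_W0 sn) (sn_W0 sn); rewrite scaler0 addr0 mul1r => /eqP.
by rewrite -subr_eq0 opprD addrA subrr sub0r oppr_eq0 => /eqP.
Qed.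

Let ell_scale z u : W u -> ell (z *: u) = z * ell u.
Proof. by move=> Wu; have := ell_lin z Wu (sn_W0 sn); rewrite !addr0 ell0 addr0. Qed.

Let ell_sub u v : W u -> W v -> ell (u - v) = ell u - ell v.
Proof.
by move=> Wu Wv; rewrite addrC -scaleN1r ell_lin // mulN1r addrC.
Qed.

Let p_decomp u : ell u *: h + p u = u.
Proof. by rewrite addrC subrK. Qed.

Let p_W u : W u -> W (p u).
Proof. by move=> Wu; apply: (W_sub sn) => //; exact: (W_scale sn). Qed.

Let p_W0 u : W u -> W0 (p u).
Proof.
move=> Wu; split; first exact: p_W.
by rewrite ell_sub ?ell_scale ?ellh ?mulr1 ?subrr //; exact: (W_scale sn).
Qed.

Let sn0 : seminormed nu W0 N.
Proof.
case: sn => *; split => //.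
- by move=> z u v [Wu eu] [Wv ev]; split; [auto|rewrite ell_lin // eu ev mulr0 addr0].
- by move=> u []; auto.
- by move=> u v [? _] [? _]; auto.
- by move=> z u [? _]; auto.
Qed.

(** The kernel of [ell] is closed because [ell] is bounded, so limits of sequences in it stay in
    it. *)
Let complete0 : geom_complete W0 N.
Proof.
move=> u D q Wu D0 q01 hu; have [v Wv hv] := complete (fun n => (Wu n).1) D0 q01 hu.
exists v => //; split=> //; apply/(sn_nu_eq0 sn).
apply: (@geometric_squeeze _ _ (L * (D / (1 - q))) q) => //; first exact: (sn_nu_ge0 sn).
move=> n; have [Wun eun] := Wu n.
have -> : nu (ell v) = nu (ell (v - u n)) by rewrite ell_sub // eun subr0.
apply: le_trans (ell_bnd (W_sub sn Wv Wun)) _.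
rewrite (dist_sym sn Wv Wun) -mulrA ler_wpM2l //.
by apply: le_trans (hv n) _; rewrite mulrAC.
Qed.

Let linA0 : linear_on W0 N A.
Proof.
split=> [u [Wu eu]|z u v [Wu _] [Wv _]]; last exact: linA.2.
by split; [exact: (lin_W linA)|rewrite ellA].
Qed.

Let resolvent0 z : r < nu z -> resolvent_set W0 N A z.
Proof.
move=> rz; apply: (neumann_resolvent sn0 complete0 linA0 M0 _ C0 _ _ rz).
- by move=> u [Wu _]; exact: bndA.
- by case/andP: r01.
- by move=> n u [Wu eu]; exact: power.
Qed.

Let eqv0 u v : eqv W0 N u v -> u ~ v.
Proof. by case=> -[Wu _] [Wv _] e. Qed.

Let Ah' : A h ~ h.
Proof. by split=> //; exact: (lin_W linA). Qed.

(** Along [u = ell u *: h + p u] the operator [z - A] is multiplication by [z - 1] on the first term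
    and is inverted by the Neumann series on the second, which lies in the kernel of [ell]. *)
Let resolvent_ne1 z : r < nu z -> z != 1 -> resolvent_set W N A z.
Proof.
move=> rz z1; have [B0 [[linS linB0 BS SB] [K' bK']]] := resolvent0 rz.
pose K := `|K'|; have K0 : 0 <= K by exact: normr_ge0.
have bK : bounded_on W0 N B0 K.
  by move=> u Wu; apply: le_trans (bK' u Wu) _; rewrite ler_wpM2r ?ler_norm // (sn_ge0 sn0).
have z10 : z - 1 != 0 by rewrite subr_eq0.
have W0W u : W0 u -> W u by case.
have WB0 u : W0 u -> W (B0 u) by move=> /(lin_W linB0)[].
have congB0 u v : W0 u -> W0 v -> u ~ v -> B0 u ~ B0 v.
  move=> Wu Wv [_ _ e]; split; [exact: WB0|exact: WB0|].
  have Wuv := W_sub sn0 Wu Wv; have WB := W_sub sn0 (lin_W linB0 Wu) (lin_W linB0 Wv).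
  apply/eqP; rewrite eq_le (sn_ge0 sn0 WB) andbT.
  by rewrite -(eqv_N sn0 (lin_sub sn0 linB0 Wu Wv)) (le_trans (bK _ Wuv)) // e mulr0.
pose B u := (ell u / (z - 1)) *: h + B0 (p u).
have WB u : W u -> W (B u).
  by move=> Wu; apply: (sn_lin sn) => //; apply: WB0; exact: p_W0.
exists B; split.
  split; first exact: (linear_on_shift sn linA).
  - split=> // y u v Wu Wv.
    suff : B (y *: u + v) ~ y *: B u + B v by case.
    have pE : p (y *: u + v) = y *: p u + p v.
      by rewrite /p ell_lin // scalerBr scalerDl scalerA opprD addrACA.
    pose k w := ell w / (z - 1).
    have -> : B (y *: u + v) = (y *: (k u *: h) + k v *: h) + B0 (y *: p u + p v).
      by rewrite /B pE ell_lin // mulrDl scalerDl scalerA /k mulrA.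
    have -> : y *: B u + B v = (y *: (k u *: h) + k v *: h) + (y *: B0 (p u) + B0 (p v)).
      by rewrite /B scalerDr addrACA.
    apply: (eqv_add sn).
      by apply: (eqv_refl sn); apply: (sn_lin sn); exact: (W_scale sn).
    by apply: eqv0; apply: (lin_eqv sn0 linB0); exact: p_W0.
  - move=> u Wu; suff : B (z *: u - A u) ~ u by case.
    have WA := lin_W linA Wu; have Wz := W_sub sn (W_scale sn z Wu) WA.
    have eE : ell (z *: u - A u) = (z - 1) * ell u.
      by rewrite ell_sub ?ell_scale ?ellA ?mulrBl ?mul1r //; exact: (W_scale sn).
    have Wpu := p_W0 Wu.
    have e1 : p (z *: u - A u) ~ z *: p u - A (p u).
      have a1 : A (p u) ~ A u - ell u *: h.
        apply: (eqv_trans sn (lin_sub sn linA Wu (W_scale sn _ Wh))).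
        apply: (eqv_sub sn); first exact: (eqv_refl sn).
        apply: (eqv_trans sn (lin_scale sn linA _ Wh)).
        exact: (eqv_scale sn).
      apply: (eqv_trans sn (w := z *: p u - (A u - ell u *: h))); last first.
        apply: (eqv_sub sn); last exact: (eqv_sym sn).
        by apply: (eqv_refl sn); apply: (W_scale sn); exact: p_W.
      have -> : p (z *: u - A u) = z *: p u - (A u - ell u *: h).
        rewrite {1}/p eE /p scalerBr mulrBl mul1r scalerBl scalerA.
        by rewrite !opprB !addrA addrAC [RHS]addrAC; congr (_ + _); rewrite addrAC.
      apply: (eqv_refl sn); apply: (W_sub sn); first by apply: (W_scale sn); exact: p_W.
      by apply: (W_sub sn) => //; exact: (W_scale sn).
    have -> : B (z *: u - A u) = ell u *: h + B0 (p (z *: u - A u)).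
      by rewrite /B eE mulrAC divff // mul1r.
    have Ws : W0 (z *: p u - A (p u)) by exact: (lin_W linS).
    rewrite -[X in _ ~ X](p_decomp u).
    apply: (eqv_add sn); first by apply: (eqv_refl sn); exact: (W_scale sn).
    apply: (eqv_trans sn (congB0 _ _ (p_W0 Wz) Ws e1)).
    by split; [exact: WB0|exact: p_W|exact: BS].
  - move=> u Wu; have Wpu := p_W0 Wu.
    have WBp := WB0 _ Wpu; set b := B0 (p u) in WBp *; pose k := ell u / (z - 1).
    have Wkh := W_scale sn k Wh.
    suff : z *: (k *: h + b) - A (k *: h + b) ~ u by case.
    rewrite -[X in _ ~ X](p_decomp u).
    have kE : z * k - k = ell u by rewrite -{2}[k]mul1r -mulrBl mulrC divfK.
    have a1 : A (k *: h + b) ~ k *: h + A b.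
      apply: (eqv_trans sn (lin_eqv sn linA k Wh WBp)).
      by apply: (eqv_add sn); [exact: (eqv_scale sn)|apply: (eqv_refl sn); exact: (lin_W linA)].
    apply: (eqv_trans sn (eqv_sub sn (eqv_refl sn (W_scale sn z (W_add sn Wkh WBp))) a1)).
    rewrite scalerDr opprD addrACA scalerA -scalerBl kE.
    apply: (eqv_add sn); first by apply: (eqv_refl sn); exact: (W_scale sn).
    by split; [apply: (W_sub sn); [exact: (W_scale sn)|exact: (lin_W linA)]|exact: p_W|exact: SB].
exists (nu (z - 1)^-1 * L * N h + K * (1 + L * N h)) => u Wu.
have WBp := WB0 _ (p_W0 Wu).
apply: le_trans (sn_add sn (W_scale sn _ Wh) WBp) _.
rewrite (sn_scale sn _ Wh) (sn_nuM sn).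
have Nh := sn_ge0 sn Wh.
have h1 : nu (ell u) * nu (z - 1)^-1 * N h <= nu (z - 1)^-1 * L * N h * N u.
  have -> : nu (z - 1)^-1 * L * N h * N u = (L * N u) * nu (z - 1)^-1 * N h by ring.
  by rewrite ler_wpM2r // ler_wpM2r ?(sn_nu_ge0 sn) // ell_bnd.
have h2 : N (p u) <= (1 + L * N h) * N u.
  apply: le_trans (Nsub sn Wu (W_scale sn _ Wh)) _; rewrite (sn_scale sn _ Wh).
  have -> : (1 + L * N h) * N u = N u + (L * N u) * N h by ring.
  by rewrite lerD2l ler_wpM2r // ell_bnd.
have h3 := bK _ (p_W0 Wu).
rewrite [leRHS]mulrDl; apply: lerD => //; apply: le_trans h3 _.
by rewrite -mulrA; exact: ler_wpM2l.
Qed.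

Let Pi u := ell u *: h.

Let PiW u : W u -> W (Pi u). Proof. by move=> _; exact: (W_scale sn). Qed.

Let ell_Pi u : ell (Pi u) = ell u.
Proof. by rewrite ell_scale // ellh mulr1. Qed.

Let Nh : N h != 0.
Proof.
apply/eqP => e; have := ell_bnd Wh; rewrite ellh e mulr0 (sn_nu1 sn).
by rewrite leNgt ltr01.
Qed.

(** On the range of [Pi] the operator [A] is the identity modulo null vectors, so [z - A] is the
    scalar [z - 1]. *)
Let resolvent_range z : z != 1 ->
  resolvent_set [set u | W u /\ N (Pi u - u) = 0] N A z.
Proof.
move=> z1; have z10 : z - 1 != 0 by rewrite subr_eq0.
set W1 := [set u | _].
have W1_lin (y : R[i]) u v : W1 u -> W1 v -> W1 (y *: u + v).
  move=> [Wu eu] [Wv ev]; split; first exact: (sn_lin sn).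
  have -> : Pi (y *: u + v) = y *: Pi u + Pi v by rewrite /Pi ell_lin // scalerDl scalerA.
  suff : y *: Pi u + Pi v ~ y *: u + v by case.
  by apply: (eqv_add sn); [apply: (eqv_scale sn)|]; split=> //; exact: PiW.
have W1_0 : W1 0.
  by split; [exact: (sn_W0 sn)|rewrite /Pi ell0 scale0r subrr (N0 sn)].
have sn1 : seminormed nu W1 N.
  case: sn => *; split => //.
  - by move=> u []; auto.
  - by move=> u v [? _] [? _]; auto.
  - by move=> y u [? _]; auto.
have A1 u : W1 u -> A u ~ u.
  move=> [Wu eu]; have e : Pi u ~ u by split=> //; exact: PiW.
  apply: (eqv_trans sn (congA (eqv_sym sn e))).
  apply: (eqv_trans sn (lin_scale sn linA (ell u) Wh)).
  exact: (eqv_trans sn (eqv_scale sn (ell u) Ah')).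
have W1A u : W1 u -> W1 (A u).
  move=> W1u; have [WA Wu _] := A1 u W1u; split=> //.
  have e : Pi u ~ u by split; [exact: PiW|exact: Wu|exact: W1u.2].
  have -> : Pi (A u) = Pi u by rewrite /Pi ellA.
  by have [] := eqv_trans sn e (eqv_sym sn (A1 u W1u)).
have linA1 : linear_on W1 N A.
  by split=> [u|y u v [Wu _] [Wv _]]; [exact: W1A|exact: linA.2].
have shift1 u : W1 u -> z *: u - A u ~ (z - 1) *: u.
  move=> W1u; rewrite scalerBl scale1r; apply: (eqv_sub sn); last exact: A1.
  by apply: (eqv_refl sn); apply: (W_scale sn); exact: W1u.1.
exists (fun u => (z - 1)^-1 *: u); split.
  split; first exact: (linear_on_shift sn1 linA1).
  - split=> [u W1u|y u v W1u W1v].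
      by rewrite -[_ *: _]addr0; exact: W1_lin.
    by rewrite scalerDr !scalerA mulrC subrr (N0 sn).
  - move=> u W1u; suff : (z - 1)^-1 *: (z *: u - A u) ~ u by case.
    apply: (eqv_trans sn (eqv_scale sn _ (shift1 u W1u))).
    by rewrite scalerA mulVf // scale1r; apply: (eqv_refl sn); exact: W1u.1.
  - move=> u W1u; set v := _ *: u.
    have W1v : W1 v by rewrite /v -[_ *: _]addr0; exact: W1_lin.
    suff : z *: v - A v ~ u by case.
    apply: (eqv_trans sn (shift1 v W1v)).
    by rewrite /v scalerA divff // scale1r; apply: (eqv_refl sn); exact: W1u.1.
by exists (nu (z - 1)^-1) => u [Wu _]; rewrite (sn_scale sn).
Qed.

Let kernel_PiE : [set u | W u /\ N (Pi u) = 0] = W0.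
Proof.
apply/seteqP; split=> u [Wu eu]; split=> //; last first.
  by rewrite /Pi eu scale0r (N0 sn).
move/eqP: eu; rewrite /Pi (sn_scale sn) // mulf_eq0 (negbTE Nh) orbF => /eqP.
exact: (sn_nu_eq0 sn).
Qed.

(** The Riesz projection is [u |-> ell u *: h]. Its range is spanned by [h], which gives algebraic
    simplicity, and on its kernel the powers decay, which puts 1 in the resolvent set there. *)
Lemma power_spectral_gap : spectral_gap W N A.
Proof.
have r1 : r < 1 by case/andP: r01.
have spec w : spectrum W N A w -> w != 1 -> nu w <= r.
  by move=> sw w1; rewrite leNgt; apply/negP => rw; exact: (sw (resolvent_ne1 rw w1)).
split; first by split; last by exists M.
- split; first by exists h; split=> //; rewrite scale1r.
  (* Other spectral points have modulus at most [r], hence lie at distance at least [1 - r] from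
     1. *)
  exists (1 - r) => [|w sw w1]; first by rewrite subr_gt0.
  have := spec w sw w1; rewrite lerBlDl => wr.
  have sym : nu (1 - w) = nu (w - 1).
    have -> : 1 - w = -1 * (w - 1) by rewrite mulN1r opprB.
    by rewrite (sn_nuM sn) (nuN1 sn) mul1r.
  have tri : 1 <= nu (1 - w) + nu w.
    rewrite -{1}(sn_nu1 sn); have e : 1 = (1 - w) + w by rewrite subrK.
    by rewrite [X in nu X <= _]e; exact: complex.le_normcD.
  by rewrite sym in tri; lra.
- exists Pi; last first.
    exists h; split=> //; first by rewrite /Pi ellh scale1r subrr (N0 sn).
    by move=> u Wu; exists (ell u); rewrite subrr (N0 sn).
  split.
  + split; last first.
      exists (L * N h) => u Wu; rewrite /Pi (sn_scale sn) // mulrAC.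
      by rewrite ler_wpM2r ?(sn_ge0 sn) // ell_bnd.
    split=> [u|y u v Wu Wv]; first exact: PiW.
    by rewrite /Pi ell_lin // scalerDl scalerA subrr (N0 sn).
  + move=> u Wu; split; first by rewrite {1}/Pi ell_Pi subrr (N0 sn).
    suff : Pi (A u) ~ A (Pi u) by case.
    rewrite /Pi ellA //; apply: (eqv_sym sn).
    by apply: (eqv_trans sn (lin_scale sn linA (ell u) Wh)); apply: (eqv_scale sn).
  + by move=> w sw; apply/eqP; apply/negPn/negP => w1; exact: (sw (resolvent_range w1)).
  + by rewrite kernel_PiE; apply: resolvent0; rewrite (sn_nu1 sn).
- by exists r.
Qed.

End SpectralGap.

(** * Completeness of Sobolev spaces *)

Section L1Complete.
Variable R : realType.
Notation mu := (@lebesgue_measure R).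
Notation TR := (measurableTypeR R).

Lemma geometric_partial_le (q : R) (m : nat) : 0 <= q < 1 -> \sum_(k < m) q ^+ k <= (1 - q)^-1.
Proof.
move=> /andP[q0 q1]; have q1' : 0 < 1 - q by rewrite subr_gt0.
have -> : \sum_(k < m) q ^+ k = (1 - q ^+ m) / (1 - q).
  elim: m => [|m IH]; first by rewrite big_ord0 expr0 subrr mul0r.
  by rewrite big_ord_recr /= IH exprS; field; rewrite gt_eqF.
by rewrite ler_pdivrMr // mulVf ?gt_eqF // gerBl exprn_ge0.
Qed.

(** The Riesz-Fischer argument: the series of absolute increments has finite integral, hence
    converges almost everywhere, and twice its sum dominates all differences of the [u n]. *)
Lemma L1I_geometric_limit (u : nat -> R -> R) (C q : R) : 0 <= C -> 0 <= q < 1 ->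
  (forall n, L1I (u n)) ->
  (forall n, integral_I (fun x => `|u n.+1 x - u n x|) <= C * q ^+ n) ->
  exists2 v, L1I v & forall n, integral_I (fun x => `|u n x - v x|) <= C * q ^+ n / (1 - q).
Proof.
move=> C0 q01 iu hu; have /andP[q0 q1] := q01.
have q1' : 0 < 1 - q by rewrite subr_gt0.
have mI : measurable (@I01 R : set TR) := @measurable_I01 R.
pose d k x := u k.+1 x - u k x.
have id k : L1I (d k) by exact: L1I_sub.
have md k : measurable_fun (@I01 R) (d k) := L1I_measurable (id k).
have mnd k : measurable_fun (I01 : set TR) (fun x => `|d k x|%:E).
  exact: (@measurable_int _ TR R mu I01 _ (L1I_norm (id k))).
pose G x : \bar R := (\sum_(0 <= k <oo) `|d k x|%:E)%E.
have mG : measurable_fun (I01 : set TR) G.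
  apply: ge0_emeasurable_sum => [k x _ _|k _]; first by rewrite lee_fin.
  exact: mnd.
have IG : (\int[mu]_(x in I01) G x < +oo)%E.
  rewrite integral_nneseries //.
  apply: (@le_lt_trans _ _ (C / (1 - q))%:E); last by rewrite ltry.
  apply: lime_le; first by apply: is_cvg_nneseries => k _ _; apply: integral_ge0 => x _; rewrite lee_fin.
  apply: nearW => n.
  have E k : (\int[mu]_(x in I01) `|d k x|%:E)%E = (integral_I (fun x => `|d k x|))%:E.
    rewrite /integral_I /Rintegral fineK //; apply: integrable_fin_num => //.
    exact: L1I_norm.
  rewrite (eq_bigr (fun k => (integral_I (fun x => `|d k x|))%:E)) // sumEFin lee_fin.
  apply: (@le_trans _ _ (\sum_(0 <= k < n) C * q ^+ k)); first by apply: ler_sum => k _; exact: hu.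
  rewrite -mulr_sumr big_mkord ler_wpM2l //; exact: geometric_partial_le.
have G0 x : (0 <= G x)%E by apply: nneseries_ge0 => k _ _; rewrite lee_fin.
have iG : mu.-integrable I01 G.
  apply/integrableP; split => //.
  by under eq_integral do rewrite gee0_abs //.
pose D : set R := [set x | I01 x /\ (G x < +oo)%E].
have mD : measurable (D : set TR).
  exact: (emeasurable_fun_infty_o mI mG).
have aeD : \forall x \ae mu, I01 x -> D x.
  have := integrable_ae mI iG; apply: aeS => x h Ix; split=> //.
  by have := h Ix; rewrite ge0_fin_numE.
pose g x : R := fine (G x).
have Gg x : D x -> G x = (g x)%:E by move=> [Ix Gx]; rewrite /g fineK // ge0_fin_numE.
have S_le n x : D x -> \sum_(0 <= k < n) `|d k x| <= g x.
  move=> Dx; rewrite -lee_fin -Gg // -sumEFin.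
  by apply: nneseries_lim_ge => k _ _; rewrite lee_fin.
have uE n x : u n x = u 0%N x + \sum_(0 <= k < n) d k x.
  by rewrite /d telescope_sumr // addrC subrK.
have cvu x : D x -> cvgn (fun n => u n x).
  move=> Dx; have c : cvgn (series (fun k => `|d k x|)).
    apply: nondecreasing_is_cvgn.
      by apply: nondecreasing_series => k _ _.
    by exists (g x) => _ [n _ <-]; exact: S_le.
  have c2 := normed_cvg c.
  have -> : (fun n => u n x) = (fun n => u 0%N x + series (fun k => d k x) n).
    by apply/funext => n; rewrite uE.
  by apply: is_cvgD => //; exact: is_cvg_cst.
(* Set to zero off the convergence set, the sequence converges at every point, so its limit is
   measurable. *)
pose un n : R -> R := (u n) \_ D.
pose v x : R := limn (fun n => un n x).
have cvun x : un n x @[n --> \oo] --> v x.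
  rewrite /v; have [Dx|nDx] := pselect (D x).
    have -> : (fun n => un n x) = (fun n => u n x).
      by apply/funext => n; rewrite /un patchE mem_set.
    exact: cvu.
  have -> : (fun n => un n x) = (fun n => 0).
    by apply/funext => n; rewrite /un patchE memNset.
  exact: is_cvg_cst.
have mun n : measurable_fun [set: R] (un n).
  apply: (@measurable_restrictT _ _ TR R D (u n) mD).1.
  by apply: (measurable_funS mI _ (L1I_measurable (iu n))) => x [].
have mv : measurable_fun [set: R] v.
  by apply: (@measurable_fun_cvg _ TR R setT un v) => // x _; exact: cvun.
have euun n : eqI (u n) (un n).
  by apply: aeS aeD => x h /h Dx; rewrite /un patchE mem_set.
have iun n : L1I (un n).
  by apply: (L1I_eqI (iu n)) => //; exact: measurable_funTS.
have ig : L1I (g \_ D).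
  apply: (@L1I_dominated _ _ (fun x => fine (G x))).
  - apply: measurable_funTS; apply: (@measurable_restrictT _ _ TR R D g mD).1.
    apply: (measurable_funS mI) => [x []//|].
    by apply: measurableT_comp => //; exact: measurable_fine.
  - move=> x Ix; rewrite patchE; case: ifP => _; rewrite ?normr0 ?fine_ge0 //.
    by rewrite ger0_norm // fine_ge0.
  - apply: (@le_integrable _ TR R mu I01 mI _ G) iG => [|x _ /=].
      by apply: (@measurable_EFinP _ TR R I01 _).2; apply: measurableT_comp => //; exact: measurable_fine.
    by have := G0 x; case: (G x) => [r||] //=; rewrite ?normr0 ?leey.
have dom N n x : I01 x -> `|un N x - un n x| <= 2 * (g \_ D) x.
  move=> _; rewrite /un !patchE; case: ifP => xD; last by rewrite subrr normr0 mulr0.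
  have Dx : D x by move: xD; rewrite inE.
  have b m : `|\sum_(0 <= k < m) d k x| <= g x.
    by apply: le_trans (S_le m x Dx); exact: ler_norm_sum.
  rewrite (uE N) (uE n) opprD addrACA subrr add0r.
  by apply: le_trans (ler_normB _ _) _; have := b N; have := b n; lra.
have iv : L1I v.
  have [|||||] // := @integral_I_dominated_cvg _ (fun n x => un 0%N x - un n x) (fun x => un 0%N x - v x) (fun x => 2 * (g \_ D) x).
  - by move=> n; apply: measurable_funTS; exact: measurable_funB.
  - by apply: measurable_funTS; exact: measurable_funB.
  - by move=> x Ix; apply: cvgB; [exact: cvg_cst|exact: cvun].
  - exact: L1I_scale.
  - by move=> n x; exact: dom.
  move=> i0 _; have := L1I_sub (iun 0%N) i0; apply: eq_integrable => // x _ /=.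
  by congr (_%:E); ring.
exists v => // N.
have [|||||_ cv] // := @integral_I_dominated_cvg _ (fun n x => `|un N x - un n x|) (fun x => `|un N x - v x|) (fun x => 2 * (g \_ D) x).
- by move=> n; apply: measurable_funTS; apply: measurableT_comp => //; exact: measurable_funB.
- by apply: measurable_funTS; apply: measurableT_comp => //; exact: measurable_funB.
- by move=> x Ix; apply: cvg_norm; apply: cvgB; [exact: cvg_cst|exact: cvun].
- exact: L1I_scale.
- by move=> n x Ix; rewrite normr_id; exact: dom.
have iabs w1 w2 : L1I w1 -> L1I w2 -> L1I (fun x => `|w1 x - w2 x|).
  by move=> h1 h2; apply: L1I_norm; exact: L1I_sub.
have -> : integral_I (fun x => `|u N x - v x|) = integral_I (fun x => `|un N x - v x|).
  apply: integral_I_eqI; [by apply: L1I_measurable; exact: iabs|by apply: L1I_measurable; exact: iabs|].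
  by apply: aeS (euun N) => x h /h ->.
(* This bound is uniform in [m], so it passes to the limit and gives the stated rate. *)
have bnd m : integral_I (fun x => `|un N x - un (N + m)%N x|) <= C * q ^+ N * \sum_(k < m) q ^+ k.
  elim: m => [|m IH].
    rewrite addn0 big_ord0 mulr0 (@integral_I_eq _ _ (fun=> 0)) ?integral_I_cst //.
    by move=> x _; rewrite subrr normr0.
  apply: (@le_trans _ _ (integral_I (fun x => `|un N x - un (N + m)%N x| + `|u (N + m).+1 x - u (N + m)%N x|))).
    apply: integral_I_ae_le; [exact: iabs|by apply: L1I_add; exact: iabs|].
    have e1 := euun (N + m)%N; have e2 := euun (N + m).+1.
    apply: aeS2 e1 e2 => x h1 h2 Ix; rewrite (h1 Ix) (h2 Ix) addnS.
    by rewrite [X in _ <= _ + X]distrC; exact: ler_distD.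
  rewrite integral_I_add; [|exact: iabs|exact: iabs].
  rewrite big_ord_recr mulrDr; apply: lerD => //=.
  by rewrite -mulrA -exprD; exact: hu.
rewrite -(cvg_lim _ cv) //; apply: limr_le; first exact: (cvgP _ cv).
near=> n; have Nn : (N <= n)%N by near: n; exact: nbhs_infty_ge.
rewrite -(subnKC Nn); apply: le_trans (bnd _) _.
by rewrite ler_wpM2l ?mulr_ge0 ?exprn_ge0 //; exact: geometric_partial_le.
Unshelve. all: by end_near.
Qed.

End L1Complete.

(** * Sobolev norms, real and complex *)

Section Sobolev.
Variable R : realType.
Notation mu := (@lebesgue_measure R).
Implicit Types (phi psi g h eta : R -> R).

Lemma integral_I_mul_le u h (K : R) : L1I u -> measurable_fun I01 h ->
  (forall x, I01 x -> `|h x| <= K) ->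
  `|integral_I (fun x => u x * h x)| <= K * integral_I (fun x => `|u x|).
Proof.
move=> iu mh hK; have iuh := L1I_mulb iu mh hK.
apply: le_trans (integral_I_abs iuh) _.
rewrite -integral_I_scale; last exact: L1I_norm.
apply: integral_I_le; [exact: L1I_norm|by apply: L1I_scale; exact: L1I_norm|].
by move=> x Ix; rewrite normrM mulrC ler_wpM2r // hK.
Qed.

Lemma is_weak_deriv_L1I j phi g : is_weak_deriv j phi g -> L1I g.
Proof. by case. Qed.

Lemma is_weak_deriv_lin j (z : R) phi psi g h : L1I phi -> L1I psi ->
  is_weak_deriv j phi g -> is_weak_deriv j psi h ->
  is_weak_deriv j (fun x => z * phi x + psi x) (fun x => z * g x + h x).
Proof.
move=> ip iq [ig hg] [ih hh]; split; first by apply: L1I_add => //; exact: L1I_scale.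
have lin (u v w : R -> R) n : L1I u -> L1I v -> test_function w ->
    integral_I (fun x => (z * u x + v x) * derive1n n w x) =
    z * integral_I (fun x => u x * derive1n n w x) + integral_I (fun x => v x * derive1n n w x).
  move=> iu iv tw; have h1 := L1I_mul_test n iu tw; have h2 := L1I_mul_test n iv tw.
  rewrite -integral_I_scale // -integral_I_add //; last exact: L1I_scale.
  by apply: integral_I_eq => x _; ring.
move=> eta te; rewrite lin // hg // hh //.
have := lin g h eta 0%N ig ih te; rewrite /= => ->; ring.
Qed.

Lemma is_weak_deriv_sub j phi psi g h : L1I phi -> L1I psi ->
  is_weak_deriv j phi g -> is_weak_deriv j psi h ->
  is_weak_deriv j (fun x => phi x - psi x) (fun x => g x - h x).
Proof.
move=> ip iq wg wh; have := is_weak_deriv_lin (-1) iq ip wh wg.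
have E (u v : R -> R) : (fun x => -1 * u x + v x) = (fun x => v x - u x).
  by apply/funext => x; rewrite mulN1r addrC.
by rewrite !E.
Qed.

Lemma is_weak_deriv_null j phi : L1I phi -> eqI phi (fun=> 0) -> is_weak_deriv j phi (fun=> 0).
Proof.
move=> ip phi0; split=> [|eta te]; first exact: L1I_cst.
rewrite (@integral_I_eqI _ _ (fun=> 0)).
- rewrite integral_I_cst (@integral_I_eq _ (fun x => 0 * eta x) (fun=> 0)) ?integral_I_cst ?mulr0 //.
  by move=> x _; rewrite mul0r.
- by apply: L1I_measurable; exact: L1I_mul_test.
- exact: measurable_cst.
- by apply: aeS phi0 => x h /h ->; rewrite mul0r.
Qed.

(** Weak differentiation is a closed operation: a test function and its j-th derivative are bounded
    on [I01], so both sides of the defining relation are continuous in [L^1]. *)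
Lemma is_weak_deriv_limit j (u g : nat -> R -> R) v w (C q : R) : 0 <= q < 1 ->
  (forall n, L1I (u n)) -> (forall n, is_weak_deriv j (u n) (g n)) -> L1I v -> L1I w ->
  (forall n, integral_I (fun x => `|u n x - v x|) <= C * q ^+ n) ->
  (forall n, integral_I (fun x => `|g n x - w x|) <= C * q ^+ n) ->
  is_weak_deriv j v w.
Proof.
move=> q01 iu wg iv iw hu hg; split=> // eta te.
have [K1 hK1] := test_bounded j te; have [K0 hK0] := test_bounded 0 te.
have K1_ge0 : 0 <= K1 by apply: le_trans (hK1 0 _); rewrite ?normr_ge0 //; apply/I01P; rewrite lexx ler01.
have K0_ge0 : 0 <= K0 by apply: le_trans (hK0 0 _); rewrite ?normr_ge0 //; apply/I01P; rewrite lexx ler01.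
apply/eqP; rewrite -subr_eq0 -normr_eq0; apply/eqP.
apply: (@geometric_squeeze _ _ ((K1 + K0) * C) q) => // n.
have ig n := is_weak_deriv_L1I (wg n).
have sub (a b : R -> R) m : L1I a -> L1I b -> integral_I (fun x => (a x - b x) * derive1n m eta x) =
   integral_I (fun x => a x * derive1n m eta x) - integral_I (fun x => b x * derive1n m eta x).
  move=> ia ib; rewrite -integral_I_sub; [|exact: L1I_mul_test|exact: L1I_mul_test].
  by apply: integral_I_eq => x _; rewrite mulrBl.
have e1 := sub _ _ j (iu n) iv; have e2 := sub _ _ 0%N (ig n) iw.
have b1 := integral_I_mul_le (L1I_sub (iu n) iv) (test_measurable j te) hK1.
have b2 := integral_I_mul_le (L1I_sub (ig n) iw) (test_measurable 0 te) hK0.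
rewrite e1 (wg n).2 // in b1; rewrite e2 in b2; move: b1 b2 => /=.
set a := integral_I _; set b := integral_I _; set c := integral_I _; set d := integral_I _; set e := integral_I _ => b1 b2.
have -> : b - (-1) ^+ j * d = - ((-1) ^+ j * a - b) + (-1) ^+ j * (a - d) by ring.
apply: le_trans (ler_normD _ _) _; rewrite normrN normrM normrX normrN1 expr1n mul1r.
rewrite mulrDl mulrDl; apply: lerD.
  by apply: le_trans b1 _; rewrite -mulrA ler_wpM2l //; exact: hu.
by apply: le_trans b2 _; rewrite -mulrA ler_wpM2l //; exact: hg.
Qed.

(** Carries explicit representatives of the weak derivatives, so that norms can be computed from any
    convenient choice instead of the one picked by [weak_deriv]. *)
Definition weak_derivs (k : nat) phi (G : nat -> R -> R) : Prop :=
  L1I phi /\ forall j, (j <= k)%N -> is_weak_deriv j phi (G j).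

Lemma weak_derivs_L1I k phi G j : weak_derivs k phi G -> (j <= k)%N -> L1I (G j).
Proof. by case=> _ h /h []. Qed.

Lemma W1_weak_derivs k phi : W1 k phi -> weak_derivs k phi (fun j => weak_deriv j phi).
Proof. by move=> [ip h]; split=> // j /h [g wg]; exact: (weak_derivP wg).1. Qed.

Lemma weak_derivs_W1 k phi G : weak_derivs k phi G -> W1 k phi.
Proof. by move=> [ip h]; split=> // j /h wg; exists (G j). Qed.

Lemma weak_derivs_eqI k phi G H j : weak_derivs k phi G -> weak_derivs k phi H ->
  (j <= k)%N -> eqI (G j) (H j).
Proof. by move=> [_ hG] [_ hH] jk; exact: weak_deriv_unique (hG j jk) (hH j jk). Qed.

Lemma weak_derivs_lin k (z : R) phi psi G H : weak_derivs k phi G -> weak_derivs k psi H ->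
  weak_derivs k (fun x => z * phi x + psi x) (fun j x => z * G j x + H j x).
Proof.
move=> [ip hG] [iq hH]; split; first by apply: L1I_add => //; exact: L1I_scale.
by move=> j jk; apply: is_weak_deriv_lin => //; [exact: hG|exact: hH].
Qed.

Lemma weak_derivs_sub k phi psi G H : weak_derivs k phi G -> weak_derivs k psi H ->
  weak_derivs k (fun x => phi x - psi x) (fun j x => G j x - H j x).
Proof.
move=> [ip hG] [iq hH]; split; first exact: L1I_sub.
by move=> j jk; apply: is_weak_deriv_sub => //; [exact: hG|exact: hH].
Qed.

Lemma weak_derivs_null k phi : L1I phi -> eqI phi (fun=> 0) -> weak_derivs k phi (fun _ _ => 0).
Proof. by move=> ip phi0; split=> // j _; exact: is_weak_deriv_null. Qed.

Lemma normc_ge (a b : R) : `|a| <= Normc.normc (a +i* b)%C /\ `|b| <= Normc.normc (a +i* b)%C.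
Proof.
by split; rewrite /= -sqrtr_sqr ler_wsqrtr // ?lerDl ?lerDr sqr_ge0.
Qed.

Lemma normc_le (a b : R) : Normc.normc (a +i* b)%C <= `|a| + `|b|.
Proof.
rewrite /= -[leRHS]ger0_norm ?addr_ge0 // -sqrtr_sqr ler_wsqrtr //.
rewrite -(real_normK (num_real a)) -(real_normK (num_real b)) sqrrD.
by rewrite -addrA [_ *+ 2 + _]addrC addrA lerDl mulrn_wge0 // mulr_ge0.
Qed.

Lemma L1I_normc g h : L1I g -> L1I h -> L1I (fun x => Normc.normc (g x +i* h x)%C).
Proof.
move=> ig ih; apply: (@L1I_dominated _ _ (fun x => `|g x| + `|h x|)).
- have mg := L1I_measurable ig; have mh := L1I_measurable ih.
  apply: (measurableT_comp (f := @Num.sqrt R)).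
    by apply: continuous_measurable; exact: sqrt_continuous.
  by apply: measurable_funD; exact: measurable_funX.
- by move=> x _; rewrite ger0_norm ?sqrtr_ge0 // normc_le.
- by apply: L1I_add; exact: L1I_norm.
Qed.

Lemma W1_normE k phi G : weak_derivs k phi G ->
  W1_norm k phi = \sum_(j < k.+1) integral_I (fun x => `|G j x|).
Proof.
move=> wG; have wD := W1_weak_derivs (weak_derivs_W1 wG).
apply: eq_bigr => j _; have jk : (j <= k)%N by rewrite -ltnS.
apply: integral_I_eqI.
- by apply: L1I_measurable; apply: L1I_norm; exact: weak_derivs_L1I wD jk.
- by apply: L1I_measurable; apply: L1I_norm; exact: weak_derivs_L1I wG jk.
- by apply: aeS (weak_derivs_eqI wD wG jk) => x h /h ->.
Qed.

Lemma cW1_normE k (u : R -> (R[i])^o) G H :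
  weak_derivs k (Re_fun u) G -> weak_derivs k (Im_fun u) H ->
  cW1_norm k u = \sum_(j < k.+1) integral_I (fun x => Normc.normc (G j x +i* H j x)%C).
Proof.
move=> wG wH; have wD := W1_weak_derivs (weak_derivs_W1 wG).
have wE := W1_weak_derivs (weak_derivs_W1 wH).
apply: eq_bigr => j _; have jk : (j <= k)%N by rewrite -ltnS.
apply: integral_I_eqI.
- by apply: L1I_measurable; apply: L1I_normc; [exact: weak_derivs_L1I wD jk|exact: weak_derivs_L1I wE jk].
- by apply: L1I_measurable; apply: L1I_normc; [exact: weak_derivs_L1I wG jk|exact: weak_derivs_L1I wH jk].
- by apply: aeS2 (weak_derivs_eqI wD wG jk) (weak_derivs_eqI wE wH jk) => x h1 h2 Ix; rewrite (h1 Ix) (h2 Ix).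
Qed.

Lemma W1_L1I k phi : W1 k phi -> L1I phi. Proof. by case. Qed.

Lemma W1_lin k (z : R) (phi psi : R -> R^o) : W1 k phi -> W1 k psi -> W1 k (z *: phi + psi).
Proof.
by move=> /W1_weak_derivs h1 /W1_weak_derivs h2; exact: weak_derivs_W1 (weak_derivs_lin z h1 h2).
Qed.

Lemma W1_const k (z : R) : W1 k (fun=> z : R^o).
Proof.
suff w1 : weak_derivs k (fun=> 1) (fun j _ => (j == 0%N)%:R).
  (* The constant [z] is the combination [(z - 1) * 1 + 1], which reduces the claim to the constant
     1. *)
  have := weak_derivs_lin (z - 1) w1 w1.
  have -> : (fun x : R => (z - 1) * 1 + 1) = (fun=> z) by apply/funext => x; rewrite mulr1 subrK.
  exact: weak_derivs_W1.
split=> [|[|j] _]; [exact: L1I_cst|by apply: weak_deriv0; exact: L1I_cst|].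
split=> [|eta te]; first exact: L1I_cst.
rewrite [X in _ * X](@integral_I_eq _ _ (fun=> 0)) ?integral_I_cst ?mulr0; last by move=> x _; rewrite mul0r.
have tj : test_function (derive1n j eta) by elim: j => //= j; exact: test_derive1.
have := weak_deriv0 (@L1I_cst R 1).
have [p [q [p0 pq q1 sup]]] := test_supp tj.
rewrite (@integral_I_eq _ _ (derive1 (derive1n j eta))); last by move=> x _; rewrite mul1r.
have c1 := @test_continuous _ _ 1 tj.
have dj x : is_derive (x : R) (1 : R) (derive1n j eta) (derive1 (derive1n j eta) x).
  by apply: smooth_is_derive; exact: tj.1.
move=> _; rewrite /integral_I /I01 (FTC2_I ler01 dj c1).
by rewrite !sup ?subrr //; [left|right].
Qed.

Lemma W1_norm_ge0 k phi : 0 <= W1_norm k phi.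
Proof. by apply: sumr_ge0 => j _; apply: integral_I_ge0 => x _. Qed.

Lemma W1_normD k (phi psi : R -> R^o) : W1 k phi -> W1 k psi ->
  W1_norm k (phi + psi) <= W1_norm k phi + W1_norm k psi.
Proof.
move=> /W1_weak_derivs wG /W1_weak_derivs wH.
have := weak_derivs_lin 1 wG wH; have -> : (fun x => 1 * phi x + psi x) = phi + psi by apply/funext => x; rewrite mul1r.
move=> wGH; rewrite (W1_normE wG) (W1_normE wH) (W1_normE wGH) -big_split /=.
apply: ler_sum => j _; have jk : (j <= k)%N by rewrite -ltnS.
have iG := weak_derivs_L1I wG jk; have iH := weak_derivs_L1I wH jk.
rewrite -integral_I_add; try exact: L1I_norm.
apply: integral_I_le => [||x _]; [exact: L1I_norm (weak_derivs_L1I wGH jk)|by apply: L1I_add; exact: L1I_norm|].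
by rewrite mul1r; exact: ler_normD.
Qed.

Lemma W1_normZ k (z : R) (phi : R -> R^o) : W1 k phi -> W1_norm k (z *: phi) = `|z| * W1_norm k phi.
Proof.
move=> /W1_weak_derivs wG.
have := weak_derivs_lin z wG (weak_derivs_null k (@L1I_cst R 0) (eqI_refl _)).
have -> : (fun x => z * phi x + 0) = z *: phi by apply/funext => x; rewrite addr0.
move=> wz; rewrite (W1_normE wG) (W1_normE wz) mulr_sumr; apply: eq_bigr => j _.
have jk : (j <= k)%N by rewrite -ltnS.
rewrite -integral_I_scale; last exact: L1I_norm (weak_derivs_L1I wG jk).
by apply: integral_I_eq => x _; rewrite addr0 normrM.
Qed.

Lemma W1_seminormed k : seminormed (fun z : R => `|z|) (W1 (R := R) k) (W1_norm k).
Proof.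
split=> //; rewrite ?normr0 ?normr1 //.
- exact: normrM.
- by move=> x /eqP; rewrite normr_eq0 => /eqP.
- exact: W1_const.
- by move=> z u v; exact: W1_lin.
- by move=> u _; exact: W1_norm_ge0.
- by move=> u v; exact: W1_normD.
- by move=> z u; exact: W1_normZ.
Qed.

Lemma W1_norm_null k (phi psi : R -> R^o) : L1I phi -> L1I psi -> eqI phi psi ->
  W1_norm k (phi - psi) = 0.
Proof.
move=> ip iq e; have ipq := L1I_sub ip iq.
have e0 : eqI (fun x => phi x - psi x) (fun=> 0) by apply: aeS e => x h /h ->; rewrite subrr.
rewrite (W1_normE (weak_derivs_null k ipq e0)); apply: big1 => j _.
by rewrite (@integral_I_eq _ _ (fun=> 0)) ?integral_I_cst // => x _; rewrite normr0.
Qed.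

Lemma W1_norm_L1 k phi : W1 k phi -> integral_I (fun x => `|phi x|) <= W1_norm k phi.
Proof.
move=> wphi; have w := W1_weak_derivs wphi.
have -> : integral_I (fun x => `|phi x|) = integral_I (fun x => `|weak_deriv 0 phi x|).
  have e := weak_deriv_unique (w.2 0%N isT) (weak_deriv0 w.1).
  apply: integral_I_eqI.
  - by apply: L1I_measurable; apply: L1I_norm; exact: w.1.
  - by apply: L1I_measurable; apply: L1I_norm; exact: weak_derivs_L1I w _.
  - by apply: aeS e => x h /h ->.
rewrite /W1_norm big_ord_recl /= lerDl; apply: sumr_ge0 => j _.
by apply: integral_I_ge0.
Qed.

(** Some geometric rate of convergence implies the sharp one: compare [u n] with [u (n + m)] by
    summing increments, and let [m] grow. *)
Lemma geom_complete_weak (K : fieldType) (nu : K -> R) (E : lmodType K) (W : set E) (N : E -> R) :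
  seminormed nu W N ->
  (forall (u : nat -> E) (C q : R), (forall n, W (u n)) -> 0 <= C -> 0 <= q < 1 ->
    (forall n, N (u n.+1 - u n) <= C * q ^+ n) ->
    exists2 v, W v & exists C' : R, forall n, N (u n - v) <= C' * q ^+ n) ->
  geom_complete W N.
Proof.
move=> sn wc u C q Wu C0 q01 hu; have [v Wv [C' hC']] := wc u C q Wu C0 q01 hu.
have /andP[q0 q1] := q01; exists v => // n; rewrite -subr_le0.
set B := C * q ^+ n / (1 - q); set x := _ - B.
have bnd m : N (u n - u (n + m)%N) <= C * q ^+ n * \sum_(k < m) q ^+ k.
  elim: m => [|m IH]; first by rewrite addn0 subrr (N0 sn) big_ord0 mulr0.
  rewrite big_ord_recr mulrDr /=; apply: le_trans (dist_tri sn (Wu _) (Wu _) (Wu (n + m)%N)) _.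
  by apply: lerD => //; rewrite addnS (dist_sym sn) // -mulrA -exprD.
have hx m : x <= C' * q ^+ n * q ^+ m.
  rewrite lerBlDl; apply: le_trans (dist_tri sn (Wu _) Wv (Wu (n + m)%N)) _.
  apply: lerD; last by rewrite -mulrA -exprD.
  apply: le_trans (bnd m) _; rewrite ler_wpM2l ?mulr_ge0 ?exprn_ge0 //.
  exact: geometric_partial_le.
have [//|x0] := leP x 0.
by have := geometric_squeeze (ltW x0) q01 hx => xe; rewrite xe ltxx in x0.
Qed.

(** The weak derivatives of each order form their own geometric sequence in [L^1]; closedness
    identifies the limits as the derivatives of the limit of order 0. Summing [k + 1] errors costs
    the factor in the rate. *)
Lemma W1_weak_complete k (u : nat -> R -> R^o) (C q : R) : (forall n, W1 k (u n)) ->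
  0 <= C -> 0 <= q < 1 -> (forall n, W1_norm k (u n.+1 - u n) <= C * q ^+ n) ->
  exists2 v, W1 k v & forall n, W1_norm k (u n - v) <= k.+1%:R * (C / (1 - q)) * q ^+ n.
Proof.
move=> Wu C0 q01 hu; pose D n := fun j => weak_deriv j (u n).
have wD n : weak_derivs k (u n) (D n) := W1_weak_derivs (Wu n).
have hD j n : (j <= k)%N -> integral_I (fun x => `|D n.+1 j x - D n j x|) <= C * q ^+ n.
  move=> jk; apply: le_trans (hu n).
  rewrite (W1_normE (weak_derivs_sub (wD n.+1) (wD n))).
  have jk' : (j < k.+1)%N by [].
  rewrite (bigD1 (Ordinal jk')) //= lerDl; apply: sumr_ge0 => i _.
  by apply: integral_I_ge0.
have lim j : exists v, (j <= k)%N -> L1I v /\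
    forall n, integral_I (fun x => `|D n j x - v x|) <= C / (1 - q) * q ^+ n.
  have [jk|_] := boolP (j <= k)%N; last by exists (fun=> 0).
  have [v iv hv] := L1I_geometric_limit C0 q01 (fun n => weak_derivs_L1I (wD n) jk) (fun n => hD j n jk).
  by exists v => _; split=> // n; rewrite mulrAC; exact: hv.
have [G hG] := choice lim.
(* [G 0] is a limit of weak derivatives of order 0, which agree almost everywhere with the functions
   [u n] themselves. *)
have wG : weak_derivs k (G 0%N) G.
  have iG0 := (hG 0%N (leq0n _)).1; split=> // j jk.
  apply: (is_weak_deriv_limit (C := C / (1 - q)) q01 (fun n => (wD n).1) (fun n => (wD n).2 j jk)) => //.
  - exact: (hG j jk).1.
  - move=> n; apply: le_trans ((hG 0%N (leq0n _)).2 n).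
    apply: integral_I_ae_le.
    + by apply: L1I_norm; apply: L1I_sub => //; exact: (wD n).1.
    + by apply: L1I_norm; apply: L1I_sub => //; exact: weak_derivs_L1I (wD n) _.
    + by apply: aeS (weak_deriv_unique ((wD n).2 0%N isT) (weak_deriv0 (wD n).1)) => x h /h ->.
  - exact: (hG j jk).2.
exists (G 0%N); first exact: weak_derivs_W1 wG.
move=> n; rewrite (W1_normE (weak_derivs_sub (wD n) wG)) -mulrA mulr_natl.
rewrite -[X in _ *+ X](card_ord k.+1) -sumr_const; apply: ler_sum => j _.
have jk : (j <= k)%N by rewrite -ltnS.
exact: (hG j jk).2.
Qed.

Lemma W1_complete k : geom_complete (W1 (R := R) k) (W1_norm k).
Proof.
apply: geom_complete_weak (W1_seminormed k) _ => u C q Wu C0 q01 hu.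
by have [v Wv hv] := W1_weak_complete Wu C0 q01 hu; exists v => //; exists (k.+1%:R * (C / (1 - q))).
Qed.

Lemma W1_0_seminormed k : seminormed (fun z : R => `|z|) (W1_0 (R := R) k) (W1_norm k).
Proof.
case: (W1_seminormed k) => *; split=> //.
- by split; [exact: W1_const|exact: integral_I_cst].
- move=> z u v [Wu iu] [Wv iv]; split; first exact: W1_lin.
  have -> : z *: u + v = (fun x => z * u x + v x) by [].
  rewrite integral_I_add ?integral_I_scale ?iu ?iv ?mulr0 ?addr0 //; try exact: W1_L1I Wv; try exact: W1_L1I Wu.
  by apply: L1I_scale; exact: W1_L1I Wu.
- by move=> u [? _]; auto.
- by move=> u v [? _] [? _]; auto.
- by move=> z u [? _]; auto.
Qed.

Lemma W1_0_complete k : geom_complete (W1_0 (R := R) k) (W1_norm k).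
Proof.
move=> u C q Wu C0 q01 hu; have [v Wv hv] := W1_complete (fun n => (Wu n).1) C0 q01 hu.
exists v => //; split=> //; apply/eqP; rewrite -normr_eq0; apply/eqP.
apply: (@geometric_squeeze _ _ (C / (1 - q)) q) => // n; rewrite mulrAC; apply: le_trans (hv n).
have iu := W1_L1I (Wu n).1; have iv := W1_L1I Wv.
have Wd : W1 k (u n - v) by apply: (W_sub (W1_seminormed k)) => //; exact: (Wu n).1.
apply: le_trans (W1_norm_L1 Wd); apply: le_trans (integral_I_abs (L1I_sub iu iv)).
by rewrite integral_I_sub // (Wu n).2 sub0r normrN.
Qed.

Section Complex.
Variable k : nat.
Implicit Types u v : R -> (R[i])^o.

(** With the reverse bounds of [cW1_norm_ge], the complex norm is equivalent to the sum of the norms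
    of the two parts, which reduces complex estimates to real ones. *)
Lemma cW1_norm_le u : cW1 k u ->
  cW1_norm k u <= W1_norm k (Re_fun u) + W1_norm k (Im_fun u).
Proof.
move=> [/W1_weak_derivs wG /W1_weak_derivs wH].
rewrite /cW1_norm /W1_norm -big_split /=; apply: ler_sum => j _.
have jk : (j <= k)%N by rewrite -ltnS.
have iG := weak_derivs_L1I wG jk; have iH := weak_derivs_L1I wH jk.
rewrite -integral_I_add; try exact: L1I_norm.
apply: integral_I_le; [exact: L1I_normc|by apply: L1I_add; exact: L1I_norm|].
by move=> x _; exact: normc_le.
Qed.

Lemma cW1_norm_ge u : cW1 k u ->
  W1_norm k (Re_fun u) <= cW1_norm k u /\ W1_norm k (Im_fun u) <= cW1_norm k u.
Proof.
move=> [/W1_weak_derivs wG /W1_weak_derivs wH].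
split; apply: ler_sum => j _; have jk : (j <= k)%N by rewrite -ltnS.
all: have iG := weak_derivs_L1I wG jk; have iH := weak_derivs_L1I wH jk.
all: apply: integral_I_le; [exact: L1I_norm|exact: L1I_normc|move=> x _].
- exact: (normc_ge _ _).1.
- exact: (normc_ge _ _).2.
Qed.

Lemma Re_fun_lin (z : R[i]) u v : Re_fun (z *: u + v) =
  complex.Re z *: (Re_fun u : R -> R^o) + (- complex.Im z *: (Im_fun u : R -> R^o) + Re_fun v).
Proof.
apply/funext => x; rewrite /Re_fun /Im_fun /= !fctE.
have -> : z *: u x = z * u x by [].
have sE (a b : R) : a *: (b : R^o) = a * b by [].
by rewrite !sE; case: z => a b; case: (u x) => p q; case: (v x) => p' q' /=; rewrite mulNr addrA.
Qed.

Lemma Im_fun_lin (z : R[i]) u v : Im_fun (z *: u + v) =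
  complex.Re z *: (Im_fun u : R -> R^o) + (complex.Im z *: (Re_fun u : R -> R^o) + Im_fun v).
Proof.
apply/funext => x; rewrite /Re_fun /Im_fun /= !fctE.
have -> : z *: u x = z * u x by [].
have sE (a b : R) : a *: (b : R^o) = a * b by [].
by rewrite !sE; case: z => a b; case: (u x) => p q; case: (v x) => p' q' /=; rewrite addrA.
Qed.

Lemma cW1_lin (z : R[i]) u v : cW1 k u -> cW1 k v -> cW1 k (z *: u + v).
Proof.
move=> [Wu Wu'] [Wv Wv']; split.
- by rewrite Re_fun_lin; apply: W1_lin => //; exact: W1_lin.
- by rewrite Im_fun_lin; apply: W1_lin => //; exact: W1_lin.
Qed.

Lemma cW1_normD u v : cW1 k u -> cW1 k v -> cW1_norm k (u + v) <= cW1_norm k u + cW1_norm k v.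
Proof.
move=> Wu Wv; have [/W1_weak_derivs wG /W1_weak_derivs wH] := Wu.
have [/W1_weak_derivs wG' /W1_weak_derivs wH'] := Wv.
have e1 : Re_fun (u + v) = (fun x => 1 * Re_fun u x + Re_fun v x).
  by apply/funext => x; rewrite mul1r /Re_fun fctE /=; case: (u x); case: (v x).
have e2 : Im_fun (u + v) = (fun x => 1 * Im_fun u x + Im_fun v x).
  by apply/funext => x; rewrite mul1r /Im_fun fctE /=; case: (u x); case: (v x).
have w1 := weak_derivs_lin 1 wG wG'; have w2 := weak_derivs_lin 1 wH wH'.
rewrite -e1 in w1; rewrite -e2 in w2.
rewrite (cW1_normE w1 w2) -big_split /=; apply: ler_sum => j _.
have jk : (j <= k)%N by rewrite -ltnS.
have iG := weak_derivs_L1I wG jk; have iH := weak_derivs_L1I wH jk.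
have iG' := weak_derivs_L1I wG' jk; have iH' := weak_derivs_L1I wH' jk.
rewrite -integral_I_add; try exact: L1I_normc.
apply: integral_I_le => [||x _].
- by apply: L1I_normc; [exact: weak_derivs_L1I w1 jk|exact: weak_derivs_L1I w2 jk].
- by apply: L1I_add; exact: L1I_normc.
- by rewrite !mul1r; exact: (complex.le_normcD (_ +i* _)%C (_ +i* _)%C).
Qed.

Lemma cW1_normZ (z : R[i]) u : cW1 k u -> cW1_norm k (z *: u) = Normc.normc z * cW1_norm k u.
Proof.
move=> Wu; have [/W1_weak_derivs wG /W1_weak_derivs wH] := Wu.
have w0 := weak_derivs_null k (@L1I_cst R 0) (eqI_refl _).
have w1 := weak_derivs_lin (complex.Re z) wG (weak_derivs_lin (- complex.Im z) wH w0).
have w2 := weak_derivs_lin (complex.Re z) wH (weak_derivs_lin (complex.Im z) wG w0).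
have := Re_fun_lin z u 0; have := Im_fun_lin z u 0; rewrite !addr0 => eI eR.
have e1 : (fun x => complex.Re z * Re_fun u x + (- complex.Im z * Im_fun u x + 0)) = Re_fun (z *: u).
  by rewrite eR; apply/funext => x; rewrite addr0.
have e2 : (fun x => complex.Re z * Im_fun u x + (complex.Im z * Re_fun u x + 0)) = Im_fun (z *: u).
  by rewrite eI; apply/funext => x; rewrite addr0.
rewrite e1 in w1; rewrite e2 in w2; rewrite (cW1_normE w1 w2) mulr_sumr.
apply: eq_bigr => j _; have jk : (j <= k)%N by rewrite -ltnS.
have iG := weak_derivs_L1I wG jk; have iH := weak_derivs_L1I wH jk.
rewrite -integral_I_scale; last exact: L1I_normc.
apply: integral_I_eq => x _; rewrite -Normc.normcM; congr (Normc.normc _).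
by case: z {w1 w2 eI eR e1 e2} => a b /=; rewrite !addr0 mulNr.
Qed.

Lemma cW1_0 : cW1 k (0 : R -> (R[i])^o).
Proof. by split; exact: W1_const. Qed.

Lemma cW1_seminormed : seminormed (@Normc.normc R) (cW1 (R := R) k) (cW1_norm k).
Proof.
split.
- exact: Normc.normc0.
- exact: Normc.normc1.
- exact: Normc.normcM.
- by case=> a b; exact: sqrtr_ge0.
- by move=> x; exact: Normc.eq0_normc.
- exact: cW1_0.
- exact: cW1_lin.
- move=> u _; apply: sumr_ge0 => j _; apply: integral_I_ge0 => x _; exact: sqrtr_ge0.
- exact: cW1_normD.
- exact: cW1_normZ.
Qed.

Lemma Re_fun_sub u v : Re_fun (u - v) = (Re_fun u : R -> R^o) - Re_fun v.
Proof. by apply/funext => x; rewrite /Re_fun !fctE; case: (u x); case: (v x). Qed.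

Lemma Im_fun_sub u v : Im_fun (u - v) = (Im_fun u : R -> R^o) - Im_fun v.
Proof. by apply/funext => x; rewrite /Im_fun !fctE; case: (u x); case: (v x). Qed.

Lemma cW1_complete : geom_complete (cW1 (R := R) k) (cW1_norm k).
Proof.
apply: geom_complete_weak cW1_seminormed _ => u C q Wu C0 q01 hu.
have Wd n : cW1 k (u n.+1 - u n) by exact: (W_sub cW1_seminormed).
have [|vr Wr hr] := W1_weak_complete (fun n => (Wu n).1) C0 q01.
  by move=> n; rewrite -Re_fun_sub; exact: le_trans (cW1_norm_ge (Wd n)).1 (hu n).
have [|vi Wi hi] := W1_weak_complete (fun n => (Wu n).2) C0 q01.
  by move=> n; rewrite -Im_fun_sub; exact: le_trans (cW1_norm_ge (Wd n)).2 (hu n).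
pose v : R -> (R[i])^o := fun x => (vr x +i* vi x)%C.
have Wv : cW1 k v by [].
exists v => //; set D := k.+1%:R * _ in hr hi; exists (D + D) => n.
have Wn : cW1 k (u n - v) by exact: (W_sub cW1_seminormed).
apply: le_trans (cW1_norm_le Wn) _; rewrite Re_fun_sub Im_fun_sub mulrDl.
exact: lerD.
Qed.

End Complex.
End Sobolev.

(** * Cusp maps *)

Section Powers.
Variable R : realType.
Notation mu := (@lebesgue_measure R).
Notation TR := (measurableTypeR R).

Lemma is_derive_id (x : R) : is_derive x (1 : R) (fun y : R => y) 1.
Proof. exact: is_derive_id. Qed.

Lemma is_derive_dist (c y : R) : y != c -> is_derive y (1 : R) (fun z : R => `|z - c|) (Num.sg (y - c)).
Proof.
move=> yc; have yc0 : y - c != 0 by rewrite subr_eq0.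
apply: (@is_derive_near _ (fun z : R => Num.sg (y - c) * (z - c))).
  have [h|h|h] := ltgtP y c; last by rewrite h eqxx in yc.
  - have : \forall z \near y, z < c by exact: lt_nbhsl.
    apply: filterS => z zc; rewrite ltr0_sg ?subr_lt0 // ltr0_norm ?subr_lt0 //.
    by rewrite mulN1r.
  - have : \forall z \near y, c < z by exact: lt_nbhsr.
    apply: filterS => z zc; rewrite gtr0_sg ?subr_gt0 // gtr0_norm ?subr_gt0 //.
    by rewrite mul1r.
apply: (@is_derive_val _ _ _ (Num.sg (y - c) * (1 + 0))); last by rewrite addr0 mulr1.
Qed.

Lemma is_derive_dist_pow (c q y : R) : y != c ->
  is_derive y (1 : R) (fun z : R => `|z - c| `^ q) (q * `|y - c| `^ (q - 1) * Num.sg (y - c)).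
Proof.
move=> yc; have yc0 : 0 < `|y - c| by rewrite normr_gt0 subr_eq0.
by apply: (@is_derive_comp _ (fun z => z `^ q) (fun z => `|z - c|)); [exact: is_derive1_powR|exact: is_derive_dist].
Qed.

Lemma ge0_integrable_bigcup d (T : measurableType d) (m : {measure set T -> \bar R})
    (A : nat -> set T) (u : T -> R) (K : R) : nondecreasing_seq A ->
  (forall n, measurable (A n)) -> measurable_fun setT u -> (forall x, 0 <= u x) ->
  (forall n, (\int[m]_(x in A n) (u x)%:E <= K%:E)%E) ->
  m.-integrable (\bigcup_n A n) (EFin \o u).
Proof.
move=> ndA mA mu_ u0 hK; apply/integrableP; split.
  by apply/measurable_EFinP; exact: measurable_funTS.
under eq_integral => x _ do rewrite /= ger0_norm //.
have cv := @ge0_nondecreasing_set_cvg_integral _ _ _ A (EFin \o u) m ndA mA _ _.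
apply: (@le_lt_trans _ _ K%:E); last by rewrite ltry.
rewrite -(cvg_lim _ (cv _ _)) //; last 2 first.
- by move=> n; apply/measurable_EFinP; exact: measurable_funTS.
- by move=> n x _; rewrite lee_fin.
apply: lime_le; last by apply: nearW.
apply/cvg_ex; eexists; apply: cv.
- by move=> n; apply/measurable_EFinP; exact: measurable_funTS.
- by move=> n x _; rewrite lee_fin.
Qed.

Lemma measurable_dist_pow (c p : R) (D : set R) : measurable_fun D (fun x : R => `|x - c| `^ p).
Proof.
apply: measurable_funTS; apply: (measurableT_comp (measurable_powR p)).
by apply: measurableT_comp => //; exact: measurable_funB.
Qed.

(** The bound is uniform over intervals that avoid [c], which is what exhaustion needs: the explicit
    primitive is at most [1/(1+p)] in absolute value at either end. *)
Lemma integral_dist_pow_le (c p a b : R) : -1 < p -> 0 <= a -> a < b -> b <= 1 -> 0 <= c <= 1 ->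
  (forall x, a <= x <= b -> x != c) ->
  (\int[mu]_(x in `[a, b]) (`|x - c| `^ p)%:E <= (2 / (1 + p))%:E)%E.
Proof.
move=> p1 a0 ab b1 /andP[c0 c1] nc.
have p0 : 0 < 1 + p by lra.
have sgE x : a <= x <= b -> Num.sg (x - c) = Num.sg (a - c).
  move=> /andP[ax xb]; have [ca|ca] := ltP c a.
    by rewrite !gtr0_sg ?subr_gt0 //; exact: lt_le_trans ca ax.
  have ac : a < c by rewrite lt_neqAle ca andbT; apply: nc; rewrite lexx ltW.
  have xc : x < c.
    rewrite ltNge; apply/negP => cx; have := nc c; rewrite ca (le_trans cx xb) => /(_ isT).
    by rewrite eqxx.
  by rewrite !ltr0_sg // subr_lt0.
(* The sign of [x - c] is constant on the interval, so freezing it at [a] yields one primitive for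
   either side of the cusp. *)
pose F (x : R) : R := Num.sg (a - c) * (1 + p)^-1 * `|x - c| `^ (1 + p).
have dF x : a <= x <= b -> is_derive (x : R) (1 : R) F (`|x - c| `^ p).
  move=> xab; have h := is_derive_scale (Num.sg (a - c) * (1 + p)^-1) (is_derive_dist_pow (1 + p) (nc x xab)).
  apply: is_derive_val h _; rewrite sgE // [1 + p]addrC addrK addrC.
  set s := Num.sg _; have s2 : s * s = 1.
    by rewrite -expr2 sqr_sg subr_eq0 nc // lexx ltW.
  by transitivity (s * s * ((1 + p)^-1 * (1 + p)) * `|x - c| `^ p); [ring|rewrite s2 mulVf ?gt_eqF // !mul1r].
have cu x : a <= x <= b -> {for x, continuous (fun x : R => `|x - c| `^ p)}.
  move=> xab; apply: differentiable_continuous; apply/derivable1_diffP.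
  exact: (@ex_derive _ _ _ _ _ _ _ (is_derive_dist_pow p (nc x xab))).
have cF x : a <= x <= b -> {for x, continuous F}.
  by move=> xab; apply: differentiable_continuous; apply/derivable1_diffP; have [] := dF x xab.
rewrite (continuous_FTC2 (F := F) ab).
- have bF x : a <= x <= b -> `|F x| <= (1 + p)^-1.
    move=> /andP[ax xb]; have p0' : 0 <= (1 + p)^-1 by rewrite invr_ge0 ltW.
    rewrite /F !normrM (ger0_norm p0') [X in _ * X]ger0_norm ?powR_ge0 //.
    rewrite -[leRHS]mulr1; apply: ler_pM; rewrite ?mulr_ge0 ?powR_ge0 ?ler_piMl ?norm_sgr_le1 //.
    rewrite [leRHS](_ : _ = 1 `^ (1 + p)); last by rewrite powR1.
    apply: ge0_ler_powR; [lra|by rewrite nnegrE|by rewrite nnegrE|].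
    by rewrite ler_norml; lra.
  rewrite -EFinB lee_fin; have h1 := bF a; have h2 := bF b.
  have {}h1 : `|F a| <= (1 + p)^-1 by apply: h1; rewrite lexx ltW.
  have {}h2 : `|F b| <= (1 + p)^-1 by apply: h2; rewrite lexx ltW.
  by move: h1 h2; rewrite !ler_norml => /andP[h1 h2] /andP[h3 h4]; lra.
- apply: continuous_in_subspaceT => x; rewrite inE /= in_itv /= => xab; exact: cu.
- split.
  + by move=> x; rewrite in_itv /= => /andP[ax xb]; have [] := dF x; rewrite ?(ltW ax) ?(ltW xb).
  + by apply: cvg_at_right_filter; apply: cF; rewrite lexx ltW.
  + by apply: cvg_at_left_filter; apply: cF; rewrite lexx ltW.
- move=> x; rewrite in_itv /= => /andP[ax xb]; rewrite derive1E.
  by have [] := dF x; rewrite ?(ltW ax) ?(ltW xb).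
Qed.

(** [I01] without [c] is the increasing union of pairs of intervals that avoid [c]; monotone
    convergence applies to the uniform bound on them, and the point [c] is negligible. *)
Lemma L1I_dist_pow (c p : R) : 0 < c < 1 -> -1 < p -> L1I (fun x : R => `|x - c| `^ p).
Proof.
move=> /andP[c0 c1] p1; pose u (x : R) := `|x - c| `^ p.
have c01 : 0 <= c <= 1 by rewrite !ltW.
have mu_ : measurable_fun [set: TR] u by exact: measurable_dist_pow.
(* Starting at [1/2] keeps [e n] below 1, so both intervals of [A n] are non-degenerate. *)
pose e (n : nat) : R := n.+2%:R^-1.
have e0 n : 0 < e n by rewrite invr_gt0.
have e1 n : e n < 1 by rewrite invf_lt1 // ltr1n.
have ele n m : (n <= m)%N -> e m <= e n by move=> nm; rewrite lef_pV2 ?posrE // ler_nat.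
have evanish (z : R) : 0 < z -> exists n, e n <= z.
  move=> z0; exists (Num.truncn z^-1).
  rewrite /e invf_ple ?posrE //; apply: ltW; apply: lt_le_trans (truncnS_gt _) _.
  by rewrite ler_nat.
pose A n : set TR := `[0, c - c * e n]%classic `|` `[c + (1 - c) * e n, 1]%classic.
have Ic : \bigcup_n A n = I01 `\ c :> set R.
  apply/seteqP; split=> x.
    case=> n _ [] /=; rewrite !in_itv /= => /andP[h1 h2].
      have h3 : 0 < c * e n by rewrite mulr_gt0.
      by split; [apply/I01P; lra|move=> xc; lra].
    have h3 : 0 < (1 - c) * e n by rewrite mulr_gt0 // subr_gt0.
    by split; [apply/I01P; lra|move=> xc; lra].
  case=> /I01P /andP[x0 x1] /= /eqP xc; have [h|h|h] := ltgtP x c; last by rewrite h eqxx in xc.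
    have [|n hn] := evanish ((c - x) / c); first by rewrite divr_gt0 // subr_gt0.
    exists n => //; left => /=; rewrite in_itv /= x0 /=; move: hn; rewrite ler_pdivlMr //; lra.
  have [|n hn] := evanish ((x - c) / (1 - c)); first by rewrite divr_gt0 // subr_gt0.
  exists n => //; right => /=; rewrite in_itv /= x1 andbT; move: hn; rewrite ler_pdivlMr ?subr_gt0 //; lra.
have mA n : measurable (A n) by apply: measurableU; exact: measurable_itv.
have iu : mu.-integrable (\bigcup_n A n) (EFin \o u).
  apply: (@ge0_integrable_bigcup _ TR mu A u (2 / (1 + p) + 2 / (1 + p))) => //.
  - move=> n m nm; apply/subsetPset; apply: setUSS => x /=; rewrite !in_itv /= => /andP[h1 h2].
      by rewrite h1 /=; apply: le_trans h2 _; rewrite lerD2l lerN2 ler_wpM2l ?ele // ltW.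
    by rewrite h2 andbT; apply: le_trans h1; rewrite lerD2l ler_wpM2l ?ele // subr_ge0 ltW.
  - by move=> x; exact: powR_ge0.
  - move=> n; have h3 : 0 < c * e n by rewrite mulr_gt0.
    have h4 : 0 < (1 - c) * e n by rewrite mulr_gt0 // subr_gt0.
    have h5 : c * e n < c by rewrite gtr_pMr.
    have h6 : (1 - c) * e n < 1 - c by rewrite gtr_pMr // subr_gt0.
    rewrite ge0_integral_setU //=.
    + rewrite EFinD; apply: leeD; apply: integral_dist_pow_le => //; try lra.
        by move=> x /andP[_ xc]; apply/eqP => xe; lra.
      by move=> x /andP[xc _]; apply/eqP => xe; lra.
    + by apply/measurable_EFinP; exact: measurable_funTS.
    + by move=> x _; rewrite lee_fin powR_ge0.
    + apply/disj_setPRL => x /=; rewrite !in_itv /= => /andP[h7 h8] /andP[h9 h10]; lra.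
rewrite Ic in iu; apply/(@negligible_integrable _ TR R mu I01 [set c]) => //.
- exact: measurable_I01.
- by apply: (@measurable_EFinP _ TR R I01 _).2; exact: measurable_dist_pow.
- exact: lebesgue_measure_set1.
Qed.

End Powers.

(** * Measurability on the product and a change of variables inequality *)

Section Measurability.
Variable R : realType.
Notation mu := (@lebesgue_measure R).
Notation TR := (measurableTypeR R).

Lemma has_deriv_in_is_derive (D : set R) (u : R -> R) (x l : R) : nbhs x D ->
  has_deriv_in D u x l -> is_derive x (1 : R) u l.
Proof.
move=> Dx h; have {}h : (u y - u x) / (y - x) @[y --> x^'] --> l.
  apply: cvg_trans h; apply: cvg_app => A [e /= e0 hA].
  have := Dx; move=> [e' /= e'0 hD].
  exists (Num.min e e') => /=; first by rewrite lt_min e0.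
  move=> y /= ; rewrite lt_min => /andP[ye ye'] yx; apply: hA => //.
  exact: hD.
have {}h : h^-1 *: ((u \o shift x) (h *: (1 : R)) - u x) @[h --> 0^'] --> l.
  apply/cvgrPdist_lt => e e0; have /cvgrPdist_lt /(_ e e0) [d /= d0 hd] := h.
  exists d => // y /=; rewrite sub0r normrN => yd y0.
  have := hd (y + x); rewrite /= opprD addrCA subrr addr0 normrN => /(_ yd).
  rewrite -subr_eq0 addrK => /(_ y0); rewrite mulrC.
  have sE (p q : R) : p *: (q : R^o) = p * q by [].
  by rewrite !sE mulr1.
by split; [apply/cvg_ex; exists l|exact: (cvg_lim (@Rhausdorff R) h)].
Qed.

(** An open set of the plane is a countable union of boxes with rational corners, each measurable
    for the product sigma-algebra. *)
Lemma open_measurable_prod (U : set (R * R)) : open U -> measurable (U : set (TR * TR)).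
Proof.
move=> oU.
pose box (q : (rat * rat) * (rat * rat)) : set (R * R) :=
  `]ratr q.1.1, ratr q.1.2[%classic `*` `]ratr q.2.1, ratr q.2.2[%classic.
pose V q := if `[< box q `<=` U >] then box q else set0.
have -> : U = \bigcup_q V q.
  apply/seteqP; split=> [p Up|p [q _]]; last by rewrite /V; case: asboolP => // h /h.
  have [[A B] /= [nA nB] AB] : filter_prod (nbhs p.1) (nbhs p.2) U by move: (oU p Up); case: p {Up}.
  have rat_itv (x : R) (W : set R) : nbhs x W -> exists q : rat * rat,
      `]ratr q.1, ratr q.2[%classic x /\ `]ratr q.1, ratr q.2[%classic `<=` W.
    move=> [e /= e0 hW].
    have [q1] := @rat_in_itvoo R (x - e) x ltac:(lra); rewrite in_itv /= => /andP[h1 h2].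
    have [q2] := @rat_in_itvoo R x (x + e) ltac:(lra); rewrite in_itv /= => /andP[h3 h4].
    exists (q1, q2); split=> [|y] /=; rewrite !in_itv /=; first by rewrite h2 h3.
    by move=> /andP[h5 h6]; apply: hW => /=; rewrite ltr_norml; lra.
  have [q1 [h1 h2]] := rat_itv _ _ nA; have [q2 [h3 h4]] := rat_itv _ _ nB.
  exists (q1, q2) => //; rewrite /V; case: asboolP => // h; exfalso; apply: h => z [z1 z2].
  by apply: AB; split; [exact: h2|exact: h4].
apply: (@countable_bigcupT_measurable _ _ _ V).
  exact: countableP.
move=> q; rewrite /V; case: ifP => _; last exact: measurable0.
by apply: measurableX; exact: measurable_itv.
Qed.

Lemma within_continuous_measurable_prod (A : set (R * R)) (F : R * R -> R) :
  measurable (A : set (TR * TR)) -> {within A, continuous F} ->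
  measurable_fun (A : set (TR * TR)) F.
Proof.
move=> mA /continuousP cF; apply: (measurability _ (RGenOpens.measurableE R)) => _ [_ [a [b ->] <-]].
have oab : open (`]a, b[%classic : set R) by exact: interval_open.
have [V oV VA] := (open_subspaceP _ _).1 (cF _ oab).
rewrite setIC -VA; apply: measurableI => //; exact: open_measurable_prod.
Qed.

(** The integral form of [lebesgue_preimage_expanding], valid although the image of [h] may be a
    small part of [I01]. Its later use is with [h] an inverse branch. *)
Lemma expanding_integral_le (Y : set R) (h : R -> R) (k : R) (W : R -> R) (K : R) : 0 < k ->
  measurable (Y : set TR) -> measurable_fun (Y : set TR) h -> (mu Y < +oo)%E ->
  (forall x, Y x -> I01 (h x)) ->
  (forall x y, Y x -> Y y -> k * `|x - y| <= `|h x - h y|) ->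
  measurable_fun I01 W -> (forall x, I01 x -> 0 <= W x <= K) ->
  \int[mu]_(x in Y) W (h x) <= k^-1 * integral_I W.
Proof.
move=> k0 mY mh fY hI hk mW W01.
have mI : measurable (I01 : set TR) := @measurable_I01 R.
have ns (A : set TR) : measurable A -> (mu A = 0 -> mu (Y `&` h @^-1` A) = 0)%E.
  move=> mA A0; apply/eqP; rewrite eq_le measure_ge0 andbT.
  by apply: le_trans (lebesgue_preimage_expanding k0 mY mh hk mA) _; rewrite A0 mule0.
have i1 : mu.-integrable Y (EFin \o (fun=> 1 : R)).
  by apply: (@measurable_bounded_integrable _ TR R mu _ Y) => //; apply: (@bounded_in _ _ _ _ 1) => x _; rewrite normr1.
have [rho [irho hrho]] := @push_density _ TR R mu Y h (fun=> 1) mY mh hI ns i1.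
have Wb x : I01 x -> `|W x| <= K by move=> /W01 /andP[h1 h2]; rewrite ger0_norm.
have lW : LooI W by exact: LooI_bounded mW Wb.
have iW : L1I W by exact: L1I_bounded mW Wb.
have [_ e] := hrho W lW.
have -> : \int[mu]_(x in Y) W (h x) = integral_I (fun x => rho x * W x).
  by rewrite e; apply: eq_Rintegral => x _; rewrite mul1r.
have rho_le : \forall x \ae mu, I01 x -> rho x <= k^-1.
  (* Testing the density against the indicator of the set where it exceeds [k^-1] shows that this
     set is null. *)
  pose A := I01 `&` [set x | k^-1 < rho x].
  have mA : measurable (A : set TR).
    have := L1I_measurable irho; move=> /(_ mI `]k^-1, +oo[%classic) => h1.
    have -> : A = I01 `&` rho @^-1` `]k^-1, +oo[%classic.
      by apply/seteqP; split=> x [Ix] /=; rewrite in_itv /= andbT.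
    by apply: h1; exact: measurable_itv.
  pose psi (x : R) : R := \1_A x.
  have mpsi : measurable_fun (I01 : set TR) psi by apply: measurable_funTS; exact: measurable_indic.
  have bpsi x : I01 x -> `|psi x| <= 1 by move=> _; rewrite /psi indicE; case: (_ \in _); rewrite ?normr0 ?normr1.
  have [ip ep] := hrho psi (LooI_bounded mpsi bpsi).
  have i_rp : L1I (fun x => rho x * psi x) by exact: L1I_mulb irho mpsi bpsi.
  have ipsi : L1I psi by exact: L1I_bounded mpsi bpsi.
  have h1 : integral_I (fun x => rho x * psi x) <= k^-1 * integral_I psi.
    rewrite ep.
    have -> : \int[mu]_(x in Y) (1 * psi (h x)) = fine (mu (Y `&` h @^-1` A)).
      pose B := Y `&` h @^-1` A.
      have mB : measurable (B : set TR) by exact: mh.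
      rewrite (@eq_Rintegral _ TR R mu Y (\1_B : TR -> R)); last first.
        move=> x; rewrite inE => Yx; rewrite mul1r /psi !indicE; congr ((_ : bool)%:R).
        have [hx|hx] := pselect (A (h x)); first by rewrite !mem_set.
        by rewrite !memNset // => -[].
      rewrite /Rintegral (@integral_indic _ TR R mu Y mY B mB); congr (fine (mu _)).
      by apply/seteqP; split=> x; [case|move=> Bx; split=> //; case: Bx].
    have -> : integral_I psi = fine (mu A).
      rewrite /integral_I /Rintegral (@integral_indic _ TR R mu I01 mI A mA); congr (fine (mu _)).
      by apply/seteqP; split=> x; [case|move=> Ax; split=> //; case: Ax].
    have fA : mu A \is a fin_num.
      rewrite ge0_fin_numE ?measure_ge0 //; apply: (@le_lt_trans _ _ (mu I01)).
        by apply: le_measure; rewrite ?inE // => x [].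
      by have -> : mu I01 = 1%E := lebesgue_I01 R; rewrite ltry.
    have := lebesgue_preimage_expanding k0 mY mh hk mA.
    rewrite -[X in (_ <= _ * X)%E](fineK fA) -EFinM => le1.
    have f1 : mu (Y `&` h @^-1` A) \is a fin_num.
      by rewrite ge0_fin_numE ?measure_ge0 //; apply: le_lt_trans le1 _; rewrite ltry.
    by rewrite -lee_fin fineK.
  pose w x := (rho x - k^-1) * psi x.
  have wE x : w x = rho x * psi x - k^-1 * psi x by rewrite /w mulrBl.
  have iw : L1I w.
    have := L1I_sub i_rp (L1I_scale k^-1 ipsi); congr L1I.
    by apply/funext => x; rewrite wE.
  have w0 x : I01 x -> 0 <= w x.
    move=> Ix; rewrite /w /psi indicE; case: (boolP (x \in A)) => [|_]; last by rewrite mulr0.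
    by rewrite inE => -[_ /= lt]; rewrite mulr1 subr_ge0 ltW.
  have I0 : integral_I w = 0.
    apply/eqP; rewrite eq_le integral_I_ge0 // andbT.
    rewrite (integral_I_eq (fun x _ => wE x)) integral_I_sub ?integral_I_scale //; last exact: L1I_scale.
    by rewrite subr_le0.
  have := @Rintegral_eq0_ae _ TR R mu I01 _ mI iw (aeT w0) I0.
  apply: aeS => x h2 Ix; rewrite leNgt; apply/negP => lt.
  have := h2 Ix; rewrite /w /psi indicE mem_set //= mulr1 => /eqP.
  by rewrite subr_eq0 => /eqP e'; rewrite e' ltxx in lt.
rewrite -integral_I_scale //; apply: integral_I_ae_le.
- exact: L1I_mulb irho mW Wb.
- exact: L1I_scale.
- apply: aeS rho_le => x h1 Ix; apply: ler_wpM2r (h1 Ix).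
  by have /andP[] := W01 x Ix.
Qed.

End Measurability.

(** The points 0 and 1 are removed along with the cusp, so that one-sided derivatives become
    ordinary ones on an open set. *)
Definition branches (R : realType) (c : R) : set R := `]0, c[ `|` `]c, 1[.

(* [F k t] is the k-th derivative of the map [F 0 t], set to zero off the
   open branches when [k > 0]. *)
Record cusp_family (R : realType) (c a beta theta m1 M1 M2 M3 : R) (Omega : set R)
    (F : nat -> R -> R -> R) : Prop := CuspFamily {
  cf_c : 0 < c < 1;
  cf_beta : -1 < beta < - (1 / 2);
  cf_theta : 1 < theta;
  cf_pos : [/\ 0 < m1, 0 < M1, 0 < M2 & 0 < M3];
  cf_I : forall t x, Omega t -> I01 x -> I01 (F 0%N t x);
  cf_ends : forall t, Omega t -> [/\ F 0%N t 0 = 0, F 0%N t 1 = 0 & F 0%N t c = a];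
  cf_cont : forall t, Omega t -> {within `[0, 1], continuous (F 0%N t)};
  cf_derive : forall k t x, (k < 3)%N -> Omega t -> branches c x ->
    is_derive (x : R) (1 : R) (F k t) (F k.+1 t x);
  cf_cont3 : forall t x, Omega t -> branches c x -> {for x, continuous (F 3%N t)};
  cf_off : forall k t x, ~ branches c x -> F k.+1 t x = 0;
  cf_expand : forall t x, Omega t -> branches c x -> theta <= `|F 1%N t x|;
  cf_bounds : forall t x, Omega t -> branches c x ->
    [/\ m1 * `|x - c| `^ beta <= `|F 1%N t x|, `|F 1%N t x| <= M1 * `|x - c| `^ beta,
        `|F 2%N t x| <= M2 * `|x - c| `^ (beta - 1) &
        `|F 3%N t x| <= M3 * `|x - c| `^ (beta - 2)];
  cf_meas : forall k, (k <= 3)%N ->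
    measurable_fun (Omega `*` branches c : set (measurableTypeR R * measurableTypeR R))
      (fun p : R * R => F k p.1 p.2) }.

Section Branches.
Variable R : realType.
Notation mu := (@lebesgue_measure R).
Notation TR := (measurableTypeR R).

Lemma branchesP (c x : R) : 0 < c < 1 -> branches c x <-> 0 < x < 1 /\ x <> c.
Proof.
move=> /andP[c0 c1]; rewrite /branches /=; split.
  by case; rewrite in_itv /= => /andP[h1 h2]; split; [lra|move=> e; lra|lra|move=> e; lra].
move=> [/andP[h1 h2] /eqP xc]; rewrite !in_itv /=.
by have [h|h|h] := ltgtP x c; [left; lra|right; lra|rewrite h eqxx in xc].
Qed.

Lemma open_branches (c : R) : open (branches c).
Proof. by apply: openU; exact: interval_open. Qed.

Lemma measurable_branches (c : R) : measurable (branches c : set TR).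
Proof. by apply: measurableU; exact: measurable_itv. Qed.

Lemma branches_I (c x : R) : 0 < c < 1 -> branches c x -> I01 x.
Proof. by move=> hc /(branchesP _ hc) [/andP[h1 h2] _]; apply/I01P; rewrite !ltW. Qed.

Lemma branches_I_minus (c x : R) : 0 < c < 1 -> branches c x -> I_minus c x.
Proof. by move=> hc Bx; split; [exact: (branches_I hc)|move/branchesP: Bx => /(_ hc) []]. Qed.

Lemma nbhs_branches (c x : R) : branches c x -> nbhs x (branches c).
Proof. by move=> Bx; apply: open_nbhs_nbhs; split=> //; exact: open_branches. Qed.

Lemma has_deriv_in_cvg (D : set R) (u : R -> R) (x l : R) (G : set_system R) :
  Filter G -> G `=>` within D x^' -> (y @[y --> G] --> x) -> (\forall y \near G, y != x) ->
  has_deriv_in D u x l -> u y @[y --> G] --> u x.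
Proof.
move=> FG GD idG neG h.
have {}h : (u y - u x) / (y - x) @[y --> G] --> l by apply: cvg_trans h; exact: cvg_app.
have lim : (u y - u x) / (y - x) * (y - x) + u x @[y --> G] --> l * (x - x) + u x.
  by apply: cvgD; [apply: cvgM => //; apply: cvgB => //; exact: cvg_cst|exact: cvg_cst].
rewrite subrr mulr0 add0r in lim; apply: cvg_trans lim; apply: near_eq_cvg.
by apply: filterS neG => y yx; rewrite divfK ?subrK // subr_eq0.
Qed.

Lemma derive_continuous (u : R -> R) (x l : R) : is_derive x (1 : R) u l -> {for x, continuous u}.
Proof. by move=> [d _]; apply: differentiable_continuous; exact/derivable1_diffP. Qed.

Section FromAdmissible.
Variables (c a beta w0 w1 : R) (P : probability (measurableTypeR R) R) (f : R -> R -> R).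
Hypotheses (hc : 0 < c < 1) (hbeta : -1 < beta < - (1 / 2)).
Notation Omega := (`[w0, w1]%classic : set R).
Hypothesis hf : admissible c a beta Omega P f.

(** Order 0 is left untouched because the values at 0, [c] and 1 and continuity on all of [[0, 1]]
    are used. *)
Definition patched (k : nat) (t : R) : R -> R :=
  if k is k'.+1 then (derivn_in (I_minus c) k (f t)) \_ (branches c) else f t.

Lemma patchedE k t x : branches c x -> patched k t x = derivn_in (I_minus c) k (f t) x.
Proof. by case: k => // k Bx; rewrite /patched patchE mem_set. Qed.

Lemma admissible_cusp_family : exists theta m1 M1 M2 M3 : R,
  cusp_family c a beta theta m1 M1 M2 M3 Omega patched.
Proof.
have [hI _ h2 h3 [theta th1 h4] [m1 [M1 [M2 [M3 [pos h5]]]]] [h6 _] _] := hf.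
have /andP[c0 c1] := hc.
have der k t x : (k < 3)%N -> Omega t -> branches c x ->
    is_derive (x : R) (1 : R) (patched k t) (patched k.+1 t x).
  move=> k3 Ot Bx; rewrite patchedE //.
  have [h3' _] := h3 t Ot; have := h3' k x k3 (branches_I_minus hc Bx) => hd.
  have nI : nbhs x (I_minus c) by apply: filterS (nbhs_branches Bx) => y; exact: branches_I_minus.
  apply: is_derive_near (has_deriv_in_is_derive nI hd).
  by apply: filterS (nbhs_branches Bx) => y By; rewrite patchedE.
exists theta, m1, M1, M2, M3; split=> //.
- by move=> t x Ot; exact: hI.
- by move=> t Ot; have [? ? ? _ _] := h2 t Ot.
(* Continuity comes from the one-sided limits at the cusp, from ordinary derivatives inside the
   branches, and from one-sided derivatives at 0 and 1. *)
- move=> t Ot; apply/(continuous_within_itvP _ ltr01); have [_ _ fc cl cr] := h2 t Ot.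
  have [h3' _] := h3 t Ot.
  have hin x : I_minus c x -> has_deriv_in (I_minus c) (f t) x (derivn_in (I_minus c) 1 (f t) x).
    by move=> Ix; exact: (h3' 0%N x isT Ix).
  split.
  + move=> x; rewrite in_itv /= => x01; have [xc|/eqP xc] := eqVneq x c.
      by rewrite xc; apply/left_right_continuousP; rewrite fc.
    have Bx : branches c x by apply/branchesP.
    exact: derive_continuous (der 0%N t x isT Ot Bx).
  + apply: (has_deriv_in_cvg _ _ _ _ (hin 0 _)).
    * move=> A; rewrite /within /= => -[e /= e0 hA]; near=> y.
      have y0 : 0 < y by near: y; exact: nbhs_right_gt.
      apply: hA; rewrite ?gt_eqF //=.
        by rewrite sub0r normrN gtr0_norm //; near: y; exact: nbhs_right_lt.
      have yc : y < c by near: y; exact: nbhs_right_lt.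
      by split; [apply/I01P; lra|move=> /= ye; lra].
    * exact: cvg_at_right_filter.
    * by near=> y; rewrite gt_eqF //; near: y; exact: nbhs_right_gt.
    * by split; [apply/I01P; lra|move=> /= ye; lra].
  + apply: (has_deriv_in_cvg _ _ _ _ (hin 1 _)).
    * move=> A; rewrite /within /= => -[e /= e0 hA]; near=> y.
      have y1 : y < 1 by near: y; exact: nbhs_left_lt.
      apply: hA; rewrite ?lt_eqF //=.
        rewrite gtr0_norm ?subr_gt0 // ltrBlDr -ltrBlDl; near: y.
        by apply: nbhs_left_gt; rewrite ltrBlDr ltrDl.
      have yc : c < y by near: y; exact: nbhs_left_gt.
      by split; [apply/I01P; lra|move=> /= ye; lra].
    * exact: cvg_at_left_filter.
    * by near=> y; rewrite lt_eqF //; near: y; exact: nbhs_left_lt.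
    * by split; [apply/I01P; lra|move=> /= ye; lra].
- move=> t x Ot Bx; have [_ h3'] := h3 t Ot.
  have oB := @open_branches c.
  have h3B : {within branches c, continuous (derivn_in (I_minus c) 3 (f t))}.
    by apply: continuous_subspaceW h3' => y; exact: branches_I_minus.
  rewrite continuous_open_subspace // in h3B.
  have hx : {for x, continuous (derivn_in (I_minus c) 3 (f t))} by apply: h3B; rewrite inE.
  rewrite /prop_for /continuous_at patchedE //; apply: cvg_trans hx; apply: near_eq_cvg.
  by apply: filterS (nbhs_branches Bx) => y By; rewrite patchedE.
- by move=> k t x nBx; rewrite /patched patchE memNset.
- by move=> t x Ot Bx; rewrite patchedE //; apply: h4 => //; exact: branches_I_minus.
- move=> t x Ot Bx; have [? ? ? ?] := h5 t x Ot (branches_I_minus hc Bx).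
  by split; rewrite patchedE.
- move=> k k3; have h := h6 k k3.
  have mI : measurable (I_minus c : set TR).
    by apply: measurableD; [exact: measurable_I01|exact: (@measurable_set1 R)].
  have mO : measurable (Omega : set TR) by exact: measurable_itv.
  have := within_continuous_measurable_prod (measurableX mO mI) h => m.
  have {}m : measurable_fun (Omega `*` branches c : set (TR * TR))
      (fun p : R * R => derivn_in (I_minus c) k (f p.1) p.2).
    apply: measurable_funS m; first exact: measurableX.
    by move=> p [? ?]; split=> //; exact: branches_I_minus.
  apply: eq_measurable_fun m => p; rewrite inE => -[_ Bp].
  by rewrite patchedE.
Unshelve. all: by end_near.
Qed.

End FromAdmissible.

Lemma I01_0 : I01 (0 : R). Proof. by apply/I01P; rewrite lexx ler01. Qed.
Lemma I01_1 : I01 (1 : R). Proof. by apply/I01P; rewrite lexx ler01. Qed.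

Lemma supp_sub (P : probability TR R) (w0 w1 : R) : P `[w0, w1]%classic = 1%E ->
  supp P `<=` `[w0, w1]%classic.
Proof.
move=> hP t st; apply: contrapT => nt.
have oC : open (~` (`[w0, w1]%classic : set R)).
  by apply: closed_openC; exact: itv_closed.
have := st _ oC nt; rewrite probability_setC ?hP ?subee ?ltxx //.
Qed.

(** Otherwise each point lies in a null interval with rational ends, and the line would be a
    countable union of null sets. *)
Lemma supp_nonempty (P : probability TR R) : exists t, supp P t.
Proof.
apply: contrapT => ns.
pose box (q : rat * rat) : set R := `]ratr q.1, ratr q.2[%classic.
pose N n : set R := if unpickle n is Some q then (if P (box q) == 0%E then box q else set0) else set0.
have negN : P.-negligible (\bigcup_n (N n : set TR)).
  apply: negligible_bigcup => n; rewrite /N; case: unpickle => [q|]; last exact: negligible_set0.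
  case: ifPn => [/eqP e|_]; last exact: negligible_set0.
  by exists (box q); split=> //; exact: measurable_itv.
have cov : [set: TR] `<=` \bigcup_n N n.
  move=> t _; have : ~ supp P t by move=> st; apply: ns; exists t.
  move=> /existsNP [U] /not_implyP [oU] /not_implyP [Ut] /negP; rewrite lt0e measure_ge0 andbT negbK => /eqP PU.
  have [e /= e0 hU] := oU t Ut.
  have [q1] := @rat_in_itvoo R (t - e) t ltac:(lra); rewrite in_itv /= => /andP[h1 h2].
  have [q2] := @rat_in_itvoo R t (t + e) ltac:(lra); rewrite in_itv /= => /andP[h3 h4].
  have [n nK] : exists n, unpickle n = Some (q1, q2) by exists (pickle (q1, q2)); rewrite pickleK.
  exists n; first exact: I.
  rewrite /N nK.
  have boxU : box (q1, q2) `<=` U.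
    move=> y; rewrite /box /= in_itv /= => /andP[h5 h6]; apply: hU => /=.
    by rewrite ltr_norml; lra.
  have -> : P (box (q1, q2)) = 0%E.
    have mb : measurable (box (q1, q2) : set TR) by exact: measurable_itv.
    have mU : measurable (U : set TR) by exact: open_measurable.
    apply/eqP; rewrite eq_le measure_ge0 andbT -PU.
    by apply: le_measure; rewrite ?inE.
  by rewrite eqxx /box /= in_itv /= h2 h3.
have [B [mB PB sub]] := negN.
have BT : B = setT by apply/seteqP; split=> // x _; apply: sub; exact: cov.
have PT : P setT = 1%E := probability_setT P.
by move: PT; rewrite -BT PB => -[] /eqP; rewrite eq_sym oner_eq0.
Qed.

Section SingleMap.
Variables (c a beta theta m1 M1 M2 M3 : R) (Omega : set R) (F : nat -> R -> R -> R).
Hypothesis cF : cusp_family c a beta theta m1 M1 M2 M3 Omega F.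
Let hc := cf_c cF.

(** Both closed branches are meant: the cusp belongs to either, so estimates up to [c] follow by
    continuity. *)
Definition same_side (x y : R) : bool := (x <= c) && (y <= c) || (c <= x) && (c <= y).

Lemma mean_value_branch t x y : Omega t -> I01 x -> I01 y -> same_side x y -> x < y ->
  exists z, [/\ x < z < y, branches c z & F 0%N t y - F 0%N t x = F 1%N t z * (y - x)].
Proof.
move=> Ot /I01P /andP[x0 x1] /I01P /andP[y0 y1] sxy xy.
have inB z : x < z < y -> branches c z.
  move=> /andP[xz zy]; apply/(branchesP _ hc); split; first by lra.
  by move=> zc; move/orP: sxy => [|] /andP[h1 h2]; lra.
have cxy : {within `[x, y], continuous (F 0%N t)}.
  apply: continuous_subspaceW (cf_cont cF Ot) => z /=; rewrite !in_itv /= => /andP[h1 h2].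
  by rewrite (le_trans x0 h1) (le_trans h2 y1).
have [z||z zxy e] := @MVT _ (F 0%N t) (F 1%N t) x y xy.
- rewrite in_itv /= => /inB Bz; exact: (cf_derive cF).
- exact: cxy.
- by rewrite in_itv /= in zxy; exists z; split=> //; exact: inB.
Qed.

Lemma expanding_branch t x y : Omega t -> I01 x -> I01 y -> same_side x y ->
  theta * `|x - y| <= `|F 0%N t x - F 0%N t y|.
Proof.
move=> Ot; wlog xy : x y / x < y => [hw Ix Iy sxy|Ix Iy sxy].
  have [h|h|->] := ltgtP x y; [exact: hw| |by rewrite !subrr !normr0 mulr0].
  by rewrite distrC [leRHS]distrC; apply: hw => //; rewrite /same_side andbC [(c <= y) && _]andbC.
have [z [zxy Bz e]] := mean_value_branch Ot Ix Iy sxy xy.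
by rewrite distrC [leRHS]distrC e normrM ler_wpM2r // (cf_expand cF).
Qed.

Lemma lipschitz_branch t x y (K : R) : Omega t -> I01 x -> I01 y -> same_side x y ->
  (forall z, branches c z -> Num.min x y <= z <= Num.max x y -> `|F 1%N t z| <= K) ->
  `|F 0%N t x - F 0%N t y| <= K * `|x - y|.
Proof.
move=> Ot; wlog xy : x y / x < y => [hw Ix Iy sxy hK|Ix Iy sxy hK].
  have [h|h|->] := ltgtP x y; [exact: hw| |by rewrite !subrr !normr0 mulr0].
  rewrite distrC [X in _ * X]distrC; apply: hw => //; first by rewrite /same_side andbC [(c <= y) && _]andbC.
  by rewrite minC maxC.
have [z [/andP[xz zy] Bz e]] := mean_value_branch Ot Ix Iy sxy xy.
rewrite distrC [X in _ * X]distrC e normrM ler_wpM2r // hK //.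
by rewrite ge_min le_max (ltW xz) (ltW zy) orbT.
Qed.

Lemma I01_c : I01 c. Proof. by move/andP: hc => [h1 h2]; apply/I01P; rewrite !ltW. Qed.

End SingleMap.

Lemma full_height (c a beta theta m1 M1 M2 M3 w0 w1 : R) (P : probability TR R)
    (F : nat -> R -> R -> R) : a <= 1 ->
  cusp_family c a beta theta m1 M1 M2 M3 `[w0, w1]%classic F ->
  P `[w0, w1]%classic = 1%E ->
  topologically_mixing_on (skew_space (supp P) a) (skew_product (F 0%N)) -> a = 1.
Proof.
move=> a1 cF hP [homT mix]; apply/eqP; rewrite eq_le a1 /= leNgt; apply/negP => lta.
have hc := cf_c cF; have /andP[c0 c1] := hc; have th1 := cf_theta cF.
have sub := supp_sub hP; have [t0 st0] := supp_nonempty P.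
have Ot0 := sub _ st0; have [T0 T1 Tc] := cf_ends cF Ot0.
have I0 := I01_0; have I1 := I01_1; have Ic := I01_c cF.
(* Expansion from 0 to [c] gives [a >= theta * c]. *)
have ca : c < a.
  have := expanding_branch cF Ot0 Ic I0; rewrite /same_side lexx ltW //= => /(_ isT).
  rewrite T0 Tc !subr0 (gtr0_norm c0); have IT := cf_I cF Ot0 Ic.
  rewrite Tc in IT; move/I01P: IT => /andP[a0 _]; rewrite ger0_norm //; nra.
have Ia : I01 a by apply/I01P; lra.
(* On the right branch expansion towards 1 gives [f x >= theta (1 - x) >= b] for [x <= a]; on the
   left branch [f x >= theta x >= x]. So [[b, a]] is invariant. *)
pose b := theta * (1 - a).
have b0 : 0 < b by rewrite mulr_gt0 ?subr_gt0 //; lra.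
have inv t x : supp P t -> I01 x -> x <= a -> b <= x -> b <= F 0%N t x.
  move=> /sub Ot Ix xa bx; have [e0 e1 ec] := cf_ends cF Ot.
  have /I01P /andP[Tx0 _] := cf_I cF Ot Ix; have /I01P /andP[x0 x1] := Ix.
  have [xc|cx] := leP x c.
    have := expanding_branch cF Ot Ix I0; rewrite /same_side xc (ltW c0) => /(_ isT).
    by rewrite e0 !subr0 !ger0_norm //; nra.
  have := expanding_branch cF Ot Ix I1; rewrite /same_side (ltW cx) (ltW c1) orbT => /(_ isT).
  rewrite e1 subr0 (ger0_norm Tx0) distrC ger0_norm ?subr_ge0 //.
  by apply: le_trans; rewrite /b ler_wpM2l //; lra.
pose X := (prod_topology (fun _ : nat => R) * R)%type.
have opn (A : set R) : open A -> open ([set p : X | A p.2]).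
  move=> oA; have := @open_comp X R snd A; apply=> // p _; exact: cvg_snd.
pose w : prod_topology (fun _ : nat => R) := fun=> t0.
have spY x : 0 <= x <= a -> skew_space (supp P) a (w, x).
  by move=> xa; split=> //=; rewrite in_itv.
(* The point [a] is on the right branch, so [b <= f a], while expansion from [c] to [a] forces
   [f a < a]. *)
have ba : b < a.
  have ba : b <= F 0%N t0 a.
    have := expanding_branch cF Ot0 Ia I1; rewrite /same_side (ltW ca) (ltW c1) orbT => /(_ isT).
    have /I01P /andP[Ta0 _] := cf_I cF Ot0 Ia.
    by rewrite T1 subr0 (ger0_norm Ta0) distrC gtr0_norm ?subr_gt0.
  have Ya : skew_space (supp P) a (w, a) by apply: spY; lra.
  have [_ /=] := homT _ Ya; rewrite in_itv /= => /andP[_ Ta].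
  have := expanding_branch cF Ot0 Ia Ic; rewrite /same_side (ltW ca) lexx orbT => /(_ isT).
  rewrite Tc (gtr0_norm (_ : 0 < a - c)) ?subr_gt0 // distrC ger0_norm ?subr_ge0 //.
  nra.
(* The open sets are the points above and below [b]; orbits starting in the first never reach the
   second. *)
have [||||n0 /(_ n0 (leqnn _))] := mix [set p : X | p.2 \in `]b, +oo[ ] [set p : X | p.2 \in `]-oo, b[ ].
- exact: (opn [set` `]b, +oo[]).
- exact: (opn [set` `]-oo, b[]).
- by exists (w, a); split; [apply: spY; lra|rewrite /= in_itv /= ba].
- by exists (w, 0); split; [apply: spY; lra|rewrite /= in_itv /= b0].
move=> [q [[p [Yp /= bp] <-] [_]]]; rewrite /= in_itv /=.
apply/negP; rewrite -leNgt; rewrite in_itv /= andbT in bp.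
have : skew_space (supp P) a (iter n0 (skew_product (F 0%N)) p) /\
    b <= (iter n0 (skew_product (F 0%N)) p).2; last by case.
elim: (n0) => [|n [IH1 IH2]] /=; first by split=> //; exact: ltW.
split; first exact: homT.
have [h1 h2] := IH1; rewrite in_itv /= in h2; move/andP: h2 => [h2 h3].
by apply: inv => //; apply/I01P; lra.
Qed.

End Branches.

(** * Transfer operators *)

Lemma integrable_fine d (T : measurableType d) (R : realType) (m : {measure set T -> \bar R})
    (A : set T) (G : T -> \bar R) (u : T -> R) : measurable A -> m.-integrable A G ->
  (forall x, A x -> u x = fine (G x)) ->
  m.-integrable A (EFin \o u) /\ \int[m]_(x in A) u x = fine (\int[m]_(x in A) G x)%E.
Proof.
move=> mA iG uG; have mG : measurable_fun A G := measurable_int m iG.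
have mE : measurable_fun A (EFin \o u).
  apply/measurable_EFinP; apply: (@eq_measurable_fun _ _ _ _ _ (fine \o G)).
    by move=> x; rewrite inE => Ax; rewrite uG.
  by apply: measurableT_comp => //; exact: measurable_fine.
have aeG : \forall x \ae m, A x -> G x = (EFin \o u) x.
  by apply: filterS (integrable_ae mA iG) => x h Ax; rewrite /= uG // fineK // h.
split; last by rewrite /Rintegral; congr fine; symmetry; exact: ae_eq_integral aeG.
apply/integrableP; split => //; move/integrableP: iG => [_]; apply: le_lt_trans.
rewrite le_eqVlt; apply/orP; left; apply/eqP; apply: ae_eq_integral => //.
- exact: measurableT_comp.
- exact: measurableT_comp.
- by apply: filterS aeG => x h Ax; rewrite h.
Qed.

(** * Fubini on a measurable rectangle *)

Section FubiniRectangle.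
Context d1 d2 (T1 : measurableType d1) (T2 : measurableType d2) (R : realType).
Variables (m1 : {sigma_finite_measure set T1 -> \bar R}) (m2 : {sigma_finite_measure set T2 -> \bar R}).
Variables (A : set T1) (B : set T2) (H : T1 * T2 -> R).
Hypotheses (mA : measurable A) (mB : measurable B).
Hypothesis iH : ((m1 \x m2)%E).-integrable (A `*` B) (EFin \o H).

Let f := (EFin \o H) \_ (A `*` B).
Let mAB : measurable (A `*` B). Proof. exact: measurableX. Qed.
Let imf : ((m1 \x m2)%E).-integrable setT f.
Proof. exact/(integrable_mkcond _ mAB). Qed.

Let fE1 x : A x -> fubini_F m2 f x = (\int[m2]_(y in B) (H (x, y))%:E)%E.
Proof.
move=> Ax; rewrite /fubini_F [RHS]integral_mkcond; apply: eq_integral => y _.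
rewrite /f !patchE; congr (if _ then _ else _).
by apply/idP/idP; rewrite !inE; [case|].
Qed.

Let fE2 y : B y -> fubini_G m1 f y = (\int[m1]_(x in A) (H (x, y))%:E)%E.
Proof.
move=> By; rewrite /fubini_G [RHS]integral_mkcond; apply: eq_integral => x _.
rewrite /f !patchE; congr (if _ then _ else _).
by apply/idP/idP; rewrite !inE; [case|].
Qed.

Lemma fubini_rect1 :
  m1.-integrable A (EFin \o (fun x => \int[m2]_(y in B) H (x, y))) /\
  \int[(m1 \x m2)%E]_(z in A `*` B) H z = \int[m1]_(x in A) \int[m2]_(y in B) H (x, y).
Proof.
have iF : m1.-integrable A (fubini_F m2 f).
  by apply: (integrableS measurableT mA) (integrable_fubini_F imf).
have [|i e] := @integrable_fine _ _ _ m1 A (fubini_F m2 f) (fun x => \int[m2]_(y in B) H (x, y)) mA iF.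
  by move=> x Ax; rewrite fE1.
split=> //; rewrite e; congr fine.
rewrite integral_mkcond -/f -integral12_prod_meas1 // [RHS]integral_mkcond.
apply: eq_integral => x _; rewrite patchE; case: ifPn => // xA.
rewrite /fubini_F; apply: integral0_eq => y _; rewrite /f patchE memNset // => -[/= Ax _].
by rewrite notin_setE in xA.
Qed.

Lemma fubini_rect2 :
  m2.-integrable B (EFin \o (fun y => \int[m1]_(x in A) H (x, y))) /\
  \int[(m1 \x m2)%E]_(z in A `*` B) H z = \int[m2]_(y in B) \int[m1]_(x in A) H (x, y).
Proof.
have mf : measurable_fun setT f := measurable_int _ imf.
have iF : m2.-integrable B (fubini_G m1 f).
  apply: (integrableS measurableT mB) => //; apply/integrableP; split.
    exact: measurable_fubini_G imf.
  have lt := (integrable21ltyP m1 m2 mf).1 imf; apply: le_lt_trans lt.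
  have mG := measurable_fubini_G imf.
  apply: ge0_le_integral => //.
  - exact: measurableT_comp.
  - by apply: (measurable_fun_fubini_tonelli_G (abse \o f)) => //=; exact: measurableT_comp.
  - move=> y _; apply: le_abse_integral => //.
    exact: measurableT_comp.
have [|i e] := @integrable_fine _ _ _ m2 B (fubini_G m1 f) (fun y => \int[m1]_(x in A) H (x, y)) mB iF.
  by move=> y By; rewrite fE2.
split=> //; rewrite e; congr fine.
rewrite integral_mkcond -/f -integral21_prod_meas1 // [RHS]integral_mkcond.
apply: eq_integral => y _; rewrite patchE; case: ifPn => // yB.
rewrite /fubini_G; apply: integral0_eq => x _; rewrite /f patchE memNset // => -[/= _ By].
by rewrite notin_setE in yB.
Qed.

End FubiniRectangle.

(** * Push-forwards of weighted densities *)

Section TransferOperators.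
Variable R : realType.
Notation mu := (@lebesgue_measure R).
Notation TR := (measurableTypeR R).
Variables (c beta theta m1 M1 M2 M3 w0 w1 : R) (P : probability TR R).
Variable F : nat -> R -> R -> R.
Notation Omega := (`[w0, w1]%classic : set TR).
Hypothesis cF : cusp_family c 1 beta theta m1 M1 M2 M3 Omega F.
Hypothesis hP : P Omega = 1%E.
Notation f := (F 0%N).
Notation B := (branches c).
Notation PM := ((P \x mu)%E : {measure set (TR * TR) -> \bar R}).
Notation OB := (Omega `*` B : set (TR * TR)).

Let hc := cf_c cF.
Let mB : measurable (B : set TR) := @measurable_branches R c.
Let mO : measurable (Omega : set TR). Proof. exact: measurable_itv. Qed.

Lemma measurable_OB : measurable OB. Proof. exact: measurableX. Qed.

Lemma ae_branches : \forall x \ae mu, I01 x -> B x.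
Proof.
have h : \forall x \ae mu, x <> 1 /\ x <> c by apply: aeS2 (ae_neq (1 : R)) (ae_neq c).
apply: aeS2 (ae_neq (0 : R)) h => x x0 [x1 xc] /I01P /andP[h0 h1]; apply/(branchesP _ hc).
by split=> //; rewrite !lt_neqAle h0 h1 !andbT eq_sym; apply/andP; split; exact/eqP.
Qed.

Lemma integrable_branches (u : R -> R) : L1I u -> mu.-integrable B (EFin \o u).
Proof.
apply: (@integrableS _ TR R mu I01 B) => //; first exact: measurable_I01.
by move=> x; exact: (branches_I hc).
Qed.

Lemma integral_branches (u : R -> R) : measurable_fun (I01 : set TR) u ->
  \int[mu]_(x in B) u x = integral_I u.
Proof.
move=> mu_; rewrite /integral_I /Rintegral; congr fine.
rewrite integral_mkcond [RHS]integral_mkcond.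
have mI : measurable (I01 : set TR) := @measurable_I01 R.
have mEu : measurable_fun (I01 : set TR) (EFin \o u) by exact: (@measurable_EFinP _ TR R I01 u).2.
apply: (@ae_eq_integral _ TR R mu setT) => //.
- apply/(measurable_restrictT _ mB); apply: measurable_funS mEu => // x; exact: (branches_I hc).
- exact/(measurable_restrictT _ mI).
- apply: aeS ae_branches => x h _; rewrite !patchE.
  have [Ix|nIx] := pselect (I01 x); first by rewrite !mem_set //; exact: h.
  by rewrite !memNset // => Bx; apply: nIx; exact: (branches_I hc).
Qed.

Lemma measurable_map t : Omega t -> measurable_fun (I01 : set TR) (f t).
Proof.
move=> Ot; apply: subspace_continuous_measurable_fun; first exact: measurable_I01.
exact: (cf_cont cF).
Qed.

Lemma map_I t x : Omega t -> B x -> I01 (f t x).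
Proof. by move=> Ot Bx; apply: (cf_I cF) => //; exact: (branches_I hc). Qed.

(** On each branch the map expands by [theta], so preimages of null sets are null by
    [lebesgue_preimage_expanding]. *)
Lemma map_nonsingular t (A : set TR) : Omega t -> measurable A -> mu A = 0%E ->
  mu (B `&` f t @^-1` A) = 0%E.
Proof.
move=> Ot mA A0; have /andP[c0 c1] := hc.
have th0 : 0 < theta by apply: lt_trans (cf_theta cF).
have half (J : set TR) : measurable J -> J `<=` I01 -> (forall x y, J x -> J y -> same_side c x y) ->
    mu (J `&` f t @^-1` A) = 0%E.
  move=> mJ JI side; apply/eqP; rewrite eq_le measure_ge0 andbT.
  have mf : measurable_fun J (f t) by apply: measurable_funS (measurable_map Ot) => //; exact: measurable_I01.
  have := lebesgue_preimage_expanding th0 mJ mf _ mA.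
  rewrite A0 mule0; apply=> x y Jx Jy; apply: (expanding_branch cF) => //; [exact: JI|exact: JI|exact: side].
rewrite /branches setIUl; apply/eqP; rewrite eq_le measure_ge0 andbT.
have m2 (J : set TR) : measurable J -> J `<=` I01 -> measurable (J `&` f t @^-1` A).
  move=> mJ JI; have mf : measurable_fun J (f t) by apply: measurable_funS (measurable_map Ot) => //; exact: measurable_I01.
  exact: mf.
have sL : `]0, c[%classic `<=` I01 by move=> x; rewrite /= in_itv /= => ?; apply/I01P; lra.
have sR : `]c, 1[%classic `<=` I01 by move=> x; rewrite /= in_itv /= => ?; apply/I01P; lra.
apply: le_trans (@measureU2 _ TR R mu _ _ _ _) _; [exact: m2|exact: m2|].
apply: (@le_trans _ _ (0 + 0)%E); last by rewrite adde0.
apply: leeD; rewrite le_eqVlt; apply/orP; left; apply/eqP; apply: half => //.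
- by move=> x y; rewrite /= !in_itv /same_side /= => /andP[_ h1] /andP[_ h2]; rewrite (ltW h1) (ltW h2).
- by move=> x y; rewrite /= !in_itv /same_side /= => /andP[h1 _] /andP[h2 _]; rewrite (ltW h1) (ltW h2) orbT.
Qed.

(** Every section at a fixed parameter is null, and the product measure integrates the measures of
    sections. *)
Lemma family_nonsingular (A : set TR) : measurable A -> mu A = 0%E ->
  PM (OB `&` (fun p => f p.1 p.2) @^-1` A) = 0%E.
Proof.
move=> mA A0; set Z := _ `&` _.
have mZ : measurable Z by exact: (cf_meas cF (isT : (0 <= 3)%N)) measurable_OB _ mA.
transitivity (\int[P]_t mu (xsection Z t))%E; first by [].
apply: integral0_eq => t _; have [Ot|nOt] := pselect (Omega t).
  rewrite -[RHS](map_nonsingular Ot mA A0); congr (mu _); apply/seteqP; split=> x.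
    by rewrite /xsection /= inE => -[[_ Bx] Ax].
  by move=> [Bx Ax]; rewrite /xsection /= inE; split.
have -> : xsection Z t = set0; last by rewrite measure0.
by apply/seteqP; split=> x //; rewrite /xsection /= inE => -[[/= Ot _] _].
Qed.

(** [g] is the density of the image of [H] times the product measure; formally, the average over [t]
    of the transfer operators applied to [H (t, _)]. The weight depends on the parameter because
    differentiating [L phi] produces quotients of derivatives of [f t]. *)
Definition is_push (H : R * R -> R) (g : R -> R) : Prop :=
  L1I g /\ forall psi, LooI psi ->
    PM.-integrable OB (EFin \o (fun p => H p * psi (f p.1 p.2))) /\
    integral_I (fun x => g x * psi x) = \int[PM]_(p in OB) (H p * psi (f p.1 p.2)).

Lemma push_exists (H : R * R -> R) : PM.-integrable OB (EFin \o H) -> exists g, is_push H g.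
Proof.
move=> iH; have mOB := measurable_OB.
apply: (@push_density _ _ R PM OB (fun p => f p.1 p.2) H mOB _ _ _ iH).
- exact: (cf_meas cF (isT : (0 <= 3)%N)).
- by move=> p [Ot Bx]; exact: map_I.
- exact: family_nonsingular.
Qed.

Lemma transfer_spec t phi : Omega t -> L1I phi -> L1I (transfer (f t) phi) /\
  forall psi, LooI psi ->
    integral_I (fun x => transfer (f t) phi x * psi x) = integral_I (fun x => phi x * psi (f t x)).
Proof.
move=> Ot ip; have iB := integrable_branches ip.
have mfB : measurable_fun B (f t).
  by apply: measurable_funS (measurable_map Ot); [exact: measurable_I01|move=> x; exact: (branches_I hc)].
have [g [ig hg]] := @push_density _ TR R mu B (f t) phi mB mfB (fun x => map_I Ot) (fun A => map_nonsingular Ot) iB.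
have ex : [set g : R -> R | L1I g /\ forall psi : R -> R, LooI psi ->
      integral_I (fun x => g x * psi x) = integral_I (fun x => phi x * psi (f t x))] g.
  split=> // psi lpsi; rewrite (hg psi lpsi).2; apply: integral_branches.
  apply: measurable_funM; first exact: L1I_measurable.
  apply: (measurable_comp (F := I01)) => //; [exact: measurable_I01| |exact: lpsi.1|exact: measurable_map].
  by move=> _ [x Ix <-]; exact: (cf_I cF).
exact: (@getPex _ _ (ex_intro _ g ex)).
Qed.

Lemma integral_Omega_cst (k : R) : \int[P]_(t in Omega) k = k.
Proof.
rewrite Rintegral_cst //; transitivity (k * 1); last by rewrite mulr1.
by congr (_ * _); exact: (congr1 fine hP).
Qed.

Lemma integrable_snd (G : R -> R) : L1I G ->
  PM.-integrable OB (EFin \o (fun p : TR * TR => G p.2)) /\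
  \int[PM]_(p in OB) G p.2 = integral_I G.
Proof.
move=> iG; have iB := integrable_branches iG.
have mGB : measurable_fun B G by exact: (@measurable_EFinP _ TR R B G).1 (measurable_int mu iB).
have mOB := measurable_OB.
have mG2 : measurable_fun OB (fun p : TR * TR => G p.2).
  apply: (measurable_comp (F := B)) => //; first by move=> _ [p [_ Bp] <-].
  by apply: measurable_funTS; exact: measurable_snd.
have i2 : PM.-integrable OB (EFin \o (fun p : TR * TR => G p.2)).
  apply/(integrable_mkcond _ mOB).
  set u := _ \_ _.
  have mu_ : measurable_fun [set: TR * TR] u.
    by apply/(measurable_restrictT _ mOB); apply/measurable_EFinP.
  apply/(@integrable12ltyP _ _ TR TR R P mu u mu_).
  apply: (@le_lt_trans _ _ (\int[P]_(t in [set: TR]) cst (\int[mu]_(x in B) `|(G x)%:E|)%E t)%E).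
    apply: ge0_le_integral => //.
    + by move=> t _; exact: integral_ge0.
    + by apply: (measurable_fun_fubini_tonelli_F (abse \o u)) => //=; exact: measurableT_comp.
    + move=> t _; rewrite /= [leRHS]integral_mkcond; apply: ge0_le_integral => //.
      * by apply: measurableT_comp => //; apply: measurableT_comp mu_ _; exact: measurable_pair1.
      * apply/(measurable_restrictT _ mB); apply: measurableT_comp => //.
        by apply: measurableT_comp.
      * move=> x _; rewrite /u !patchE; case: ifPn => [|_]; last by rewrite abse0; case: ifP.
        by rewrite inE => -[_ /= Bx]; rewrite mem_set.
  rewrite integral_cst //= probability_setT mule1.
  by move/integrableP: iB => [].
split=> //; have [_ ->] := @fubini_rect1 _ _ TR TR R P mu Omega B _ mO mB i2.
rewrite /= integral_Omega_cst; apply: integral_branches; exact: L1I_measurable.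
Qed.

Lemma integrable_OB (G : R -> R) (H : R * R -> R) : L1I G ->
  measurable_fun OB H -> (forall p, OB p -> `|H p| <= G p.2) -> PM.-integrable OB (EFin \o H).
Proof.
move=> iG mH HG; have [i2 _] := integrable_snd iG.
exact: (integrable_dominated measurable_OB mH HG i2).
Qed.

Lemma measurable_snd_OB (u : R -> R) : measurable_fun (I01 : set TR) u ->
  measurable_fun OB (fun p : TR * TR => u p.2).
Proof.
move=> mu_; apply: (measurable_comp (F := I01)) => //; first exact: measurable_I01.
- by move=> _ [p [_ Bp] <-]; exact: (branches_I hc).
- by apply: measurable_funTS; exact: measurable_snd.
Qed.

Lemma measurable_comp_OB (psi : R -> R) : measurable_fun (I01 : set TR) psi ->
  measurable_fun OB (fun p : TR * TR => psi (f p.1 p.2)).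
Proof.
move=> mpsi; apply: (measurable_comp (F := I01)) => //; first exact: measurable_I01.
- by move=> _ [p [Op Bp] <-]; exact: map_I.
- exact: (cf_meas cF (isT : (0 <= 3)%N)).
Qed.

(** Pairing [g] with its own sign gives its norm, and the sign composed with the maps is bounded by
    1. Both the [L^1] contraction and the Lasota-Yorke inequalities start from this bound. *)
Lemma push_norm_le (G : R -> R) (H : R * R -> R) g : is_push H g -> L1I G ->
  measurable_fun OB H -> (forall p, OB p -> `|H p| <= G p.2) ->
  integral_I (fun x => `|g x|) <= integral_I G.
Proof.
move=> [ig hg] iG mH HG.
have mpsi : measurable_fun I01 (fun x => Num.sg (g x)) by apply: measurable_sgr; exact: L1I_measurable.
have bpsi x : I01 x -> `|Num.sg (g x)| <= 1 by move=> _; exact: norm_sgr_le1.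
have [iH eH] := hg _ (LooI_bounded mpsi bpsi).
have -> : integral_I (fun x => `|g x|) = integral_I (fun x => g x * Num.sg (g x)).
  by apply: integral_I_eq => x _; rewrite mulr_sgr_norm.
have [iG2 <-] := integrable_snd iG; rewrite eH.
apply: le_Rintegral => //; first exact: measurable_OB.
move=> p Op; apply: le_trans (ler_norm _) _; rewrite normrM.
by apply: le_trans (HG p Op); rewrite ler_piMr // norm_sgr_le1.
Qed.

(** Pairing with the indicator of the set where [g] is negative yields a quantity of both signs,
    hence zero. *)
Lemma push_ge0 (H : R * R -> R) g : is_push H g -> (forall p, OB p -> 0 <= H p) ->
  \forall x \ae mu, I01 x -> 0 <= g x.
Proof.
move=> [ig hg] H0; pose psi (x : R) : R := if g x < 0 then 1 else 0.
have mg := L1I_measurable ig.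
have mpsi : measurable_fun I01 psi.
  pose s (y : R) : R := if y < 0 then 1 else 0.
  have -> : psi = s \o g by [].
  apply: measurableT_comp => //; rewrite /s.
  by apply: measurable_fun_ifT => //; exact: measurable_fun_ltr.
have bpsi x : I01 x -> `|psi x| <= 1 by move=> _; rewrite /psi; case: (_ < _); rewrite ?normr1 ?normr0.
have psi0 x : 0 <= psi x by rewrite /psi; case: ifP.
have [iH eH] := hg _ (LooI_bounded mpsi bpsi).
have igp : L1I (fun x => g x * psi x) by exact: L1I_mulb ig mpsi bpsi.
have np x : - (g x * psi x) = `|g x * psi x|.
  by rewrite /psi; case: ltP => h; rewrite ?mulr1 ?mulr0 ?normr0 ?oppr0 // ltr0_norm.
have e0 : integral_I (fun x => `|g x * psi x|) = 0.
  apply/eqP; rewrite eq_le integral_I_ge0 ?andbT; last by move=> x _.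
  have -> : integral_I (fun x => `|g x * psi x|) = -1 * integral_I (fun x => g x * psi x).
    by rewrite -integral_I_scale //; apply: integral_I_eq => x _; rewrite mulN1r np.
  rewrite mulN1r oppr_le0 eH; apply: Rintegral_ge0 => p Op; rewrite mulr_ge0 ?H0 //.
have := integral_I_abs_eq0 igp e0; apply: aeS => x h Ix; rewrite leNgt; apply/negP => gx.
by have := h Ix; rewrite /psi gx mulr1 => e; rewrite e ltxx in gx.
Qed.

Notation L := (annealed (`[w0, w1]%classic : set R) P f).

(** Both nested choices in the definition of the operator are discharged here: Fubini shows that the
    push-forward density on the product satisfies the weak integral relation, so the chosen
    representative does too. *)
Lemma annealed_push phi : L1I phi -> is_push (fun p => phi p.2) (L phi).
Proof.
move=> ip; have [i2 _] := integrable_snd ip.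
have [g pg] := push_exists i2.
have pairE psi t : LooI psi -> Omega t -> integral_I (fun x => transfer (f t) phi x * psi x) =
    \int[mu]_(x in B) (phi x * psi (f t x)).
  move=> lpsi Ot; rewrite (transfer_spec Ot ip).2 // integral_branches //.
  apply: measurable_funM; first exact: L1I_measurable.
  apply: (measurable_comp (F := I01)) => //; [exact: measurable_I01| |exact: lpsi.1|exact: measurable_map].
  by move=> _ [x Ix <-]; exact: (cf_I cF).
have pairI psi : LooI psi -> P.-integrable Omega (EFin \o (fun t => integral_I (fun x => transfer (f t) phi x * psi x))) /\
    \int[PM]_(p in OB) (phi p.2 * psi (f p.1 p.2)) =
    \int[P]_(t in Omega) integral_I (fun x => transfer (f t) phi x * psi x).
  move=> lpsi; have [iH _] := pg.2 psi lpsi.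
  have [i1 ->] := @fubini_rect1 _ _ TR TR R P mu Omega B _ mO mB iH.
  split; last by apply: eq_Rintegral => t; rewrite inE => Ot; rewrite pairE.
  by apply: eq_integrable i1 => // t; rewrite inE => Ot /=; rewrite pairE.
have ex : [set g : R -> R | L1I g /\ forall psi : R -> R, LooI psi ->
      let pairing t := integral_I (fun x => transfer (f t) phi x * psi x) in
      P.-integrable Omega (EFin \o pairing) /\
      integral_I (fun x => g x * psi x) = \int[P]_(t in Omega) pairing t] g.
  split; first exact: pg.1.
  move=> psi lpsi /=; have [i1 e1] := pairI psi lpsi; split=> //.
  by rewrite (pg.2 psi lpsi).2.
have [iL hL] := @getPex _ _ (ex_intro _ g ex); split=> // psi lpsi.
split; first by have [] := pg.2 psi lpsi.
by rewrite (hL psi lpsi).2 -(pairI psi lpsi).2.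
Qed.

End TransferOperators.

(** * Lasota-Yorke inequalities *)

Section LasotaYorke.
Variable R : realType.
Notation mu := (@lebesgue_measure R).
Notation TR := (measurableTypeR R).

Lemma measurable_fun_inv d (T : measurableType d) (D : set T) (u : T -> R) :
  measurable_fun D u -> measurable_fun D (fun x => (u x)^-1).
Proof.
move=> mu_; have minv : measurable_fun [set: R] (fun y : R => y^-1).
  (* Written as a sign times a real power, the inverse is measurable across 0 as well. *)
  have -> : (fun y : R => y^-1) = (fun y => Num.sg y * `|y| `^ (-1)).
    apply/funext => y; rewrite powR_inv1 //.
    have [->|y0] := eqVneq y 0; first by rewrite sgr0 mul0r invr0.
    by rewrite {1}[y]numEsg invfM; congr (_ * _); case: (sgrP y) y0 => // _ _; rewrite ?invr1 ?invrN1.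
  apply: measurable_funM; first exact: measurable_sgr.
  exact: (measurableT_comp (measurable_powR (-1)) (@normr_measurable R setT)).
exact: (measurableT_comp minv).
Qed.

Variables (c beta theta m1 M1 M2 M3 w0 w1 : R) (P : probability TR R).
Variable F : nat -> R -> R -> R.
Notation Omega := (`[w0, w1]%classic : set TR).
Hypothesis cF : cusp_family c 1 beta theta m1 M1 M2 M3 Omega F.
Hypothesis hP : P Omega = 1%E.
Notation f := (F 0%N).
Notation B := (branches c).
Notation PM := ((P \x mu)%E : {measure set (TR * TR) -> \bar R}).
Notation OB := (Omega `*` B : set (TR * TR)).
Notation push := (is_push c w0 w1 P F).

Let hc := cf_c cF.

(** Each map takes the values 0, 1, 0 at 0, [c], 1, outside [[p, q]], so preimages of [[p, q]] avoid
    these three points. Closedness on the line is what makes an extension by zero of class [C^1]. *)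
Lemma branches_preimage_closed t (p q : R) : Omega t -> 0 < p -> q < 1 ->
  exists2 Z : set R, closed Z & forall x, Z x <-> B x /\ p <= f t x <= q.
Proof.
move=> Ot p0 q1; have [T0 T1 Tc] := cf_ends cF Ot.
have /continuous_closedP cf := cf_cont cF Ot.
have cl : closed (`[p, q]%classic : set R) by exact: itv_closed.
have /closed_subspaceP [V cV VZ] := cf _ cl.
exists (V `&` `[0, 1]%classic); first by apply: closedI => //; exact: itv_closed.
move=> x; rewrite VZ /=; split=> [[/= pq Ix]|[Bx pq]]; last first.
  by split; [rewrite /= in_itv|exact: (branches_I hc)].
have {}pq : p <= f t x <= q by rewrite in_itv in pq.
split=> //; have Ix' : I01 x by [].
move/I01P: Ix' => /andP[x0 x1]; move/andP: pq => [h1 h2].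
apply/(branchesP _ hc); split; last by move=> xc; rewrite xc Tc in h2; lra.
rewrite !lt_neqAle x0 x1 !andbT; apply/andP; split; apply/eqP => e.
  by rewrite -e T0 in h1; lra.
by rewrite e T1 in h1; lra.
Qed.

(* The weak derivative of [phi] is tested against [eta (f t) * k], which is
   C^1 on the line: since both branches of [f t] are onto [0, 1], it vanishes
   near the end points of the branches. *)
Lemma cutoff_ibp t (phi g eta k k' : R -> R) : Omega t -> L1I phi -> is_weak_deriv 1 phi g ->
  test_function eta ->
  (forall x, B x -> is_derive (x : R) (1 : R) k (k' x)) ->
  (forall x, B x -> {for x, continuous k'}) ->
  let u x := phi x * (derive1 eta (f t x) * F 1%N t x * k x + eta (f t x) * k' x)
    + g x * (eta (f t x) * k x) in
  mu.-integrable B (EFin \o u) /\ \int[mu]_(x in B) u x = 0.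
Proof.
move=> Ot ip wd te dk ck.
have [p [q [p0 pq q1 sup]]] := test_supp te.
have sup1 := test_supp_derive1 sup.
have [Z cZ hZ] := branches_preimage_closed Ot p0 q1.
pose zeta0 x := eta (f t x) * k x.
pose zeta0' x := derive1 eta (f t x) * F 1%N t x * k x + eta (f t x) * k' x.
pose zeta := zeta0 \_ B; pose zeta' := zeta0' \_ B.
have zetaE x : B x -> zeta x = zeta0 x by move=> Bx; rewrite /zeta patchE mem_set.
have zetaE' x : B x -> zeta' x = zeta0' x by move=> Bx; rewrite /zeta' patchE mem_set.
have out x : ~ Z x -> zeta x = 0 /\ zeta' x = 0.
  move=> nZ; have [Bx|nB] := pselect (B x); last by rewrite /zeta /zeta' !patchE !memNset.
  rewrite zetaE // zetaE' // /zeta0 /zeta0'.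
  have o : f t x < p \/ q < f t x.
    by have [h|h] := ltP (f t x) p; [left|right; rewrite ltNge; apply/negP => h2; apply: nZ; apply/hZ; rewrite h].
  by rewrite sup // sup1 // !mul0r addr0.
have nbhs_out x : ~ Z x -> \forall y \near x, ~ Z y.
  move=> nZ; have oZ : open (~` Z) by exact: closed_openC.
  exact: (@open_nbhs_nbhs _ x (~` Z) (conj oZ nZ)).
have df x : B x -> is_derive (x : R) (1 : R) (f t) (F 1%N t x) by move=> Bx; exact: (cf_derive cF).
have cd1 : continuous (derive1 eta) := @test_continuous _ _ 1 te.
(* Either the point lies in a branch and [zeta] is given nearby by its formula, or it lies off the
   closed set [Z] and [zeta] vanishes nearby. *)
have dzeta x : is_derive (x : R) (1 : R) zeta (zeta' x).
  have [Bx|nB] := pselect (B x); last first.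
    have nZ : ~ Z x by move=> /hZ[].
    rewrite (out x nZ).2; apply: (@is_derive_near _ (fun=> 0)).
    by apply: filterS (nbhs_out x nZ) => y nZy; rewrite (out y nZy).1.
  rewrite zetaE' //; apply: (@is_derive_near _ zeta0).
    by apply: filterS (nbhs_branches Bx) => y By; rewrite zetaE.
  apply: is_derive_mul; last exact: dk.
  by apply: (is_derive_comp (f := eta)); [apply: smooth_is_derive; exact: te.1|exact: df].
have cf1 x : B x -> {for x, continuous (F 1%N t)}.
  by move=> Bx; exact: derive_continuous (cf_derive cF (isT : (1 < 3)%N) Ot Bx).
have czeta : continuous zeta'.
  move=> x; have [Bx|nB] := pselect (B x); last first.
    have nZ : ~ Z x by move=> /hZ[].
    have cv0 : (fun _ : R => 0 : R) y @[y --> x] --> (0 : R) by exact: cvg_cst.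
    rewrite /continuous_at (out x nZ).2; apply: cvg_trans cv0.
    by apply: near_eq_cvg; apply: filterS (nbhs_out x nZ) => y nZy; rewrite (out y nZy).2.
  rewrite /continuous_at zetaE' //; apply: (@cvg_trans _ (zeta0' @ x)).
    by apply: near_eq_cvg; apply: filterS (nbhs_branches Bx) => y By; rewrite zetaE'.
  have cf0 := derive_continuous (df x Bx).
  have ce : continuous eta := @test_continuous _ _ 0 te.
  have e1 : derive1 eta (f t y) @[y --> x] --> derive1 eta (f t x) := continuous_comp cf0 (cd1 _).
  have e2 : eta (f t y) @[y --> x] --> eta (f t x) := continuous_comp cf0 (ce _).
  have e3 : F 1%N t y @[y --> x] --> F 1%N t x := cf1 x Bx.
  have e4 : k y @[y --> x] --> k x := derive_continuous (dk x Bx).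
  have e5 : k' y @[y --> x] --> k' x := ck x Bx.
  exact: (cvgD (cvgM (cvgM e1 e3) e4) (cvgM e2 e5)).
have nB0 : ~ B 0 by move=> /(branchesP _ hc); rewrite ltxx => -[].
have nB1 : ~ B 1 by move=> /(branchesP _ hc); rewrite ltxx andbF => -[].
have z0 : zeta 0 = 0 by rewrite /zeta patchE memNset.
have z1 : zeta 1 = 0 by rewrite /zeta patchE memNset.
have ibp := weak_ibp ip wd dzeta czeta z0 z1.
have ig : L1I g := wd.1.
have cz : continuous zeta by move=> x; exact: derive_continuous (dzeta x).
have [K hK] := continuous_bounded_I01 czeta; have [K' hK'] := continuous_bounded_I01 cz.
have mz : measurable_fun I01 zeta by apply: measurable_funTS; exact: continuous_measurable.
have mz' : measurable_fun I01 zeta' by apply: measurable_funTS; exact: continuous_measurable.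
have i1 : L1I (fun x => phi x * zeta' x) := L1I_mulb ip mz' hK.
have i2 : L1I (fun x => g x * zeta x) := L1I_mulb ig mz hK'.
have i12 := L1I_add i1 i2; have mB : measurable (B : set TR) := @measurable_branches R c; split.
  apply: eq_integrable (integrable_branches cF i12) => // x; rewrite inE => Bx.
  by rewrite /= zetaE // zetaE'.
transitivity (integral_I (fun x => phi x * zeta' x + g x * zeta x)).
  rewrite -(integral_branches cF); last by apply: L1I_measurable; exact: L1I_add.
  by apply: eq_Rintegral => x; rewrite inE => Bx; rewrite zetaE // zetaE'.
by rewrite integral_I_add // ibp addNr.
Qed.

(** Each quotient is the upper bound of its numerator divided by a power of [m1 |x - c|^beta]. The
    exponents are [(beta - 1) - 2 beta], [(beta - 1) - 3 beta], [(beta - 2) - 3 beta] and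
    [2 (beta - 1) - 4 beta]; the first and the last two exceed -1, and the second is positive. *)
Lemma derivative_powers t x : Omega t -> B x ->
  [/\ F 1%N t x != 0 /\ `|(F 1%N t x)^-1| <= theta^-1,
      `|F 2%N t x / F 1%N t x ^+ 2| <= M2 / m1 ^+ 2 * `|x - c| `^ (- 1 - beta),
      `|F 2%N t x / F 1%N t x ^+ 3| <= M2 / m1 ^+ 3,
      `|F 3%N t x / F 1%N t x ^+ 3| <= M3 / m1 ^+ 3 * `|x - c| `^ (- 2 - 2 * beta) &
      `|F 2%N t x ^+ 2 / F 1%N t x ^+ 4| <= (M2 / m1 ^+ 2) ^+ 2 * `|x - c| `^ (- 2 - 2 * beta)].
Proof.
move=> Ot Bx; have [b1 b1' b2 b3] := cf_bounds cF Ot Bx; have be := cf_expand cF Ot Bx.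
have [m1p M1p M2p M3p] := cf_pos cF; have th1 := cf_theta cF.
have th0 : 0 < theta by apply: lt_trans th1.
have [/andP[x0 x1] xc] := (branchesP x hc).1 Bx.
have /andP[c0 c1] := hc; have /andP[bm1 bh] := cf_beta cF.
set d := `|x - c| in b1 b1' b2 b3 *; set A := `|F 1%N t x| in b1 b1' be.
have d0 : 0 < d by rewrite normr_gt0 subr_eq0; apply/eqP.
have d1 : d <= 1 by rewrite ler_norml; lra.
have A0 : 0 < A by apply: lt_le_trans be.
set e := d `^ beta in b1 b1'; have e0 : 0 < e by exact: powR_gt0.
have pw (r s : R) : d `^ (r + s) = d `^ r * d `^ s by rewrite powRD // (gt_eqF d0) implybT.
have en n : d `^ (n%:R * beta) = e ^+ n by rewrite mulrC powRrM powR_mulrn ?powR_ge0.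
have Ainv n : (A ^+ n)^-1 <= ((m1 * e) ^+ n)^-1.
  rewrite lef_pV2 ?posrE ?exprn_gt0 ?mulr_gt0 //.
  by apply: lerXn2r; rewrite ?nnegrE ?mulr_ge0 // ltW // mulr_gt0.
have E2 : d `^ (beta - 1) = d `^ (- 1 - beta) * e ^+ 2.
  by rewrite -en -pw; congr (_ `^ _); ring.
have E3 : d `^ (beta - 1) = d `^ (- 1 - 2 * beta) * e ^+ 3.
  by rewrite -en -pw; congr (_ `^ _); ring.
have E4 : d `^ (beta - 2) = d `^ (- 2 - 2 * beta) * e ^+ 3.
  by rewrite -en -pw; congr (_ `^ _); ring.
have E5 : (d `^ (beta - 1)) ^+ 2 = d `^ (- 2 - 2 * beta) * e ^+ 4.
  by rewrite -powR_mulrn ?powR_ge0 // -powRrM -en -pw; congr (_ `^ _); ring.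
(* The exponent is positive by [beta < -1/2], and [d <= 1]. *)
have le1 : d `^ (- 1 - 2 * beta) <= 1.
  rewrite -[leRHS](powRr0 d); apply: ger_powR; first by rewrite d0 d1.
  by lra.
have quot (N n : nat) (X Y : R) : `|X| <= Y -> `|X / F 1%N t x ^+ n| <= Y / ((m1 * e) ^+ n).
  move=> XY; rewrite normrM normfV normrX -/A.
  by apply: ler_pM => //; rewrite invr_ge0 exprn_ge0 // ltW.
have m0 : m1 != 0 by rewrite gt_eqF.
have e0' : e != 0 by rewrite gt_eqF.
split.
- split; first by rewrite -normr_gt0.
  by rewrite normfV lef_pV2 ?posrE.
- apply: le_trans (quot 0%N 2%N _ _ b2) _; rewrite E2 le_eqVlt; apply/orP; left; apply/eqP.
  by field; rewrite m0 e0'.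
- apply: le_trans (quot 0%N 3%N _ _ b2) _; rewrite E3.
  apply: (@le_trans _ _ (M2 / m1 ^+ 3 * d `^ (- 1 - 2 * beta))).
    by rewrite le_eqVlt; apply/orP; left; apply/eqP; field; rewrite m0 e0'.
  by rewrite ler_piMr // divr_ge0 ?exprn_ge0 // ltW.
- apply: le_trans (quot 0%N 3%N _ _ b3) _; rewrite E4 le_eqVlt; apply/orP; left; apply/eqP.
  by field; rewrite m0 e0'.
- have b2' : `|F 2%N t x ^+ 2| <= (M2 * d `^ (beta - 1)) ^+ 2.
    by rewrite normrX; apply: lerXn2r; rewrite ?nnegrE ?mulr_ge0 ?powR_ge0 // ltW.
  apply: le_trans (quot 0%N 4%N _ _ b2') _; rewrite exprMn E5 le_eqVlt; apply/orP; left; apply/eqP.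
  by field; rewrite m0 e0'.
Qed.

Definition pushD1 (phi g : R -> R) (p : R * R) : R :=
  g p.2 / F 1%N p.1 p.2 - phi p.2 * (F 2%N p.1 p.2 / F 1%N p.1 p.2 ^+ 2).

Definition pushD2 (phi g h : R -> R) (p : R * R) : R :=
  h p.2 / F 1%N p.1 p.2 ^+ 2 - 3 * g p.2 * (F 2%N p.1 p.2 / F 1%N p.1 p.2 ^+ 3)
  - phi p.2 * (F 3%N p.1 p.2 / F 1%N p.1 p.2 ^+ 3)
  + 3 * phi p.2 * (F 2%N p.1 p.2 ^+ 2 / F 1%N p.1 p.2 ^+ 4).

Lemma is_derive_inv_exp t x n : Omega t -> B x ->
  is_derive (x : R) (1 : R) (fun y => (F 1%N t y ^+ n)^-1) (- (n%:R * F 2%N t x / F 1%N t x ^+ n.+1)).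
Proof.
move=> Ot Bx; have [[F0 _] _ _ _ _] := derivative_powers Ot Bx.
have d1 := is_derive_exp n (cf_derive cF (isT : (1 < 3)%N) Ot Bx).
have Fn : F 1%N t x ^+ n != 0 by rewrite expf_neq0.
have d2 := @is_derive_inv _ (fun y => F 1%N t y ^+ n) x _ Fn d1.
apply: is_derive_val d2 _; case: n {d1 Fn} => [|n]; first by rewrite !mul0r oppr0 mul0r.
have Xn : F 1%N t x ^+ n != 0 by exact: expf_neq0.
by rewrite /= !exprS; field; rewrite ?F0 ?Xn.
Qed.

Lemma continuous_derivs t x : Omega t -> B x -> [/\ {for x, continuous (F 1%N t)},
  {for x, continuous (F 2%N t)} & {for x, continuous (F 3%N t)}].
Proof.
move=> Ot Bx; split; last exact: (cf_cont3 cF).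
- exact: derive_continuous (cf_derive cF (isT : (1 < 3)%N) Ot Bx).
- exact: derive_continuous (cf_derive cF (isT : (2 < 3)%N) Ot Bx).
Qed.

Lemma cvg_expn (u : R -> R) (x l : R) n : u y @[y --> x] --> l -> u y ^+ n @[y --> x] --> l ^+ n.
Proof.
move=> ul; elim: n => [|n IH]; first by under eq_fun do rewrite expr0; rewrite expr0; exact: cvg_cst.
by under eq_fun do rewrite exprS; rewrite exprS; exact: cvgM.
Qed.

(** The cutoff factor [1 / f'] cancels the inner derivative of [eta (f t x)]; its own derivative
    produces the term with [f'']. *)
Lemma pushD1_ibp t (phi g eta : R -> R) : Omega t -> L1I phi -> is_weak_deriv 1 phi g ->
  test_function eta ->
  \int[mu]_(x in B) (phi x * derive1 eta (f t x) + pushD1 phi g (t, x) * eta (f t x)) = 0.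
Proof.
move=> Ot ip wd te.
pose k y := (F 1%N t y ^+ 1)^-1; pose k' y := - (1%:R * F 2%N t y / F 1%N t y ^+ 2).
have dk x : B x -> is_derive (x : R) (1 : R) k (k' x) by move=> Bx; exact: is_derive_inv_exp.
have ck x : B x -> {for x, continuous k'}.
  move=> Bx; have [c1 c2 _] := continuous_derivs Ot Bx; have [[F0 _] _ _ _ _] := derivative_powers Ot Bx.
  apply: cvgN; apply: cvgM; first by apply: cvgM => //; exact: cvg_cst.
  by apply: cvgV; [exact: expf_neq0|exact: cvg_expn].
have [_ <-] := cutoff_ibp Ot ip wd te dk ck.
apply: eq_Rintegral => x; rewrite inE => Bx; have [[F0 _] _ _ _ _] := derivative_powers Ot Bx.
by rewrite /pushD1 /k /k' /=; field.
Qed.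

(** The two terms of [pushD1] are integrated by parts separately: [g] with the factor [1 / f'^2],
    and [phi] with the factor [f'' / f'^3]. *)
Lemma pushD2_ibp t (phi g h eta : R -> R) : Omega t -> L1I phi -> is_weak_deriv 1 phi g ->
  is_weak_deriv 1 g h -> test_function eta ->
  \int[mu]_(x in B) (pushD1 phi g (t, x) * derive1 eta (f t x) + pushD2 phi g h (t, x) * eta (f t x)) = 0.
Proof.
move=> Ot ip wg wh te; have ig := wg.1.
pose k y := (F 1%N t y ^+ 2)^-1; pose k' y := - (2%:R * F 2%N t y / F 1%N t y ^+ 3).
have dk x : B x -> is_derive (x : R) (1 : R) k (k' x) by move=> Bx; exact: is_derive_inv_exp.
have ck x : B x -> {for x, continuous k'}.
  move=> Bx; have [c1 c2 _] := continuous_derivs Ot Bx; have [[F0 _] _ _ _ _] := derivative_powers Ot Bx.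
  apply: cvgN; apply: cvgM; first by apply: cvgM => //; exact: cvg_cst.
  by apply: cvgV; [exact: expf_neq0|exact: cvg_expn].
pose l y := F 2%N t y * (F 1%N t y ^+ 3)^-1.
pose l' y := F 3%N t y * (F 1%N t y ^+ 3)^-1 + F 2%N t y * - (3%:R * F 2%N t y / F 1%N t y ^+ 4).
have dl x : B x -> is_derive (x : R) (1 : R) l (l' x).
  move=> Bx; apply: is_derive_mul; last exact: is_derive_inv_exp.
  exact: (cf_derive cF).
have cl x : B x -> {for x, continuous l'}.
  move=> Bx; have [c1 c2 c3] := continuous_derivs Ot Bx; have [[F0 _] _ _ _ _] := derivative_powers Ot Bx.
  apply: cvgD; first by apply: cvgM => //; apply: cvgV; [exact: expf_neq0|exact: cvg_expn].
  apply: cvgM => //; apply: cvgN; apply: cvgM; first by apply: cvgM => //; exact: cvg_cst.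
  by apply: cvgV; [exact: expf_neq0|exact: cvg_expn].
have [i1 e1] := cutoff_ibp Ot ig wh te dk ck.
have [i2 e2] := cutoff_ibp Ot ip wg te dl cl.
have mB : measurable (B : set TR) := @measurable_branches R c.
have e := RintegralB mB i1 i2; rewrite e1 e2 subrr in e; rewrite -[RHS]e.
apply: eq_Rintegral => x; rewrite inE => Bx; have [[F0 _] _ _ _ _] := derivative_powers Ot Bx.
by rewrite /pushD1 /pushD2 /k /k' /l /l' /=; field.
Qed.

Lemma L1I_mul_sobolev (phi g w : R -> R) : L1I phi -> is_weak_deriv 1 phi g -> L1I w ->
  L1I (fun x => w x * phi x).
Proof.
move=> ip wd iw; have lp : LooI phi.
  by split; [exact: L1I_measurable|eexists; exact: (sobolev_bound ip wd)].
have [phi' [K [mphi' K0 bphi' e]]] := LooI_repr lp.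
have i' : L1I (fun x => w x * phi' x).
  by apply: (L1I_mulb iw (K := K)) => //; exact: measurable_funTS.
apply: (L1I_eqI i'); first by apply: measurable_funM; exact: L1I_measurable.
by apply: aeS e => x h /h ->.
Qed.

(** A majorant of the first order integrand that no longer depends on the parameter, so that its
    integral over the product is an integral over [I01]. *)
Let G1 (phi g : R -> R) (x : R) : R :=
  theta^-1 * `|g x| + M2 / m1 ^+ 2 * (`|x - c| `^ (- 1 - beta) * `|phi x|).

Let L1I_G1 phi g : L1I phi -> is_weak_deriv 1 phi g -> L1I (G1 phi g).
Proof.
move=> ip wd; have /andP[bm1 bh] := cf_beta cF.
have iw : L1I (fun x => `|x - c| `^ (- 1 - beta)) by apply: (L1I_dist_pow hc); lra.
apply: L1I_add; apply: L1I_scale; first by apply: L1I_norm; exact: wd.1.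
have := L1I_norm (L1I_mul_sobolev ip wd iw); congr L1I; apply/funext => x.
by rewrite normrM [X in X * _]ger0_norm ?powR_ge0.
Qed.

Let pushD1_le phi g p : OB p -> `|pushD1 phi g p| <= G1 phi g p.2.
Proof.
case: p => t x [/= Ot Bx]; have [[_ b1] b2 _ _ _] := derivative_powers Ot Bx.
apply: le_trans (ler_normB _ _) _; rewrite !normrM /G1.
apply: lerD; first by rewrite mulrC ler_wpM2r.
rewrite -normrM mulrA [X in _ <= X]mulrC; apply: ler_wpM2l => //.
Qed.

Let measurable_F k : (k <= 3)%N -> measurable_fun OB (fun p : TR * TR => F k p.1 p.2).
Proof. exact: (cf_meas cF). Qed.

Let measurable_pushD1 phi g : L1I phi -> L1I g -> measurable_fun OB (pushD1 phi g).
Proof.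
move=> /L1I_measurable/(measurable_snd_OB (w0 := w0) (w1 := w1) cF) mp /L1I_measurable/(measurable_snd_OB (w0 := w0) (w1 := w1) cF) mg.
apply: measurable_funB; apply: measurable_funM => //.
- by apply: measurable_fun_inv; exact: measurable_F.
- apply: measurable_funM; first exact: measurable_F.
  by apply: measurable_fun_inv; apply: measurable_funX; exact: measurable_F.
Qed.

Let measurable_pushD2 phi g h : L1I phi -> L1I g -> L1I h -> measurable_fun OB (pushD2 phi g h).
Proof.
move=> /L1I_measurable/(measurable_snd_OB (w0 := w0) (w1 := w1) cF) mp /L1I_measurable/(measurable_snd_OB (w0 := w0) (w1 := w1) cF) mg /L1I_measurable/(measurable_snd_OB (w0 := w0) (w1 := w1) cF) mh.
have mFX k n : (k <= 3)%N -> measurable_fun OB (fun p : TR * TR => (F k p.1 p.2 ^+ n)).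
  by move=> k3; apply: measurable_funX; exact: measurable_F.
have mVX n : measurable_fun OB (fun p : TR * TR => (F 1%N p.1 p.2 ^+ n)^-1).
  by apply: measurable_fun_inv; exact: mFX.
apply: measurable_funD; last first.
  apply: measurable_funM; first exact: measurable_funM.
  by apply: measurable_funM => //; exact: mFX.
apply: measurable_funB; last first.
  by apply: measurable_funM => //; apply: measurable_funM => //; exact: measurable_F.
apply: measurable_funB; first exact: measurable_funM.
apply: measurable_funM; first exact: measurable_funM.
by apply: measurable_funM => //; exact: measurable_F.
Qed.

Let G2 (phi g h : R -> R) (x : R) : R :=
  (theta^-1) ^+ 2 * `|h x| + 3 * (M2 / m1 ^+ 3) * `|g x| +
  (M3 / m1 ^+ 3 + 3 * (M2 / m1 ^+ 2) ^+ 2) * (`|x - c| `^ (- 2 - 2 * beta) * `|phi x|).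

Let L1I_G2 phi g h : L1I phi -> is_weak_deriv 1 phi g -> L1I h -> L1I (G2 phi g h).
Proof.
move=> ip wd ih; have /andP[bm1 bh] := cf_beta cF.
have iw : L1I (fun x => `|x - c| `^ (- 2 - 2 * beta)) by apply: (L1I_dist_pow hc); lra.
apply: L1I_add; first apply: L1I_add.
- by apply: L1I_scale; exact: L1I_norm.
- by apply: L1I_scale; apply: L1I_norm; exact: wd.1.
- apply: L1I_scale; have := L1I_norm (L1I_mul_sobolev ip wd iw); congr L1I; apply/funext => x.
  by rewrite normrM [X in X * _]ger0_norm ?powR_ge0.
Qed.

Let pushD2_le phi g h p : OB p -> `|pushD2 phi g h p| <= G2 phi g h p.2.
Proof.
case: p => t x [/= Ot Bx]; have [[_ b1] _ b3 b4 b5] := derivative_powers Ot Bx.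
have nM (A X Y : R) : `|X| <= Y -> `|A * X| <= Y * `|A|.
  by move=> XY; rewrite normrM mulrC ler_wpM2r.
have h1 : `|h x / F 1%N t x ^+ 2| <= (theta^-1) ^+ 2 * `|h x|.
  apply: nM; rewrite -exprVn normrX; apply: lerXn2r => //; rewrite nnegrE //.
  by rewrite invr_ge0; apply: ltW; apply: lt_trans (cf_theta cF).
have h2 : `|3 * g x * (F 2%N t x / F 1%N t x ^+ 3)| <= 3 * (M2 / m1 ^+ 3) * `|g x|.
  apply: le_trans (nM _ _ _ b3) _; rewrite normrM (ger0_norm (ler0n _ 3)) le_eqVlt.
  by apply/orP; left; apply/eqP; ring.
have h3 := nM (phi x) _ _ b4.
have h4 := nM (3 * phi x) _ _ b5; rewrite [X in _ <= _ * X]normrM (ger0_norm (ler0n _ 3)) in h4.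
rewrite /pushD2 /G2 /=.
apply: le_trans (ler_normD _ _) _; apply: le_trans (lerD (ler_normB _ _) h4) _.
apply: le_trans (lerD (lerD (ler_normB _ _) h3) (lexx _)) _.
apply: le_trans (lerD (lerD (lerD h1 h2) (lexx _)) (lexx _)) _.
by rewrite le_eqVlt; apply/orP; left; apply/eqP; ring.
Qed.

Notation L := (annealed (`[w0, w1]%classic : set R) P f).

Let integrable_pair (H : R * R -> R) (G eta : R -> R) (K : R) : L1I G -> measurable_fun OB H ->
  (forall p, OB p -> `|H p| <= G p.2) -> measurable_fun I01 eta ->
  (forall x, I01 x -> `|eta x| <= K) ->
  PM.-integrable OB (EFin \o (fun p => H p * eta (f p.1 p.2))).
Proof.
move=> iG mH HG me be; have mOB := @measurable_OB R c w0 w1.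
have iH := integrable_OB cF hP iG mH HG.
apply: (integrable_bounded_mul mOB iH (measurable_comp_OB (w0 := w0) (w1 := w1) cF me)) => p [Op Bp].
by apply: be; exact: (map_I cF).
Qed.

Let integral_OB_sections (H H' : R * R -> R) :
  PM.-integrable OB (EFin \o H) -> PM.-integrable OB (EFin \o H') ->
  (forall t, Omega t -> \int[mu]_(x in B) (H (t, x) + H' (t, x)) = 0) ->
  \int[PM]_(p in OB) H p = - \int[PM]_(p in OB) H' p.
Proof.
move=> iH iH' h; have mOB := @measurable_OB R c w0 w1.
have mO : measurable (Omega : set TR) by exact: measurable_itv.
have mB : measurable (B : set TR) := @measurable_branches R c.
apply/eqP; rewrite -subr_eq0 opprK -RintegralD //; apply/eqP.
have iHH := integrable_add mOB iH iH'.
have [_ ->] := @fubini_rect1 _ _ TR TR R P mu Omega B _ mO mB iHH.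
rewrite (@eq_Rintegral _ _ _ P _ (fun=> 0)) ?(integral_Omega_cst hP) //.
by move=> t; rewrite inE => Ot; exact: h.
Qed.

Lemma annealed_weak_deriv1 phi g : L1I phi -> is_weak_deriv 1 phi g ->
  exists2 g1, is_weak_deriv 1 (L phi) g1 & push (pushD1 phi g) g1.
Proof.
move=> ip wd; have mD := measurable_pushD1 ip wd.1.
have iG := L1I_G1 ip wd; have iD := integrable_OB cF hP iG mD (pushD1_le phi g).
have [g1 pg1] := push_exists cF iD; exists g1 => //; split; first exact: pg1.1.
have [iL hL] := annealed_push cF hP ip.
move=> eta te; have [K hK] := test_bounded 0 te; have [K' hK'] := test_bounded 1 te.
have me : measurable_fun I01 eta := @test_measurable _ _ 0 I01 te.
have me' : measurable_fun I01 (derive1 eta) := @test_measurable _ _ 1 I01 te.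
rewrite (hL _ (LooI_bounded me' hK')).2 (pg1.2 _ (LooI_bounded me hK)).2 expr1 mulN1r.
apply: integral_OB_sections.
- by have [] := hL _ (LooI_bounded me' hK').
- exact: integrable_pair iG mD (pushD1_le phi g) me hK.
- by move=> t Ot; exact: pushD1_ibp.
Qed.

Lemma annealed_weak_deriv2 phi g h : L1I phi -> is_weak_deriv 1 phi g -> is_weak_deriv 1 g h ->
  exists2 g2, is_weak_deriv 2 (L phi) g2 & push (pushD2 phi g h) g2.
Proof.
move=> ip wd wh; have [g1 wg1 pg1] := annealed_weak_deriv1 ip wd.
have ih := wh.1; have mD2 := measurable_pushD2 ip wd.1 ih; have mD := measurable_pushD1 ip wd.1.
have iG1 := L1I_G1 ip wd; have iG := L1I_G2 ip wd ih.
have iD := integrable_OB cF hP iG mD2 (pushD2_le phi g h).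
have [g2 pg2] := push_exists cF iD; exists g2 => //; split; first exact: pg2.1.
move=> eta te; have [K hK] := test_bounded 0 te; have [K' hK'] := test_bounded 1 te.
have me : measurable_fun I01 eta := @test_measurable _ _ 0 I01 te.
have me' : measurable_fun I01 (derive1 eta) := @test_measurable _ _ 1 I01 te.
(* The first derivative is tested with [derive1 eta], itself a test function; a single further
   integration by parts remains. *)
have -> : integral_I (fun x => L phi x * derive1n 2 eta x) =
    - integral_I (fun x => g1 x * derive1 eta x).
  have := wg1.2 _ (test_derive1 te); rewrite expr1 mulN1r => <-.
  by [].
rewrite expr2 mulrNN !mul1r; apply: oppr_inj; rewrite opprK.
rewrite (pg1.2 _ (LooI_bounded me' hK')).2 (pg2.2 _ (LooI_bounded me hK)).2.
apply: integral_OB_sections.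
- exact: integrable_pair iG1 mD (pushD1_le phi g) me' hK'.
- exact: integrable_pair iG mD2 (pushD2_le phi g h) me hK.
- by move=> t Ot; exact: pushD2_ibp.
Qed.

(** At distance less than [r] from the cusp the weight is at most [r^s |x - c|^beta] with
    [s = -1 - 2 beta > 0]: a small factor times an integrable one, while [phi] is bounded by its
    Sobolev norm. Farther away the weight is at most [r^(-1 - beta)]. *)
Lemma weighted_sobolev (d : R) : 0 < d -> exists2 C : R, 0 <= C &
  forall phi g, L1I phi -> is_weak_deriv 1 phi g ->
  integral_I (fun x => `|x - c| `^ (- 1 - beta) * `|phi x|) <=
    d * integral_I (fun x => `|g x|) + C * integral_I (fun x => `|phi x|).
Proof.
move=> d0; have /andP[bm1 bh] := cf_beta cF.
set s := - 1 - 2 * beta; have s0 : 0 < s by rewrite /s; lra.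
pose J := integral_I (fun x : R => `|x - c| `^ beta).
have iJ : L1I (fun x : R => `|x - c| `^ beta) by exact: (L1I_dist_pow hc).
have J0 : 0 <= J by apply: integral_I_ge0 => x _; exact: powR_ge0.
have J1 : 0 < J + 1 by apply: ltr_wpDl.
(* Chosen so that [r^s J <= d]; the added 1 keeps the denominator positive. *)
pose r := (d / (J + 1)) `^ s^-1.
have dJ : 0 < d / (J + 1) by rewrite divr_gt0.
have r0 : 0 < r by exact: powR_gt0.
have rs : r `^ s * J <= d.
  rewrite /r -powRrM mulVf ?gt_eqF // powRr1 ?(ltW dJ) // mulrAC ler_pdivrMr // mulrDr mulr1.
  by rewrite lerDl (ltW d0).
pose C := d + r `^ (- 1 - beta); exists C => [|phi g ip wd].
  by rewrite addr_ge0 ?powR_ge0 // (ltW d0).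
set Np := integral_I (fun x => `|phi x|); set Ng := integral_I (fun x => `|g x|).
have iw : L1I (fun x => `|x - c| `^ (- 1 - beta)) by apply: (L1I_dist_pow hc); lra.
have iwp : L1I (fun x => `|x - c| `^ (- 1 - beta) * `|phi x|).
  have := L1I_norm (L1I_mul_sobolev ip wd iw); congr L1I; apply/funext => x.
  by rewrite normrM [X in X * _]ger0_norm ?powR_ge0.
have Np0 : 0 <= Np by exact: integral_I_ge0.
have Ng0 : 0 <= Ng by exact: integral_I_ge0.
apply: (@le_trans _ _ (integral_I (fun x => (r `^ s * (Np + Ng)) * `|x - c| `^ beta + r `^ (- 1 - beta) * `|phi x|))).
  apply: integral_I_ae_le => //.
    by apply: L1I_add; apply: L1I_scale => //; exact: L1I_norm.
  apply: aeS2 (sobolev_bound ip wd) (ae_branches cF) => x sb Bx Ix.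
  have xc : 0 < `|x - c|.
    by rewrite normr_gt0 subr_eq0; apply/eqP; have [_] := (branchesP x hc).1 (Bx Ix).
  set D := `|x - c| in xc *; have {}sb := sb Ix.
  have pw (p q : R) : D `^ (p + q) = D `^ p * D `^ q by rewrite powRD // (gt_eqF xc) implybT.
  have [Dr|rD] := ltP D r.
    have -> : D `^ (- 1 - beta) = D `^ s * D `^ beta by rewrite -pw /s; congr (_ `^ _); ring.
    have h1 : D `^ s <= r `^ s by apply: ge0_ler_powR; rewrite ?nnegrE; apply: ltW.
    apply: (@le_trans _ _ (r `^ s * D `^ beta * (Np + Ng))).
      by apply: ler_pM; rewrite ?mulr_ge0 ?powR_ge0 // ler_wpM2r ?powR_ge0.
    by rewrite mulrAC lerDl mulr_ge0 ?powR_ge0.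
  have h1 : D `^ (- 1 - beta) <= r `^ (- 1 - beta).
    have -> : - 1 - beta = - (1 + beta) by rewrite opprD.
    rewrite !powRN lef_pV2 ?posrE ?powR_gt0 //.
    by apply: ge0_ler_powR; rewrite ?nnegrE ?(ltW r0) ?(ltW xc) //; lra.
  apply: (@le_trans _ _ (r `^ (- 1 - beta) * `|phi x|)); first by rewrite ler_wpM2r.
  by rewrite lerDr !mulr_ge0 ?powR_ge0 // addr_ge0.
rewrite integral_I_add; [|exact: L1I_scale|by apply: L1I_scale; exact: L1I_norm].
rewrite !integral_I_scale //; last exact: L1I_norm.
rewrite -/J -/Np.
have h1 : r `^ s * (Np + Ng) * J <= d * (Np + Ng).
  by rewrite mulrAC ler_wpM2r // addr_ge0.
rewrite /C mulrDl; move: h1; rewrite mulrDr; lra.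
Qed.

Lemma annealed_L1 phi : L1I phi -> L1I (L phi) /\ integral_I (L phi) = integral_I phi.
Proof.
move=> ip; have [iL hL] := annealed_push cF hP ip; split=> //.
have l1 : LooI (fun _ : R => 1 : R).
  by apply: (LooI_bounded (K := 1)) => [|x _]; [exact: measurable_cst|rewrite normr1].
have [_ e] := hL _ l1; have [i2 e2] := integrable_snd cF hP ip.
transitivity (integral_I (fun x => L phi x * 1)); first by apply: integral_I_eq => x _; rewrite mulr1.
by rewrite e -e2; apply: eq_Rintegral => p _; rewrite mulr1.
Qed.

Lemma annealed_norm_le phi : L1I phi -> integral_I (fun x => `|L phi x|) <= integral_I (fun x => `|phi x|).
Proof.
move=> ip; apply: (push_norm_le cF hP (annealed_push cF hP ip)) => //; first exact: L1I_norm.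
by apply: (measurable_snd_OB cF); exact: L1I_measurable.
Qed.

Lemma annealed_LY1 : exists lam C : R, [/\ 0 <= lam < 1, 0 <= C &
  forall phi g g1, L1I phi -> is_weak_deriv 1 phi g -> is_weak_deriv 1 (L phi) g1 ->
  integral_I (fun x => `|g1 x|) <= lam * integral_I (fun x => `|g x|) + C * integral_I (fun x => `|phi x|)].
Proof.
have th1 := cf_theta cF; have th0 : 0 < theta by apply: lt_trans th1.
have ti : theta^-1 < 1 by rewrite invf_lt1.
have ti0 : 0 < theta^-1 by rewrite invr_gt0.
have [m1p _ M2p _] := cf_pos cF.
pose K := M2 / m1 ^+ 2; have K0 : 0 < K by rewrite divr_gt0 // exprn_gt0.
(* The singular term then contributes [K d = (1 - theta^-1) / 2], and adding [theta^-1] gives the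
   rate [(1 + theta^-1) / 2]. *)
pose d := (1 - theta^-1) / (2 * K).
have d0 : 0 < d by rewrite divr_gt0 ?subr_gt0 // mulr_gt0.
have [C C0 hC] := weighted_sobolev d0.
exists ((1 + theta^-1) / 2), (K * C); split; [lra|by rewrite mulr_ge0 // ltW|].
move=> phi g g1 ip wd wg1; have [g1' wg1' pg1] := annealed_weak_deriv1 ip wd.
have -> : integral_I (fun x => `|g1 x|) = integral_I (fun x => `|g1' x|).
  apply: integral_I_eqI.
  - by apply: L1I_measurable; apply: L1I_norm; exact: wg1.1.
  - by apply: L1I_measurable; apply: L1I_norm; exact: wg1'.1.
  - by apply: aeS (weak_deriv_unique wg1 wg1') => x h /h ->.
apply: le_trans (push_norm_le cF hP pg1 (L1I_G1 ip wd) (measurable_pushD1 ip wd.1) (pushD1_le phi g)) _.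
have ig := L1I_norm wd.1.
have iw : L1I (fun x => `|x - c| `^ (- 1 - beta)).
  by apply: (L1I_dist_pow hc); have /andP[] := cf_beta cF; lra.
have iwp : L1I (fun x => `|x - c| `^ (- 1 - beta) * `|phi x|).
  have := L1I_norm (L1I_mul_sobolev ip wd iw); congr L1I; apply/funext => x.
  by rewrite normrM [X in X * _]ger0_norm ?powR_ge0.
rewrite /G1 integral_I_add; [|exact: L1I_scale|exact: L1I_scale].
rewrite !integral_I_scale // -/K; have := hC phi g ip wd.
set a := integral_I _; set b := integral_I _; set e := integral_I _ => h.
have h1 : K * a <= K * (d * b + C * e) by rewrite ler_wpM2l // ltW.
have Kd : K * d = (1 - theta^-1) / 2.
  by rewrite /d; field; rewrite (gt_eqF th0) (gt_eqF K0).
have h2 : K * (d * b + C * e) = (1 - theta^-1) / 2 * b + K * C * e by rewrite mulrDr (mulrA K d) Kd (mulrA K C).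
rewrite h2 in h1; lra.
Qed.

(** The singular weights multiply [phi] only, whose supremum is bounded by the [W^{1,1}] norm; they
    go entirely into the weak term and the rate is [theta^-2]. *)
Lemma annealed_LY2 : exists lam C : R, [/\ 0 <= lam < 1, 0 <= C &
  forall phi g h g2, L1I phi -> is_weak_deriv 1 phi g -> is_weak_deriv 1 g h -> is_weak_deriv 2 (L phi) g2 ->
  integral_I (fun x => `|g2 x|) <= lam * integral_I (fun x => `|h x|) +
    C * (integral_I (fun x => `|phi x|) + integral_I (fun x => `|g x|))].
Proof.
have th1 := cf_theta cF; have th0 : 0 < theta by apply: lt_trans th1.
have ti : theta^-1 < 1 by rewrite invf_lt1.
have ti0 : 0 < theta^-1 by rewrite invr_gt0.
have [m1p _ M2p M3p] := cf_pos cF.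
have iw : L1I (fun x : R => `|x - c| `^ (- 2 - 2 * beta)).
  by apply: (L1I_dist_pow hc); have /andP[] := cf_beta cF; lra.
pose J := integral_I (fun x : R => `|x - c| `^ (- 2 - 2 * beta)).
have J0 : 0 <= J by apply: integral_I_ge0 => x _; exact: powR_ge0.
pose K1 := 3 * (M2 / m1 ^+ 3); pose K2 := M3 / m1 ^+ 3 + 3 * (M2 / m1 ^+ 2) ^+ 2.
have K10 : 0 <= K1 by rewrite mulr_ge0 // divr_ge0 ?exprn_ge0 // ltW.
have K20 : 0 <= K2.
  apply: addr_ge0; last by rewrite mulr_ge0 // sqr_ge0.
  by rewrite divr_ge0 ?exprn_ge0 // ltW.
exists ((theta^-1) ^+ 2), (K1 + K2 * J); split.
- by rewrite sqr_ge0 expr2 /=; nra.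
- by rewrite addr_ge0 // mulr_ge0.
move=> phi g h g2 ip wd wh w2; have [g2' w2' pg2] := annealed_weak_deriv2 ip wd wh.
have -> : integral_I (fun x => `|g2 x|) = integral_I (fun x => `|g2' x|).
  apply: integral_I_eqI.
  - by apply: L1I_measurable; apply: L1I_norm; exact: w2.1.
  - by apply: L1I_measurable; apply: L1I_norm; exact: w2'.1.
  - by apply: aeS (weak_deriv_unique w2 w2') => x hx /hx ->.
apply: le_trans (push_norm_le cF hP pg2 (L1I_G2 ip wd wh.1) (measurable_pushD2 ip wd.1 wh.1) (pushD2_le phi g h)) _.
have ig := L1I_norm wd.1; have ih := L1I_norm wh.1.
have iwp : L1I (fun x => `|x - c| `^ (- 2 - 2 * beta) * `|phi x|).
  have := L1I_norm (L1I_mul_sobolev ip wd iw); congr L1I; apply/funext => x.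
  by rewrite normrM [X in X * _]ger0_norm ?powR_ge0.
rewrite /G2 integral_I_add; [|by apply: L1I_add; exact: L1I_scale|exact: L1I_scale].
rewrite integral_I_add; [|exact: L1I_scale|exact: L1I_scale].
rewrite !integral_I_scale // -/K1 -/K2.
set A := integral_I (fun x => `|h x|); set b := integral_I (fun x => `|g x|).
set e := integral_I (fun x => `|phi x|).
have e0 : 0 <= e by exact: integral_I_ge0.
have b0 : 0 <= b by exact: integral_I_ge0.
have hw : integral_I (fun x => `|x - c| `^ (- 2 - 2 * beta) * `|phi x|) <= (e + b) * J.
  rewrite -integral_I_scale //; apply: integral_I_ae_le => //; first exact: L1I_scale.
  apply: aeS (sobolev_bound ip wd) => x sb Ix; rewrite mulrC.
  by rewrite ler_wpM2r ?powR_ge0 // sb.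
have h1 : K2 * integral_I (fun x => `|x - c| `^ (- 2 - 2 * beta) * `|phi x|) <= K2 * ((e + b) * J) by rewrite ler_wpM2l.
have h2 : K1 * b <= K1 * (e + b) by rewrite ler_wpM2l // lerDr.
rewrite -addrA lerD2l [leRHS]mulrDl; apply: lerD => //.
by apply: le_trans h1 _; rewrite le_eqVlt; apply/orP; left; apply/eqP; ring.
Qed.

End LasotaYorke.

(** * Minorization *)

Section Minorization.
Variable R : realType.
Notation mu := (@lebesgue_measure R).
Notation TR := (measurableTypeR R).
Variables (c beta theta m1 M1 M2 M3 w0 w1 : R) (P : probability TR R).
Variable F : nat -> R -> R -> R.
Notation Omega := (`[w0, w1]%classic : set TR).
Hypothesis cF : cusp_family c 1 beta theta m1 M1 M2 M3 Omega F.
Hypothesis hP : P Omega = 1%E.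
Notation f := (F 0%N).
Notation B := (branches c).
Notation PM := ((P \x mu)%E : {measure set (TR * TR) -> \bar R}).
Notation OB := (Omega `*` B : set (TR * TR)).
Notation L := (annealed (`[w0, w1]%classic : set R) P f).

Let hc := cf_c cF.
Let mB : measurable (B : set TR) := @measurable_branches R c.
Let mO : measurable (Omega : set TR). Proof. exact: measurable_itv. Qed.

(** The dual of the annealed operator. It acts on functions rather than classes, so positivity and
    bounds of its iterates hold at every point; the null set off the branches gets the value 0. *)
Definition koopman (chi : R -> R) : R -> R :=
  (fun x => \int[P]_(t in Omega) chi (f t x)) \_ B.

Definition bounded_meas (K : R) (chi : R -> R) : Prop :=
  measurable_fun I01 chi /\ forall x, I01 x -> `|chi x| <= K.

Lemma bounded_meas_LooI K chi : bounded_meas K chi -> LooI chi.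
Proof. by move=> [m b]; exact: LooI_bounded m b. Qed.

Let measurable_section (chi : R -> R) x : measurable_fun I01 chi -> B x ->
  measurable_fun Omega (fun t => chi (f t x)).
Proof.
move=> m Bx; have mcs : measurable_fun OB (fun p : TR * TR => chi (f p.1 p.2)) by exact: (measurable_comp_OB cF).
have -> : (fun t => chi (f t x)) = (fun p : TR * TR => chi (f p.1 p.2)) \o (fun t => (t, x)) by [].
apply: (measurable_comp (F := OB)) => //; first exact: measurable_OB.
- by move=> _ [t Ot <-].
- by apply: measurable_funTS; exact: measurable_pair2.
Qed.

Let integrable_section (K : R) (chi : R -> R) x : bounded_meas K chi -> B x ->
  P.-integrable Omega (EFin \o (fun t => chi (f t x))).
Proof.
move=> [m b] Bx; apply: measurable_bounded_integrable => //.
- by apply: le_lt_trans (probability_le1 P mO) _; rewrite ltry.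
- exact: measurable_section.
- by apply: (@bounded_in _ _ _ _ K) => t Ot; apply: b; exact: (map_I cF).
Qed.

Lemma koopman_bounded (K : R) chi : bounded_meas K chi -> bounded_meas K (koopman chi).
Proof.
move=> bm; have [m b] := bm; have I0 : I01 (0 : R) by exact: I01_0.
have K0 : 0 <= K by apply: le_trans (b 0 I0).
have mcs : measurable_fun OB (fun p : TR * TR => chi (f p.1 p.2)) by exact: (measurable_comp_OB cF).
have iH : PM.-integrable OB (EFin \o (fun p : TR * TR => chi (f p.1 p.2))).
  by apply: (integrable_OB cF hP (L1I_cst K) mcs) => p [Op Bp]; apply: b; exact: (map_I cF).
have [i2 _] := @fubini_rect2 _ _ TR TR R P mu Omega B _ mO mB iH.
have mU : measurable_fun B (fun x => \int[P]_(t in Omega) chi (f t x)).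
  exact: (@measurable_EFinP _ TR R B _).1 (measurable_int mu i2).
split; first by apply: measurable_funTS; apply: (@measurable_restrictT _ _ TR R B _ mB).1.
move=> x _; rewrite /koopman patchE; case: ifPn => [|_]; last by rewrite normr0.
rewrite inE => Bx; have iS := integrable_section bm Bx.
apply: le_trans (le_normr_Rintegral mO iS) _; rewrite -[leRHS](integral_Omega_cst hP).
apply: le_Rintegral => //.
- exact: integrable_abs.
- apply: measurable_bounded_integrable => //; last by apply: (@bounded_in _ _ _ _ `|K|).
  by apply: le_lt_trans (probability_le1 P mO) _; rewrite ltry.
- by move=> t Ot; apply: b; exact: (map_I cF).
Qed.

Lemma koopman_ge0 chi : (forall x, I01 x -> 0 <= chi x) -> forall x, 0 <= koopman chi x.
Proof.
move=> h x; rewrite /koopman patchE; case: ifPn => [|_] //; rewrite inE => Bx.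
by apply: Rintegral_ge0 => t Ot; apply: h; exact: (map_I cF).
Qed.

Lemma koopman_pairing (phi chi : R -> R) (K : R) : L1I phi -> bounded_meas K chi ->
  [/\ P.-integrable Omega (EFin \o (fun t => \int[mu]_(x in B) (phi x * chi (f t x)))),
  integral_I (fun x => phi x * koopman chi x) =
    \int[P]_(t in Omega) \int[mu]_(x in B) (phi x * chi (f t x)) &
  integral_I (fun x => L phi x * chi x) = integral_I (fun x => phi x * koopman chi x)].
Proof.
move=> ip bm; have [iL hL] := annealed_push cF hP ip.
have [iH e] := hL _ (bounded_meas_LooI bm).
have [i1 e1] := @fubini_rect1 _ _ TR TR R P mu Omega B _ mO mB iH.
have [i2 e2] := @fubini_rect2 _ _ TR TR R P mu Omega B _ mO mB iH.
have [mU bU] := koopman_bounded bm.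
have eU : integral_I (fun x => phi x * koopman chi x) = \int[PM]_(p in OB) (phi p.2 * chi (f p.1 p.2)).
  rewrite e2 -(integral_branches cF); last by apply: L1I_measurable; exact: L1I_mulb ip mU bU.
  apply: eq_Rintegral => x; rewrite inE => Bx; rewrite /koopman patchE mem_set //.
  by symmetry; exact: (@RintegralZl _ TR R P Omega (fun t => chi (f t x)) (phi x) mO (integrable_section bm Bx)).
by split=> //; rewrite eU // e.
Qed.

Lemma iter_koopman_bounded n (K : R) chi : bounded_meas K chi -> bounded_meas K (iter n koopman chi).
Proof. by move=> h; elim: n => //= n; exact: koopman_bounded. Qed.

Lemma iter_koopman_ge0 n chi : (forall x, I01 x -> 0 <= chi x) ->
  forall x, I01 x -> 0 <= iter n koopman chi x.
Proof. by move=> h; elim: n => //= n IH x _; exact: koopman_ge0. Qed.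

Lemma L1I_iter n phi : L1I phi -> L1I (iter n L phi).
Proof. by move=> ip; elim: n => //= n IH; have [] := annealed_L1 cF hP IH. Qed.

Lemma integral_iter n phi : L1I phi -> integral_I (iter n L phi) = integral_I phi.
Proof.
by move=> ip; elim: n => //= n IH; have [_ ->] := annealed_L1 cF hP (L1I_iter n ip).
Qed.

Lemma iter_pairing n phi (K : R) chi : L1I phi -> bounded_meas K chi ->
  integral_I (fun x => iter n L phi x * chi x) = integral_I (fun x => phi x * iter n koopman chi x).
Proof.
elim: n phi chi => [//|n IH] phi chi ip bm.
have [_ _ /= ->] := koopman_pairing (L1I_iter n ip) bm.
by rewrite (IH _ (koopman chi)) // -?iterSr //; exact: koopman_bounded.
Qed.

(** Formally the bound on [|f'|] integrated from [x] to the cusp. Since [f'] is unbounded there, [G]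
    below is compared at [x] and at a point [y] between [x] and [c], and [y] then tends to [c]. *)
Lemma peak_bound t x : Omega t -> B x ->
  1 - f t x <= M1 / (1 + beta) * `|x - c| `^ (1 + beta).
Proof.
move=> Ot Bx; have [_ _ Tc] := cf_ends cF Ot; have /andP[bm1 bh] := cf_beta cF.
have [_ M1p _ _] := cf_pos cF; have q0 : 0 < 1 + beta by lra.
have /andP[c0 c1] := hc; have [/andP[x0 x1] xc] := (branchesP x hc).1 Bx.
pose K := M1 / (1 + beta); have K0 : 0 < K by rewrite divr_gt0.
(* The derivative of the added term has modulus at least [|f'|] and the sign of [y - c], so [G]
   decreases before the cusp and increases after it. *)
pose G y := f t y + K * `|y - c| `^ (1 + beta).
have xc0 : x - c != 0 by rewrite subr_eq0; apply/eqP.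
suff key tau : 0 < tau < 1 -> f t (c + tau * (x - c)) <= G x.
  rewrite lerBlDl addrC -/K -/(G x) leNgt; apply/negP => lt.
  have /(continuous_within_itvP _ ltr01) [cin _ _] := cf_cont cF Ot.
  have /cvgrPdist_lt := cin c (ltac:(by rewrite in_itv /= c0)).
  have e0 : 0 < 1 - G x by rewrite /G; lra.
  move=> /(_ _ e0) [d /= d0 hd].
  (* Small enough for continuity at the cusp to bring [f t] within [1 - G x] of its peak 1, which
     contradicts [f t <= G x]. *)
  pose tau := Num.min (1 / 2) (d / 2).
  have tau0 : 0 < tau by rewrite lt_min !divr_gt0.
  have taud : tau <= d / 2 by rewrite ge_min lexx orbT.
  have tauh : tau <= 1 / 2 by rewrite ge_min lexx.
  have /key h : 0 < tau < 1 by rewrite tau0 /=; lra.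
  have := hd (c + tau * (x - c)); rewrite /= opprD addrA subrr sub0r normrN normrM (gtr0_norm tau0).
  have xle : `|x - c| <= 1 by rewrite ler_norml; lra.
  have lt1 : tau * `|x - c| < d by apply: (@le_lt_trans _ _ tau); [rewrite ler_piMr // ltW|lra].
  by move=> /(_ lt1); rewrite Tc ltr_norml => /andP[_ h2]; lra.
move=> /andP[tau0 tau1]; set y := c + tau * (x - c).
have yc : y - c = tau * (x - c) by rewrite /y addrC addKr.
have dG z : B z -> is_derive (z : R) (1 : R) G (F 1%N t z + M1 * `|z - c| `^ beta * Num.sg (z - c)).
  move=> Bz; have zc : z != c by have [_ /eqP] := (branchesP z hc).1 Bz.
  have d1 := cf_derive cF (isT : (0 < 3)%N) Ot Bz.
  have d2 := is_derive_scale K (is_derive_dist_pow (1 + beta) zc).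
  apply: is_derive_val (is_derive_add d1 d2) _; congr (_ + _).
  rewrite (_ : 1 + beta - 1 = beta); last by ring.
  by rewrite !mulrA; congr (_ * _ * _); rewrite /K divfK // gt_eqF.
have sgF z : B z -> [/\ 0 < z - c -> 0 <= F 1%N t z + M1 * `|z - c| `^ beta * Num.sg (z - c) &
    z - c < 0 -> F 1%N t z + M1 * `|z - c| `^ beta * Num.sg (z - c) <= 0].
  move=> Bz; have [_ b _ _] := cf_bounds cF Ot Bz.
  by split=> h; [rewrite gtr0_sg|rewrite ltr0_sg] => //; move: b; rewrite ler_norml => /andP[]; lra.
have cG (u v : R) : (forall z, u <= z <= v -> B z) -> {within `[u, v], continuous G}.
  move=> h; apply: continuous_in_subspaceT => z; rewrite inE /= in_itv /= => /h Bz.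
  exact: derive_continuous (dG z Bz).
have Gy : f t y <= G y by rewrite lerDl mulr_ge0 ?powR_ge0 // ltW.
apply: le_trans Gy _; have [xlt|xgt] := ltP (x - c) 0.
- have yc' : y < c by rewrite -subr_lt0 yc pmulr_rlt0.
  have xy : x < y.
    by rewrite -subr_gt0 (_ : y - x = (tau - 1) * (x - c)); [rewrite nmulr_lgt0 // subr_lt0|rewrite /y; ring].
  have hB z : x <= z <= y -> B z.
    move=> /andP[h1 h2]; apply/(branchesP _ hc).
    by split; [lra|move=> ze; lra].
  have [z||z zxy e] := @MVT _ G (fun z => F 1%N t z + M1 * `|z - c| `^ beta * Num.sg (z - c)) x y xy.
  + by rewrite in_itv /= => /andP[h1 h2]; apply: dG; apply: hB; rewrite !ltW.
  + exact: cG.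
  + rewrite in_itv /= in zxy; have /andP[h1 h2] := zxy.
    have Bz : B z by apply: hB; rewrite !ltW.
    have [_ s] := sgF z Bz; have zc : z - c < 0 by rewrite subr_lt0 (lt_trans h2).
    by rewrite -subr_le0 e; apply: mulr_le0_ge0; [exact: s|lra].
- have {}xgt : 0 < x - c by rewrite lt_neqAle xgt eq_sym xc0.
  have yc' : c < y by rewrite -subr_gt0 yc mulr_gt0.
  have xy : y < x.
    by rewrite -subr_gt0 (_ : x - y = (1 - tau) * (x - c)); [rewrite mulr_gt0 // subr_gt0|rewrite /y; ring].
  have hB z : y <= z <= x -> B z.
    move=> /andP[h1 h2]; apply/(branchesP _ hc).
    by split; [lra|move=> ze; lra].
  have [z||z zxy e] := @MVT _ G (fun z => F 1%N t z + M1 * `|z - c| `^ beta * Num.sg (z - c)) y x xy.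
  + by rewrite in_itv /= => /andP[h1 h2]; apply: dG; apply: hB; rewrite !ltW.
  + exact: cG.
  + rewrite in_itv /= in zxy; have /andP[h1 h2] := zxy.
    have Bz : B z by apply: hB; rewrite !ltW.
    have [s _] := sgF z Bz; have zc : 0 < z - c by rewrite subr_gt0 (lt_trans _ h1).
    by rewrite -subr_ge0 e; apply: mulr_ge0; [exact: s|lra].
Qed.

Lemma ler_powRN (p d e : R) : 0 <= p -> 0 < d -> d <= e -> e `^ (- p) <= d `^ (- p).
Proof.
move=> p0 d0 de; have e0 : 0 < e by exact: lt_le_trans d0 de.
rewrite !powRN lef_pV2 ?posrE ?powR_gt0 //.
by apply: ge0_ler_powR; rewrite ?nnegrE // ltW.
Qed.

(** Near 0 and 1 the slope is bounded uniformly in [t], so a value at least [k] needs room; near the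
    cusp [peak_bound] makes the value exceed [1 - k]. Every constant comes from the uniform bounds,
    hence [k'] does not depend on the parameter. *)
Lemma preimage_moduli (k : R) : 0 < k -> exists2 k' : R, 0 < k' &
  forall t x, Omega t -> I01 x -> k <= f t x <= 1 - k -> [/\ k' <= x <= 1 - k', k' <= `|x - c| & B x].
Proof.
move=> k0; have /andP[c0 c1] := hc; have [_ M1p _ _] := cf_pos cF.
have /andP[bm1 bh] := cf_beta cF; have q0 : 0 < 1 + beta by lra.
pose K := M1 / (1 + beta); have K0 : 0 < K by rewrite divr_gt0.
(* A bound of the slope at distance at least [d] from the cusp. *)
pose A (d : R) := M1 * d `^ beta.
have A0 d : 0 < d -> 0 < A d by move=> d0; rewrite mulr_gt0 // powR_gt0.
have bA (d : R) t z : 0 < d -> Omega t -> B z -> d <= `|z - c| -> `|F 1%N t z| <= A d.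
  move=> d0 Ot Bz dz; have [_ b _ _] := cf_bounds cF Ot Bz; apply: le_trans b _.
  rewrite ler_wpM2l ?(ltW M1p) //.
  have -> : beta = - (- beta) by rewrite opprK.
  have nb0 : 0 <= - beta by lra.
  by have := ler_powRN nb0 d0 dz; rewrite !opprK.
(* At distance less than [rho] the value of the map is at least [1 - k / 2]. *)
pose rho := (k / (2 * K)) `^ (1 + beta)^-1.
have rho0 : 0 < rho by rewrite powR_gt0 // divr_gt0 // mulr_gt0.
have rhoE : rho `^ (1 + beta) = k / (2 * K).
  by rewrite /rho -powRrM mulVf ?gt_eqF // powRr1 // ltW // divr_gt0 // mulr_gt0.
(* To the left of [c / 2] the slope is at most [A (c / 2)], so reaching height [k] takes the
   distance [k / A (c / 2)]; [k2] is its mirror image. *)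
pose k1 := Num.min (c / 2) (k / A (c / 2)).
pose k2 := Num.min ((1 - c) / 2) (k / A ((1 - c) / 2)).
have c20 : 0 < c / 2 by lra.
have c21 : 0 < (1 - c) / 2 by lra.
have k10 : 0 < k1 by rewrite lt_min c20 divr_gt0 // A0.
have k20 : 0 < k2 by rewrite lt_min c21 divr_gt0 // A0.
exists (Num.min rho (Num.min k1 k2)); first by rewrite lt_min rho0 /= lt_min k10 k20.
move=> t x Ot Ix /andP[h1 h2]; have [T0 T1 Tc] := cf_ends cF Ot.
have /I01P /andP[x0 x1] := Ix.
have x1k : k1 <= x.
  have [xc|xc] := leP x (c / 2); last by apply: ltW; apply: le_lt_trans xc; rewrite ge_min lexx.
  have lip := @lipschitz_branch _ c 1 beta theta m1 M1 M2 M3 Omega F cF t x 0 (A (c / 2)) Ot Ix (I01_0 R).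
  rewrite T0 !subr0 in lip; have fx0 : 0 <= f t x by lra.
  rewrite (ger0_norm fx0) (ger0_norm x0) in lip.
  rewrite ge_min; apply/orP; right; rewrite ler_pdivrMr ?A0 // mulrC; apply: (le_trans h1); apply: lip.
    by rewrite /same_side; apply/orP; left; apply/andP; split; lra.
  move=> z Bz; rewrite minC maxC (min_idPl x0) (max_idPr x0) => /andP[z0 zx].
  by apply: bA => //; rewrite ler_normr; apply/orP; right; lra.
have x2k : x <= 1 - k2.
  have [xc|xc] := leP ((1 - c) / 2) (1 - x).
    by rewrite lerBrDr -lerBrDl; apply: le_trans xc; rewrite ge_min lexx.
  have lip := @lipschitz_branch _ c 1 beta theta m1 M1 M2 M3 Omega F cF t x 1 (A ((1 - c) / 2)) Ot Ix (I01_1 R).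
  rewrite T1 !subr0 in lip; have fx0 : 0 <= f t x by lra.
  rewrite (ger0_norm fx0) distrC (@ger0_norm _ (1 - x)) in lip; last by lra.
  suff : k2 <= 1 - x by lra.
  rewrite ge_min; apply/orP; right; rewrite ler_pdivrMr ?A0 // mulrC; apply: (le_trans h1); apply: lip.
    by rewrite /same_side; apply/orP; right; apply/andP; split; lra.
  move=> z Bz; rewrite (min_idPl x1) (max_idPr x1) => /andP[z0 zx].
  by apply: bA => //; rewrite ler_normr; apply/orP; left; lra.
have Bx : B x.
  apply/(branchesP _ hc); split; last by move=> xe; rewrite xe Tc in h2; lra.
  by apply/andP; split; [apply: lt_le_trans x1k|apply: le_lt_trans x2k _; rewrite ltrBlDr ltrDl].
have xr : rho <= `|x - c|.
  rewrite leNgt; apply/negP => lt.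
  have h3 : `|x - c| `^ (1 + beta) <= k / (2 * K).
    by rewrite -rhoE; apply: ge0_ler_powR; rewrite ?nnegrE ?(ltW rho0) ?(ltW lt) ?(ltW q0).
  have := peak_bound Ot Bx; rewrite -/K => h4.
  have h5 : K * `|x - c| `^ (1 + beta) <= K * (k / (2 * K)) by rewrite ler_wpM2l // ltW.
  have h6 : K * (k / (2 * K)) = k / 2 by field; rewrite gt_eqF.
  by rewrite h6 in h5; lra.
have l1 : Num.min rho (Num.min k1 k2) <= k1.
  by apply: (@le_trans _ _ (Num.min k1 k2)); rewrite ge_min lexx ?orbT.
have l2 : Num.min rho (Num.min k1 k2) <= k2.
  by apply: (@le_trans _ _ (Num.min k1 k2)); rewrite ge_min lexx ?orbT.
split=> //; last by rewrite ge_min xr.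
by rewrite (le_trans l1 x1k) (le_trans x2k) // lerD2l lerN2.
Qed.

Lemma far_between (k y z w : R) : same_side c y z -> k <= `|y - c| -> k <= `|z - c| ->
  Num.min y z <= w <= Num.max y z -> k <= `|w - c|.
Proof.
rewrite /same_side ge_min le_max => /orP[|] /andP[s1 s2] n1 n2 /andP[/orP h1 /orP h2].
  rewrite ler0_norm in n1; last by rewrite subr_le0.
  rewrite ler0_norm in n2; last by rewrite subr_le0.
  by rewrite ler0_norm; case: h2; lra.
rewrite ger0_norm in n1; last by rewrite subr_ge0.
rewrite ger0_norm in n2; last by rewrite subr_ge0.
by rewrite ger0_norm; case: h1; lra.
Qed.

(** Selects the closed branch of [x], assigning the cusp itself to the left one, so that a single
    inverse branch is followed. *)
Definition on_side (x y : R) : bool := if x <= c then y <= c else c <= y.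

Lemma on_same_side x y z : on_side x y -> on_side x z -> same_side c y z.
Proof. by rewrite /on_side /same_side; case: ifP => _ -> ->; rewrite ?orbT. Qed.

Lemma on_side_refl x : on_side x x.
Proof. by rewrite /on_side; case: leP => // /ltW. Qed.

(* The branch through [x] is onto [0, 1], and expanding. *)
Lemma branch_surjective t x z (r : R) : Omega t -> I01 x -> I01 z -> `|z - f t x| <= theta * r ->
  exists y, [/\ I01 y, on_side x y, `|y - x| <= r & f t y = z].
Proof.
move=> Ot Ix Iz zr; have /andP[c0 c1] := hc; have [T0 T1 Tc] := cf_ends cF Ot.
have /I01P /andP[x0 x1] := Ix; have /I01P /andP[z0 z1] := Iz.
have th0 : 0 < theta by apply: lt_trans (cf_theta cF).
have cont := cf_cont cF Ot.
suff [y Iy [ss e]] : exists2 y, I01 y & on_side x y /\ f t y = z.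
  exists y; split=> //.
  have := expanding_branch cF Ot Iy Ix (on_same_side ss (on_side_refl x)).
  by rewrite e => h; rewrite -(ler_pM2l th0) (le_trans h).
rewrite /on_side; have [xc|cx] := leP x c.
- have c01 : {within `[0, c], continuous (f t)}.
    by apply: continuous_subspaceW cont => y /=; rewrite !in_itv /= => /andP[h1 h2]; lra.
  have [|y] := @IVT _ (f t) 0 c z (ltW c0) c01.
    by rewrite T0 Tc (min_idPl ler01) (max_idPr ler01) z0.
  rewrite in_itv /= => /andP[y0 yc] e; exists y; first by apply/I01P; lra.
  by [].
- have c01 : {within `[c, 1], continuous (f t)}.
    by apply: continuous_subspaceW cont => y /=; rewrite !in_itv /= => /andP[h1 h2]; lra.
  have [|y] := @IVT _ (f t) c 1 z (ltW c1) c01.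
    by rewrite T1 Tc minC maxC (min_idPl ler01) (max_idPr ler01) z0.
  rewrite in_itv /= => /andP[y0 yc] e; exists y; first by apply/I01P; lra.
  by [].
Qed.

(** The indicator of a ball cut to [[k, 1 - k]]. Points mapped into this strip stay away from the
    cusp, where the unbounded slope would destroy any lower bound for a transferred density. *)
Definition window (x r k y : R) : R :=
  if (`|y - x| <= r) && (k <= y <= 1 - k) then 1 else 0.

Lemma window_bounded x r k : bounded_meas 1 (window x r k).
Proof.
split; last by move=> y _; rewrite /window; case: ifP; rewrite ?normr0 ?normr1.
apply: measurable_funTS.
have -> : window x r k = \1_(`[x - r, x + r]%classic `&` `[k, 1 - k]%classic) :> (R -> R).
  apply/funext => y; rewrite /window indicE.
  have -> : (y \in `[x - r, x + r]%classic `&` `[k, 1 - k]%classic) = (`|y - x| <= r) && (k <= y <= 1 - k).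
    rewrite ler_distl; apply/idP/idP; rewrite ?inE /= !in_itv /=.
      by move=> [-> ->].
    by move=> /andP[-> ->].
  by case: ifP.
by apply: measurable_indic; apply: measurableI; exact: measurable_itv.
Qed.

Lemma window_ge0 x r k y : 0 <= window x r k y.
Proof. by rewrite /window; case: ifP. Qed.

Lemma L1I_window_mul x r k K chi : bounded_meas K chi -> L1I (fun y => window x r k y * chi y).
Proof.
move=> [m b]; have [mw bw] := window_bounded x r k.
exact: L1I_mulb (L1I_bounded mw bw) m b.
Qed.

(** One expanding step: the ball of radius [r] at [x] covers the ball of radius [theta r] at its
    image. On the window the inverse branch contracts by at most [D], the slope bound at distance
    [k'] from the cusp, so mass is lost by at most the factor [1 / D]. *)
Lemma branch_minorization (k : R) : 0 < k -> exists k' d : R, [/\ 0 < k', 0 < d &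
  forall t x r chi K, Omega t -> I01 x -> 0 < r -> bounded_meas K chi ->
    (forall y, I01 y -> 0 <= chi y) ->
    d * integral_I (fun z => window (f t x) (theta * r) k z * chi z) <=
    \int[mu]_(y in B) (window x r k' y * chi (f t y))].
Proof.
move=> k0; have [k' k'0 hk'] := preimage_moduli k0.
have [_ M1p _ _] := cf_pos cF; have /andP[bm1 bh] := cf_beta cF.
have th0 : 0 < theta by apply: lt_trans (cf_theta cF).
pose D := M1 * k' `^ beta; have D0 : 0 < D by rewrite mulr_gt0 // powR_gt0.
have Di0 : 0 < D^-1 by rewrite invr_gt0.
exists k', D^-1; split=> // t x r chi K Ot Ix r0 [mchi bchi] chi0.
have mI : measurable (I01 : set TR) := @measurable_I01 R.
pose Z : set R := `[f t x - theta * r, f t x + theta * r]%classic `&` `[k, 1 - k]%classic.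
have mZ : measurable (Z : set TR) by apply: measurableI; exact: measurable_itv.
have ZI : Z `<=` I01 by move=> z [_ /=]; rewrite in_itv /= => ?; apply/I01P; lra.
(* The inverse branch over the window, made a function by choice and injective because its values
   stay on the side of [x]. *)
have surj z : exists y, Z z -> [/\ I01 y, on_side x y, `|y - x| <= r & f t y = z].
  have [Zz|nZ] := pselect (Z z); last by exists 0.
  have [|y h] := @branch_surjective t x z r Ot Ix (ZI z Zz); last by exists y.
  by case: Zz; rewrite /= in_itv /= ler_distl.
have [g hg] := choice surj.
have gI z : Z z -> I01 (g z) by move=> /hg[].
have gmod z : Z z -> [/\ k' <= g z <= 1 - k', k' <= `|g z - c| & B (g z)].
  move=> Zz; have [Iy _ _ e] := hg z Zz; apply: (hk' t (g z)) => //; rewrite e.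
  by case: Zz => _ /=; rewrite in_itv.
have gside z z' : Z z -> Z z' -> same_side c (g z) (g z').
  by move=> /hg[_ s1 _ _] /hg[_ s2 _ _]; exact: on_same_side s1 s2.
have gE z : Z z -> f t (g z) = z by move=> /hg[].
have g_exp z z' : Z z -> Z z' -> D^-1 * `|z - z'| <= `|g z - g z'|.
  move=> Zz Zz'; rewrite mulrC ler_pdivrMr // mulrC -{1}(gE z Zz) -{1}(gE z' Zz').
  apply: (lipschitz_branch cF Ot (gI z Zz) (gI z' Zz') (gside z z' Zz Zz')) => w Bw hw.
  have [_ n1 _] := gmod z Zz; have [_ n2 _] := gmod z' Zz'.
  have kw : k' <= `|w - c| := far_between (gside z z' Zz Zz') n1 n2 hw.
  have [_ b _ _] := cf_bounds cF Ot Bw; apply: le_trans b _; rewrite /D ler_wpM2l ?(ltW M1p) //.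
  have nb0 : 0 <= - beta by lra.
  by have := ler_powRN nb0 k'0 kw; rewrite !opprK.
have g_lip z z' : Z z -> Z z' -> theta * `|g z - g z'| <= `|z - z'|.
  move=> Zz Zz'; rewrite -{2}(gE z Zz) -{2}(gE z' Zz').
  exact: (expanding_branch cF Ot (gI z Zz) (gI z' Zz') (gside z z' Zz Zz')).
have mg : measurable_fun Z g.
  apply: subspace_continuous_measurable_fun => //.
  apply/subspace_continuousP => z Zz; apply/cvgrPdist_lt => e e0.
  exists e => //= z' zz' Zz'; apply: le_lt_trans zz'.
  apply: le_trans (g_lip z z' Zz Zz'); rewrite ler_peMl // ltW //; exact: (cf_theta cF).
have [mw bw] := window_bounded x r k'.
pose W y := window x r k' y * chi (f t y).
have mchif : measurable_fun (I01 : set TR) (fun y => chi (f t y)).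
  apply: (measurable_comp (F := I01)) => //; last exact: (measurable_map cF).
  by move=> _ [y Iy <-]; exact: (cf_I cF).
have mW : measurable_fun I01 W by exact: measurable_funM.
have W01 y : I01 y -> 0 <= W y <= K.
  move=> Iy; have If := cf_I cF Ot Iy; rewrite /W mulr_ge0 ?window_ge0 ?chi0 //=.
  have h1 := bchi _ If; rewrite ger0_norm ?chi0 // in h1.
  by apply: le_trans h1; rewrite /window; case: ifP; rewrite ?mul1r ?mul0r ?chi0.
have fZ : (mu (Z : set TR) < +oo)%E.
  apply: (@le_lt_trans _ _ (mu I01)); first by apply: le_measure; rewrite ?inE.
  by have -> : mu I01 = 1%E := lebesgue_I01 R; rewrite ltry.
have := expanding_integral_le Di0 mZ mg fZ gI g_exp mW W01.
have -> : \int[mu]_(z in Z) W (g z) = integral_I (fun z => window (f t x) (theta * r) k z * chi z).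
  rewrite /integral_I Rintegral_mkcond [RHS]Rintegral_mkcond; apply: eq_Rintegral => z _.
  rewrite !patchE; have [Zz|nZ] := pselect (Z z).
    rewrite !mem_set //; last exact: ZI.
    have [_ _ h1 e] := hg z Zz; have [h2 _ _] := gmod z Zz.
    rewrite /W /window h1 h2 e; case: Zz; rewrite /= !in_itv /= ler_distl => -> ->.
    by [].
  rewrite [X in if X then _ else _]memNset //; case: ifP => // _.
  rewrite /window; case: ifPn => [/andP[h1 h2]|_]; last by rewrite mul0r.
  by exfalso; apply: nZ; split; rewrite /= in_itv //= -ler_distl.
rewrite invrK -(integral_branches cF mW) => h.
by rewrite [leLHS]mulrC ler_pdivrMr // [leRHS]mulrC.
Qed.

(** Each step enlarges the radius by [theta], so after [n] steps the ball covers everything. The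
    centre moves with the parameter, which is harmless because the induction hypothesis is uniform
    over centres; only [k] and [d] deteriorate. *)
Lemma window_minorization n : exists k d : R, [/\ 0 < k, 0 < d &
  forall x r chi K, I01 x -> theta ^- n <= r -> bounded_meas K chi ->
    (forall y, I01 y -> 0 <= chi y) ->
    d * integral_I (fun z => window 0 1 (1 / 4) z * chi z) <=
    integral_I (fun y => window x r k y * iter n koopman chi y)].
Proof.
have th0 : 0 < theta by apply: lt_trans (cf_theta cF).
elim: n => [|n [k [d [k0 d0 IH]]]].
  (* At radius at least 1 the ball condition is void on [I01] and the two windows coincide. *)
  exists (1 / 4), 1; split=> // x r chi K Ix r1 bm chi0.
  rewrite mul1r expr0 invr1 in r1 *; rewrite (integral_I_eq (v := fun y => window x r (1 / 4) y * chi y)) //.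
  move=> y Iy; congr (_ * _); rewrite /window.
  have /I01P /andP[x0 x1] := Ix; have /I01P /andP[y0 y1] := Iy.
  have -> : `|y - 0| <= 1 by rewrite ler_norml; lra.
  have -> // : `|y - x| <= r.
  by apply: le_trans r1; rewrite ler_norml; lra.
have [k' [d' [k'0 d'0 step]]] := branch_minorization k0.
exists k', (d' * d); split=> //; first exact: mulr_gt0.
move=> x r chi K Ix rr bm chi0.
have r0 : 0 < r by apply: lt_le_trans rr; rewrite invr_gt0 exprn_gt0.
have bn := iter_koopman_bounded n bm; have n0 := @iter_koopman_ge0 n _ chi0.
have [mw bw] := window_bounded x r k'.
have iw : L1I (window x r k') by exact: L1I_bounded mw bw.
have [iP eP _] := koopman_pairing iw bn.
rewrite /= eP -[leLHS](integral_Omega_cst hP); apply: le_Rintegral => //.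
  apply: measurable_bounded_integrable => //; last by apply: (@bounded_in _ _ _ _ `|d' * d * integral_I (fun z => window 0 1 (1 / 4) z * chi z)|).
  by apply: le_lt_trans (probability_le1 P mO) _; rewrite ltry.
move=> t Ot; apply: le_trans (step t x r _ K Ot Ix r0 bn n0).
rewrite -mulrA ler_wpM2l ?(ltW d'0) //; apply: (IH _ _ _ K) => //; first exact: (cf_I cF).
have -> : theta ^- n = theta * theta ^- n.+1.
  by rewrite exprS invfM mulVKf // gt_eqF.
by rewrite ler_wpM2l // ltW.
Qed.

Lemma integral_quarter_window : integral_I (window 0 1 (1 / 4)) = 1 / 2.
Proof.
have mI : measurable (I01 : set TR) := @measurable_I01 R.
pose Q : set TR := `[1 / 4, 3 / 4]%classic.
have mQ : measurable Q by exact: measurable_itv.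
rewrite (@integral_I_eq _ _ (\1_Q : R -> R)).
  rewrite /integral_I /Rintegral (@integral_indic _ TR R mu I01 mI Q mQ).
  have -> : Q `&` I01 = Q.
    by apply/seteqP; split=> x; [case|move=> Qx; split=> //; move: Qx; rewrite /Q /= in_itv /= => ?; apply/I01P; lra].
  have e : mu (`[1 / 4, 3 / 4]%classic : set R) = (1 / 2)%:E.
    by rewrite lebesgue_measure_itv /= lte_fin ifT; [rewrite -EFinB; congr (_%:E); lra|lra].
  exact: (congr1 fine e).
move=> x /I01P /andP[x0 x1]; rewrite /window indicE subr0.
have -> : `|x| <= 1 by rewrite ler_norml; lra.
have -> : (x \in Q) = (1 / 4 <= x <= 1 - 1 / 4).
  rewrite (_ : 1 - 1 / 4 = 3 / 4 :> R); last by lra.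
  by apply/idP/idP; rewrite inE /Q /= in_itv.
by case: ifP => /= ->.
Qed.

(* Otherwise [u] would be below [m / 4 + osc] on every interval of length
   [1 / q], which contradicts [\int u^+ = m / 2] when [q > 4 K]. *)
Lemma large_on_interval (K : R) (q : nat) : 0 <= K -> 4 * K < q.+1%:R ->
  forall u g, L1I u -> is_weak_deriv 1 u g -> integral_I u = 0 ->
  integral_I (fun x => `|g x|) <= K * integral_I (fun x => `|u x|) ->
  exists2 x, I01 x & \forall y \ae mu, I01 y -> `|y - x| <= (2 * q.+1%:R)^-1 ->
    integral_I (fun x => `|u x|) / 4 <= u y.
Proof.
move=> K0 qK u g iu wd iu0 gK; have ig := wd.1.
set m := integral_I (fun x => `|u x|) in gK *.
have m0 : 0 <= m by exact: integral_I_ge0.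
have q0 : 0 < q.+1%:R :> R by [].
have [m_eq|mn0] := eqVneq m 0.
  exists 0; first exact: I01_0.
  by apply: aeS (integral_I_abs_eq0 iu m_eq) => y h Iy _; rewrite m_eq mul0r h.
have mp : 0 < m by rewrite lt_neqAle eq_sym mn0.
have [C eC] := weak_deriv_primitive iu wd.
pose v x := C + primitive g x.
have iv : L1I v by apply: L1I_add; [exact: L1I_cst|exact: L1I_primitive].
pose vp x := Num.max (v x) 0.
have ivp : L1I vp.
  apply: (@L1I_dominated _ _ (fun x => `|v x|)); last exact: L1I_norm.
    by apply: measurable_maxr; [exact: L1I_measurable|exact: measurable_cst].
  move=> x _; rewrite /vp ger0_norm ?le_max ?lexx ?orbT //.
  by rewrite ge_max ler_norm normr_ge0.
(* Zero average splits the norm equally between positive and negative parts. *)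
have vpE : integral_I vp = m / 2.
  have e1 : integral_I (fun x => vp x + vp x) = integral_I (fun x => `|u x| + u x).
    apply: integral_I_eqI.
    - by apply: L1I_measurable; exact: L1I_add.
    - by apply: L1I_measurable; apply: L1I_add => //; exact: L1I_norm.
    - apply: aeS eC => x h Ix; rewrite (h Ix) -/(v x) /vp.
      by have [v0|v0] := leP (v x) 0; [rewrite ler0_norm //; ring|rewrite gtr0_norm].
  move: e1; rewrite !integral_I_add //; last exact: L1I_norm.
  by rewrite iu0 addr0 -/m; lra.
pose a (i : nat) : R := i%:R / q.+1%:R.
have a0 i : 0 <= a i by rewrite divr_ge0.
have aS i : a i.+1 = a i + q.+1%:R^-1 by rewrite /a -addn1 natrD mulrDl mul1r.
have ale i : (i < q.+1)%N -> a i.+1 <= 1.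
  by move=> iq; rewrite /a ler_pdivrMr // mul1r ler_nat.
have [[i iq hi]|nex] := pselect (exists2 i, (i < q.+1)%N & forall y, a i <= y <= a i.+1 -> m / 4 <= v y).
  (* The midpoint of a good cell of the grid, whose half-length is the stated radius. *)
  exists (a i + (2 * q.+1%:R)^-1).
    have e1 := ale i iq; rewrite aS in e1; apply/I01P; rewrite addr_ge0 ?invr_ge0 ?mulr_ge0 //=.
    apply: le_trans e1; rewrite lerD2l lef_pV2 ?posrE ?mulr_gt0 //; lra.
  apply: aeS eC => y h Iy yx; rewrite (h Iy) -/(v y); apply: hi; rewrite aS.
  have e2 : q.+1%:R^-1 = 2 * (2 * q.+1%:R)^-1 :> R by rewrite invfM mulrA divff // mul1r.
  move: yx e2; rewrite ler_distl; move: (_^-1) => z /andP[h7 h8]; move: (_^-1) => w e2.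
  by apply/andP; split; lra.
exfalso; pose og x := primitive (fun x => `|g x|) x.
have ing := L1I_norm ig.
(* On a bad cell [v] falls below [m / 4] somewhere, hence exceeds it by at most its variation there;
   variations over the cells add up to the norm of [g]. *)
have loc i : (i < q.+1)%N -> primitive vp (a i.+1) - primitive vp (a i) <=
    q.+1%:R^-1 * (m / 4 + (og (a i.+1) - og (a i))).
  move=> iq; have a1 := ale i iq; have aa : a i <= a i.+1 by rewrite aS lerDl invr_ge0.
  have [y ay vy] : exists2 y, a i <= y <= a i.+1 & v y < m / 4.
    apply: contrapT => ny; apply: nex; exists i => // y ay; rewrite leNgt; apply/negP => h.
    by apply: ny; exists y.
  have osc s t : a i <= s -> s <= t -> t <= a i.+1 -> `|v t - v s| <= og (a i.+1) - og (a i).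
    move=> as_ st ta; have s0 : 0 <= s by apply: le_trans as_.
    have t1 : t <= 1 by apply: le_trans a1.
    rewrite /v opprD addrACA subrr add0r; apply: le_trans (primitiveB_le ig s0 st t1) _.
    rewrite /og -(primitiveB ing s0 st t1).
    have mono p r : 0 <= p -> p <= r -> r <= 1 -> primitive (fun x => `|g x|) p <= primitive (fun x => `|g x|) r.
      move=> p0 pr r1; rewrite -subr_ge0 primitiveB //; exact: Rintegral_ge0.
    have h1 := mono _ _ (a0 i) as_ (le_trans st t1).
    have h2 := mono _ _ (le_trans s0 st) ta a1.
    lra.
  have bnd x : a i <= x <= a i.+1 -> vp x <= m / 4 + (og (a i.+1) - og (a i)).
    move=> /andP[ax xa]; move/andP: ay => [ay ya].
    have o : `|v x - v y| <= og (a i.+1) - og (a i).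
      by have [h|h] := leP x y; [rewrite distrC; exact: osc|apply: osc => //; exact: ltW].
    have o0 : 0 <= og (a i.+1) - og (a i) by apply: le_trans o.
    rewrite /vp ge_max; apply/andP; split; last by rewrite addr_ge0 // divr_ge0.
    by have := ler_norm (v x - v y); lra.
  rewrite primitiveB //.
  have mJ : measurable (`[a i, a i.+1]%classic : set TR) by exact: measurable_itv.
  have lenJ : mu `[a i, a i.+1]%classic = (q.+1%:R^-1)%:E.
    rewrite lebesgue_measure_itv /= lte_fin aS ltrDl invr_gt0 q0 -EFinB; congr (_%:E); ring.
  set k := _ + _ in bnd *.
  have -> : q.+1%:R^-1 * k = \int[mu]_(x in `[a i, a i.+1]) k.
    by rewrite Rintegral_cst //; transitivity (k * q.+1%:R^-1); [rewrite mulrC|congr (_ * _); rewrite /= -[LHS]/(fine (q.+1%:R^-1)%:E) -lenJ].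
  apply: le_Rintegral => //.
  - exact: L1I_sub_itv.
  - by apply: L1I_sub_itv => //; exact: L1I_cst.
have sumle : \sum_(0 <= i < q.+1) (primitive vp (a i.+1) - primitive vp (a i)) <=
    \sum_(0 <= i < q.+1) (q.+1%:R^-1 * (m / 4 + (og (a i.+1) - og (a i)))).
  by rewrite !big_mkord; apply: ler_sum => i _; exact: loc.
rewrite (telescope_sumr (fun i => primitive vp (a i))) // in sumle.
rewrite -mulr_sumr big_split /= (telescope_sumr (fun i => og (a i))) // in sumle.
have aq : a q.+1 = 1 by rewrite /a divff // gt_eqF.
have a00 : a 0%N = 0 by rewrite /a mul0r.
have p1 w : primitive w 1 = integral_I w by [].
have p0 w : primitive w 0 = 0 by rewrite /primitive set_itv1 Rintegral_set1.
rewrite aq a00 /og !p1 !p0 !subr0 vpE sumr_const_nat subn0 mulrDr in sumle.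
have e3 : q.+1%:R^-1 * ((m / 4) *+ q.+1) = m / 4.
  by rewrite -[(m / 4) *+ q.+1]mulr_natr mulrCA mulVf ?mulr1 // gt_eqF.
rewrite e3 in sumle.
have h5 : q.+1%:R^-1 * integral_I (fun x => `|g x|) <= q.+1%:R^-1 * (K * m) by rewrite ler_wpM2l // invr_ge0.
have h6 : q.+1%:R^-1 * (K * m) < m / 4.
  have Kq : K / q.+1%:R < 1 / 4 by rewrite ltr_pdivrMr //; lra.
  by have := ltr_pM2r mp (K / q.+1%:R) (1 / 4); rewrite Kq => Km; rewrite mulrA [_ * K]mulrC (lt_le_trans Km) //; lra.
by move: sumle (le_lt_trans h5 h6); move: (_ * integral_I _) => z; lra.
Qed.

(** By duality the norm of [L^N u] is a pairing of [u] with iterated Koopman images of [1 - psi] and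
    [1 + psi], where [psi] is the sign of [L^N u]. Cancellation is gained on one interval where
    [u >= m/4] and on another where [- u >= m/4]; each is expanded onto the fixed window, and the
    two functions sum to 2 there whatever [psi] is. *)
Lemma doeblin (K : R) : 0 <= K -> exists (N : nat) (d : R), [/\ (0 < N)%N, 0 < d <= 1 &
  forall u g, L1I u -> is_weak_deriv 1 u g -> integral_I u = 0 ->
  integral_I (fun x => `|g x|) <= K * integral_I (fun x => `|u x|) ->
  integral_I (fun x => `|iter N L u x|) <= (1 - d) * integral_I (fun x => `|u x|)].
Proof.
move=> K0; have th1 := cf_theta cF; have th0 : 0 < theta by apply: lt_trans th1.
pose q := Num.truncn (4 * K).
have qK : 4 * K < q.+1%:R by exact: truncnS_gt.
have q0 : 0 < (2 * q.+1%:R)^-1 :> R by rewrite invr_gt0 mulr_gt0.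
have [N0 hN0] : exists N, theta ^- N <= (2 * q.+1%:R)^-1.
  have ti : `|theta^-1| < 1 by rewrite gtr0_norm ?invr_gt0 // invf_lt1.
  have /cvgrPdist_lt /(_ _ q0) [N _ hN] := cvg_expr ti.
  exists N; have := hN N (leqnn N); rewrite sub0r normrN normrX gtr0_norm ?invr_gt0 //.
  by rewrite exprVn => /ltW.
have hN : theta ^- N0.+1 <= (2 * q.+1%:R)^-1.
  apply: le_trans hN0; rewrite lef_pV2 ?posrE ?exprn_gt0 // exprS ler_peMl ?exprn_ge0 ?ltW //.
have [k [d0 [k0 d00 minor]]] := window_minorization N0.+1.
(* The estimate reads [2 m - 2 |L^N u|_1 >= m d0 / 2], whence [d0 / 4]; the successor makes the
   block length positive. *)
exists N0.+1, (Num.min 1 (d0 / 4)); split=> //.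
  by rewrite lt_min ltr01 divr_gt0 //= ge_min lexx.
move=> u g iu wd iu0 gK; move: (N0.+1) hN minor => N hN minor.
have ig := wd.1; have iN := L1I_iter N iu; have iau := L1I_norm iu.
have wdN : is_weak_deriv 1 (fun x => - u x) (fun x => - g x).
  have h0 : is_weak_deriv 1 (fun=> 0 : R) (fun=> 0).
    by apply: is_weak_deriv_null; [exact: L1I_cst|exact: eqI_refl].
  have := is_weak_deriv_sub (L1I_cst 0) iu h0 wd.
  by under eq_fun do rewrite sub0r; under [X in is_weak_deriv _ _ X]eq_fun do rewrite sub0r.
have [x Ix hx] := large_on_interval K0 qK iu wd iu0 gK.
have [x' Ix' hx'] : exists2 x, I01 x & \forall y \ae mu, I01 y -> `|y - x| <= (2 * q.+1%:R)^-1 ->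
    integral_I (fun x => `|u x|) / 4 <= - u y.
  have iuN : L1I (fun x => - u x) by apply: L1I_eqI (L1I_scale (-1) iu) _ _; [apply: measurableT_comp => //; exact: L1I_measurable|apply: aeT => y _; rewrite mulN1r].
  have abN : integral_I (fun x => `|- u x|) = integral_I (fun x => `|u x|).
    by apply: integral_I_eq => y _; rewrite normrN.
  have gN : integral_I (fun x => `|- g x|) = integral_I (fun x => `|g x|).
    by apply: integral_I_eq => y _; rewrite normrN.
  rewrite -abN; apply: (large_on_interval K0 qK iuN wdN); last by rewrite gN abN.
  by rewrite -[RHS]oppr0 -iu0 -mulN1r -integral_I_scale //; apply: integral_I_eq => y _; rewrite mulN1r.
set r := (2 * q.+1%:R)^-1 in q0 hN hx hx'.
set m := integral_I (fun x => `|u x|) in gK hx hx' *.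
have m0 : 0 <= m by exact: integral_I_ge0.
pose psi y := Num.sg (iter N L u y).
have mpsi : measurable_fun I01 psi by apply: measurable_sgr; exact: L1I_measurable.
have psi1 y : -1 <= psi y <= 1 by have := norm_sgr_le1 (iter N L u y); rewrite ler_norml.
(* Both are nonnegative, as minorization requires; since [L^N u] has zero average, they pair with it
   to minus and plus its norm. *)
pose chi1 y := 1 - psi y; pose chi2 y := 1 + psi y.
have b1 : bounded_meas 2 chi1.
  by split=> [|y _]; [exact: measurable_funB|rewrite ler_norml /chi1; have /andP[] := psi1 y; lra].
have b2 : bounded_meas 2 chi2.
  by split=> [|y _]; [exact: measurable_funD|rewrite ler_norml /chi2; have /andP[] := psi1 y; lra].
have p1 y : I01 y -> 0 <= chi1 y by move=> _; have /andP[] := psi1 y; rewrite /chi1; lra.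
have p2 y : I01 y -> 0 <= chi2 y by move=> _; have /andP[] := psi1 y; rewrite /chi2; lra.
pose k1 := iter N koopman chi1; pose k2 := iter N koopman chi2.
have [mk1 bk1] : bounded_meas 2 k1 by exact: iter_koopman_bounded.
have [mk2 bk2] : bounded_meas 2 k2 by exact: iter_koopman_bounded.
have k1p y : I01 y -> 0 <= k1 y by exact: iter_koopman_ge0.
have k2p y : I01 y -> 0 <= k2 y by exact: iter_koopman_ge0.
have iap := L1I_mulb (L1I_iter N iau) mpsi (fun y _ => norm_sgr_le1 _).
have inp := L1I_mulb iN mpsi (fun y _ => norm_sgr_le1 _).
have norm_psi : integral_I (fun y => iter N L u y * psi y) = integral_I (fun y => `|iter N L u y|).
  by apply: integral_I_eq => y _; rewrite mulr_sgr_norm.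
have e1 : integral_I (fun y => u y * k1 y) = - integral_I (fun y => `|iter N L u y|).
  rewrite -(iter_pairing N iu b1) (integral_I_eq (v := fun y => iter N L u y - iter N L u y * psi y)).
    by rewrite integral_I_sub // integral_iter // iu0 sub0r norm_psi.
  by move=> y _; rewrite /chi1; ring.
have e2 : integral_I (fun y => u y * k2 y) = integral_I (fun y => `|iter N L u y|).
  rewrite -(iter_pairing N iu b2) (integral_I_eq (v := fun y => iter N L u y + iter N L u y * psi y)).
    by rewrite integral_I_add // integral_iter // iu0 add0r norm_psi.
  by move=> y _; rewrite /chi2; ring.
have e3 : integral_I (fun y => `|u y| * k1 y) + integral_I (fun y => `|u y| * k2 y) = 2 * m.
  rewrite -(iter_pairing N iau b1) -(iter_pairing N iau b2).
  rewrite (integral_I_eq (v := fun y => iter N L (fun x => `|u x|) y - iter N L (fun x => `|u x|) y * psi y)); last by move=> y _; rewrite /chi1; ring.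
  rewrite [X in _ + X](integral_I_eq (v := fun y => iter N L (fun x => `|u x|) y + iter N L (fun x => `|u x|) y * psi y)); last by move=> y _; rewrite /chi2; ring.
  have iaN := L1I_iter N iau.
  by rewrite integral_I_sub // integral_I_add // integral_iter // -/m; lra.
have iuk1 := L1I_mulb iu mk1 bk1; have iuk2 := L1I_mulb iu mk2 bk2.
have iak1 := L1I_mulb iau mk1 bk1; have iak2 := L1I_mulb iau mk2 bk2.
(* [|u| + s u] is nonnegative everywhere and at least [m / 2] on the ball around [z], so it
   dominates [m / 2] times the window. *)
have wmin (s z : R) (kk chi : R -> R) : s = 1 \/ s = -1 -> bounded_meas 2 kk ->
    (forall y, I01 y -> 0 <= kk y) ->
    (\forall y \ae mu, I01 y -> `|y - z| <= r -> m / 4 <= s * u y) ->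
    d0 * integral_I (fun y => window 0 1 (1 / 4) y * chi y) <= integral_I (fun y => window z r k y * kk y) ->
    m / 2 * (d0 * integral_I (fun y => window 0 1 (1 / 4) y * chi y)) <=
    integral_I (fun y => `|u y| * kk y) + s * integral_I (fun y => u y * kk y).
  move=> hs bm kkp hz hw; have [mkk bkk] := bm.
  have m20 : 0 <= m / 2 by rewrite divr_ge0.
  have i1 : L1I (fun y => window z r k y * kk y) by exact: L1I_window_mul bm.
  have i2 : L1I (fun y => u y * kk y) by exact: L1I_mulb iu mkk bkk.
  have i3 : L1I (fun y => `|u y| * kk y) by exact: L1I_mulb iau mkk bkk.
  apply: le_trans (ler_wpM2l m20 hw) _.
  rewrite -(integral_I_scale _ i1) -(integral_I_scale _ i2) -integral_I_add //; last exact: L1I_scale.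
  apply: integral_I_ae_le.
  - exact: L1I_scale.
  - by apply: L1I_add => //; exact: L1I_scale.
  - apply: aeS hz => y h Iy; rewrite mulrA [s * _]mulrA -mulrDl ler_wpM2r ?kkp // /window.
    have su : - (s * u y) <= `|u y| /\ s * u y <= `|u y|.
      by case: hs => ->; rewrite ?mulN1r ?mul1r ?opprK; split; rewrite ler_normr lexx ?orbT.
    case: ifPn => [/andP[yz _]|_]; rewrite ?mulr1 ?mulr0.
      by have := h Iy yz; lra.
    by lra.
have h1 : m / 2 * (d0 * integral_I (fun y => window 0 1 (1 / 4) y * chi1 y)) <=
    integral_I (fun y => `|u y| * k1 y) + 1 * integral_I (fun y => u y * k1 y).
  apply: (wmin 1 x) => //; [by left| |exact: minor b1 p1].
  by apply: aeS hx => y h Iy yx; rewrite mul1r h.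
have h2 : m / 2 * (d0 * integral_I (fun y => window 0 1 (1 / 4) y * chi2 y)) <=
    integral_I (fun y => `|u y| * k2 y) + -1 * integral_I (fun y => u y * k2 y).
  apply: (wmin (-1) x') => //; [by right| |exact: minor b2 p2].
  by apply: aeS hx' => y h Iy yx; rewrite mulN1r h.
have sumw : integral_I (fun y => window 0 1 (1 / 4) y * chi1 y) +
    integral_I (fun y => window 0 1 (1 / 4) y * chi2 y) = 1.
  rewrite -integral_I_add; [|exact: L1I_window_mul b1|exact: L1I_window_mul b2].
  rewrite (integral_I_eq (v := fun y => 2 * window 0 1 (1 / 4) y)).
    rewrite integral_I_scale ?integral_quarter_window; first by lra.
    by have [mw bw] := window_bounded 0 1 (1 / 4); exact: L1I_bounded mw bw.
  by move=> y _; rewrite /chi1 /chi2; ring.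
have dmin : Num.min 1 (d0 / 4) <= d0 / 4 by rewrite ge_min lexx orbT.
have := ler_wpM2r m0 dmin; rewrite e1 in h1; rewrite e2 in h2.
have h12 : m / 2 * d0 <= 2 * m - 2 * integral_I (fun y => `|iter N L u y|).
  move: h1 h2 sumw e3; move: (integral_I _) (integral_I _) (integral_I _) => i1 i2 i3.
  move: (integral_I _) (integral_I _) => i4 i5 h1 h2 sumw e3.
  have : m / 2 * (d0 * (i3 + i5)) = m / 2 * d0 by rewrite sumw mulr1.
  lra.
move: h12; move: (integral_I _) (Num.min _ _) => a b; lra.
Qed.

End Minorization.

(** * Geometric decay *)

Section Sequences.
Variable R : realType.
Implicit Types (v a b : nat -> R) (r rho M lam C d : R).

Lemma bernoulli_sub (s : R) n : 0 <= s <= 1 -> 1 - n%:R * s <= (1 - s) ^+ n.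
Proof.
move=> /andP[s0 s1]; elim: n => [|n IH]; first by rewrite expr0; lra.
rewrite exprS; apply: (@le_trans _ _ ((1 - s) * (1 - n%:R * s))); last by rewrite ler_wpM2l ?subr_ge0.
have n0 : 0 <= n%:R * s * s by rewrite !mulr_ge0.
by rewrite -addn1 natrD; lra.
Qed.

(** Writing [n] as quotient and remainder by [N], full blocks contract by [rho <= r^N] and the
    remainder costs at most [(M / r)^N]. *)
Lemma geometric_block (N : nat) rho M : (0 < N)%N -> 0 <= rho < 1 -> 1 <= M ->
  exists C r, [/\ 0 <= C, 0 < r < 1 & forall v, (forall n, 0 <= v n) ->
    (forall n, v (n + N)%N <= rho * v n) -> (forall n, v n.+1 <= M * v n) ->
    forall n, v n <= C * r ^+ n * v 0%N].
Proof.
move=> N0 /andP[rho0 rho1] M1.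
(* Bernoulli's inequality gives [r^N >= 1 - N s >= rho]; dividing by [N + 1 >= 2] keeps [r] positive
   even when [rho] is 0. *)
pose s := (1 - rho) / N.+1%:R; pose r := 1 - s.
have s0 : 0 < s by rewrite divr_gt0 ?subr_gt0.
have N2 : 2 <= N.+1%:R :> R by rewrite ler_nat.
have s1 : s <= 1 / 2 by rewrite ler_pdivrMr //; lra.
have r01 : 0 < r < 1 by rewrite /r; apply/andP; split; lra.
have /andP[r0 r1] := r01.
have rN : rho <= r ^+ N.
  apply: (@le_trans _ _ (1 - N%:R * s)); last by apply: bernoulli_sub; lra.
  have : N%:R * s <= 1 - rho; last by lra.
  by rewrite /s mulrCA ler_piMr ?subr_ge0 ?(ltW rho1) // ler_pdivrMr // mul1r ler_nat.
have Mr : 1 <= M / r by rewrite ler_pdivlMr // mul1r (le_trans (ltW r1)).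
exists ((M / r) ^+ N), r; split=> //; first by rewrite exprn_ge0 // (le_trans ler01).
move=> v v0 hN h1 n.
have hM k t : v (k + t)%N <= M ^+ k * v t.
  elim: k => [|k IH]; first by rewrite mul1r.
  rewrite addSn exprS -mulrA; apply: le_trans (h1 _) _.
  by rewrite ler_wpM2l // (le_trans ler01).
have hq k t : v (t + k * N)%N <= r ^+ (k * N) * v t.
  elim: k => [|k IH]; first by rewrite mul0n addn0 mul1r.
  rewrite mulSn addnCA [(N + _)%N]addnC; apply: le_trans (hN _) _.
  apply: (@le_trans _ _ (r ^+ N * v (t + k * N)%N)); first by rewrite ler_wpM2r.
  by rewrite [(N + _)%N]addnC exprD [r ^+ (k * N) * _]mulrC -mulrA ler_wpM2l // exprn_ge0 // ltW.
rewrite (divn_eq n N) addnC; apply: le_trans (hq _ _) _.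
apply: (@le_trans _ _ (r ^+ (n %/ N * N) * (M ^+ (n %% N) * v 0%N))).
  by rewrite ler_wpM2l ?exprn_ge0 ?(ltW r0) //; have := hM (n %% N)%N 0%N; rewrite addn0.
rewrite exprD [leRHS](_ : _ = r ^+ (n %/ N * N) * ((M / r) ^+ N * r ^+ (n %% N) * v 0%N)); last by ring.
rewrite ler_wpM2l ?exprn_ge0 ?(ltW r0) // ler_wpM2r //.
have e : M ^+ (n %% N) = (M / r) ^+ (n %% N) * r ^+ (n %% N) by rewrite -exprMn divfK // gt_eqF.
rewrite {1}e ler_wpM2r ?exprn_ge0 ?(ltW r0) //.
by rewrite ler_weXn2l // ltnW // ltn_mod.
Qed.

(* The two alternatives of Harris' theorem: either [b <= K a], and the
   Doeblin bound contracts [a], or [b > K a], and the Lasota-Yorke bound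
   contracts [b]; the weighted sum [eps b + a] decreases in both. *)
Lemma harris_geometric lam C d (N : nat) : 0 <= lam < 1 -> 0 <= C -> 0 < d <= 1 -> (0 < N)%N ->
  exists A r, [/\ 0 <= A, 0 < r < 1 & forall a b,
    (forall n, 0 <= a n) -> (forall n, 0 <= b n) -> (forall n, a n.+1 <= a n) ->
    (forall n, b n.+1 <= lam * b n + C * a n) ->
    (forall n, b n <= 2 * (C / (1 - lam) + 1) / (1 - lam) * a n -> a (n + N)%N <= (1 - d) * a n) ->
    forall n, a n + b n <= A * r ^+ n * (a 0%N + b 0%N)].
Proof.
move=> /andP[lam0 lam1] C0 /andP[d0 d1] N0.
have l1 : 0 < 1 - lam by rewrite subr_gt0.
(* [C'] is the fixed point of [x |-> lam x + C], so it bounds the accumulated weak terms over any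
   number of steps. [K] is such that half of the gain [(1 - lam) b] exceeds [(C' + 1) a] when
   [b > K a]. *)
pose C' := C / (1 - lam); pose K := 2 * (C' + 1) / (1 - lam).
have C'0 : 0 <= C' by rewrite divr_ge0 // ltW.
have C'E : lam * C' + C = C' by rewrite /C'; field; rewrite gt_eqF.
have KE : (1 - lam) * K = 2 * (C' + 1) by rewrite /K; field; rewrite gt_eqF.
(* The weak terms re-entering through [eps b] cost at most half of the Doeblin gain [d]. *)
pose eps := d / (2 * (C' + 1)).
have C'1 : 0 < 2 * (C' + 1) by lra.
have eps0 : 0 < eps by rewrite divr_gt0.
have epsE : eps * (C' + 1) = d / 2 by rewrite /eps; field; rewrite gt_eqF //; lra.
have eps1 : eps <= 1.
  by rewrite ler_pdivrMr //; lra.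
pose eta := Num.min eps ((1 - lam) / 2).
have eta0 : 0 < eta by rewrite lt_min eps0 divr_gt0.
have eta1 : eta <= eps by rewrite ge_min lexx.
have eta2 : eta <= (1 - lam) / 2 by rewrite ge_min lexx orbT.
pose rho := Num.max lam (Num.max (1 - d / 2) (1 - eta)).
have rho1 : lam <= rho by rewrite le_max lexx.
have rho2 : 1 - d / 2 <= rho by rewrite !le_max lexx orbT.
have rho3 : 1 - eta <= rho by rewrite !le_max lexx !orbT.
have rho01 : 0 <= rho < 1.
  rewrite (le_trans lam0 rho1) /= !gt_max lam1 /=; apply/andP; split; lra.
have M1 : 1 <= 1 + eps * C by rewrite lerDl mulr_ge0 // ltW.
have [A [r [A0 r01 hA]]] := geometric_block N0 rho01 M1.
exists (A / eps), r; split=> //; first by rewrite divr_ge0 // ltW.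
move=> a b a0 b0 ha hb hd n.
pose v k := eps * b k + a k.
have v0 k : 0 <= v k by rewrite addr_ge0 // mulr_ge0 // ltW.
have hbk k t : b (t + k)%N <= lam ^+ k * b t + C' * a t /\ a (t + k)%N <= a t.
  elim: k => [|k [IHb IHa]]; first by rewrite addn0 mul1r lexx lerDl mulr_ge0.
  rewrite addnS (le_trans (ha _) IHa); split=> //; apply: le_trans (hb _) _.
  have h3 : C * a (t + k)%N <= C * a t by rewrite ler_wpM2l.
  have h4 : lam * b (t + k)%N <= lam * (lam ^+ k * b t + C' * a t) by rewrite ler_wpM2l.
  have h5 : (lam * C' + C) * a t = C' * a t by rewrite C'E.
  rewrite exprS; lra.
have step k : v (k + N)%N <= rho * v k.
  have [bN aN] := hbk N k.
  have bN' : b (k + N)%N <= lam * b k + C' * a k.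
    apply: (le_trans bN); rewrite lerD2r ler_wpM2r //.
    by case: (N) N0 => // j _; rewrite exprS ler_piMr // exprn_ile1 // ltW.
  have ebN : eps * b (k + N)%N <= eps * (lam * b k + C' * a k) by rewrite ler_wpM2l // ltW.
  have ebp : 0 <= eps * b k by rewrite mulr_ge0 // ltW.
  rewrite /v; have [ba|ab] := leP (b k) (K * a k).
    have h5 := hd k ba.
    have h6 : lam * (eps * b k) <= rho * (eps * b k) by rewrite ler_wpM2r.
    have h7 : (1 - d / 2) * a k <= rho * a k by rewrite ler_wpM2r.
    have h8 : (eps * (C' + 1)) * a k = d / 2 * a k by rewrite epsE.
    have h9 : 0 <= eps * a k by rewrite mulr_ge0 // ltW.
    lra.
  have h6 : (1 - eta) * (eps * b k) <= rho * (eps * b k) by rewrite ler_wpM2r.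
  have h7 : (1 - eta) * a k <= rho * a k by rewrite ler_wpM2r.
  have h8 : eta * a k <= eps * a k by rewrite ler_wpM2r.
  have h9 : (1 - lam) / 2 * (eps * b k) <= (1 - lam - eta) * (eps * b k) by rewrite ler_wpM2r //; lra.
  have h10 : eps * ((1 - lam) / 2 * (K * a k)) <= eps * ((1 - lam) / 2 * b k).
    by rewrite ler_wpM2l ?(ltW eps0) // ler_wpM2l ?(ltW ab) // divr_ge0 // ltW.
  have h11 : eps * ((1 - lam) / 2 * (K * a k)) = eps * ((C' + 1) * a k).
    by rewrite (_ : (1 - lam) / 2 * (K * a k) = (1 - lam) * K / 2 * a k); [rewrite KE; congr (_ * _); field|ring].
  lra.
have grow k : v k.+1 <= (1 + eps * C) * v k.
  have h3 : eps * b k.+1 <= eps * (lam * b k + C * a k) by rewrite ler_wpM2l // ltW.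
  have h4 := ha k; have h5 : lam * (eps * b k) <= 1 * (eps * b k) by rewrite ler_wpM2r ?(ltW lam1) // mulr_ge0 // ltW.
  have e0 := ltW eps0; have h6 : 0 <= eps * C * (eps * b k) by apply: mulr_ge0; exact: mulr_ge0.
  by rewrite /v; lra.
have h1 : eps * (a n + b n) <= A * r ^+ n * (a 0%N + b 0%N).
  apply: (@le_trans _ _ (v n)).
    by rewrite /v mulrDr addrC lerD2l ler_piMl.
  apply: le_trans (hA _ v0 step grow n) _; have /andP[r0 _] := r01.
  rewrite ler_wpM2l ?mulr_ge0 ?exprn_ge0 ?(ltW r0) // /v addrC lerD2l ler_piMl //.
rewrite -(ler_pM2l eps0); apply: le_trans h1 _; rewrite le_eqVlt; apply/orP; left; apply/eqP.
by rewrite mulrA; congr (_ * _); rewrite mulrA mulrCA divff ?mulr1 // gt_eqF.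
Qed.

(** The rate [r'] lies strictly above both [lam] and [r], which excludes the resonance [n r^n] at
    [lam = r]; [B / (r' - lam)] then absorbs the forcing. *)
Lemma geometric_forcing lam r : 0 <= lam < 1 -> 0 < r < 1 -> exists A r', [/\ 0 <= A, r <= r' < 1 &
  forall b (B : R), 0 <= B -> 0 <= b 0%N -> (forall n, b n.+1 <= lam * b n + B * r ^+ n) ->
  forall n, b n <= A * r' ^+ n * (b 0%N + B)].
Proof.
move=> /andP[lam0 lam1] /andP[r0 r1].
pose r' := (1 + Num.max lam r) / 2.
have m1 : Num.max lam r < 1 by rewrite gt_max lam1.
have ml : lam <= Num.max lam r by rewrite le_max lexx.
have mr : r <= Num.max lam r by rewrite le_max lexx orbT.
have rr' : r <= r' by rewrite /r'; lra.
have r'0 : 0 < r' by apply: lt_le_trans rr'.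
pose del := r' - lam; have del0 : 0 < del by rewrite /del /r'; lra.
exists (1 + del^-1), r'; split; first by rewrite addr_ge0 // invr_ge0 ltW.
  by rewrite rr' /r'; lra.
move=> b B B0 b0 hb n.
have Bd : 0 <= B / del by rewrite divr_ge0 // ltW.
have BdE : (r' - lam) * (B / del) = B by rewrite -/del mulrCA divff ?mulr1 // gt_eqF.
have {}key : b n <= (b 0%N + B / del) * r' ^+ n.
  elim: n => [|n IH]; first by rewrite mulr1 lerDl.
  apply: le_trans (hb n) _.
  have h1 : lam * b n <= lam * ((b 0%N + B / del) * r' ^+ n) by rewrite ler_wpM2l.
  have h2 : B * r ^+ n <= B * r' ^+ n by rewrite ler_wpM2l // lerXn2r ?nnegrE ?(ltW r0) ?(ltW r'0).
  have p0 : 0 <= r' ^+ n by rewrite exprn_ge0 // ltW.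
  have h3 : (lam * (b 0%N + B / del) + B) * r' ^+ n <= r' * (b 0%N + B / del) * r' ^+ n.
    by rewrite ler_wpM2r //; have : 0 <= (r' - lam) * b 0%N; [rewrite mulr_ge0 // ltW|lra].
  by rewrite exprS; lra.
apply: le_trans key _; rewrite mulrAC ler_wpM2r ?exprn_ge0 ?(ltW r'0) //.
have : 0 <= b 0%N / del by rewrite divr_ge0 // ltW.
lra.
Qed.

End Sequences.

(** * Spectral gaps of the annealed operator *)

Section SobolevNorms.
Variable R : realType.
Implicit Types (phi psi g h : R -> R).

Lemma W1_norm1E phi g : L1I phi -> is_weak_deriv 1 phi g ->
  W1_norm 1 phi = integral_I (fun x => `|phi x|) + integral_I (fun x => `|g x|).
Proof.
move=> ip wg; rewrite (@W1_normE _ 1 phi (nth (fun=> 0) [:: phi; g])).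
  by rewrite !big_ord_recr big_ord0 /= add0r.
by split=> // -[|[|]] // _; exact: weak_deriv0.
Qed.

Lemma W1_norm2E phi g h : L1I phi -> is_weak_deriv 1 phi g -> is_weak_deriv 2 phi h ->
  W1_norm 2 phi = W1_norm 1 phi + integral_I (fun x => `|h x|).
Proof.
move=> ip wg wh; rewrite (W1_norm1E ip wg) (@W1_normE _ 2 phi (nth (fun=> 0) [:: phi; g; h])).
  by rewrite !big_ord_recr big_ord0 /= add0r.
by split=> // -[|[|[|]]] // _; exact: weak_deriv0.
Qed.

Lemma W1_deriv k j phi : W1 k phi -> (j <= k)%N -> is_weak_deriv j phi (weak_deriv j phi).
Proof. by move=> [_ h] jk; have [g wg] := h j jk; have [] := weak_derivP wg. Qed.

Lemma W1_le k j phi : W1 k phi -> (j <= k)%N -> W1 j phi.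
Proof. by move=> [ip h] jk; split=> // i ij; apply: h; exact: leq_trans jk. Qed.

Lemma W1_norm_eqI k phi psi : W1 k phi -> W1 k psi -> eqI phi psi -> W1_norm k phi = W1_norm k psi.
Proof.
move=> Wp Wq e; apply: (eqv_N (W1_seminormed R k)); split=> //.
by apply: W1_norm_null => //; [exact: W1_L1I Wp|exact: W1_L1I Wq].
Qed.

Lemma W1_norm_eq0 k phi : W1 k phi -> W1_norm k phi = 0 -> eqI phi (fun=> 0).
Proof.
move=> Wp N0; apply: integral_I_abs_eq0; first exact: W1_L1I Wp.
apply/eqP; rewrite eq_le integral_I_ge0 // andbT -N0; exact: W1_norm_L1.
Qed.

End SobolevNorms.

Lemma double_bound (R : realType) (M n x y X Y : R) : 0 <= M ->
  x <= M * X -> y <= M * Y -> X <= n -> Y <= n -> x + y <= 2 * M * n.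
Proof.
move=> M0 hx hy hX hY; have := ler_wpM2l M0 hX; have := ler_wpM2l M0 hY; lra.
Qed.

(** * Passage to the complexification *)

Section Complexify.
Variables (R : realType) (k : nat) (L : (R -> R) -> (R -> R)).
Hypothesis LW : forall u, W1 k u -> W1 k (L u).
Hypothesis Llin : forall (z : R) u v, W1 k u -> W1 k v ->
  eqI (L (fun x => z * u x + v x)) (fun x => z * L u x + L v x).
Hypothesis Lint : forall u, W1 k u -> integral_I (L u) = integral_I u.

Lemma Re_fun_complexify n (u : R -> (R[i])^o) :
  Re_fun (iter n (complexify L) u) = iter n L (Re_fun u).
Proof. elim: n => [|n IH]; [exact (erefl _)|exact (congr1 L IH)]. Qed.

Lemma Im_fun_complexify n (u : R -> (R[i])^o) :
  Im_fun (iter n (complexify L) u) = iter n L (Im_fun u).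
Proof. elim: n => [|n IH]; [exact (erefl _)|exact (congr1 L IH)]. Qed.

Lemma operator_lin2 (a b : R) (u v w : R -> R) : W1 k u -> W1 k v -> W1 k w ->
  eqI (L (fun x => a * u x + (b * v x + w x))) (fun x => a * L u x + (b * L v x + L w x)).
Proof.
move=> Wu Wv Ww; have Wvw : W1 k (fun x => b * v x + w x) := W1_lin b Wv Ww.
by apply: aeS2 (Llin a Wu Wvw) (Llin b Wv Ww) => x h1 h2 Ix; rewrite (h1 Ix) (h2 Ix).
Qed.

(** Linearity holds up to null sets only, so even [L 0 = 0] has to be extracted from it; it is used
    for the imaginary part of the complex stationary density. *)
Lemma operator0_eqI : eqI (L (fun=> 0)) (fun=> 0).
Proof.
have W0 : W1 k (fun=> 0 : R) := W1_const k 0.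
have := Llin (-1) W0 W0; under [X in L X]eq_fun do rewrite mulr0 addr0.
by apply: aeS => x h Ix; have := h Ix; rewrite mulN1r addNr.
Qed.

(** The complexified operator acts on real and imaginary parts separately, and a vanishing complex
    integral means zero average of both; decay and boundedness pass over with doubled constants. The
    functional is the complex integral. *)
Lemma complexify_spectral_gap (C r M : R) (h0 : R -> R) : 0 <= C -> 0 < r < 1 ->
  (forall n u, W1_0 k u -> W1_norm k (iter n L u) <= C * r ^+ n * W1_norm k u) ->
  0 <= M -> bounded_on (W1 (R := R) k) (W1_norm k) L M ->
  W1 k h0 -> stationary_density L h0 ->
  spectral_gap (cW1 (R := R) k) (cW1_norm k) (complexify L).
Proof.
move=> C0 /andP[r0 r1] dec M0 bM Wh [ih _ eh Lh].
have null (u : R -> (R[i])^o) : cW1 k u -> W1_norm k (Re_fun u) = 0 -> W1_norm k (Im_fun u) = 0 ->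
    cW1_norm k u = 0.
  move=> Wu h1 h2; apply/eqP; rewrite eq_le (sn_ge0 (cW1_seminormed R k)) // andbT.
  by apply: le_trans (cW1_norm_le Wu) _; rewrite h1 h2 addr0.
have Wc (u : R -> (R[i])^o) : cW1 (R := R) k u -> cW1 k (complexify L u).
  by move=> [h1 h2]; split; exact: LW.
have linc : linear_on (cW1 (R := R) k) (cW1_norm k) (complexify L).
  split=> // z u v Wu Wv; have [[u1 u2] [v1 v2]] := (Wu, Wv).
  have Wuv := Wc _ (cW1_lin z Wu Wv); have Wuv' := cW1_lin z (Wc _ Wu) (Wc _ Wv).
  apply: null; first exact: (W_sub (cW1_seminormed R k)).
    rewrite Re_fun_sub; apply: W1_norm_null; [exact: (W1_L1I Wuv.1)|exact: (W1_L1I Wuv'.1)|].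
    rewrite Re_fun_lin -[Re_fun (complexify L _)]/(L (Re_fun _)) Re_fun_lin.
    exact: (operator_lin2 _ _ u1 u2 v1).
  rewrite Im_fun_sub; apply: W1_norm_null; [exact: (W1_L1I Wuv.2)|exact: (W1_L1I Wuv'.2)|].
  rewrite Im_fun_lin -[Im_fun (complexify L _)]/(L (Im_fun _)) Im_fun_lin.
  exact: (operator_lin2 _ _ u2 u1 v2).
pose ell (u : R -> (R[i])^o) : R[i] := (integral_I (Re_fun u) +i* integral_I (Im_fun u))%C.
pose h : R -> (R[i])^o := fun x => (h0 x +i* 0)%C.
have Ch : cW1 k h by split; [exact: Wh|exact: (W1_const k 0)].
have M20 : 0 <= 2 * M by rewrite mulr_ge0.
have C20 : 0 <= 2 * C by rewrite mulr_ge0.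
apply: (@power_spectral_gap R _ _ _ _ ell h (2 * C) (2 * M) 2 r
  (cW1_seminormed R k) (@cW1_complete R k) linc M20 _ _ _ _ _ Ch _ _ C20 _ _) => //.
- move=> u Wu; have [g1 g2] := cW1_norm_ge Wu; have [u1 u2] := Wu.
  have b1 : W1_norm k (Re_fun (complexify L u)) <= M * W1_norm k (Re_fun u) := bM _ u1.
  have b2 : W1_norm k (Im_fun (complexify L u)) <= M * W1_norm k (Im_fun u) := bM _ u2.
  exact: (le_trans (cW1_norm_le (Wc _ Wu)) (double_bound M0 b1 b2 g1 g2)).
- move=> z u v [u1 u2] [v1 v2]; rewrite /ell Re_fun_lin Im_fun_lin.
  have integral_lin2 (a b : R) (p q s : R -> R) : L1I p -> L1I q -> L1I s ->
      integral_I ((a *: (p : R -> R^o) + (b *: (q : R -> R^o) + (s : R -> R^o))) : R -> R) =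
      a * integral_I p + (b * integral_I q + integral_I s).
    move=> ip iq is_; have ibq := L1I_scale b iq; have iap := L1I_scale a ip.
    have := integral_I_add iap (L1I_add ibq is_).
    by rewrite (integral_I_add ibq is_) !integral_I_scale.
  rewrite (integral_lin2 _ _ _ _ _ (W1_L1I u1) (W1_L1I u2) (W1_L1I v1)).
  rewrite (integral_lin2 _ _ _ _ _ (W1_L1I u2) (W1_L1I u1) (W1_L1I v2)).
  by case: z => a b; apply/eqP; rewrite eq_complex /=; apply/andP; split; apply/eqP; ring.
- move=> u Wu; have [g1 g2] := cW1_norm_ge Wu; have [u1 u2] := Wu.
  apply: le_trans (normc_le _ _) _.
  have b1 := le_trans (integral_I_abs (W1_L1I u1)) (W1_norm_L1 u1).
  have b2 := le_trans (integral_I_abs (W1_L1I u2)) (W1_norm_L1 u2).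
  by rewrite mulr_natl mulr2n; apply: lerD; [exact: le_trans b1 g1|exact: le_trans b2 g2].
- move=> u [u1 u2]; rewrite /ell.
  by congr (_ +i* _)%C; [exact: Lint u1|exact: Lint u2].
- by rewrite /ell -[RHS]/(1 +i* 0)%C; congr (_ +i* _)%C; [exact: eh|exact: integral_I_cst].
- have WLh := Wc _ Ch.
  apply: null; first exact: (W_sub (cW1_seminormed R k)).
    by rewrite Re_fun_sub; apply: W1_norm_null Lh; [exact: (W1_L1I WLh.1)|].
  by rewrite Im_fun_sub; apply: W1_norm_null operator0_eqI; [exact: (W1_L1I WLh.2)|exact: L1I_cst].
- by rewrite (ltW r0).
- move=> n u Wu; rewrite /ell => -[e1 e2]; have [u1 u2] := Wu.
  have [g1 g2] := cW1_norm_ge Wu.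
  have Wn : cW1 k (iter n (complexify L) u) by elim: n => //= n; exact: Wc.
  apply: le_trans (cW1_norm_le Wn) _; rewrite Re_fun_complexify Im_fun_complexify.
  have d1 := dec n _ (conj u1 e1); have d2 := dec n _ (conj u2 e2).
  have p0 : 0 <= C * r ^+ n by rewrite mulr_ge0 // exprn_ge0 // ltW.
  by have := double_bound p0 d1 d2 g1 g2; rewrite mulrA.
Qed.

End Complexify.

(** * Decay, stationary density and resolvent of the annealed operator *)

Section Annealed.
Variable R : realType.
Notation mu := (@lebesgue_measure R).
Notation TR := (measurableTypeR R).
Variables (c beta theta m1 M1 M2 M3 w0 w1 : R) (P : probability TR R).
Variable F : nat -> R -> R -> R.
Notation Omega := (`[w0, w1]%classic : set TR).
Hypothesis cF : cusp_family c 1 beta theta m1 M1 M2 M3 Omega F.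
Hypothesis hP : P Omega = 1%E.
Notation f := (F 0%N).
Notation L := (annealed (`[w0, w1]%classic : set R) P f).
Notation norm1 u := (integral_I (fun x => `|u x|)).
Implicit Types (u v phi psi g : R -> R).

(** The difference of the two sides is paired with its own sign. *)
Lemma eqI_lin_pairing (z : R) (w u v : R -> R) : L1I w -> L1I u -> L1I v ->
  (forall chi, bounded_meas 1 chi -> integral_I (fun x => w x * chi x) =
    z * integral_I (fun x => u x * chi x) + integral_I (fun x => v x * chi x)) ->
  eqI w (fun x => z * u x + v x).
Proof.
move=> iw iu iv h; have izu := L1I_scale z iu; have izuv := L1I_add izu iv.
have id := L1I_sub iw izuv; apply: sub_eqI0; apply: (integral_I_abs_eq0 id).
pose chi x := Num.sg (w x - (z * u x + v x)).
have bchi : bounded_meas 1 chi.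
  by split=> [|x _]; [apply: measurable_sgr; exact: L1I_measurable|exact: norm_sgr_le1].
have [mchi lchi] := bchi.
rewrite (integral_I_eq (v := fun x => w x * chi x - (z * (u x * chi x) + v x * chi x))); last first.
  by move=> x _; rewrite -mulr_sgr_norm mulrBl mulrDl mulrA.
have i1 := L1I_mulb iu mchi lchi; have i2 := L1I_mulb iv mchi lchi.
have i3 := L1I_mulb iw mchi lchi; have i4 := L1I_scale z i1.
by rewrite (integral_I_sub i3 (L1I_add i4 i2)) (integral_I_add i4 i2) (integral_I_scale z i1) h // subrr.
Qed.

Lemma annealed_lin (z : R) u v : L1I u -> L1I v ->
  eqI (L (fun x => z * u x + v x)) (fun x => z * L u x + L v x).
Proof.
move=> iu iv.
have iuv : L1I (fun x => z * u x + v x) by apply: L1I_add => //; exact: L1I_scale.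
have [iLu _] := annealed_L1 cF hP iu; have [iLv _] := annealed_L1 cF hP iv.
have [iLuv _] := annealed_L1 cF hP iuv.
apply: (eqI_lin_pairing iLuv iLu iLv) => chi bchi.
have [mk bk] := koopman_bounded cF hP bchi.
have [_ _ e1] := koopman_pairing cF hP iu bchi; have [_ _ e2] := koopman_pairing cF hP iv bchi.
have [_ _ e3] := koopman_pairing cF hP iuv bchi.
apply: (etrans e3); apply: (etrans _ (esym (f_equal2 (fun s t => z * s + t) e1 e2))).
move: (koopman _ _ _ _ _ _) mk bk => k mk bk.
have j1 := L1I_mulb iu mk bk; have j2 := L1I_mulb iv mk bk; have j3 := L1I_scale z j1.
rewrite -(integral_I_scale z j1) -(integral_I_add j3 j2).
by apply: integral_I_eq => x _; rewrite mulrDl mulrA.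
Qed.

(** The operator chooses a representative for each function, so compatibility with almost everywhere
    equality needs an argument: the [L^1] contraction applied to the difference. *)
Lemma annealed_eqI u v : L1I u -> L1I v -> eqI u v -> eqI (L u) (L v).
Proof.
move=> iu iv e; have [iLu _] := annealed_L1 cF hP iu; have [iLv _] := annealed_L1 cF hP iv.
have iw : L1I (fun x => -1 * u x + v x) by apply: L1I_add => //; exact: L1I_scale.
have [iLw _] := annealed_L1 cF hP iw.
have w0' : integral_I (fun x => `|L (fun x => -1 * u x + v x) x|) = 0.
  apply/eqP; rewrite eq_le integral_I_ge0 // andbT; apply: le_trans (annealed_norm_le cF hP iw) _.
  rewrite -[leRHS](integral_I_cst 0) le_eqVlt; apply/orP; left; apply/eqP; apply: integral_I_eqI.
  - by apply: L1I_measurable; exact: L1I_norm.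
  - exact: measurable_cst.
  - by apply: aeS e => x h Ix; rewrite (h Ix) mulN1r addNr normr0.
apply: eqI_sym; apply: aeS2 (integral_I_abs_eq0 iLw w0') (annealed_lin (-1) iu iv) => x h1 h2 Ix.
by have := h2 Ix; rewrite (h1 Ix) mulN1r => /eqP; rewrite eq_sym addrC subr_eq0 => /eqP.
Qed.

Lemma annealed_W1 k phi : (k <= 2)%N -> W1 k phi -> W1 k (L phi).
Proof.
move=> k2 Wp; have ip := W1_L1I Wp; have [iL _] := annealed_L1 cF hP ip.
split=> // j jk; case: j jk => [|[|[|j]]] jk.
- by exists (L phi); exact: weak_deriv0.
- by have [g1 wg _] := annealed_weak_deriv1 cF hP ip (W1_deriv Wp jk); exists g1.
- have d1 := W1_deriv Wp (ltnW jk); have d2 := weak_deriv_1_2 d1 (W1_deriv Wp jk).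
  by have [g2 wg _] := annealed_weak_deriv2 cF hP ip d1 d2; exists g2.
- by move: (leq_trans jk k2).
Qed.

Lemma iter_W1 n k phi : (k <= 2)%N -> W1 k phi -> W1 k (iter n L phi).
Proof. by move=> k2 Wp; elim: n => //= n; exact: annealed_W1. Qed.

Lemma annealed_linear_on k : (k <= 2)%N -> linear_on (W1 (R := R) k) (W1_norm k) L.
Proof.
move=> k2; split=> [u|z u v Wu Wv]; first exact: annealed_W1.
have iu := W1_L1I Wu; have iv := W1_L1I Wv.
apply: W1_norm_null; last exact: annealed_lin.
- exact: (W1_L1I (annealed_W1 k2 (W1_lin z Wu Wv))).
- exact: (W1_L1I (W1_lin z (annealed_W1 k2 Wu) (annealed_W1 k2 Wv))).
Qed.

Lemma annealed_linear_on0 : linear_on (W1_0 (R := R) 1) (W1_norm 1) L.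
Proof.
have [h1 h2] := @annealed_linear_on 1 isT; split=> [u [Wu u0]|z u v [Wu _] [Wv _]]; last exact: h2.
by split; [exact: h1|rewrite (annealed_L1 cF hP (W1_L1I Wu)).2].
Qed.

Lemma annealed_bounded_on1 : exists2 C : R, 0 <= C & bounded_on (W1 (R := R) 1) (W1_norm 1) L C.
Proof.
have [lam [C [/andP[lam0 lam1] C0 LY]]] := annealed_LY1 cF hP.
exists (1 + C); first by rewrite addr_ge0.
move=> u Wu; have ip := W1_L1I Wu; have d1 := W1_deriv Wu (leqnn 1).
have WL := annealed_W1 (isT : (1 <= 2)%N) Wu; have iL := W1_L1I WL; have e1 := W1_deriv WL (leqnn 1).
rewrite (W1_norm1E ip d1) (W1_norm1E iL e1).
have := LY _ _ _ ip d1 e1; have := annealed_norm_le cF hP ip.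
have := integral_I_ge0 (u := fun x => `|u x|) (fun x _ => normr_ge0 (u x)).
have := integral_I_ge0 (u := fun x => `|weak_deriv 1 u x|) (fun x _ => normr_ge0 _).
move: (integral_I _) (integral_I _) (integral_I _) (integral_I _) => i1 i2 i3 i4 h1 h2 h3 h4.
have : lam * i4 <= 1 * i4 by rewrite ler_wpM2r // ltW.
have : 0 <= C * i4 by rewrite mulr_ge0.
lra.
Qed.

Lemma annealed_bounded_on2 : exists2 C : R, 0 <= C & bounded_on (W1 (R := R) 2) (W1_norm 2) L C.
Proof.
have [lam [C [/andP[lam0 lam1] C0 LY]]] := annealed_LY2 cF hP.
have [M M0 hM] := annealed_bounded_on1.
exists (1 + C + M); first by rewrite !addr_ge0.
move=> u Wu; have ip := W1_L1I Wu; have d1 := W1_deriv Wu (isT : (1 <= 2)%N); have d2 := W1_deriv Wu (leqnn 2).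
have WL := annealed_W1 (leqnn 2) Wu; have iL := W1_L1I WL.
have e1 := W1_deriv WL (isT : (1 <= 2)%N); have e2 := W1_deriv WL (leqnn 2).
rewrite (W1_norm2E ip d1 d2) (W1_norm2E iL e1 e2).
have := LY _ _ _ _ ip d1 (weak_deriv_1_2 d1 d2) e2; rewrite -(W1_norm1E ip d1).
have := hM _ (W1_le Wu (isT : (1 <= 2)%N)); have := W1_norm_ge0 1 u.
have := integral_I_ge0 (u := fun x => `|weak_deriv 2 u x|) (fun x _ => normr_ge0 _).
set d := integral_I _; set n1 := W1_norm 1 u; move: d n1 (integral_I _) (W1_norm _ _) => d n1 i1 i2 h1 h2 h3 h4.
have : lam * d <= 1 * d by rewrite ler_wpM2r // ltW.
have : 0 <= C * d by rewrite mulr_ge0.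
have : 0 <= M * d by rewrite mulr_ge0.
lra.
Qed.

Lemma decay1 : exists C r, [/\ 0 <= C, 0 < r < 1 & forall n u, W1_0 1 u ->
  W1_norm 1 (iter n L u) <= C * r ^+ n * W1_norm 1 u].
Proof.
have [lam [C [lam01 C0 LY]]] := annealed_LY1 cF hP; have /andP[lam0 lam1] := lam01.
have K0 : 0 <= 2 * (C / (1 - lam) + 1) / (1 - lam).
  by rewrite divr_ge0 ?subr_ge0 ?(ltW lam1) // mulr_ge0 // addr_ge0 // divr_ge0 // subr_ge0 ltW.
have [N [d [N0 d01 hd]]] := doeblin cF hP K0.
have [A [r [A0 r01 hA]]] := harris_geometric lam01 C0 d01 N0.
exists A, r; split=> // n u [Wu u0].
have ip k : L1I (iter k L u) by exact: (L1I_iter cF hP k (W1_L1I Wu)).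
have d1 k : is_weak_deriv 1 (iter k L u) (weak_deriv 1 (iter k L u)).
  exact: W1_deriv (iter_W1 k (isT : (1 <= 2)%N) Wu) (leqnn 1).
rewrite (W1_norm1E (ip n) (d1 n)) (W1_norm1E (ip 0%N) (d1 0%N)).
apply: (hA (fun k => norm1 (iter k L u)) (fun k => norm1 (weak_deriv 1 (iter k L u)))) => k.
- exact: integral_I_ge0.
- exact: integral_I_ge0.
- exact: (annealed_norm_le cF hP (ip k)).
- exact: LY (ip k) (d1 k) (d1 k.+1).
- move=> h; rewrite addnC iterD; apply: hd (ip k) (d1 k) _ h.
  by rewrite (integral_iter cF hP k (W1_L1I Wu)).
Qed.

(** The norm of the second derivative contracts up to a forcing by the [W^{1,1}] norm, which already
    decays geometrically by [decay1]. *)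
Lemma decay2 : exists C r, [/\ 0 <= C, 0 < r < 1 & forall n u, W1_0 2 u ->
  W1_norm 2 (iter n L u) <= C * r ^+ n * W1_norm 2 u].
Proof.
have [C1 [r1 [C10 r101 dec]]] := decay1.
have [lam [C [lam01 C0 LY]]] := annealed_LY2 cF hP.
have [A [r [A0 /andP[r1r rlt] hA]]] := geometric_forcing lam01 r101.
have /andP[r10 r11] := r101; have r0 : 0 < r by apply: lt_le_trans r1r.
exists (C1 + A * (1 + C * C1)), r; split; first by rewrite addr_ge0 // mulr_ge0 // addr_ge0 // mulr_ge0.
  by rewrite r0.
move=> n u [Wu u0].
have W1u : W1_0 1 u by split=> //; exact: W1_le Wu _.
have WL k : W1 2 (iter k L u) by exact: iter_W1.
have ip k : L1I (iter k L u) := W1_L1I (WL k).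
have d1 k : is_weak_deriv 1 (iter k L u) (weak_deriv 1 (iter k L u)) by exact: W1_deriv (WL k) _.
have d2 k : is_weak_deriv 2 (iter k L u) (weak_deriv 2 (iter k L u)) by exact: W1_deriv (WL k) _.
rewrite (W1_norm2E (ip n) (d1 n) (d2 n)) (W1_norm2E (ip 0%N) (d1 0%N) (d2 0%N)) /=.
have N10 : 0 <= W1_norm 1 u by exact: W1_norm_ge0.
have b0 : 0 <= norm1 (weak_deriv 2 u) by exact: integral_I_ge0.
have B0 : 0 <= C * (C1 * W1_norm 1 u) by rewrite mulr_ge0 // mulr_ge0.
have := hA (fun k => norm1 (weak_deriv 2 (iter k L u))) _ B0 b0.
have forced k : norm1 (weak_deriv 2 (iter k.+1 L u)) <=
    lam * norm1 (weak_deriv 2 (iter k L u)) + C * (C1 * W1_norm 1 u) * r1 ^+ k.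
  apply: (le_trans (LY _ _ _ _ (ip k) (d1 k) (weak_deriv_1_2 (d1 k) (d2 k)) (d2 k.+1))).
  rewrite lerD2l -(W1_norm1E (ip k) (d1 k)) -mulrA ler_wpM2l // mulrAC; exact: dec.
move=> /(_ forced n) /= h1; have h2 := dec n u W1u.
have h3 : C1 * r1 ^+ n * W1_norm 1 u <= C1 * r ^+ n * W1_norm 1 u.
  by rewrite ler_wpM2r // ler_wpM2l // lerXn2r ?nnegrE ?(ltW r10) ?(ltW r0).
have rn : 0 <= r ^+ n by rewrite exprn_ge0 // ltW.
move: h1 h2 h3 b0 N10; move: (integral_I _) (integral_I _) (W1_norm _ _) (W1_norm _ _) => i1 i2 i3 i4.
move: (r ^+ n) rn => z z0 h1 h2 h3 b0 N10.
have q1 : 0 <= C1 * z * i1 by rewrite !mulr_ge0.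
have q2 : 0 <= A * z * (C * C1) * i1 by rewrite !mulr_ge0.
have q3 : 0 <= A * z * i4 by rewrite !mulr_ge0.
lra.
Qed.

Lemma iter_lin n (z : R) u v : L1I u -> L1I v ->
  eqI (iter n L (fun x => z * u x + v x)) (fun x => z * iter n L u x + iter n L v x).
Proof.
move=> iu iv; elim: n => [|n IH]; first exact: eqI_refl.
have iuv : L1I (fun x => z * u x + v x) by apply: L1I_add => //; exact: L1I_scale.
have iun := L1I_iter cF hP n iu; have ivn := L1I_iter cF hP n iv.
apply: eqI_trans (annealed_lin z iun ivn).
have iL := L1I_iter cF hP n iuv; apply: annealed_eqI IH => //.
by apply: L1I_add => //; exact: L1I_scale.
Qed.

(** Positivity of an iterate is known almost everywhere only; replacing it by its absolute value
    does not change its image and makes the weight nonnegative at every point. *)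
Lemma iter_ge0 n u : L1I u -> (forall x, 0 <= u x) ->
  \forall x \ae mu, I01 x -> 0 <= iter n L u x.
Proof.
move=> iu u0; elim: n => [|n IH]; first by apply: aeT => x _; exact: u0.
have iun := L1I_iter cF hP n iu; have iab := L1I_norm iun.
have e : eqI (L (iter n L u)) (L (fun x => `|iter n L u x|)).
  by apply: annealed_eqI => //; apply: aeS IH => x h Ix; rewrite ger0_norm // h.
have pos := push_ge0 (annealed_push cF hP iab) (fun p _ => normr_ge0 _).
by apply: aeS2 e pos => x h1 h2 Ix; rewrite /= (h1 Ix); exact: h2.
Qed.

Lemma norm_sub_le u v w h : L1I u -> L1I v -> L1I w -> L1I h ->
  eqI v (fun x => -1 * u x + w x) ->
  integral_I (fun x => `|u x - h x|) <=
  integral_I (fun x => `|v x|) + integral_I (fun x => `|w x - h x|).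
Proof.
move=> iu iv iw ih e; have iwh := L1I_norm (L1I_sub iw ih); have ivn := L1I_norm iv.
rewrite -(integral_I_add ivn iwh).
apply: (integral_I_ae_le (L1I_norm (L1I_sub iu ih)) (L1I_add ivn iwh)).
apply: aeS e => x e Ix; have -> : u x - h x = - v x + (w x - h x) by rewrite (e Ix); ring.
by apply: le_trans (ler_normD _ _) _; rewrite normrN.
Qed.

Lemma stationary_density_exists : exists2 h0, W1 2 h0 & stationary_density L h0.
Proof.
have [C [r [C0 /andP[r0 r1] dec]]] := decay2.
pose one : R -> R^o := fun=> 1.
have W1one : W1 2 one := W1_const 2 1; have i1 := W1_L1I W1one.
have WL : W1 2 (L one) by exact: annealed_W1.
(* The increment from [L^n 1] to [L^(n+1) 1] is [L^n w], and [w] has zero average because the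
   operator preserves integrals. *)
pose w : R -> R^o := -1 *: one + (L one : R -> R^o).
have Ww : W1 2 w by exact: W1_lin.
have iw := W1_L1I Ww.
have w0' : integral_I w = 0.
  have -> : integral_I w = integral_I (fun x => -1 * one x + L one x) by [].
  have iL := W1_L1I WL.
  rewrite integral_I_add ?integral_I_scale //; last exact: L1I_scale.
  by rewrite (annealed_L1 cF hP i1).2 mulN1r addNr.
pose un n : R -> R^o := iter n L one.
have Wun n : W1 2 (un n) by exact: iter_W1.
have iun n : L1I (un n) := W1_L1I (Wun n).
have incr n : W1_norm 2 (un n.+1 - un n) <= C * W1_norm 2 w * r ^+ n.
  rewrite mulrAC; apply: le_trans (dec n w (conj Ww w0')); rewrite le_eqVlt; apply/orP; left; apply/eqP.
  have WS := W_sub (W1_seminormed R 2) (Wun n.+1) (Wun n).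
  apply: (W1_norm_eqI WS (iter_W1 n (leqnn 2) Ww)).
  apply: eqI_sym; apply: aeS (iter_lin n (-1) i1 (W1_L1I WL)) => x h Ix.
  by have := h Ix; rewrite -iterSr mulN1r addrC => h'; exact: h'.
have [h0 Wh hh] := W1_complete (R := R) (k := 2) Wun (mulr_ge0 C0 (W1_norm_ge0 2 w))
  (introT andP (conj (ltW r0) r1)) incr.
have ih := W1_L1I Wh; have r01 : 0 <= r < 1 by rewrite (ltW r0).
pose D := C * W1_norm 2 w / (1 - r).
have near n : integral_I (fun x => `|un n x - h0 x|) <= D * r ^+ n.
  apply: le_trans (W1_norm_L1 _) _; first exact: (W_sub (W1_seminormed R 2) (Wun n) Wh).
  by apply: le_trans (hh n) _; rewrite /D mulrAC.
exists h0 => //; split=> //.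
(* Since [L^n 1] is nonnegative, [h0] and [|h0|] are both within [|L^n 1 - h0|] of it. *)
- have d0 : integral_I (fun x => `|h0 x - `|h0 x| |) = 0.
    apply: (@geometric_squeeze _ _ (2 * D) r) => // [|n]; first exact: integral_I_ge0.
    have iab := L1I_norm ih; have iabd := L1I_norm (L1I_sub ih iab).
    have idn := L1I_norm (L1I_sub (iun n) ih).
    rewrite -mulrA; apply: le_trans (ler_wpM2l _ (near n)) => //.
    rewrite -integral_I_scale //; apply: integral_I_ae_le => //; first exact: L1I_scale.
    apply: aeS (iter_ge0 n i1 (fun _ => ler01)) => x h Ix; have := h Ix.
    rewrite -/(un n) => p; have e1 := ler_dist_dist (un n x) (h0 x); rewrite (ger0_norm p) in e1.
    have -> : h0 x - `|h0 x| = - (un n x - h0 x) + (un n x - `|h0 x|) by ring.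
    by apply: le_trans (ler_normD _ _) _; rewrite normrN; lra.
  have e := integral_I_abs_eq0 (L1I_sub ih (L1I_norm ih)) d0.
  by apply: aeS e => x h Ix; have /eqP := h Ix; rewrite subr_eq0 => /eqP ->.
- apply/eqP; rewrite -subr_eq0 -normr_eq0; apply/eqP.
  apply: (@geometric_squeeze _ _ D r) => // n; apply: le_trans (near n).
  have -> : 1 = integral_I (un n) by rewrite (integral_iter cF hP n i1) integral_I_cst.
  by rewrite distrC -integral_I_sub //; apply: integral_I_abs; exact: L1I_sub.
- have iLh := (annealed_L1 cF hP ih).1.
  apply: sub_eqI0; apply: (integral_I_abs_eq0 (L1I_sub iLh ih)).
  apply: (@geometric_squeeze _ _ (2 * D) r) => // [|n]; first exact: integral_I_ge0.
  have iN : L1I (fun x => -1 * h0 x + un n x) by apply: L1I_add => //; exact: L1I_scale.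
  have a1 : integral_I (fun x => `|L (fun x => -1 * h0 x + un n x) x|) <= D * r ^+ n.
    apply: le_trans (annealed_norm_le cF hP iN) _; apply: le_trans (near n).
    by rewrite le_eqVlt; apply/orP; left; apply/eqP; apply: integral_I_eq => x _; rewrite mulN1r addrC.
  have a2 : integral_I (fun x => `|un n.+1 x - h0 x|) <= D * r ^+ n.
    apply: le_trans (near n.+1) _; rewrite exprS mulrCA ler_piMl ?(ltW r1) //.
    by rewrite mulr_ge0 ?exprn_ge0 ?(ltW r0) // divr_ge0 ?subr_ge0 ?(ltW r1) // mulr_ge0 ?W1_norm_ge0.
  have iLN := (annealed_L1 cF hP iN).1.
  apply: (le_trans (norm_sub_le iLh iLN (iun n.+1) ih (annealed_lin (-1) ih (iun n)))).
  by rewrite (_ : 2 * D * r ^+ n = D * r ^+ n + D * r ^+ n); [exact: lerD a1 a2|ring].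
Qed.

(** The difference of two stationary densities is fixed by the operator and has zero average, so
    geometric decay annihilates it. *)
Lemma stationary_density_unique h h' : W1 1 h -> W1 1 h' ->
  stationary_density L h -> stationary_density L h' -> eqI h h'.
Proof.
move=> Wh Wh' [ih _ e1 Lh] [ih' _ e1' Lh'].
have [C [r [C0 /andP[r0 r1] dec]]] := decay1.
pose w : R -> R^o := -1 *: (h' : R -> R^o) + (h : R -> R^o).
have Ww : W1 1 w by exact: W1_lin.
have iw : L1I (fun x => -1 * h' x + h x) := W1_L1I Ww.
have w0' : integral_I w = 0.
  have -> : integral_I w = integral_I (fun x => -1 * h' x + h x) by [].
  rewrite integral_I_add ?integral_I_scale //; last exact: L1I_scale.
  by rewrite e1 e1' mulr1 addNr.
have fixed n : eqI (iter n L w) w.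
  elim: n => [|n IH]; first exact: eqI_refl.
  apply: eqI_trans (annealed_eqI (L1I_iter cF hP n iw) iw IH) _.
  apply: eqI_trans (annealed_lin (-1) ih' ih) _.
  by apply: aeS2 Lh Lh' => x p q Ix; rewrite (p Ix) (q Ix).
have N0 : W1_norm 1 w = 0.
  apply: (@geometric_squeeze _ _ (C * W1_norm 1 w) r); rewrite ?W1_norm_ge0 ?(ltW r0) // => n.
  rewrite mulrAC; apply: le_trans (dec n w (conj Ww w0')); rewrite le_eqVlt; apply/orP; left; apply/eqP.
  exact: (W1_norm_eqI Ww (iter_W1 n (isT : (1 <= 2)%N) Ww) (eqI_sym (fixed n))).
apply: aeS (W1_norm_eq0 Ww N0) => x p Ix; have := p Ix.
have -> : w x = -1 * h' x + h x by [].
by rewrite mulN1r addrC => /eqP; rewrite subr_eq0 => /eqP.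
Qed.

(** The Neumann series at [z = 1], which converges on zero averages because there the powers decay
    at a rate below 1. *)
Lemma annealed_inverse : exists B : (R -> R^o) -> (R -> R^o),
  inverse_on (W1_0 (R := R) 1) (W1_norm 1) (fun u => u - L u) B /\
  exists2 C : R, 0 < C & bounded_on (W1_0 (R := R) 1) (W1_norm 1) B C.
Proof.
have [C [r [C0 /andP[r0 r1] dec]]] := decay1; have [M M0 bM] := annealed_bounded_on1.
have [B [inv [D bD]]] : resolvent_set (W1_0 (R := R) 1) (W1_norm 1) (L : (R -> R^o) -> (R -> R^o)) (1 : R).
  apply: (neumann_resolvent (W1_0_seminormed R 1) (@W1_0_complete R 1) annealed_linear_on0 M0 _ C0 (ltW r0)).
  - by move=> u [Wu _]; exact: bM.
  - by move=> n u Wu; exact: dec.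
  - by rewrite normr1.
exists B; split.
  have -> : (fun u : R -> R^o => u - L u) = (fun u : R -> R^o => 1 *: u - L u) by apply/funext => u; rewrite scale1r.
  exact: inv.
(* The resolvent bound comes without a sign; the maximum makes it positive. *)
exists (Num.max D 1); first by rewrite lt_max ltr01 orbT.
move=> u Wu; apply: le_trans (bD u Wu) _; rewrite ler_wpM2r ?W1_norm_ge0 //.
by rewrite le_max lexx.
Qed.

Lemma annealed_spectral_gap k C r M h0 : (k <= 2)%N -> 0 <= C -> 0 < r < 1 ->
  (forall n u, W1_0 k u -> W1_norm k (iter n L u) <= C * r ^+ n * W1_norm k u) ->
  0 <= M -> bounded_on (W1 (R := R) k) (W1_norm k) L M ->
  W1 k h0 -> stationary_density L h0 ->
  spectral_gap (cW1 (R := R) k) (cW1_norm k) (complexify L).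
Proof.
move=> k2; apply: complexify_spectral_gap.
- by move=> u; exact: annealed_W1.
- by move=> z u v Wu Wv; exact: annealed_lin (W1_L1I Wu) (W1_L1I Wv).
- by move=> u Wu; exact: (annealed_L1 cF hP (W1_L1I Wu)).2.
Qed.

Lemma annealed_spectral_gap1 : spectral_gap (cW1 (R := R) 1) (cW1_norm 1) (complexify L).
Proof.
have [C [r [C0 r01 dec]]] := decay1; have [M M0 bM] := annealed_bounded_on1.
have [h0 Wh sh] := stationary_density_exists.
exact: annealed_spectral_gap (isT : (1 <= 2)%N) C0 r01 dec M0 bM (W1_le Wh (isT : (1 <= 2)%N)) sh.
Qed.

Lemma annealed_spectral_gap2 : spectral_gap (cW1 (R := R) 2) (cW1_norm 2) (complexify L).
Proof.
have [C [r [C0 r01 dec]]] := decay2; have [M M0 bM] := annealed_bounded_on2.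
have [h0 Wh sh] := stationary_density_exists.
exact: annealed_spectral_gap (leqnn 2) C0 r01 dec M0 bM Wh sh.
Qed.

End Annealed.

Unset Implicit Arguments.

Theorem proposition3p6 (R : realType) (c a beta w0 w1 : R)
    (P : probability (measurableTypeR R) R) (f : R -> R -> R)
    (hc : 0 < c < 1) (ha : 0 < a <= 1) (hbeta : -1 < beta < - (1 / 2))
    (hOmega : w0 <= w1) (hP : P `[w0, w1]%classic = 1%E)
    (hf : admissible c a beta `[w0, w1]%classic P f) :
  let L := annealed `[w0, w1]%classic P f in
  [/\ exists h0 : R -> R,
        [/\ W1 2 h0, stationary_density L h0 &
            forall h : R -> R, W1 1 h -> stationary_density L h -> eqI h h0],
      spectral_gap (cW1 (R := R) 1) (cW1_norm 1) (complexify L),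
      spectral_gap (cW1 (R := R) 2) (cW1_norm 2) (complexify L) &
      exists B : (R -> R^o) -> (R -> R^o),
        inverse_on (W1_0 (R := R) 1) (W1_norm 1) (fun u => u - L u) B /\
        exists2 C : R, 0 < C & bounded_on (W1_0 (R := R) 1) (W1_norm 1) B C].
Proof.
move=> L; have [theta [m1 [M1 [M2 [M3 cF]]]]] := admissible_cusp_family hc hbeta hf.
have /andP[_ a1] := ha.
have {}a1 : a = 1 := full_height a1 cF hP (cusp_A7 hf).
rewrite {}a1 in cF.
have [h0 Wh sh] := stationary_density_exists cF hP.
split.
- exists h0; split=> // h Wh' sh'.
  exact: (stationary_density_unique cF hP Wh' (W1_le Wh (isT : (1 <= 2)%N)) sh' sh).
- exact: (annealed_spectral_gap1 cF hP).
- exact: (annealed_spectral_gap2 cF hP).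
- exact: (annealed_inverse cF hP).
Qed.
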